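(* Let $a>0$, $\bar p,\bar\delta>0$ with $c_0=\ln(\bar p/\bar\delta)>2$, and consider the delay differential equation $$u'(t)=\bar p\,u(t-\check\tau)e^{-au(t-\check\tau)}-\bar\delta\,u(t)$$ with delay $\check\tau$ as bifurcation parameter. At each Hopf bifurcation value $\check\tau_n=(\theta_0+2n\pi)/h_0$, $n=0,1,2,\dots$, of its positive equilibrium, the direction of the Hopf bifurcation is forward, that is, the bifurcating periodic solutions exist for $\check\tau>\check\tau_n$; and the bifurcating periodic solution from the first Hopf bifurcation value $\check\tau_0=\theta_0/h_0$ is orbitally asymptotically stable.
   Context: The positive equilibrium is $u=c_0/a$. The numbers $\theta_0\in[0,2\pi]$ and $h_0$ are given by $\cos\theta_0=\frac1{1-c_0}$, $\sin\theta_0=-\frac{\sqrt{c_0^2-2c_0}}{1-c_0}$, $h_0=\bar\delta\sqrt{c_0^2-2c_0}$. The bifurcating periodic solutions at $\check\tau_n$ are the small-amplitude non-constant periodic solutions that bifurcate from the equilibrium as $\check\tau$ passes through $\check\tau_n$. *)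

(* Defs.v *)
From HB Require Import structures.
From mathcomp Require Import all_boot all_order all_algebra.
From mathcomp Require Import all_classical all_reals all_analysis.
Set Implicit Arguments.
Unset Strict Implicit.
Unset Printing Implicit Defensive.
Import Order.TTheory GRing.Theory Num.Theory.
Import numFieldNormedType.Exports.
Local Open Scope classical_set_scope.
Local Open Scope ring_scope.

(** Scalar equations u'(t) = F (u t) (u (t - tau)) with one discrete delay. *)

(** Solution of the initial value problem at time 0: the history is the
    restriction of [u] to [-tau, 0]; values before -tau are irrelevant. *)
Definition dde_forward_solution (R : realType) (F : R -> R -> R) (tau : R)
    (u : R -> R) : Prop :=
  {within `[- tau, +oo[, continuous u} /\
  forall t : R, 0 < t -> is_derive t 1 u (F (u t) (u (t - tau))).

Definition dde_periodic_solution (R : realType) (F : R -> R -> R) (tau T : R)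
    (v : R -> R) : Prop :=
  [/\ 0 < T,
      forall t : R, v (t + T) = v t,
      exists s t : R, v s != v t
    & forall t : R, is_derive t 1 v (F (v t) (v (t - tau)))].

(** In C([-tau, 0]) with the sup norm, the segment u_t is at distance < r from
    the orbit {v_s : s in R}: the supremum over [-tau, 0] is attained and, the
    orbit of a periodic [v] being compact, so is the infimum over s. *)
Definition near_orbit (R : realType) (tau : R) (v : R -> R) (r : R)
    (u : R -> R) (t : R) : Prop :=
  exists s : R, forall th : R, - tau <= th <= 0 -> `|u (t + th) - v (s + th)| < r.

Definition orbitally_stable (R : realType) (F : R -> R -> R) (tau : R)
    (v : R -> R) : Prop :=
  forall e : R, 0 < e -> exists2 d : R, 0 < d &
    forall u : R -> R, dde_forward_solution F tau u -> near_orbit tau v d u 0 ->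
    forall t : R, 0 <= t -> near_orbit tau v e u t.

Definition orbitally_attractive (R : realType) (F : R -> R -> R) (tau : R)
    (v : R -> R) : Prop :=
  exists2 d : R, 0 < d &
    forall u : R -> R, dde_forward_solution F tau u -> near_orbit tau v d u 0 ->
    forall e : R, 0 < e ->
    exists t0 : R, forall t : R, t0 <= t -> near_orbit tau v e u t.

Definition orbitally_asymptotically_stable (R : realType) (F : R -> R -> R)
    (tau : R) (v : R -> R) : Prop :=
  orbitally_stable F tau v /\ orbitally_attractive F tau v.

(** The one-parameter family given by the Hopf bifurcation theorem at the
    equilibrium [us], delay [taus] and critical frequency [om]: for e in
    ]0, e0[, [u e] is a non-constant periodic solution for the delay [tau e],
    of period [T e]; at e = 0 the family starts at the equilibrium. Time is
    rescaled by the period in the continuity requirement, since functions with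
    different periods are not uniformly close; continuity at e = 0 says that the
    amplitude tends to 0. The last clause says that, up to translation in time,
    the family contains all non-constant periodic solutions near the
    bifurcation point with period near 2 pi / om. *)
Definition hopf_branch (R : realType) (F : R -> R -> R) (us taus om e0 : R)
    (tau T : R -> R) (u : R -> R -> R) : Prop :=
  [/\ 0 < e0,
      [/\ tau 0 = taus, T 0 = 2 * pi / om & forall t : R, u 0 t = us],
      [/\ {within `[0, e0[, continuous tau},
          {within `[0, e0[, continuous T}
        & {within `[0, e0[, continuous
             (fun e : R => (fun s : R => u e (T e * s)) : {uniform R -> R})}],
      (forall e : R, 0 < e < e0 -> dde_periodic_solution F (tau e) (T e) (u e))
    & exists2 r : R, 0 < r &
        forall (tau' T' : R) (v : R -> R),
          `|tau' - taus| < r -> `|T' - 2 * pi / om| < r ->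
          (forall t : R, `|v t - us| < r) ->
          dde_periodic_solution F tau' T' v ->
          exists e s : R, [/\ 0 < e < e0, tau e = tau', T e = T'
                        & forall t : R, v t = u e (t + s)]].

(** The delays [tau e] of the branch lie above [taus] and fill a right
    neighbourhood of it. *)
Definition forward_branch (R : realType) (taus e0 : R) (tau : R -> R) : Prop :=
  (forall e : R, 0 < e < e0 -> taus < tau e) /\
  exists2 r : R, 0 < r &
    forall tau' : R, taus < tau' < taus + r ->
    exists2 e : R, 0 < e < e0 & tau e = tau'.

(** F x y = p y e^{-a y} - d x, with x = u(t) and y = u(t - tau). *)
Definition nicholson (R : realType) (a p d : R) (x y : R) : R :=
  p * y * expR (- a * y) - d * x.

(* Main.v *)
(** In the variable x = a u - c with c = ln (p / d) the equation reads x' = d (f (x (t - tau)) - x) with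
    f y = (c + y) e^(-y) - c = - be y + n0 y^2 + y^3 n3 (y), be = c - 1. A periodic solution of period T is
    v (nu d t), where v is 2 pi-periodic, nu v' (s) + v (s) = f (v (s - kap)), nu = 2 pi / (T d) and
    tau = (kap + 2 pi n) / (nu d).

    Existence and direction: write v = e cos s + e^2 psi with psi orthogonal to cos and sin. The linearisation at
    criticality is inverted on that complement by Fourier series, and psi is the fixed point of a contraction depending
    Lipschitz continuously on e; nu and kap are determined by the first harmonic
    (1 + i nu) e^(i kap) = - be + e^2 (a - i b). Evaluating a and b at e = 0 shows that (kap + 2 pi n) / nu increases
    like e^2, so the branch is forward. A small periodic solution, after a shift of phase, is such a fixed point,
    which gives the uniqueness of the branch.

    Stability for n = 0, in the time scale where the delay is 1: on the complement of the critical eigenvectors the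
    linearised equation decays exponentially, by a Parseval estimate for the truncated solution, uniform up to the
    imaginary axis, and Datko's argument. A solution of the full equation is compared, over a fixed multiple D of the
    critical period, with the orbit X^e of the branch member that its critical projection selects. Since the branch
    member e solves the equation with another delay, the mismatch of the delays acts as a resonant forcing, which by
    the increase of the delay moves the amplitude e towards the amplitude e* of the orbit under study by a factor
    1 - k e*^2 per step.

    The argument is carried out over the real numbers of the standard library and transported to an arbitrary
    [realType] along the unique isomorphism of complete ordered fields. *)

(** The unknown of the contraction is the right-hand side [g], with [psi = K g]. Since [nu] and
    [kap] vary, the equation for [psi] contains [(w - nu) psi'] and differences of shifts of [psi];
    these lose a derivative in [psi] but are bounded by [g], because both [K] and [K'] are. The
    increase of the delay is needed between any two members of the branch, since the stability
    argument compares an orbit with its neighbours; hence differentiability is used in its strict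
    form. Solutions without critical component satisfy [x = m be Ic x] and [Is x = 0]. The first
    relation alone has the symbol [lambda Delta / (lambda^2 + th^2)], which vanishes at 0; adding
    [m be / th] times the second turns the factor [lambda] into [lambda + 1], and the symbol becomes
    bounded below for positive real part. In the stability argument the gain per step is of second
    order in the amplitude, so errors proportional to the amplitude defect must be of third order.
    This is why the effect of the resonant forcing is computed explicitly and why phase and
    amplitude are readjusted in each step. *)

Module NicholsonReal.
From Stdlib Require Import Reals ZArith Lra Lia Psatz ClassicalEpsilon FunctionalExtensionality.
From Coquelicot Require Import Coquelicot.
Open Scope R_scope.

(** * Calculus of everywhere continuous functions and their integrals *)

Definition cont (f : R -> R) : Prop := forall x, continuous f x.

Lemma cont_ext (f g : R -> R) : (forall x, f x = g x) -> cont f -> cont g.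
Proof. intros E Hf x. apply continuous_ext with f; auto. Qed.
Lemma cont_const (c : R) : cont (fun _ => c).
Proof. intros x. apply continuous_const. Qed.
Lemma cont_id : cont (fun x => x).
Proof. intros x. apply continuous_id. Qed.
Lemma cont_plus f g : cont f -> cont g -> cont (fun x => f x + g x).
Proof. intros Hf Hg x. apply (continuous_plus (V := R_NormedModule)); auto. Qed.
Lemma cont_opp f : cont f -> cont (fun x => - f x).
Proof. intros Hf x. apply (continuous_opp (V := R_NormedModule)); auto. Qed.
Lemma cont_minus f g : cont f -> cont g -> cont (fun x => f x - g x).
Proof. intros Hf Hg x. apply (continuous_minus (V := R_NormedModule)); auto. Qed.
Lemma cont_mult f g : cont f -> cont g -> cont (fun x => f x * g x).
Proof. intros Hf Hg x. apply (continuous_mult (K := R_AbsRing)); auto. Qed.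
Lemma cont_comp f g : cont f -> cont g -> cont (fun x => f (g x)).
Proof. intros Hf Hg x. apply continuous_comp; auto. Qed.
Lemma cont_cos f : cont f -> cont (fun x => cos (f x)).
Proof. intros Hf x. apply continuous_cos_comp; auto. Qed.
Lemma cont_sin f : cont f -> cont (fun x => sin (f x)).
Proof. intros Hf x. apply continuous_sin_comp; auto. Qed.
Lemma cont_exp f : cont f -> cont (fun x => exp (f x)).
Proof. intros Hf x. apply continuous_exp_comp; auto. Qed.
Lemma cont_pow f n : cont f -> cont (fun x => f x ^ n).
Proof.
  intros Hf; induction n; simpl. apply cont_const. apply (cont_mult f (fun x => f x ^ n)); auto.
Qed.
Lemma cont_abs f : cont f -> cont (fun x => Rabs (f x)).
Proof. intros Hf x. apply continuous_comp; [apply Hf | apply continuous_Rabs]. Qed.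
Lemma cont_max f g : cont f -> cont g -> cont (fun x => Rmax (f x) (g x)).
Proof.
  intros Hf Hg. apply cont_ext with (fun x => (f x + g x + Rabs (f x - g x)) * / 2).
  intros x. unfold Rmax, Rabs. destruct (Rle_dec _ _); destruct (Rcase_abs _); lra.
  apply (cont_mult (fun x => f x + g x + Rabs (f x - g x)) (fun _ => / 2)); [|apply cont_const].
  apply (cont_plus (fun x => f x + g x) (fun x => Rabs (f x - g x))). now apply cont_plus.
  apply (cont_abs (fun x => f x - g x)). now apply cont_minus.
Qed.
Lemma cont_min f g : cont f -> cont g -> cont (fun x => Rmin (f x) (g x)).
Proof.
  intros Hf Hg. apply cont_ext with (fun x => - Rmax (- f x) (- g x)).
  intros x. unfold Rmax, Rmin. destruct (Rle_dec _ _); destruct (Rle_dec _ _); lra.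
  apply (cont_opp (fun x => Rmax (- f x) (- g x))).
  apply (cont_max (fun x => - f x) (fun x => - g x)); now apply cont_opp.
Qed.
Lemma is_derive_cont (f f' : R -> R) : (forall x, is_derive f x (f' x)) -> cont f.
Proof. intros H x. apply (ex_derive_continuous f). exists (f' x). apply H. Qed.

Ltac triang := eapply Rle_trans; [apply Rabs_triang |].
Ltac unabs H := apply Rabs_le_between in H.
Ltac from_abs H := eapply Rle_trans; [apply Rabs_pos | apply H].
Ltac min_le := first [apply Rmin_l | apply Rmin_r | eapply Rle_trans; [apply Rmin_r | min_le]].
Ltac prod_pos := lazymatch goal with
  | |- 0 <= ?x * ?x => apply Rle_0_sqr
  | |- 0 <= _ * _ => apply Rmult_le_pos; prod_pos
  | |- 0 < _ * _ => apply Rmult_lt_0_compat; prod_pos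
  | |- 0 <= Rabs _ => apply Rabs_pos
  | |- _ => lra
  end.
Ltac pnra := first [solve [prod_pos] | nra].

Ltac ct :=
  repeat first
    [ assumption
    | match goal with
      | |- cont (fun _ => ?c) => apply (cont_const c)
      | |- cont (fun x => x) => apply cont_id
      | |- cont (fun x => @?f x + @?g x) => apply (cont_plus f g)
      | |- cont (fun x => @?f x - @?g x) => apply (cont_minus f g)
      | |- cont (fun x => - @?f x) => apply (cont_opp f)
      | |- cont (fun x => @?f x * @?g x) => apply (cont_mult f g)
      | |- cont (fun x => @?f x / ?c) => apply (cont_mult f (fun _ => / c))
      | |- cont (fun x => (@?f x) ^ ?n) => apply (cont_pow f n)
      | |- cont (fun x => cos (@?f x)) => apply (cont_cos f)
      | |- cont (fun x => sin (@?f x)) => apply (cont_sin f)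
      | |- cont (fun x => exp (@?f x)) => apply (cont_exp f)
      | |- cont (fun x => Rabs (@?f x)) => apply (cont_abs f)
      | |- cont (fun x => Rmax (@?f x) (@?g x)) => apply (cont_max f g)
      | |- cont (fun x => Rmin (@?f x) (@?g x)) => apply (cont_min f g)
      | |- cont (fun x => ?f (@?g x)) => apply (cont_comp f g)
      | |- cont ?f => change (cont (fun x => f x)); assumption
      end
    | assumption ].

Lemma ex_RI (f : R -> R) a b : cont f -> ex_RInt f a b.
Proof. intros Hf. apply (ex_RInt_continuous (V := R_CompleteNormedModule)). intros; apply Hf. Qed.
(** The laws below restate those of [RInt] with the operations of [R], so that [ring] and [lra]
    apply after rewriting; continuity everywhere settles integrability. *)
Definition RI (f : R -> R) (a b : R) : R := RInt f a b.
Lemma RI_ext (f g : R -> R) a b : (forall x, f x = g x) -> RI f a b = RI g a b.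
Proof. unfold RI; intros E. apply RInt_ext. intros; apply E. Qed.
Lemma RI_plus f g a b : cont f -> cont g -> RI (fun x => f x + g x) a b = RI f a b + RI g a b.
Proof. unfold RI; intros. apply (RInt_plus (V := R_CompleteNormedModule)); now apply ex_RI. Qed.
Lemma RI_minus f g a b : cont f -> cont g -> RI (fun x => f x - g x) a b = RI f a b - RI g a b.
Proof. unfold RI; intros. apply (RInt_minus (V := R_CompleteNormedModule)); now apply ex_RI. Qed.
Lemma RI_scal k f a b : cont f -> RI (fun x => k * f x) a b = k * RI f a b.
Proof. unfold RI; intros. apply (RInt_scal (V := R_CompleteNormedModule)); now apply ex_RI. Qed.
Lemma RI_const k a b : RI (fun _ => k) a b = (b - a) * k.
Proof. unfold RI; rewrite RInt_const. reflexivity. Qed.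
Lemma RI_chasles f a b c : cont f -> RI f a b + RI f b c = RI f a c.
Proof. unfold RI; intros. apply (RInt_Chasles (V := R_CompleteNormedModule)); now apply ex_RI. Qed.
Lemma RI_le f g a b : a <= b -> cont f -> cont g -> (forall x, a <= x <= b -> f x <= g x) ->
  RI f a b <= RI g a b.
Proof. unfold RI; intros. apply RInt_le; auto using ex_RI. intros; apply H2; lra. Qed.
Lemma RI_ge0 f a b : a <= b -> cont f -> (forall x, a <= x <= b -> 0 <= f x) -> 0 <= RI f a b.
Proof. unfold RI; intros. apply RInt_ge_0; auto using ex_RI. intros; apply H1; lra. Qed.
Lemma RI_abs f a b M : a <= b -> cont f -> (forall x, a <= x <= b -> Rabs (f x) <= M) ->
  Rabs (RI f a b) <= (b - a) * M.
Proof. unfold RI; intros. apply abs_RInt_le_const; auto using ex_RI. Qed.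
Lemma RI_derive (f f' : R -> R) a b : (forall x, is_derive f x (f' x)) -> cont f' ->
  RI f' a b = f b - f a.
Proof. unfold RI;
  intros. apply is_RInt_unique. apply (is_RInt_derive (V := R_CompleteNormedModule)); auto.
Qed.
Lemma RI_prim f a t : cont f -> is_derive (fun t => RI f a t) t (f t).
Proof. unfold RI;
  intros. apply is_derive_RInt with a; auto. apply filter_forall. intros y.
  apply (RInt_correct (V := R_CompleteNormedModule)). now apply ex_RI.
Qed.
Lemma RI_shift f a b k : cont f -> RI (fun t => f (t - k)) a b = RI f (a - k) (b - k).
Proof. unfold RI;
  intros Hf. pose proof (RInt_comp_lin f 1 (- k) a b (ex_RI f _ _ Hf)) as E.
  replace (1 * a + - k) with (a - k) in E by ring.
  replace (1 * b + - k) with (b - k) in E by ring.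
  rewrite <- E. apply RI_ext. intros x. unfold scal; simpl; unfold mult; simpl.
  rewrite Rmult_1_l. f_equal; ring.
Qed.
Lemma RI_0 f a : RI f a a = 0.
Proof. apply (RInt_point (V := R_CompleteNormedModule)). Qed.

Lemma is_derive_eq (f : R -> R) (x l l' : R) : is_derive f x l -> l = l' -> is_derive f x l'.
Proof. intros H <-; exact H. Qed.
Lemma D_plus (f g : R -> R) x a b :
  is_derive f x a -> is_derive g x b -> is_derive (fun y => f y + g y) x (a + b).
Proof. intros; now apply (is_derive_plus (K := R_AbsRing) (V := R_NormedModule)). Qed.
Lemma D_minus (f g : R -> R) x a b :
  is_derive f x a -> is_derive g x b -> is_derive (fun y => f y - g y) x (a - b).
Proof. intros; now apply (is_derive_minus (K := R_AbsRing) (V := R_NormedModule)). Qed.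
Lemma D_mult (f g : R -> R) x a b :
  is_derive f x a -> is_derive g x b -> is_derive (fun y => f y * g y) x (a * g x + f x * b).
Proof.
  intros. apply (is_derive_mult f g); auto. intros; apply Rmult_comm.
Qed.
Lemma D_scal (k : R) (f : R -> R) x a :
  is_derive f x a -> is_derive (fun y => k * f y) x (k * a).
Proof. intros; now apply (is_derive_scal f). Qed.
Lemma D_const (k x : R) : is_derive (fun _ : R => k) x 0.
Proof. apply (is_derive_const (K := R_AbsRing) (V := R_NormedModule)). Qed.
Lemma D_id (x : R) : is_derive (fun y : R => y) x 1.
Proof. apply (is_derive_id (K := R_AbsRing)). Qed.
Lemma D_comp (f g : R -> R) x a b :
  is_derive f (g x) a -> is_derive g x b -> is_derive (fun y => f (g y)) x (b * a).
Proof. intros; now apply (is_derive_comp f g). Qed.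
Lemma D_shift (f : R -> R) k x a : is_derive f (x - k) a -> is_derive (fun y => f (y - k)) x a.
Proof.
  intros. eapply is_derive_eq. apply (D_comp f (fun y => y - k)); eauto.
  apply D_minus. apply D_id. apply D_const. ring.
Qed.
Lemma D_window f t : cont f -> is_derive (fun t => RI f (t - 1) t) t (f t - f (t - 1)).
Proof.
  intros. apply (is_derive_ext (fun t => RI f 0 t - RI f 0 (t - 1))).
  intros s. rewrite <- (RI_chasles f 0 (s - 1) s); auto. simpl; ring.
  apply D_minus. now apply RI_prim. apply (D_shift (fun s => RI f 0 s)). now apply RI_prim.
Qed.

(** The integrals of [(f - g / k)^2] and [(f + g / k)^2] are nonnegative. The weight [k] stays free;
    optimising it gives the Cauchy-Schwarz inequality, see [sq_le_of_amgm]. *)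
Lemma RI_amgm f g a b k : a <= b -> 0 < k -> cont f -> cont g ->
  Rabs (RI (fun x => f x * g x) a b) <= / 2 * (k * RI (fun x => f x ^ 2) a b + / k * RI (fun x => g x ^ 2) a b).
Proof.
  intros Hab Hk Hf Hg.
  assert (Hkk : k * / k = 1) by (field; lra).
  assert (Hk' : 0 < / k) by now apply Rinv_0_lt_compat.
  assert (E : forall s, s * s = 1 -> 0 <= / 2 * (k * RI (fun x => f x ^ 2) a b + / k * RI (fun x => g x ^ 2) a b) - s * RI (fun x => f x * g x) a b).
  { intros s Hs.
    rewrite <- (RI_scal k), <- (RI_scal (/ k)) by ct.
    rewrite <- RI_plus by ct. rewrite <- RI_scal by ct. rewrite <- (RI_scal s) by ct.
    rewrite <- RI_minus by ct. apply RI_ge0; auto. ct.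
    intros x _.
    replace (/ 2 * (k * f x ^ 2 + / k * g x ^ 2) - s * (f x * g x)) with (/2 * k * (f x - s * / k * g x) ^ 2).
    apply Rmult_le_pos. lra. apply pow2_ge_0.
    replace (k * f x ^ 2 + / k * g x ^ 2) with (k * f x ^ 2 + (s * s) * (k * / k) * / k * g x ^ 2) by (rewrite Hs, Hkk; ring).
    replace (s * (f x * g x)) with (s * (k * / k) * (f x * g x)) by (rewrite Hkk; ring). field; lra. }
  pose proof (E 1 ltac:(ring)). pose proof (E (-1) ltac:(ring)).
  apply Rabs_le; lra.
Qed.

(** * Fourier series *)

Fixpoint psum (f : nat -> R) (n : nat) : R :=
  match n with O => 0 | S n => psum f n + f n end.

Lemma psum_ext f g n : (forall k, (k < n)%nat -> f k = g k) -> psum f n = psum g n.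
Proof. induction n; simpl; intros H; auto. rewrite IHn, H; auto. Qed.
Lemma psum_le f g n : (forall k, (k < n)%nat -> f k <= g k) -> psum f n <= psum g n.
Proof.
  induction n; simpl; intros H. lra.
  apply Rplus_le_compat. apply IHn; auto. apply H; auto.
Qed.
Lemma psum_scal c f n : psum (fun k => c * f k) n = c * psum f n.
Proof. induction n; simpl. ring. rewrite IHn; ring. Qed.

Section Fourier.
Variables P nu : R.
Hypothesis P_pos : 0 < P.
Hypothesis nuP : nu * P = 2 * PI.

Definition ck (k : nat) (t : R) : R := cos (INR k * nu * t).
Definition sk (k : nat) (t : R) : R := sin (INR k * nu * t).
Definition fA (f : R -> R) (k : nat) : R := RI (fun t => f t * ck k t) 0 P.
Definition fB (f : R -> R) (k : nat) : R := RI (fun t => f t * sk k t) 0 P.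
Definition wt (k : nat) : R := match k with O => / P | _ => 2 / P end.

Lemma nu_pos : 0 < nu.
Proof. pose proof PI_RGT_0. apply Rmult_lt_reg_r with P; auto. rewrite nuP; lra. Qed.
Lemma wt_pos k : 0 < wt k.
Proof.
  destruct k; simpl. now apply Rinv_0_lt_compat. apply Rdiv_lt_0_compat; lra.
Qed.
Lemma cont_ck k : cont (ck k). Proof. unfold ck; ct. Qed.
Lemma cont_sk k : cont (sk k). Proof. unfold sk; ct. Qed.
Hint Resolve cont_ck cont_sk : core.
Lemma ck_bound k t : Rabs (ck k t) <= 1.
Proof. apply Rabs_le, COS_bound. Qed.
Lemma sk_bound k t : Rabs (sk k t) <= 1.
Proof. apply Rabs_le, SIN_bound. Qed.
Lemma ck_P k : ck k P = 1.
Proof.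
  unfold ck. replace (INR k * nu * P) with (0 + 2 * INR k * PI). now rewrite cos_period, cos_0.
  transitivity (INR k * (nu * P)). rewrite nuP; ring. ring.
Qed.
Lemma sk_P k : sk k P = 0.
Proof.
  unfold sk. replace (INR k * nu * P) with (0 + 2 * INR k * PI). now rewrite sin_period, sin_0.
  transitivity (INR k * (nu * P)). rewrite nuP; ring. ring.
Qed.
Lemma ck_0 k : ck k 0 = 1.
Proof. unfold ck. now rewrite Rmult_0_r, cos_0. Qed.
Lemma sk_0 k : sk k 0 = 0.
Proof. unfold sk. now rewrite Rmult_0_r, sin_0. Qed.
Lemma ck_per k t : ck k (t + P) = ck k t.
Proof.
  unfold ck. rewrite <- (cos_period (INR k * nu * t) k). f_equal.
  replace (2 * INR k * PI) with (INR k * (2 * PI)) by ring. rewrite <- nuP. ring.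
Qed.
Lemma sk_per k t : sk k (t + P) = sk k t.
Proof.
  unfold sk. rewrite <- (sin_period (INR k * nu * t) k). f_equal.
  replace (2 * INR k * PI) with (INR k * (2 * PI)) by ring. rewrite <- nuP. ring.
Qed.
Lemma D_ck k t : is_derive (ck k) t (- (INR k * nu) * sk k t).
Proof. unfold ck, sk. auto_derive; auto. ring. Qed.
Lemma D_sk k t : is_derive (sk k) t ((INR k * nu) * ck k t).
Proof. unfold ck, sk. auto_derive; auto. ring. Qed.

Lemma fB_0 f : fB f 0 = 0.
Proof.
  unfold fB. rewrite (RI_ext _ (fun _ => 0)). rewrite RI_const; ring.
  intros t. unfold sk; simpl. rewrite !Rmult_0_l, sin_0; ring.
Qed.
Lemma fA_lin f g a k : cont f -> cont g -> fA (fun t => f t + a * g t) k = fA f k + a * fA g k.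
Proof.
  intros. unfold fA. rewrite <- RI_scal by (ct; auto).
  rewrite <- RI_plus by (ct; auto). apply RI_ext; intros; ring.
Qed.
Lemma fB_lin f g a k : cont f -> cont g -> fB (fun t => f t + a * g t) k = fB f k + a * fB g k.
Proof.
  intros. unfold fB. rewrite <- RI_scal by (ct; auto).
  rewrite <- RI_plus by (ct; auto). apply RI_ext; intros; ring.
Qed.

Lemma int_ck k : (k <> 0)%nat -> RI (ck k) 0 P = 0.
Proof.
  intros Hk. assert (INR k * nu <> 0).
  { apply Rmult_integral_contrapositive; split. now apply not_0_INR. pose proof nu_pos; lra. }
  rewrite (RI_derive (fun t => / (INR k * nu) * sk k t) (ck k)); auto.
  rewrite sk_P, sk_0; ring.
  intros t. eapply is_derive_eq. apply D_scal, D_sk. field. split; auto.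
  pose proof nu_pos; lra. now apply not_0_INR.
Qed.
Lemma int_sk k : RI (sk k) 0 P = 0.
Proof.
  destruct k as [|k]. { transitivity (fB (fun _ => 1) 0). apply RI_ext; intros; ring. apply fB_0. }
  assert (INR (S k) <> 0) by (apply not_0_INR; lia). pose proof nu_pos.
  rewrite (RI_derive (fun t => - / (INR (S k) * nu) * ck (S k) t) (sk (S k))); auto.
  rewrite ck_P, ck_0; ring.
  intros t. eapply is_derive_eq. apply D_scal, D_ck. field. lra.
Qed.

Lemma ckck_le j k t : (j <= k)%nat -> ck j t * ck k t = / 2 * (ck (k - j) t + ck (k + j) t).
Proof.
  intros H. unfold ck. rewrite minus_INR, plus_INR by auto.
  replace ((INR k - INR j) * nu * t) with (INR k * nu * t - INR j * nu * t) by ring.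
  replace ((INR k + INR j) * nu * t) with (INR k * nu * t + INR j * nu * t) by ring.
  rewrite cos_minus, cos_plus; field.
Qed.
Lemma sksk_le j k t : (j <= k)%nat -> sk j t * sk k t = / 2 * (ck (k - j) t - ck (k + j) t).
Proof.
  intros H. unfold ck, sk. rewrite minus_INR, plus_INR by auto.
  replace ((INR k - INR j) * nu * t) with (INR k * nu * t - INR j * nu * t) by ring.
  replace ((INR k + INR j) * nu * t) with (INR k * nu * t + INR j * nu * t) by ring.
  rewrite cos_minus, cos_plus; field.
Qed.
Lemma int_ckck j k : j <> k -> RI (fun t => ck j t * ck k t) 0 P = 0.
Proof.
  assert (E : forall j k, (j < k)%nat -> RI (fun t => ck j t * ck k t) 0 P = 0).
  { intros i l H. rewrite (RI_ext _ (fun t => / 2 * (ck (l - i) t + ck (l + i) t))).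
    2: intros; apply ckck_le; lia.
    rewrite RI_scal, RI_plus by (ct; auto). rewrite !int_ck by lia. ring. }
  intros H. destruct (Nat.lt_ge_cases j k). now apply E.
  rewrite (RI_ext _ (fun t => ck k t * ck j t)). apply E; lia. intros; ring.
Qed.
Lemma int_sksk j k : j <> k -> RI (fun t => sk j t * sk k t) 0 P = 0.
Proof.
  assert (E : forall j k, (j < k)%nat -> RI (fun t => sk j t * sk k t) 0 P = 0).
  { intros i l H. rewrite (RI_ext _ (fun t => / 2 * (ck (l - i) t - ck (l + i) t))).
    2: intros; apply sksk_le; lia.
    rewrite RI_scal, RI_minus by (ct; auto). rewrite !int_ck by lia. ring. }
  intros H. destruct (Nat.lt_ge_cases j k). now apply E.
  rewrite (RI_ext _ (fun t => sk k t * sk j t)). apply E; lia. intros; ring.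
Qed.
Lemma int_cksk j k : RI (fun t => ck j t * sk k t) 0 P = 0.
Proof.
  destruct (Nat.le_ge_cases j k) as [H|H].
  - rewrite (RI_ext _ (fun t => / 2 * (sk (k - j) t + sk (k + j) t))).
    rewrite RI_scal, RI_plus by (ct; auto). rewrite !int_sk. ring.
    intros t. unfold ck, sk. rewrite minus_INR, plus_INR by auto.
    replace ((INR k - INR j) * nu * t) with (INR k * nu * t - INR j * nu * t) by ring.
    replace ((INR k + INR j) * nu * t) with (INR k * nu * t + INR j * nu * t) by ring.
    rewrite sin_minus, sin_plus; field.
  - rewrite (RI_ext _ (fun t => / 2 * (sk (j + k) t - sk (j - k) t))).
    rewrite RI_scal, RI_minus by (ct; auto). rewrite !int_sk. ring.
    intros t. unfold ck, sk. rewrite minus_INR, plus_INR by auto.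
    replace ((INR j - INR k) * nu * t) with (INR j * nu * t - INR k * nu * t) by ring.
    replace ((INR j + INR k) * nu * t) with (INR j * nu * t + INR k * nu * t) by ring.
    rewrite sin_minus, sin_plus; field.
Qed.
Lemma int_ck2 k : wt k * RI (fun t => ck k t * ck k t) 0 P = 1.
Proof.
  rewrite (RI_ext _ (fun t => / 2 * (ck (k - k) t + ck (k + k) t))).
  2: intros; now apply ckck_le.
  rewrite RI_scal, RI_plus by (ct; auto). rewrite Nat.sub_diag.
  assert (E : RI (ck 0) 0 P = P).
  { rewrite (RI_ext _ (fun _ => 1)). rewrite RI_const; ring.
    intros t; unfold ck; simpl. rewrite !Rmult_0_l; apply cos_0. }
  rewrite E. destruct k; simpl. rewrite E; field; lra.
  rewrite int_ck by lia. field; lra.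
Qed.
Lemma int_sk2 k : (k <> 0)%nat -> wt k * RI (fun t => sk k t * sk k t) 0 P = 1.
Proof.
  intros Hk.
  rewrite (RI_ext _ (fun t => / 2 * (ck (k - k) t - ck (k + k) t))).
  2: intros; now apply sksk_le.
  rewrite RI_scal, RI_minus by (ct; auto). rewrite Nat.sub_diag.
  assert (E : RI (ck 0) 0 P = P).
  { rewrite (RI_ext _ (fun _ => 1)). rewrite RI_const; ring.
    intros t; unfold ck; simpl. rewrite !Rmult_0_l; apply cos_0. }
  rewrite E. destruct k; simpl. easy.
  rewrite int_ck by lia. field; lra.
Qed.

Definition tp (a b : nat -> R) (n : nat) (t : R) : R := psum (fun k => a k * ck k t + b k * sk k t) n.

Lemma cont_tp a b n : cont (tp a b n).
Proof.
  unfold tp; induction n; simpl. apply cont_const.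
  ct; auto.
Qed.
Hint Resolve cont_tp : core.

Lemma fA_tp_ge a b n j : (n <= j)%nat -> fA (tp a b n) j = 0.
Proof.
  induction n; intros H.
  - unfold fA, tp; simpl. rewrite (RI_ext _ (fun _ => 0)). rewrite RI_const; ring. intros; ring.
  - unfold fA. rewrite (RI_ext _ (fun t => tp a b n t * ck j t + (a n * (ck n t * ck j t) + b n * (ck j t * sk n t)))).
    2: intros; unfold tp; simpl; ring.
    rewrite !RI_plus, !RI_scal by (ct; auto). rewrite int_ckck, int_cksk by lia.
    change (fA (tp a b n) j + (a n * 0 + b n * 0) = 0). rewrite IHn by lia. ring.
Qed.
Lemma fB_tp_ge a b n j : (n <= j)%nat -> fB (tp a b n) j = 0.
Proof.
  induction n; intros H.
  - unfold fB, tp; simpl. rewrite (RI_ext _ (fun _ => 0)). rewrite RI_const; ring. intros; ring.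
  - unfold fB. rewrite (RI_ext _ (fun t => tp a b n t * sk j t + (a n * (ck n t * sk j t) + b n * (sk n t * sk j t)))).
    2: intros; unfold tp; simpl; ring.
    rewrite !RI_plus, !RI_scal by (ct; auto). rewrite int_sksk, int_cksk by lia.
    change (fB (tp a b n) j + (a n * 0 + b n * 0) = 0). rewrite IHn by lia. ring.
Qed.
Lemma fA_tp a b n j : (j < n)%nat -> fA (tp a b n) j = a j / wt j.
Proof.
  induction 1.
  - unfold fA. rewrite (RI_ext _ (fun t => tp a b j t * ck j t + (a j * (ck j t * ck j t) + b j * (ck j t * sk j t)))).
    2: intros; unfold tp; simpl; ring.
    rewrite !RI_plus, !RI_scal by (ct; auto). rewrite int_cksk.
    change (fA (tp a b j) j + (a j * RI (fun x => ck j x * ck j x) 0 P + b j * 0) = a j / wt j).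
    rewrite fA_tp_ge by lia. pose proof (wt_pos j). pose proof (int_ck2 j).
    apply Rmult_eq_reg_l with (wt j); [|lra]. transitivity (a j * (wt j * RI (fun x => ck j x * ck j x) 0 P)). ring.
    rewrite H0; field; lra.
  - unfold fA. rewrite (RI_ext _ (fun t => tp a b m t * ck j t + (a m * (ck m t * ck j t) + b m * (ck j t * sk m t)))).
    2: intros; unfold tp; simpl; ring.
    rewrite !RI_plus, !RI_scal by (ct; auto). rewrite int_ckck, int_cksk by lia.
    change (fA (tp a b m) j + (a m * 0 + b m * 0) = a j / wt j). rewrite IHle. ring.
Qed.
Lemma fB_tp a b n j : (j <> 0)%nat -> (j < n)%nat -> fB (tp a b n) j = b j / wt j.
Proof.
  intros Hj. induction 1.
  - unfold fB. rewrite (RI_ext _ (fun t => tp a b j t * sk j t + (a j * (ck j t * sk j t) + b j * (sk j t * sk j t)))).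
    2: intros; unfold tp; simpl; ring.
    rewrite !RI_plus, !RI_scal by (ct; auto). rewrite int_cksk.
    change (fB (tp a b j) j + (a j * 0 + b j * RI (fun x => sk j x * sk j x) 0 P) = b j / wt j).
    rewrite fB_tp_ge by lia. pose proof (wt_pos j). pose proof (int_sk2 j Hj).
    apply Rmult_eq_reg_l with (wt j); [|lra]. transitivity (b j * (wt j * RI (fun x => sk j x * sk j x) 0 P)). ring.
    rewrite H0; field; lra.
  - unfold fB. rewrite (RI_ext _ (fun t => tp a b m t * sk j t + (a m * (ck m t * sk j t) + b m * (sk m t * sk j t)))).
    2: intros; unfold tp; simpl; ring.
    rewrite !RI_plus, !RI_scal by (ct; auto). rewrite int_sksk, int_cksk by lia.
    change (fB (tp a b m) j + (a m * 0 + b m * 0) = b j / wt j). rewrite IHle. ring.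
Qed.

Definition cA f k := wt k * fA f k.
Definition cB f k := wt k * fB f k.

(** Induction on [n]: the partial sum has no harmonic of order [n], so the remainder still has the
    n-th coefficients of [f], and subtracting the n-th term lowers the square integral by the n-th
    summand. *)
Lemma bessel_eq f n : cont f ->
  RI (fun t => (f t - tp (cA f) (cB f) n t) ^ 2) 0 P
  = RI (fun t => f t ^ 2) 0 P - psum (fun k => wt k * (fA f k ^ 2 + fB f k ^ 2)) n.
Proof.
  intros Hf. induction n.
  - unfold tp; simpl. rewrite (RI_ext _ (fun t => f t * (f t * 1))). ring. intros; ring.
  - set (g := fun t => f t - tp (cA f) (cB f) n t) in *.
    assert (Hg : cont g) by (unfold g; ct; auto).
    change (RI (fun t => g t ^ 2) 0 P = RI (fun t => f t ^ 2) 0 P - psum (fun k => wt k * (fA f k ^ 2 + fB f k ^ 2)) n) in IHn.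
    rewrite (RI_ext _ (fun t => g t ^ 2 + ((-2 * cA f n) * (g t * ck n t) + ((-2 * cB f n) * (g t * sk n t) +
       (cA f n ^ 2 * (ck n t * ck n t) + (cB f n ^ 2 * (sk n t * sk n t) + 2 * cA f n * cB f n * (ck n t * sk n t))))))).
    2: intros; unfold g, tp; simpl; ring.
    rewrite !RI_plus, !RI_scal by (ct; auto). rewrite IHn.
    assert (EA : RI (fun t => g t * ck n t) 0 P = fA f n).
    { change (fA g n = fA f n). unfold g.
      transitivity (fA (fun t => f t + -1 * tp (cA f) (cB f) n t) n). apply RI_ext; intros; ring.
      rewrite fA_lin by auto. rewrite fA_tp_ge; auto; ring. }
    assert (EB : RI (fun t => g t * sk n t) 0 P = fB f n).
    { change (fB g n = fB f n). unfold g.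
      transitivity (fB (fun t => f t + -1 * tp (cA f) (cB f) n t) n). apply RI_ext; intros; ring.
      rewrite fB_lin by auto. rewrite fB_tp_ge; auto; ring. }
    rewrite EA, EB, int_cksk. unfold cA, cB. simpl psum.
    pose proof (int_ck2 n) as E1.
    assert (E2 : fB f n ^ 2 * (wt n * RI (fun t => sk n t * sk n t) 0 P) = fB f n ^ 2).
    { destruct n. rewrite fB_0; ring. rewrite int_sk2 by lia; ring. }
    set (I1 := RI (fun t => ck n t * ck n t) 0 P) in *.
    set (I2 := RI (fun t => sk n t * sk n t) 0 P) in *.
    replace ((wt n * fA f n) ^ 2 * I1) with (wt n * fA f n ^ 2 * (wt n * I1)) by ring.
    replace ((wt n * fB f n) ^ 2 * I2) with (wt n * (fB f n ^ 2 * (wt n * I2))) by ring.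
    rewrite E1, E2. ring.
Qed.
Lemma bessel f n : cont f ->
  psum (fun k => wt k * (fA f k ^ 2 + fB f k ^ 2)) n <= RI (fun t => f t ^ 2) 0 P.
Proof.
  intros Hf. pose proof (bessel_eq f n Hf).
  assert (0 <= RI (fun t => (f t - tp (cA f) (cB f) n t) ^ 2) 0 P).
  { apply RI_ge0. lra. ct; auto. intros; apply pow2_ge_0. }
  lra.
Qed.
End Fourier.

(** * Uniform limits and completeness of the trigonometric system *)

Lemma cont_eps f : cont f <-> forall x e, 0 < e -> exists d, 0 < d /\ forall y, Rabs (y - x) < d -> Rabs (f y - f x) < e.
Proof.
  split.
  - intros H x e He. specialize (H x). apply continuity_pt_filterlim in H.
    destruct (proj1 (continuity_pt_locally f x) H (mkposreal e He)) as [d Hd].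
    exists d; split. apply cond_pos. intros y Hy. apply Hd. exact Hy.
  - intros H x. apply continuity_pt_filterlim. apply continuity_pt_locally. intros e.
    destruct (H x e (cond_pos e)) as [d [Hd Hx]]. exists (mkposreal d Hd). intros y Hy. apply Hx, Hy.
Qed.

Lemma cont_pt f x : cont f -> continuity_pt f x.
Proof. intros H. apply continuity_pt_filterlim, H. Qed.

Lemma cont_bounded f a b : cont f -> exists M, 0 < M /\ forall x, a <= x <= b -> Rabs (f x) <= M.
Proof.
  intros Hf. destruct (Rle_lt_dec a b) as [Hab|Hab].
  - destruct (continuity_ab_maj (fun x => Rabs (f x)) a b Hab) as [m [Hm _]].
    intros c _. apply (cont_pt (fun x => Rabs (f x))). ct.
    exists (Rabs (f m) + 1). split. pose proof (Rabs_pos (f m)); lra. intros x Hx. specialize (Hm x Hx); lra.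
  - exists 1. split. lra. intros; lra.
Qed.

Lemma uniform_limit (F : nat -> R -> R) : (forall n, cont (F n)) ->
  (forall e, 0 < e -> exists N, forall n m, (N <= n)%nat -> (N <= m)%nat -> forall t, Rabs (F n t - F m t) <= e) ->
  exists S, cont S /\ forall e, 0 < e -> exists N, forall n, (N <= n)%nat -> forall t, Rabs (F n t - S t) <= e.
Proof.
  intros HF HC.
  assert (L : forall t, { l : R | Un_cv (fun n => F n t) l}).
  { intros t. apply Rcomplete.R_complete. intros e He. destruct (HC (e / 2)) as [N HN]. lra.
    exists N. intros n m Hn Hm. unfold Rdist. specialize (HN n m Hn Hm t). lra. }
  set (S := fun t => proj1_sig (L t)).
  assert (HS : forall t, Un_cv (fun n => F n t) (S t)) by (intros t; apply (proj2_sig (L t))).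
  assert (HU : forall e, 0 < e -> exists N, forall n, (N <= n)%nat -> forall t, Rabs (F n t - S t) <= e).
  { intros e He. destruct (HC (e / 2)) as [N HN]. lra. exists N. intros n Hn t.
    destruct (HS t (e / 2)) as [N' HN']. lra.
    specialize (HN n (N + N')%nat Hn ltac:(lia) t). specialize (HN' (N + N')%nat ltac:(lia)).
    unfold Rdist in HN'. replace (F n t - S t) with ((F n t - F (N + N')%nat t) + (F (N + N')%nat t - S t)) by ring.
    triang. lra. }
  exists S. split; auto. apply cont_eps. intros x e He.
  destruct (HU (e / 4)) as [N HN]. lra. specialize (HN N (le_n _)).
  destruct (proj1 (cont_eps (F N)) (HF N) x (e / 4)) as [d [Hd Hx]]. lra.
  exists d; split; auto. intros y Hy. specialize (Hx y Hy). pose proof (HN x) as H1. pose proof (HN y) as H2.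
  apply Rabs_def2 in Hx. unabs H1. unabs H2.
  apply Rabs_def1; lra.
Qed.

Lemma psum_inv_sq n : psum (fun k => match k with O => 0 | _ => / INR k ^ 2 end) n <= 2.
Proof.
  assert (E : forall n, psum (fun k => match k with O => 0 | _ => / INR k ^ 2 end) (S (S n)) <= 2 - / INR (S n)).
  { induction n0. simpl. lra.
    set (f := fun k => _) in *. change (psum f (S (S n0)) + f (S (S n0)) <= 2 - / INR (S (S n0))). unfold f at 2.
    rewrite !S_INR in *. pose proof (pos_INR n0). set (x := INR n0) in *.
    enough (/ (x + 1 + 1) ^ 2 <= / (x + 1) - / (x + 1 + 1)) by lra.
    replace (/ (x + 1) - / (x + 1 + 1)) with (/ ((x + 1) * (x + 1 + 1))) by (field; lra).
    apply Rinv_le_contravar; pnra. }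
  destruct n as [|[|n]]; [simpl; lra | simpl; lra |].
  eapply Rle_trans. apply E. pose proof (pos_INR n). rewrite S_INR.
  assert (0 < / (INR n + 1)) by (apply Rinv_0_lt_compat; lra). lra.
Qed.

(** Termwise [|a k| <= (l k^2 (a k)^2 + 1 / (l k^2)) / 2] for [k >= 1]; the two sequences contribute
    twice the sum of inverse squares, which is at most 2. The parameter [l] is free so that the
    bound can be made homogeneous in the data. *)
Lemma psum_abs_le (a b : nat -> R) E l n : 0 < l ->
  (forall n, psum (fun k => INR k ^ 2 * (a k ^ 2 + b k ^ 2)) n <= E) ->
  psum (fun k => Rabs (a k) + Rabs (b k)) n <= Rabs (a 0%nat) + Rabs (b 0%nat) + / 2 * (l * E + 4 / l).
Proof.
  intros Hl HE.
  assert (Hil : 0 < / l) by now apply Rinv_0_lt_compat.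
  assert (Hll : l * / l = 1) by (field; lra).
  pose proof (psum_inv_sq n) as H2. specialize (HE n).
  eapply Rle_trans. 2:{ apply Rplus_le_compat_l. apply Rmult_le_compat_l. lra. apply Rplus_le_compat.
    apply Rmult_le_compat_l. lra. exact HE.
    apply Rle_trans with (2 / l * psum (fun k => match k with O => 0 | _ => / INR k ^ 2 end) n).
    apply Rle_refl. unfold Rdiv. pnra. }
  clear H2 HE. induction n. simpl. pose proof (Rabs_pos (a 0%nat)); pose proof (Rabs_pos (b 0%nat)); lra.
  destruct n.
  { simpl. pose proof (Rabs_pos (a 0%nat)); pose proof (Rabs_pos (b 0%nat)); pnra. }
  set (f := fun k => Rabs (a k) + _) in *. set (g := fun k => match k with O => 0 | _ => _ end) in *.
  set (h := fun k => INR k ^ 2 * _) in *.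
  change (psum f (S n) + f (S n) <= Rabs (a 0%nat) + Rabs (b 0%nat) + / 2 * (l * (psum h (S n) + h (S n)) + 2 / l * (psum g (S n) + g (S n)))).
  enough (f (S n) <= / 2 * (l * h (S n) + 2 / l * g (S n))) by lra.
  unfold f, g, h. clear -Hl Hil Hll. assert (0 < INR (S n)) by (apply lt_0_INR; lia). set (x := INR (S n)) in *.
  assert (E : forall y, Rabs y <= / 2 * (l * (x ^ 2 * y ^ 2) + / l * / x ^ 2)).
  { intros y. assert (0 <= (l * x ^ 2 * Rabs y - 1) ^ 2) by apply pow2_ge_0.
    assert (Rabs y ^ 2 = y ^ 2) by (rewrite pow2_abs; auto).
    apply Rmult_le_reg_l with (2 * (l * x ^ 2)). assert (0 < x ^ 2) by (apply pow_lt; auto). assert (0 < l * x ^ 2) by now apply Rmult_lt_0_compat. lra.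
    replace (2 * (l * x ^ 2) * (/ 2 * (l * (x ^ 2 * y ^ 2) + / l * / x ^ 2))) with ((l * x ^ 2) ^ 2 * y ^ 2 + 1) by (field; lra).
    rewrite <- H1. simpl in H0 |- *. lra. }
  pose proof (E (a (S n))). pose proof (E (b (S n))). unfold Rdiv. lra.
Qed.

Lemma cos_le_away x a : 0 <= a <= PI -> a <= Rabs x <= 2 * PI - a -> cos x <= cos a.
Proof.
  intros Ha Hx. assert (E : cos x = cos (Rabs x)).
  { unfold Rabs. destruct (Rcase_abs x); auto. now rewrite cos_neg. }
  rewrite E. destruct (Rle_lt_dec (Rabs x) PI).
  - apply cos_decr_1; lra.
  - replace (cos (Rabs x)) with (cos (2 * PI - Rabs x)). apply cos_decr_1; lra.
    rewrite cos_minus, cos_2PI, sin_2PI; ring.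
Qed.

Section Completeness.
Variables P nu : R.
Hypothesis P_pos : 0 < P.
Hypothesis nuP : nu * P = 2 * PI.
Notation fA := (fA P nu).
Notation fB := (fB P nu).
Notation ck := (ck nu).
Notation sk := (sk nu).
Notation wt := (wt P).
Notation tp := (tp nu).
Notation cA := (cA P nu).
Notation cB := (cB P nu).
Hint Resolve cont_ck cont_sk cont_tp : core.

(** Orthogonality to all harmonics passes to the powers of a kernel peaked at [s0]: multiplying by
    [(1 + cos) / 2] mixes the harmonics [k - 1], [k], [k + 1]. *)
Lemma peak_orth h s0 : cont h -> (forall k, fA h k = 0) -> (forall k, fB h k = 0) ->
  forall n k, RI (fun t => h t * (((1 + cos (nu * (t - s0))) / 2) ^ n * cos (INR k * (nu * (t - s0))))) 0 P = 0.
Proof.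
  intros Hh HA HB. induction n; intros k.
  - rewrite (RI_ext _ (fun t => cos (INR k * nu * s0) * (h t * ck k t) + sin (INR k * nu * s0) * (h t * sk k t))).
    rewrite RI_plus, !RI_scal by (ct; auto).
    change (cos (INR k * nu * s0) * fA h k + sin (INR k * nu * s0) * fB h k = 0). rewrite HA, HB; ring.
    intros t. unfold ck, sk. replace (INR k * (nu * (t - s0))) with (INR k * nu * t - INR k * nu * s0) by ring.
    rewrite cos_minus. simpl. ring.
  - set (x := fun t => nu * (t - s0)). set (q := fun t => ((1 + cos (x t)) / 2) ^ n).
    assert (Hq : cont q) by (unfold q, x; ct).
    assert (Hx : cont x) by (unfold x; ct).
    assert (IH : forall k, RI (fun t => h t * (q t * cos (INR k * x t))) 0 P = 0) by exact IHn.
    destruct k as [|k].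
    + rewrite (RI_ext _ (fun t => / 2 * (h t * (q t * cos (INR 0 * x t))) + / 2 * (h t * (q t * cos (INR 1 * x t))))).
      rewrite RI_plus, !RI_scal by (ct; auto). rewrite (IH 0%nat), (IH 1%nat). ring.
      intros t. unfold q. change (nu * (t - s0)) with (x t). simpl. rewrite Rmult_0_l, cos_0, Rmult_1_l. field.
    + rewrite (RI_ext _ (fun t => / 2 * (h t * (q t * cos (INR (S k) * x t))) + (/ 4 * (h t * (q t * cos (INR k * x t)))
         + / 4 * (h t * (q t * cos (INR (S (S k)) * x t)))))).
      rewrite !RI_plus, !RI_scal by (ct; auto). rewrite (IH k), (IH (S k)), (IH (S (S k))). ring.
      intros t. unfold q. change (nu * (t - s0)) with (x t). rewrite !S_INR.
      replace (INR k * x t) with ((INR k + 1) * x t - x t) by ring.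
      replace ((INR k + 1 + 1) * x t) with ((INR k + 1) * x t + x t) by ring.
      rewrite cos_minus, cos_plus. simpl. field.
Qed.

(** If [h s0] were positive, high powers of the kernel would concentrate so much mass at [s0] that
    their integral against [h] could not vanish. No periodicity of [h] is required, at the price of
    an interior point. *)
Lemma trig_complete_le h : cont h -> (forall k, fA h k = 0) -> (forall k, fB h k = 0) ->
  forall s0, 0 < s0 < P -> h s0 <= 0.
Proof.
  intros Hh HA HB s0 Hs0. destruct (Rle_lt_dec (h s0) 0) as [|Hpos]; auto. exfalso.
  assert (Hnu := nu_pos P nu P_pos nuP).
  destruct (proj1 (cont_eps h) Hh s0 (h s0 / 2)) as [d0 [Hd0 Hc]]. lra.
  (* Within distance [d] of [s0] the function exceeds [h s0 / 2], and the peak stays inside the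
     period. *)
  set (d := Rmin (d0 / 2) (Rmin s0 (P - s0))).
  assert (Hd : 0 < d) by (unfold d; repeat apply Rmin_pos; lra).
  assert (Hd1 : d <= d0 / 2) by apply Rmin_l.
  assert (Hd2 : d <= s0) by (min_le).
  assert (Hd3 : d <= P - s0) by (min_le).
  set (q := fun t => (1 + cos (nu * (t - s0))) / 2).
  set (qd := (1 + cos (nu * d)) / 2). set (qh := (1 + cos (nu * (d / 2))) / 2).
  assert (Hdpi : nu * d <= PI).
  { apply Rle_trans with (nu * (P / 2)). apply Rmult_le_compat_l; lra. lra. }
  assert (Hcd : cos (nu * d) < cos (nu * (d / 2))).
  { apply cos_decreasing_1; try nra. }
  pose proof (COS_bound (nu * d)) as Bd.
  assert (Hqq : 0 <= qd < qh) by (unfold qd, qh; lra).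
  destruct (cont_bounded h 0 P Hh) as [M [HM HMb]].
  assert (Hq0 : forall t, 0 <= q t) by (intros t; unfold q; pose proof (COS_bound (nu * (t - s0))); lra).
  assert (Hqc : cont q) by (unfold q; ct).
  assert (Hlow : forall n t, 0 <= t <= P -> - M * qd ^ n <= h t * q t ^ n).
  { intros n t Ht. assert (0 <= qd ^ n) by (apply pow_le; lra). assert (0 <= q t ^ n) by (apply pow_le; auto).
    destruct (Rle_lt_dec d (Rabs (t - s0))) as [Ha|Ha].
    - assert (q t <= qd).
      { unfold q, qd. enough (cos (nu * (t - s0)) <= cos (nu * d)) by lra. apply cos_le_away. split; pnra.
        rewrite Rabs_mult, (Rabs_pos_eq nu) by lra. rewrite <- nuP.
        assert (Rabs (t - s0) <= P - d) by (apply Rabs_le; lra). pnra. }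
      assert (q t ^ n <= qd ^ n) by (apply pow_incr; auto).
      specialize (HMb t Ht). unabs HMb.
      apply Rle_trans with (- M * q t ^ n). pnra. pnra.
    - apply Rle_trans with 0. pnra. apply Rmult_le_pos; auto.
      specialize (Hc t ltac:(lra)). apply Rabs_def2 in Hc. lra. }
  (* The half-width neighbourhood of [s0] contributes at least the left side to an integral that is
     zero, the rest of the period at least minus the right side. The ratio [(qd / qh)^n] then tends
     to 0, a contradiction. *)
  assert (Hmain : forall n, (h s0 / 2 * d) * qh ^ n <= (M * P) * qd ^ n).
  { intros n. pose proof (peak_orth h s0 Hh HA HB n 0) as E.
    rewrite (RI_ext _ (fun t => h t * q t ^ n)) in E.
    2:{ intros t. unfold q. simpl. rewrite Rmult_0_l, cos_0; ring. }
    rewrite <- (RI_chasles _ 0 (s0 - d / 2) P) in E by ct.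
    rewrite <- (RI_chasles _ (s0 - d / 2) (s0 + d / 2) P) in E by ct.
    assert (E1 : RI (fun _ => - M * qd ^ n) 0 (s0 - d / 2) <= RI (fun t => h t * q t ^ n) 0 (s0 - d / 2)).
    { apply RI_le; try ct. lra. intros t Ht. apply Hlow; lra. }
    assert (E3 : RI (fun _ => - M * qd ^ n) (s0 + d / 2) P <= RI (fun t => h t * q t ^ n) (s0 + d / 2) P).
    { apply RI_le; try ct. lra. intros t Ht. apply Hlow; lra. }
    assert (E2 : RI (fun _ => h s0 / 2 * qh ^ n) (s0 - d / 2) (s0 + d / 2) <= RI (fun t => h t * q t ^ n) (s0 - d / 2) (s0 + d / 2)).
    { apply RI_le; try ct. lra. intros t Ht.
      assert (Ha : Rabs (t - s0) <= d / 2) by (apply Rabs_le; lra).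
      specialize (Hc t ltac:(lra)). apply Rabs_def2 in Hc.
      assert (0 <= qh ^ n) by (apply pow_le; lra).
      assert (qh ^ n <= q t ^ n).
      { apply pow_incr; split. lra. unfold q, qh. enough (cos (nu * (d / 2)) <= cos (nu * (t - s0))) by lra.
        assert (E' : cos (nu * (t - s0)) = cos (nu * Rabs (t - s0))).
        { unfold Rabs. destruct (Rcase_abs (t - s0)); auto. replace (nu * - (t - s0)) with (- (nu * (t - s0))) by ring.
          now rewrite cos_neg. }
        rewrite E'. pose proof (Rabs_pos (t - s0)). apply cos_decr_1; pnra. }
      pnra. }
    rewrite RI_const in E1, E2, E3. assert (0 <= qd ^ n) by (apply pow_le; lra).
    assert (0 <= M * qd ^ n) by (apply Rmult_le_pos; lra).
    apply Rle_trans with ((P - d) * (M * qd ^ n)). lra. pnra. }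
  assert (Hr : 0 <= qd / qh < 1).
  { split. apply Rmult_le_pos. lra. left; apply Rinv_0_lt_compat; lra.
    apply Rmult_lt_reg_r with qh. lra. unfold Rdiv. rewrite Rmult_assoc, Rinv_l; lra. }
  destruct (pow_lt_1_zero (qd / qh)) with (y := (h s0 / 2 * d) / (M * P)) as [N HN].
  rewrite Rabs_pos_eq; lra. apply Rdiv_lt_0_compat; pnra.
  specialize (HN N (le_n _)). specialize (Hmain N).
  rewrite Rabs_pos_eq in HN by (apply pow_le; lra).
  assert (HP : 0 < qh ^ N) by (apply pow_lt; lra).
  unfold Rdiv at 1 in HN. rewrite Rpow_mult_distr, pow_inv in HN.
  apply (Rmult_lt_compat_r (qh ^ N)) in HN; auto. rewrite Rmult_assoc, Rinv_l, Rmult_1_r in HN by lra.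
  assert (0 < M * P) by pnra.
  apply (Rmult_lt_compat_l (M * P)) in HN; auto.
  replace (M * P * (h s0 / 2 * d / (M * P) * qh ^ N)) with (h s0 / 2 * d * qh ^ N) in HN by (field; lra).
  lra.
Qed.

Lemma trig_complete h : cont h -> (forall k, fA h k = 0) -> (forall k, fB h k = 0) ->
  forall s, 0 < s < P -> h s = 0.
Proof.
  intros Hh HA HB s Hs. apply Rle_antisym. now apply trig_complete_le.
  enough (- h s <= 0) by lra. apply (trig_complete_le (fun t => - h t)); auto. ct.
  - intros k. unfold fA. rewrite (RI_ext _ (fun t => -1 * (h t * ck k t))) by (intros; ring).
    rewrite RI_scal by (ct; auto). change (-1 * fA h k = 0). rewrite HA; ring.
  - intros k. unfold fB. rewrite (RI_ext _ (fun t => -1 * (h t * sk k t))) by (intros; ring).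
    rewrite RI_scal by (ct; auto). change (-1 * fB h k = 0). rewrite HB; ring.
Qed.

Lemma eq_on_closed f g : cont f -> cont g -> (forall s, 0 < s < P -> f s = g s) ->
  forall s, 0 <= s <= P -> f s = g s.
Proof.
  intros Hf Hg E s Hs. set (h := fun t => f t - g t).
  assert (Hh : cont h) by (unfold h; ct).
  enough (h s = 0) by (unfold h in *; lra).
  destruct (Req_dec (h s) 0) as [|N]; auto. exfalso.
  destruct (proj1 (cont_eps h) Hh s (Rabs (h s))) as [d [Hd Hx]]. now apply Rabs_pos_lt.
  set (e := Rmin (d / 2) (P / 3)).
  assert (He : 0 < e) by (unfold e; apply Rmin_pos; lra).
  assert (He1 : e <= d / 2) by apply Rmin_l.
  assert (He2 : e <= P / 3) by apply Rmin_r.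
  destruct (Rle_lt_dec s (P / 2)).
  - assert (Hz : h (s + e) = 0) by (unfold h; rewrite E; lra).
    specialize (Hx (s + e)). rewrite Hz in Hx. rewrite Rminus_0_l, Rabs_Ropp in Hx.
    replace (s + e - s) with e in Hx by ring. rewrite (Rabs_pos_eq e) in Hx by lra. specialize (Hx ltac:(lra)). lra.
  - assert (Hz : h (s - e) = 0) by (unfold h; rewrite E; lra).
    specialize (Hx (s - e)). rewrite Hz in Hx. rewrite Rminus_0_l, Rabs_Ropp in Hx.
    replace (s - e - s) with (- e) in Hx by ring. rewrite Rabs_Ropp, (Rabs_pos_eq e) in Hx by lra. specialize (Hx ltac:(lra)). lra.
Qed.

Lemma tp_tail a b m n t : (m <= n)%nat ->
  Rabs (tp a b n t - tp a b m t) <= psum (fun k => Rabs (a k) + Rabs (b k)) n - psum (fun k => Rabs (a k) + Rabs (b k)) m.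
Proof.
  induction 1. rewrite !Rminus_diag, Rabs_R0; lra.
  unfold tp in *. simpl.
  set (x := psum _ m0) in *. set (y := psum _ m) in *.
  replace (x + (a m0 * ck m0 t + b m0 * sk m0 t) - y) with ((x - y) + (a m0 * ck m0 t + b m0 * sk m0 t)) by ring.
  triang.
  assert (Rabs (a m0 * ck m0 t + b m0 * sk m0 t) <= Rabs (a m0) + Rabs (b m0)).
  { triang. rewrite !Rabs_mult.
    pose proof (ck_bound nu m0 t). pose proof (sk_bound nu m0 t). pose proof (Rabs_pos (a m0)). pose proof (Rabs_pos (b m0)).
    apply Rplus_le_compat; pnra. }
  lra.
Qed.

Lemma trig_series a b K : (forall n, psum (fun k => Rabs (a k) + Rabs (b k)) n <= K) ->
  exists S, cont S /\ (forall e, 0 < e -> exists N, forall n, (N <= n)%nat -> forall t, Rabs (tp a b n t - S t) <= e).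
Proof.
  intros HK. apply uniform_limit. auto.
  intros e He. set (s := psum (fun k => Rabs (a k) + Rabs (b k))).
  assert (Hpos : forall k, 0 <= Rabs (a k) + Rabs (b k)).
  { intros k. pose proof (Rabs_pos (a k)); pose proof (Rabs_pos (b k)); lra. }
  assert (Hcv : { l : R | Un_cv s l }).
  { apply growing_cv. intros n. unfold s; simpl. specialize (Hpos n); lra.
    exists K. intros x [n ->]. apply HK. }
  destruct Hcv as [l Hl]. assert (Hc : Cauchy_crit s) by (apply CV_Cauchy; exists l; auto).
  destruct (Hc e He) as [N HN]. exists N. intros n m Hn Hm t.
  specialize (HN n m Hn Hm). unfold Rdist in HN.
  destruct (Nat.le_ge_cases m n) as [H|H].
  - eapply Rle_trans. apply tp_tail; auto. fold s. pose proof (Rle_abs (s n - s m)). lra.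
  - rewrite Rabs_minus_sym. eapply Rle_trans. apply tp_tail; auto. fold s.
    rewrite Rabs_minus_sym in HN. pose proof (Rle_abs (s m - s n)). lra.
Qed.

Lemma coef_limit (F : nat -> R -> R) S (c : R -> R) l : (forall n, cont (F n)) -> cont S -> cont c -> (forall t, Rabs (c t) <= 1) ->
  (forall e, 0 < e -> exists N, forall n, (N <= n)%nat -> forall t, Rabs (F n t - S t) <= e) ->
  (exists N, forall n, (N <= n)%nat -> RI (fun t => F n t * c t) 0 P = l) ->
  RI (fun t => S t * c t) 0 P = l.
Proof.
  intros HF HS Hc Hb HU [N0 HN0].
  apply cond_eq. intros e He. destruct (HU (e / (2 * P))) as [N HN]. apply Rdiv_lt_0_compat; lra.
  rewrite <- (HN0 (N + N0)%nat ltac:(lia)). rewrite <- RI_minus by (ct; auto).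
  eapply Rle_lt_trans. apply (RI_abs _ 0 P (e / (2 * P))). lra. ct; auto.
  intros t _. replace (S t * c t - F (N + N0)%nat t * c t) with (- (F (N + N0)%nat t - S t) * c t) by ring.
  rewrite Rabs_mult, Rabs_Ropp. specialize (HN (N + N0)%nat ltac:(lia) t). specialize (Hb t).
  pose proof (Rabs_pos (F (N + N0)%nat t - S t)). pose proof (Rabs_pos (c t)). pnra.
  replace ((P - 0) * (e / (2 * P))) with (e / 2) by (field; lra). lra.
Qed.

Lemma trig_series_coef a b S : cont S -> b 0%nat = 0 ->
  (forall e, 0 < e -> exists N, forall n, (N <= n)%nat -> forall t, Rabs (tp a b n t - S t) <= e) ->
  forall k, fA S k = a k / wt k /\ fB S k = b k / wt k.
Proof.
  intros HS Hb0 HU k. split.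
  - unfold fA. apply (coef_limit (tp a b)); auto. apply ck_bound.
    exists (Datatypes.S k). intros n Hn. apply (fA_tp P nu P_pos nuP); lia.
  - destruct k. rewrite fB_0, Hb0. field. simpl. apply Rinv_neq_0_compat; lra.
    unfold fB. apply (coef_limit (tp a b)); auto. apply sk_bound.
    exists (Datatypes.S (Datatypes.S k)). intros n Hn. apply (fB_tp P nu P_pos nuP); lia.
Qed.

(** The absolutely convergent Fourier series of [u] has a continuous sum with the same coefficients,
    which by completeness is [u] itself. *)
Lemma fourier_uniform u K : cont u -> (forall n, psum (fun k => Rabs (cA u k) + Rabs (cB u k)) n <= K) ->
  forall e, 0 < e -> exists N, forall n, (N <= n)%nat -> forall t, 0 <= t <= P -> Rabs (tp (cA u) (cB u) n t - u t) <= e.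
Proof.
  intros Hu HK e He. destruct (trig_series _ _ K HK) as [S [HS HU]].
  assert (HE : forall t, 0 <= t <= P -> u t = S t).
  { apply eq_on_closed; auto. intros s Hs. enough (u s + -1 * S s = 0) by lra.
    apply (trig_complete (fun t => u t + -1 * S t)); auto. ct.
    - intros k. rewrite fA_lin by auto.
      destruct (trig_series_coef (cA u) (cB u) S HS) with (k := k) as [E _]; auto.
      unfold cB. rewrite fB_0; ring. rewrite E. unfold cA. field. pose proof (wt_pos P P_pos k); lra.
    - intros k. rewrite fB_lin by auto.
      destruct (trig_series_coef (cA u) (cB u) S HS) with (k := k) as [_ E]; auto.
      unfold cB. rewrite fB_0; ring. rewrite E. unfold cB. field. pose proof (wt_pos P P_pos k); lra. }
  destruct (HU e He) as [N HN]. exists N. intros n Hn t Ht. rewrite HE; auto.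
Qed.

(** Only [u] needs the full Parseval identity and hence summable coefficients; for [G], merely
    continuous in the application, Bessel's inequality suffices. *)
Lemma parseval_le u G C K : cont u -> cont G -> 0 <= C ->
  (forall n, psum (fun k => Rabs (cA u k) + Rabs (cB u k)) n <= K) ->
  (forall k, fA u k ^ 2 + fB u k ^ 2 <= C * (fA G k ^ 2 + fB G k ^ 2)) ->
  RI (fun t => u t ^ 2) 0 P <= C * RI (fun t => G t ^ 2) 0 P.
Proof.
  intros Hu HG HC HK HM. apply le_epsilon. intros e He.
  set (d := Rmin 1 (e / P)).
  assert (Hd : 0 < d) by (apply Rmin_pos; [lra | apply Rdiv_lt_0_compat; lra]).
  destruct (fourier_uniform u K Hu HK d Hd) as [N HN]. specialize (HN N (le_n _)).
  pose proof (bessel_eq P nu P_pos nuP u N Hu) as E.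
  assert (E1 : RI (fun t => (u t - tp (cA u) (cB u) N t) ^ 2) 0 P <= e).
  { eapply Rle_trans. apply (RI_le _ (fun _ => e / P)). lra. ct; auto. ct.
    intros t Ht. specialize (HN t Ht). rewrite Rabs_minus_sym in HN. rewrite <- pow2_abs.
    pose proof (Rabs_pos (u t - tp (cA u) (cB u) N t)).
    assert (d <= 1) by apply Rmin_l. assert (d <= e / P) by apply Rmin_r. pnra.
    rewrite RI_const. right; field; lra. }
  pose proof (bessel P nu P_pos nuP G N HG) as E2.
  assert (E3 : psum (fun k => wt k * (fA u k ^ 2 + fB u k ^ 2)) N <= C * psum (fun k => wt k * (fA G k ^ 2 + fB G k ^ 2)) N).
  { rewrite <- psum_scal. apply psum_le. intros k _. pose proof (wt_pos P P_pos k). specialize (HM k). pnra. }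
  pnra.
Qed.

Lemma coef_deriv u u' : (forall t, is_derive u t (u' t)) -> cont u' -> u 0 = u P ->
  forall k, fA u' k = INR k * nu * fB u k /\ fB u' k = - (INR k * nu * fA u k).
Proof.
  intros Hd Hu' H0 k. assert (Hu : cont u) by (eapply is_derive_cont; eauto). split.
  - assert (E : RI (fun t => u' t * ck k t + u t * (- (INR k * nu) * sk k t)) 0 P = u P * ck k P - u 0 * ck k 0).
    { apply (RI_derive (fun t => u t * ck k t)). intros t. apply D_mult; auto. apply D_ck. ct; auto. }
    rewrite (ck_P P nu nuP), ck_0, H0 in E.
    rewrite (RI_ext _ (fun t => u' t * ck k t + (- (INR k * nu)) * (u t * sk k t))) in E by (intros; ring).
    rewrite RI_plus, RI_scal in E by (ct; auto).
    change (fA u' k + - (INR k * nu) * fB u k = u P * 1 - u P * 1) in E. lra.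
  - assert (E : RI (fun t => u' t * sk k t + u t * ((INR k * nu) * ck k t)) 0 P = u P * sk k P - u 0 * sk k 0).
    { apply (RI_derive (fun t => u t * sk k t)). intros t. apply D_mult; auto. apply D_sk. ct; auto. }
    rewrite (sk_P P nu nuP), sk_0, H0 in E.
    rewrite (RI_ext _ (fun t => u' t * sk k t + (INR k * nu) * (u t * ck k t))) in E by (intros; ring).
    rewrite RI_plus, RI_scal in E by (ct; auto).
    change (fB u' k + (INR k * nu) * fA u k = u P * 0 - u P * 0) in E. lra.
Qed.

(** Bessel's inequality for [u'] bounds the squares of the coefficients of [u] weighted by [k^2],
    which is the hypothesis of [psum_abs_le]. *)
Lemma summable_C1 u u' : (forall t, is_derive u t (u' t)) -> cont u' -> u 0 = u P ->
  exists K, forall n, psum (fun k => Rabs (cA u k) + Rabs (cB u k)) n <= K.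
Proof.
  intros Hd Hu' H0. pose proof (coef_deriv u u' Hd Hu' H0) as E.
  assert (Hnu := nu_pos P nu P_pos nuP).
  eexists. intros n. eapply (psum_abs_le _ _ (2 / P / nu ^ 2 * RI (fun t => u' t ^ 2) 0 P) 1). lra.
  intros m. eapply Rle_trans. 2:{ apply Rmult_le_compat_l. 2: apply (bessel P nu P_pos nuP u' m Hu').
    apply Rmult_le_pos. apply Rmult_le_pos. lra. left; apply Rinv_0_lt_compat; lra. left; apply Rinv_0_lt_compat. apply pow_lt; lra. }
  rewrite <- psum_scal. apply psum_le. intros k _. destruct (E k) as [-> ->].
  unfold cA, cB. assert (Hw : wt k <= 2 / P).
  { destruct k; simpl. unfold Rdiv. assert (0 < / P) by now apply Rinv_0_lt_compat. lra. lra. }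
  pose proof (wt_pos P P_pos k).
  replace (2 / P / nu ^ 2 * (wt k * ((INR k * nu * fB u k) ^ 2 + (- (INR k * nu * fA u k)) ^ 2)))
    with ((2 / P) * (wt k * (INR k ^ 2 * (fA u k ^ 2 + fB u k ^ 2)))) by (field; lra).
  replace (INR k ^ 2 * ((wt k * fA u k) ^ 2 + (wt k * fB u k) ^ 2))
    with (wt k * (wt k * (INR k ^ 2 * (fA u k ^ 2 + fB u k ^ 2)))) by ring.
  apply Rmult_le_compat_r; auto. apply Rmult_le_pos. lra.
  pose proof (pow2_ge_0 (INR k)). pose proof (pow2_ge_0 (fA u k)). pose proof (pow2_ge_0 (fB u k)). pnra.
Qed.
End Completeness.

(** * Functions of period 2 pi *)

Notation tau2 := (2 * PI).
Lemma tau2_pos : 0 < tau2. Proof. pose proof PI_RGT_0; lra. Qed.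
Lemma nu1 : 1 * tau2 = 2 * PI. Proof. ring. Qed.

Definition per (f : R -> R) : Prop := forall t, f (t + tau2) = f t.

Lemma per_nat f n t : per f -> f (t + INR n * tau2) = f t.
Proof.
  intros H; induction n. f_equal; simpl; ring.
  rewrite S_INR. replace (t + (INR n + 1) * tau2) with ((t + INR n * tau2) + tau2) by ring. now rewrite H.
Qed.
Lemma per_Z f z t : per f -> f (t + IZR z * tau2) = f t.
Proof.
  intros H. destruct (Z.le_gt_cases 0 z).
  - rewrite <- (Z2Nat.id z) by lia. rewrite <- INR_IZR_INZ. now apply per_nat.
  - rewrite <- (per_nat f (Z.to_nat (- z)) (t + IZR z * tau2) H). rewrite INR_IZR_INZ, Z2Nat.id by lia.
    rewrite opp_IZR. f_equal; ring.
Qed.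
Lemma mod_tau2 t : exists z, 0 <= t + IZR z * tau2 <= tau2.
Proof.
  pose proof tau2_pos as H. destruct (archimed (t / tau2)) as [H1 H2].
  exists (1 - up (t / tau2))%Z. rewrite minus_IZR.
  assert (E : t = t / tau2 * tau2) by (field; lra). set (x := t / tau2) in *. rewrite E at 1 2. pnra.
Qed.
Lemma per_eq f g : per f -> per g -> (forall t, 0 <= t <= tau2 -> f t = g t) -> forall t, f t = g t.
Proof.
  intros Hf Hg E t. destruct (mod_tau2 t) as [z Hz]. rewrite <- (per_Z f z), <- (per_Z g z) by auto. now apply E.
Qed.
Lemma per_bounded f : cont f -> per f -> exists M, 0 < M /\ forall t, Rabs (f t) <= M.
Proof.
  intros Hc Hp. destruct (cont_bounded f 0 tau2 Hc) as [M [HM H]]. exists M; split; auto.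
  intros t. destruct (mod_tau2 t) as [z Hz]. rewrite <- (per_Z f z) by auto. now apply H.
Qed.
Lemma zero_deriv (g : R -> R) : (forall t, is_derive g t 0) -> forall a b, g a = g b.
Proof.
  intros H a b. pose proof (RI_derive g (fun _ => 0) a b H (cont_const 0)) as E. rewrite RI_const in E. lra.
Qed.
(** The integral over a moving period has derivative zero. *)
Lemma per_int f k : cont f -> per f -> RI f (0 - k) (tau2 - k) = RI f 0 tau2.
Proof.
  intros Hc Hp. set (G := fun a => RI f 0 (a + tau2) - RI f 0 a).
  assert (E : forall a, G a = RI f a (a + tau2)).
  { intros a. unfold G. rewrite <- (RI_chasles f 0 a (a + tau2)); auto. ring. }
  assert (HG : G (- k) = G 0).
  { apply zero_deriv. intros t. unfold G. eapply is_derive_eq. apply D_minus.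
    apply (D_comp (fun t => RI f 0 t) (fun a => a + tau2)). now apply RI_prim. apply D_plus. apply D_id. apply D_const.
    now apply RI_prim. rewrite Hp; ring. }
  rewrite !E in HG. replace (0 - k) with (- k) by ring. replace (tau2 - k) with (- k + tau2) by ring.
  rewrite HG. f_equal; ring.
Qed.

Notation pA := (fA tau2 1).
Notation pB := (fB tau2 1).

Lemma ck1 k t : ck 1 k t = cos (INR k * t). Proof. unfold ck; f_equal; ring. Qed.
Lemma sk1 k t : sk 1 k t = sin (INR k * t). Proof. unfold sk; f_equal; ring. Qed.

Lemma per_shift f k : per f -> per (fun t => f (t - k)).
Proof. intros H t. replace (t + tau2 - k) with ((t - k) + tau2) by ring. apply H. Qed.

Lemma coef_shift f k j : cont f -> per f ->
  pA (fun t => f (t - k)) j = cos (INR j * k) * pA f j - sin (INR j * k) * pB f j /\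
  pB (fun t => f (t - k)) j = sin (INR j * k) * pA f j + cos (INR j * k) * pB f j.
Proof.
  intros Hc Hp.
  assert (Pc : per (fun u => f u * ck 1 j (u + k))).
  { intros u. rewrite Hp. f_equal. replace (u + tau2 + k) with (u + k + tau2) by ring. apply (ck_per tau2 1 nu1). }
  assert (Ps : per (fun u => f u * sk 1 j (u + k))).
  { intros u. rewrite Hp. f_equal. replace (u + tau2 + k) with (u + k + tau2) by ring. apply (sk_per tau2 1 nu1). }
  assert (Cc : cont (fun u => f u * ck 1 j (u + k))) by (unfold ck; ct).
  assert (Cs : cont (fun u => f u * sk 1 j (u + k))) by (unfold sk; ct).
  split.
  - transitivity (RI (fun u => f u * ck 1 j (u + k)) 0 tau2).
    { rewrite <- (per_int _ k) by auto. rewrite <- (RI_shift _ 0 tau2 k) by auto. apply RI_ext.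
      intros t. do 2 f_equal. ring. }
    rewrite (RI_ext _ (fun u => cos (INR j * k) * (f u * ck 1 j u) + - sin (INR j * k) * (f u * sk 1 j u))).
    rewrite RI_plus, !RI_scal by (ct; auto using cont_ck, cont_sk). unfold fA, fB. ring.
    intros t. rewrite !ck1, sk1. rewrite Rmult_plus_distr_l, cos_plus. ring.
  - transitivity (RI (fun u => f u * sk 1 j (u + k)) 0 tau2).
    { rewrite <- (per_int _ k) by auto. rewrite <- (RI_shift _ 0 tau2 k) by auto. apply RI_ext.
      intros t. do 2 f_equal. ring. }
    rewrite (RI_ext _ (fun u => sin (INR j * k) * (f u * ck 1 j u) + cos (INR j * k) * (f u * sk 1 j u))).
    rewrite RI_plus, !RI_scal by (ct; auto using cont_ck, cont_sk). unfold fA, fB. ring.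
    intros t. rewrite ck1, !sk1. rewrite Rmult_plus_distr_l, sin_plus. ring.
Qed.

Lemma per_complete f g : cont f -> cont g -> per f -> per g ->
  (forall k, pA f k = pA g k /\ pB f k = pB g k) -> forall t, f t = g t.
Proof.
  intros Hf Hg Pf Pg E. apply per_eq; auto. apply (eq_on_closed tau2 tau2_pos); auto. intros s Hs.
  enough (f s + -1 * g s = 0) by lra.
  apply (trig_complete tau2 1 tau2_pos nu1 (fun t => f t + -1 * g t)); auto. ct.
  - intros k. rewrite fA_lin by auto. destruct (E k) as [-> _]. ring.
  - intros k. rewrite fB_lin by auto. destruct (E k) as [_ ->]. ring.
Qed.

(** Variation of constants. It serves to gain a derivative: a Fourier series known only to be
    continuous is identified with the differentiable solution of such an equation. *)
Lemma per_ode w q : 0 < w -> cont q -> per q ->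
  exists y y', (forall t, is_derive y t (y' t)) /\ cont y' /\ per y /\ forall t, w * y' t + y t = q t.
Proof.
  intros Hw Hq Pq. set (F := fun t => RI (fun s => exp (s / w) * q s) 0 t).
  assert (Ci : cont (fun s => exp (s / w) * q s)) by ct.
  assert (DF : forall t, is_derive F t (exp (t / w) * q t)) by (intros t; exact (RI_prim (fun s => exp (s / w) * q s) 0 t Ci)).
  set (e := exp (- tau2 / w)).
  assert (He : e < 1).
  { unfold e. rewrite <- exp_0. apply exp_increasing. pose proof tau2_pos.
    assert (0 < tau2 / w) by now apply Rdiv_lt_0_compat. unfold Rdiv in *. lra. }
  (* The initial value is the one for which the solution returns to itself after one period. *)
  set (y0 := e * (/ w * F tau2) / (1 - e)).
  set (y := fun t => exp (- t / w) * (y0 + / w * F t)).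
  set (y' := fun t => / w * (q t - y t)).
  assert (CF : cont F) by exact (is_derive_cont F _ DF).
  assert (Cy : cont y) by (unfold y; ct).
  assert (Dy : forall t, is_derive y t (y' t)).
  { intros t. eapply is_derive_eq. unfold y. apply D_mult.
    assert (D1 : is_derive (fun y => exp (- y / w)) t (- / w * exp (- t / w))). auto_derive; auto. unfold Rdiv; ring.
    exact D1.
    apply D_plus. apply D_const. apply D_scal. apply DF.
    unfold y', y. assert (E : exp (- t / w) * exp (t / w) = 1). rewrite <- exp_plus, <- exp_0. f_equal. field; lra.
    replace (/ w * (q t - exp (- t / w) * (y0 + / w * F t))) with (/ w * ((exp (- t / w) * exp (t / w)) * q t - exp (- t / w) * (y0 + / w * F t))). ring. rewrite E; ring. }
  assert (E0 : y tau2 = y 0).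
  { unfold y. unfold F at 2. rewrite RI_0. replace (- 0 / w) with 0 by (field; lra). rewrite exp_0.
    fold e. unfold y0. field. lra. }
  exists y, y'. split; auto. split. unfold y'; ct. split; [|intros t; unfold y'; field; lra].
  (* The increment over a period solves the homogeneous equation, so its product with [exp (t / w)]
     is constant, and it vanishes at 0. *)
  intros t. enough (Z : exp (t / w) * (y (t + tau2) - y t) = 0).
  { pose proof (exp_pos (t / w)). apply Rmult_integral in Z. lra. }
  rewrite (zero_deriv (fun t => exp (t / w) * (y (t + tau2) - y t))) with (b := 0).
  rewrite Rplus_0_l, E0. ring.
  intros s. eapply is_derive_eq. apply D_mult.
  assert (D1 : is_derive (fun y => exp (y / w)) s (/ w * exp (s / w))). auto_derive; auto. unfold Rdiv; ring.
  exact D1. apply D_minus. apply (D_comp y (fun t => t + tau2)). apply Dy. apply D_plus. apply D_id. apply D_const. apply Dy.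
  unfold y'. rewrite Pq. ring.
Qed.

Definition P1 (g : R -> R) (t : R) : R := / PI * (pA g 1 * cos t + pB g 1 * sin t).

Lemma coef_cos_sin a b k : pA (fun t => a * cos t + b * sin t) k = (if Nat.eq_dec k 1 then PI * a else 0)
  /\ pB (fun t => a * cos t + b * sin t) k = (if Nat.eq_dec k 1 then PI * b else 0).
Proof.
  pose proof PI_RGT_0. pose proof tau2_pos.
  assert (E1 := int_ck2 tau2 1 tau2_pos nu1 1). assert (E2 := int_sk2 tau2 1 tau2_pos nu1 1 ltac:(lia)).
  simpl wt in E1, E2.
  split.
  - unfold fA. rewrite (RI_ext _ (fun t => a * (ck 1 1 t * ck 1 k t) + b * (ck 1 k t * sk 1 1 t))).
    2:{ intros t. rewrite (ck1 1), (sk1 1). simpl. rewrite Rmult_1_l; ring. }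
    rewrite RI_plus, !RI_scal by (ct; auto using cont_ck, cont_sk).
    rewrite (int_cksk tau2 1 tau2_pos nu1). destruct (Nat.eq_dec k 1) as [->|N].
    apply (Rmult_eq_compat_l PI) in E1. rewrite <- (Rmult_1_r (PI * a)), <- (Rmult_comm a), Rmult_assoc.
    rewrite <- E1. field. lra.
    rewrite (int_ckck tau2 1 tau2_pos nu1) by auto. ring.
  - unfold fB. rewrite (RI_ext _ (fun t => a * (ck 1 1 t * sk 1 k t) + b * (sk 1 1 t * sk 1 k t))).
    2:{ intros t. rewrite (ck1 1), (sk1 1). simpl. rewrite Rmult_1_l; ring. }
    rewrite RI_plus, !RI_scal by (ct; auto using cont_ck, cont_sk).
    rewrite (int_cksk tau2 1 tau2_pos nu1). destruct (Nat.eq_dec k 1) as [->|N].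
    apply (Rmult_eq_compat_l PI) in E2. rewrite <- (Rmult_1_r (PI * b)), <- (Rmult_comm b), Rmult_assoc.
    rewrite <- E2. field. lra.
    rewrite (int_sksk tau2 1 tau2_pos nu1) by auto. ring.
Qed.

Lemma cont_P1 g : cont (P1 g). Proof. unfold P1; ct. Qed.
Lemma per_P1 g : per (P1 g).
Proof. intros t. unfold P1. rewrite (cos_plus t), (sin_plus t), cos_2PI, sin_2PI; f_equal; ring. Qed.
Lemma coef_P1 g k : pA (P1 g) k = (if Nat.eq_dec k 1 then pA g 1 else 0) /\ pB (P1 g) k = (if Nat.eq_dec k 1 then pB g 1 else 0).
Proof.
  pose proof PI_RGT_0. destruct (coef_cos_sin (/ PI * pA g 1) (/ PI * pB g 1) k) as [E1 E2].
  assert (X : P1 g = fun t => / PI * pA g 1 * cos t + / PI * pB g 1 * sin t).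
  { apply functional_extensionality; intros t; unfold P1; ring. }
  rewrite X, E1, E2. destruct (Nat.eq_dec k 1); split; auto; field; lra.
Qed.
Lemma coef_bound g M k : cont g -> (forall t, Rabs (g t) <= M) -> Rabs (pA g k) <= tau2 * M /\ Rabs (pB g k) <= tau2 * M.
Proof.
  intros Hg HM. pose proof tau2_pos. split; (replace tau2 with (tau2 - 0) at 2 by ring; apply RI_abs; [lra | ct; auto using cont_ck, cont_sk |]);
  intros t _; rewrite Rabs_mult; specialize (HM t); pose proof (Rabs_pos (g t)).
  pose proof (ck_bound 1 k t). pose proof (Rabs_pos (ck 1 k t)). pnra.
  pose proof (sk_bound 1 k t). pose proof (Rabs_pos (sk 1 k t)). pnra.
Qed.
Lemma P1_bound g M : cont g -> (forall t, Rabs (g t) <= M) -> forall t, Rabs (P1 g t) <= 4 * M.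
Proof.
  intros Hg HM t. destruct (coef_bound g M 1 Hg HM) as [HA HB]. pose proof PI_RGT_0.
  unfold P1. rewrite Rabs_mult, (Rabs_pos_eq (/ PI)) by (left; now apply Rinv_0_lt_compat).
  apply Rmult_le_reg_l with PI; auto. rewrite <- Rmult_assoc, Rinv_r, Rmult_1_l by lra.
  triang. rewrite !Rabs_mult.
  pose proof (Rabs_le _ _ (COS_bound t)). pose proof (Rabs_le _ _ (SIN_bound t)).
  assert (Rabs (pA g 1) * Rabs (cos t) <= tau2 * M * 1) by (apply Rmult_le_compat; auto using Rabs_pos).
  assert (Rabs (pB g 1) * Rabs (sin t) <= tau2 * M * 1) by (apply Rmult_le_compat; auto using Rabs_pos).
  lra.
Qed.

(** * Inversion of the linearised operator *)

Section K0.
Variables be w th : R.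
Hypothesis be1 : 1 < be.
Hypothesis w0 : 0 < w.
Hypothesis w2 : w * w = be * be - 1.

(** [Dr k + i Di k] is [1 + i k w + be e^(-i k th)], the symbol of the linearisation on the k-th
    harmonic; at the critical [th] it vanishes for [k = 1]. *)
Definition Dr k := 1 + be * cos (INR k * th).
Definition Di k := w * INR k - be * sin (INR k * th).
Definition DN k := Dr k ^ 2 + Di k ^ 2.
Definition CD := (2 * be / (w * w)) ^ 2.

(** Since [1 + w^2 = be^2], the modulus [s] of [1 + i k w] exceeds [be] as soon as [k >= 2], and the
    symbol is at least [s - be], which grows linearly in [k]. No property of [th] is involved. *)
Lemma DN_lower k : (k <> 1)%nat -> 0 < DN k /\ INR k ^ 2 <= CD * DN k.
Proof.
  intros Hk. assert (Hww : 0 < w * w) by pnra.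
  destruct k as [|k].
  - unfold DN, Dr, Di. simpl INR. rewrite !Rmult_0_l, cos_0, sin_0. split.
    pnra. assert (0 <= CD) by apply pow2_ge_0. pnra.
  - assert (Hk2 : 2 <= INR (S k)). { replace 2 with (INR 2) by reflexivity. apply le_INR; lia. }
    set (x := INR (S k)) in *. set (s := sqrt (1 + (w * x) ^ 2)).
    assert (Hs2 : s * s = 1 + (w * x) ^ 2) by (apply sqrt_sqrt; pnra).
    assert (Hs0 : 0 <= s) by apply sqrt_pos.
    assert (Hsk : s <= x * be).
    { apply Rsqr_incr_0_var; [|pnra]. unfold Rsqr. rewrite Hs2. replace (x * be * (x * be)) with (x * x * (be * be)) by ring.
      replace (be * be) with (1 + w * w) by lra. pnra. }
    (* From [(s - be) (s + be) = (x^2 - 1) w^2] with [s + be <= (x + 1) be], and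
       [x - 1 >= x / 2]. *)
    assert (Hsb : x * (w * w) / (2 * be) <= s - be).
    { apply Rmult_le_reg_r with (s + be). lra.
      replace ((s - be) * (s + be)) with ((x * x - 1) * (w * w)) by (replace ((s - be) * (s + be)) with (s * s - be * be) by ring; rewrite Hs2; replace (be * be) with (1 + w * w) by lra; ring).
      apply Rle_trans with (x * (w * w) / (2 * be) * ((x + 1) * be)).
      apply Rmult_le_compat_l. apply Rmult_le_pos. pnra. left; apply Rinv_0_lt_compat; lra. lra.
      replace (x * (w * w) / (2 * be) * ((x + 1) * be)) with (w * w * (x * (x + 1) / 2)) by (field; lra).
      rewrite (Rmult_comm (x * x - 1)). apply Rmult_le_compat_l. lra. pnra. }
    assert (Hp : 0 < x * (w * w) / (2 * be)) by (apply Rdiv_lt_0_compat; pnra).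
    assert (HD : (s - be) ^ 2 <= DN (S k)).
    { unfold DN, Dr, Di. fold x. set (c := cos (x * th)). set (n := sin (x * th)).
      assert (Hcn : c * c + n * n = 1) by (unfold c, n; pose proof (sin2_cos2 (x * th)); unfold Rsqr in *; lra).
      enough (- s <= c - w * x * n) by pnra.
      assert ((c - w * x * n) * (c - w * x * n) <= s * s).
      { rewrite Hs2. pose proof (pow2_ge_0 (n + w * x * c)). pnra. }
      destruct (Rle_lt_dec (-s) (c - w * x * n)); auto. pnra. }
    assert (Hq : (x * (w * w) / (2 * be)) ^ 2 <= DN (S k)).
    { eapply Rle_trans; [|apply HD]. apply pow_incr; lra. }
    split. eapply Rlt_le_trans; [|apply Hq]. now apply pow_lt.
    apply Rle_trans with (CD * (x * (w * w) / (2 * be)) ^ 2). unfold CD. right; field; lra.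
    apply Rmult_le_compat_l; auto. apply pow2_ge_0.
Qed.

(** With complex coefficients written [A - i B], this is the division of [pA g k - i pB g k] by the
    symbol; the resonant harmonic is set to zero. *)
Definition solA g k := if Nat.eq_dec k 1 then 0 else (Dr k * pA g k - Di k * pB g k) / DN k.
Definition solB g k := if Nat.eq_dec k 1 then 0 else (Dr k * pB g k + Di k * pA g k) / DN k.

(* [L0] is the linearisation at criticality, in the time scale where the critical period is [2 * PI]. *)
Definition L0 (x x' : R -> R) (t : R) : R := w * x' t + x t + be * x (t - th).

Lemma coef_L0 x x' k : (forall t, is_derive x t (x' t)) -> cont x' -> per x ->
  pA (L0 x x') k = Dr k * pA x k + Di k * pB x k /\ pB (L0 x x') k = Dr k * pB x k - Di k * pA x k.
Proof.
  intros Hd Hc Hp. assert (Cx : cont x) by exact (is_derive_cont _ _ Hd).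
  assert (H0 : x 0 = x tau2) by (rewrite <- (Hp 0); f_equal; ring).
  destruct (coef_deriv tau2 1 nu1 x x' Hd Hc H0 k) as [E1 E2].
  destruct (coef_shift x th k Cx Hp) as [E3 E4].
  assert (X : L0 x x' = fun t => (x t + w * x' t) + be * x (t - th)).
  { apply functional_extensionality; intros t; unfold L0; ring. }
  rewrite X. split.
  - rewrite !fA_lin by ct. rewrite E1, E3. unfold Dr, Di. ring.
  - rewrite !fB_lin by ct. rewrite E2, E4. unfold Dr, Di. ring.
Qed.

Lemma L0_coef_unique A B g1 g2 k : (k <> 1)%nat -> g1 = Dr k * A + Di k * B -> g2 = Dr k * B - Di k * A ->
  A = (Dr k * g1 - Di k * g2) / DN k /\ B = (Dr k * g2 + Di k * g1) / DN k.
Proof.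
  intros Hk -> ->. destruct (DN_lower k Hk) as [H _]. unfold DN in *. split; field; lra.
Qed.

Definition K0_spec (g x x' : R -> R) : Prop :=
  ((forall t, is_derive x t (x' t)) /\ cont x' /\ per x /\ pA x 1 = 0 /\ pB x 1 = 0) /\
  (forall t, L0 x x' t = g t - P1 g t).

Lemma K0_unique g x x' y y' : cont g -> K0_spec g x x' -> K0_spec g y y' -> forall t, x t = y t.
Proof.
  intros Hg [[Dx [Cx [Px [Ax Bx]]]] Ex] [[Dy [Cy [Py [Ay By]]]] Ey].
  apply per_complete; auto. exact (is_derive_cont _ _ Dx). exact (is_derive_cont _ _ Dy).
  intros k. destruct (Nat.eq_dec k 1) as [->|N]. rewrite Ax, Ay, Bx, By; auto.
  destruct (coef_L0 x x' k Dx Cx Px) as [E1 E2]. destruct (coef_L0 y y' k Dy Cy Py) as [E3 E4].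
  replace (L0 y y') with (L0 x x') in E3, E4 by (apply functional_extensionality; intros t; now rewrite Ex, Ey).
  destruct (L0_coef_unique _ _ _ _ k N E1 E2) as [-> ->]. destruct (L0_coef_unique _ _ _ _ k N E3 E4) as [-> ->]. auto.
Qed.

(** [CD + 2] bounds the harmonics of positive order and 1 the mean value. [CK'] is read off from the
    equation solved for the derivative, where [g - P1 g] costs [1 + 4]. *)
Definition CK := CD + 3.
Definition CK' := (5 + (1 + be) * CK) / w.

(** Dividing by the symbol gains one power of [k], so the series of the solution converges
    absolutely, though differentiability is not yet visible. It comes from [per_ode], applied with
    the delayed term moved to the right-hand side. *)
Lemma K0_exists g : cont g -> per g -> exists x x', K0_spec g x x' /\
  forall M, 0 < M -> (forall t, Rabs (g t) <= M) -> forall t, Rabs (x t) <= CK * M /\ Rabs (x' t) <= CK' * M.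
Proof.
  intros Hg Pg. pose proof PI_RGT_0 as HPI. pose proof tau2_pos as Ht2.
  set (a := fun k => wt tau2 k * solA g k). set (b := fun k => wt tau2 k * solB g k).
  assert (Hsq : forall k, INR k ^ 2 * (solA g k ^ 2 + solB g k ^ 2) <= CD * (pA g k ^ 2 + pB g k ^ 2)).
  { intros k. unfold solA, solB. destruct (Nat.eq_dec k 1) as [->|N].
    - simpl. assert (0 <= CD) by apply pow2_ge_0. pose proof (pow2_ge_0 (pA g 1)). pose proof (pow2_ge_0 (pB g 1)). pnra.
    - destruct (DN_lower k N) as [H1 H2].
      replace (((Dr k * pA g k - Di k * pB g k) / DN k) ^ 2 + ((Dr k * pB g k + Di k * pA g k) / DN k) ^ 2)
        with ((pA g k ^ 2 + pB g k ^ 2) / DN k) by (unfold DN in *; field; lra).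
      apply Rmult_le_reg_r with (DN k); auto.
      replace (INR k ^ 2 * ((pA g k ^ 2 + pB g k ^ 2) / DN k) * DN k) with (INR k ^ 2 * (pA g k ^ 2 + pB g k ^ 2)) by (field; lra).
      pose proof (pow2_ge_0 (pA g k)). pose proof (pow2_ge_0 (pB g k)). pnra. }
  assert (Hwt : forall k, 0 < wt tau2 k <= / PI).
  { intros k. split. now apply wt_pos. destruct k; simpl; unfold Rdiv; rewrite Rinv_mult.
    assert (0 < / PI) by now apply Rinv_0_lt_compat. lra. right; field; lra. }
  assert (HE : forall M, (forall t, Rabs (g t) <= M) -> forall n, psum (fun k => INR k ^ 2 * (a k ^ 2 + b k ^ 2)) n <= 2 * CD * M ^ 2).
  { intros M HM n. apply Rle_trans with (/ PI * CD * psum (fun k => wt tau2 k * (pA g k ^ 2 + pB g k ^ 2)) n).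
    - rewrite <- psum_scal. apply psum_le. intros k _. unfold a, b. destruct (Hwt k) as [W1 W2]. specialize (Hsq k).
      replace (INR k ^ 2 * ((wt tau2 k * solA g k) ^ 2 + (wt tau2 k * solB g k) ^ 2)) with
       (wt tau2 k * (wt tau2 k * (INR k ^ 2 * (solA g k ^ 2 + solB g k ^ 2)))) by ring.
      replace (/ PI * CD * (wt tau2 k * (pA g k ^ 2 + pB g k ^ 2))) with (/ PI * (wt tau2 k * (CD * (pA g k ^ 2 + pB g k ^ 2)))) by ring.
      apply Rmult_le_compat; auto; try lra.
      apply Rmult_le_pos. lra. apply Rmult_le_pos. apply pow2_ge_0. pose proof (pow2_ge_0 (solA g k)). pose proof (pow2_ge_0 (solB g k)). lra.
      apply Rmult_le_compat_l; lra.
    - pose proof (bessel tau2 1 Ht2 nu1 g n Hg) as B.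
      assert (B2 : RI (fun t => g t ^ 2) 0 tau2 <= tau2 * M ^ 2).
      { apply Rle_trans with (RI (fun _ => M ^ 2) 0 tau2). apply RI_le; try ct. lra. intros t _. rewrite <- pow2_abs.
        apply pow_incr. split. apply Rabs_pos. apply HM. rewrite RI_const. lra. }
      apply Rle_trans with (/ PI * CD * (tau2 * M ^ 2)). apply Rmult_le_compat_l; [|lra].
      apply Rmult_le_pos. left; now apply Rinv_0_lt_compat. apply pow2_ge_0.
      right; field; lra. }
  destruct (per_bounded g Hg Pg) as [M0 [HM0 HM0b]].
  destruct (trig_series 1 a b (Rabs (a 0%nat) + Rabs (b 0%nat) + / 2 * (1 * (2 * CD * M0 ^ 2) + 4 / 1))) as [x [Cx HU]].
  { intros n. apply psum_abs_le. lra. apply HE; auto. }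
  assert (Hb0 : b 0%nat = 0).
  { unfold b, solB. simpl. replace (pB g 0) with 0 by (symmetry; apply fB_0).
    unfold Dr, Di. simpl. rewrite Rmult_0_l, sin_0. unfold Rdiv; ring. }
  assert (Hcoef : forall k, pA x k = solA g k /\ pB x k = solB g k).
  { intros k. destruct (trig_series_coef tau2 1 Ht2 nu1 a b x Cx Hb0 HU k) as [-> ->].
    unfold a, b. destruct (Hwt k) as [W _]. split; field; lra. }
  assert (Px : per x).
  { intros t. apply cond_eq. intros e He. destruct (HU (e / 3)) as [N HN]. lra.
    specialize (HN N (le_n _)). pose proof (HN t) as H1. pose proof (HN (t + tau2)) as H2.
    replace (tp 1 a b N (t + tau2)) with (tp 1 a b N t) in H2.
    2:{ unfold tp. apply psum_ext. intros k _. now rewrite (ck_per tau2 1 nu1), (sk_per tau2 1 nu1). }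
    unabs H1. unabs H2. apply Rabs_def1; lra. }
  assert (Hxb : forall M, 0 < M -> (forall t, Rabs (g t) <= M) -> forall t, Rabs (x t) <= CK * M).
  { intros M HM HgM t. apply le_epsilon. intros e He. destruct (HU e He) as [N HN]. specialize (HN N (le_n _) t).
    pose proof (tp_tail 1 a b 0 N t ltac:(lia)) as H1. unfold tp at 2 in H1. simpl in H1. rewrite !Rminus_0_r in H1.
    (* The weight [1 / M] balances the two terms and makes the bound linear in [M]. *)
    pose proof (psum_abs_le a b (2 * CD * M ^ 2) (/ M) N ltac:(now apply Rinv_0_lt_compat) (HE M HgM)) as H2.
    rewrite Hb0, Rabs_R0 in H2.
    assert (H3 : Rabs (a 0%nat) <= M).
    { unfold a, solA. simpl. replace (pB g 0) with 0 by (symmetry; apply fB_0). unfold Dr, Di, DN. simpl.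
      unfold Dr, Di. simpl. rewrite !Rmult_0_l, cos_0, sin_0.
      destruct (coef_bound g M 0 Hg HgM) as [HA _].
      replace (/ tau2 * (((1 + be * 1) * pA g 0 - (w * 0 - be * 0) * 0) / ((1 + be * 1) * ((1 + be * 1) * 1) + (w * 0 - be * 0) * ((w * 0 - be * 0) * 1))))
       with (/ (tau2 * (1 + be)) * pA g 0) by (field; lra).
      assert (0 < tau2 * (1 + be)) by pnra.
      rewrite Rabs_mult, (Rabs_pos_eq (/ _)) by (left; now apply Rinv_0_lt_compat).
      apply Rmult_le_reg_l with (tau2 * (1 + be)); auto. rewrite <- Rmult_assoc, Rinv_r, Rmult_1_l by lra. assert (0 < tau2 * M) by (apply Rmult_lt_0_compat; lra). assert (0 < be * (tau2 * M)) by (apply Rmult_lt_0_compat; lra). lra. }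
    replace (/ M * (2 * CD * M ^ 2) + 4 / / M) with (2 * (CD * M) + 4 * M) in H2 by (field; lra).
    replace (x t) with (tp 1 a b N t - (tp 1 a b N t - x t)) by ring. triang. rewrite Rabs_Ropp.
    unfold CK. lra. }
  set (q := fun t => g t - P1 g t - be * x (t - th)).
  assert (Cq : cont q) by (unfold q; ct; apply cont_P1).
  assert (Pq : per q).
  { intros t. unfold q. rewrite Pg, per_P1. replace (t + tau2 - th) with (t - th + tau2) by ring. now rewrite Px. }
  destruct (per_ode w q w0 Cq Pq) as [y [y' [Dy [Cy' [Py Ey]]]]].
  assert (Cy : cont y) by exact (is_derive_cont _ _ Dy).
  assert (Hqc : forall k, pA q k = (if Nat.eq_dec k 1 then 0 else pA g k) - be * (cos (INR k * th) * solA g k - sin (INR k * th) * solB g k) /\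
     pB q k = (if Nat.eq_dec k 1 then 0 else pB g k) - be * (sin (INR k * th) * solA g k + cos (INR k * th) * solB g k)).
  { intros k. assert (X : q = fun t => (g t + -1 * P1 g t) + (- be) * x (t - th)).
    { apply functional_extensionality; intros t; unfold q; ring. }
    rewrite X. destruct (coef_shift x th k Cx Px) as [E3 E4]. destruct (coef_P1 g k) as [E5 E6].
    destruct (Hcoef k) as [E7 E8].
    rewrite !fA_lin, !fB_lin by (ct; apply cont_P1). rewrite E3, E4, E5, E6, E7, E8. destruct (Nat.eq_dec k 1) as [->|N]; split; ring. }
  (* Both sides have the same Fourier coefficients: a two by two system of determinant [1 + (w k)^2]
     is solved by either. *)
  assert (Hyx : forall t, y t = x t).
  { apply per_complete; auto. intros k. destruct (Hcoef k) as [-> ->].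
    assert (H0 : y 0 = y tau2) by (rewrite <- (Py 0); f_equal; ring).
    destruct (coef_deriv tau2 1 nu1 y y' Dy Cy' H0 k) as [E1 E2].
    assert (Eq : (pA q k = pA y k + w * INR k * pB y k) /\ (pB q k = pB y k - w * INR k * pA y k)).
    { replace q with (fun t => y t + w * y' t). rewrite fA_lin, fB_lin by auto. rewrite E1, E2. split; ring.
      apply functional_extensionality; intros t. rewrite <- Ey. ring. }
    destruct Eq as [F1 F2]. destruct (Hqc k) as [G1 G2].
    assert (S1 : solA g k + w * INR k * solB g k = pA q k /\ solB g k - w * INR k * solA g k = pB q k).
    { rewrite G1, G2. unfold solA, solB. destruct (Nat.eq_dec k 1) as [->|N]. split; ring.
      destruct (DN_lower k N) as [HD _].
      split; (apply Rminus_diag_uniq; unfold DN, Dr, Di in *; field; lra). }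
    destruct S1 as [S1 S2]. set (m := w * INR k) in *.
    assert (Hm : 0 < 1 + m * m) by pnra.
    assert (U1 : (pA y k - solA g k) + m * (pB y k - solB g k) = 0) by lra.
    assert (U2 : (pB y k - solB g k) - m * (pA y k - solA g k) = 0) by lra.
    assert (U3 : (1 + m * m) * (pB y k - solB g k) = 0) by pnra.
    apply Rmult_integral in U3. destruct U3 as [U3|U3]. lra. rewrite U3 in U1. split; lra. }
  assert (Exy : y = x) by (apply functional_extensionality; auto). subst y.
  exists x, y'. split.
  - split; [|intros t; unfold L0; specialize (Ey t); unfold q in Ey; lra]. destruct (Hcoef 1%nat) as [E1 E2]. rewrite E1, E2. repeat (split; auto).
  - intros M HM HgM t. split. auto.
    specialize (Ey t). unfold q in Ey. replace (y' t) with ((g t - P1 g t - be * x (t - th) - x t) / w) by (rewrite <- Ey; field; lra).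
    unfold Rdiv. rewrite Rabs_mult, (Rabs_pos_eq (/ w)) by (left; now apply Rinv_0_lt_compat).
    unfold CK'. replace ((5 + (1 + be) * CK) / w * M) with ((5 * M + (1 + be) * (CK * M)) * / w) by (unfold Rdiv; ring).
    apply Rmult_le_compat_r. left; now apply Rinv_0_lt_compat.
    pose proof (HgM t) as B1. pose proof (P1_bound g M Hg HgM t) as B2. pose proof (Hxb M HM HgM t) as B3. pose proof (Hxb M HM HgM (t - th)) as B4.
    unabs B1. unabs B2. unabs B3. unabs B4.
    apply Rabs_le. pnra.
Qed.

(** The operator is chosen on all functions at once, so that the fixed point map is a plain function
    of [g]; its values outside continuous periodic functions are arbitrary. *)
Lemma K0_operator : exists K K' : (R -> R) -> R -> R, forall g, cont g -> per g ->
  K0_spec g (K g) (K' g) /\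
  forall M, 0 < M -> (forall t, Rabs (g t) <= M) -> forall t, Rabs (K g t) <= CK * M /\ Rabs (K' g t) <= CK' * M.
Proof.
  set (Q := fun (g : R -> R) (p : (R -> R) * (R -> R)) => cont g -> per g -> K0_spec g (fst p) (snd p) /\
    forall M, 0 < M -> (forall t, Rabs (g t) <= M) -> forall t, Rabs (fst p t) <= CK * M /\ Rabs (snd p t) <= CK' * M).
  assert (X : forall g, exists p, Q g p).
  { intros g. destruct (classic (cont g /\ per g)) as [[H1 H2]|N].
    - destruct (K0_exists g H1 H2) as [x [x' H]]. exists (x, x'). intros _ _. exact H.
    - exists (fun _ => 0, fun _ => 0). intros H1 H2. now destruct N. }
  set (F := fun g => proj1_sig (constructive_indefinite_description _ (X g))).
  exists (fun g => fst (F g)), (fun g => snd (F g)). intros g. exact (proj2_sig (constructive_indefinite_description _ (X g))).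
Qed.

(* The operator is linear by uniqueness, so its bounds are Lipschitz bounds. *)
Lemma K0_lip (K K' : (R -> R) -> R -> R) :
  (forall g, cont g -> per g -> K0_spec g (K g) (K' g) /\
  forall M, 0 < M -> (forall t, Rabs (g t) <= M) -> forall t, Rabs (K g t) <= CK * M /\ Rabs (K' g t) <= CK' * M) ->
  forall g1 g2 M, cont g1 -> per g1 -> cont g2 -> per g2 -> 0 < M -> (forall t, Rabs (g1 t - g2 t) <= M) ->
  forall t, Rabs (K g1 t - K g2 t) <= CK * M /\ Rabs (K' g1 t - K' g2 t) <= CK' * M.
Proof.
  intros HK g1 g2 M C1 P1' C2 P2 HM Hd.
  set (g := fun t => g1 t + -1 * g2 t). assert (Cg : cont g) by (unfold g; ct).
  assert (Pg : per g) by (intros t; unfold g; now rewrite P1', P2).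
  destruct (HK g Cg Pg) as [Hs Hb].
  destruct (HK g1 C1 P1') as [[[D1 [K1 [Q1 [A1 B1]]]] E1] _]. destruct (HK g2 C2 P2) as [[[D2 [K2 [Q2 [A2 B2]]]] E2] _].
  assert (S : K0_spec g (fun t => K g1 t + -1 * K g2 t) (fun t => K' g1 t + -1 * K' g2 t)).
  { assert (X1 : cont (K g1)) by exact (is_derive_cont _ _ D1). assert (X2 : cont (K g2)) by exact (is_derive_cont _ _ D2).
    split; [split; [|split; [|split; [|split]]]|].
    - intros t. apply D_plus; auto. apply D_scal; auto.
    - ct.
    - intros t. now rewrite Q1, Q2.
    - rewrite fA_lin by auto. rewrite A1, A2. ring.
    - rewrite fB_lin by auto. rewrite B1, B2. ring.
    - intros t. specialize (E1 t). specialize (E2 t). unfold L0 in *. unfold P1 in *. unfold g at 2 3. rewrite fA_lin, fB_lin by auto.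
      unfold g. lra. }
  intros t. assert (HgM : forall t, Rabs (g t) <= M).
  { intros s. unfold g. replace (g1 s + -1 * g2 s) with (g1 s - g2 s) by ring. auto. }
  specialize (Hb M HM HgM). pose proof (K0_unique g _ _ _ _ Cg S Hs) as E.
  assert (E' : forall s, K' g1 s + -1 * K' g2 s = K' g s).
  { intros s. destruct S as [[Da _] _]. destruct Hs as [[Db _] _].
    rewrite <- (is_derive_unique _ _ _ (Da s)), <- (is_derive_unique _ _ _ (Db s)).
    apply Derive_ext. auto. }
  specialize (E t). specialize (E' t). specialize (Hb t). simpl in E.
  replace (K g1 t - K g2 t) with (K g t) by lra. replace (K' g1 t - K' g2 t) with (K' g t) by lra. auto.
Qed.
End K0.

(* Strict differentiability, of functions of two variables at [(x0, y0)] and of one variable at [u0]. *)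
Definition SD (x0 y0 : R) (f : R -> R -> R) (gx gy : R) : Prop := forall eta, 0 < eta -> exists r, 0 < r /\
  forall x1 y1 x2 y2, Rabs (x1 - x0) <= r -> Rabs (y1 - y0) <= r -> Rabs (x2 - x0) <= r -> Rabs (y2 - y0) <= r ->
  Rabs (f x1 y1 - f x2 y2 - gx * (x1 - x2) - gy * (y1 - y2)) <= eta * (Rabs (x1 - x2) + Rabs (y1 - y2)).
Definition SD1 (u0 : R) (h : R -> R) (h' : R) : Prop := forall eta, 0 < eta -> exists r, 0 < r /\
  forall u1 u2, Rabs (u1 - u0) <= r -> Rabs (u2 - u0) <= r -> Rabs (h u1 - h u2 - h' * (u1 - u2)) <= eta * Rabs (u1 - u2).

(** By the mean value theorem, continuity of the derivative at the single point [u0] already gives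
    the strict form. *)
Lemma SD1_C1 u0 (h dh : R -> R) r0 : 0 < r0 -> (forall u, Rabs (u - u0) <= r0 -> is_derive h u (dh u)) ->
  continuous dh u0 -> SD1 u0 h (dh u0).
Proof.
  intros Hr0 Hd Hc eta He. apply continuity_pt_filterlim in Hc.
  destruct (proj1 (continuity_pt_locally dh u0) Hc (mkposreal eta He)) as [d Hd'].
  exists (Rmin r0 (d / 2)). pose proof (cond_pos d). split. apply Rmin_pos; lra.
  intros u1 u2 H1 H2.
  assert (R1 : Rmin r0 (d / 2) <= r0) by apply Rmin_l. assert (R2 : Rmin r0 (d / 2) <= d / 2) by apply Rmin_r.
  assert (Hin : forall u, Rmin u2 u1 <= u <= Rmax u2 u1 -> Rabs (u - u0) <= Rmin r0 (d / 2)).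
  { intros u Hu. unabs H1. unabs H2. apply Rabs_le. revert Hu. unfold Rmin at 1, Rmax. destruct (Rle_dec u2 u1); lra. }
  destruct (MVT_gen h u2 u1 dh) as [c [Hc1 Hc2]].
  - intros u Hu. apply Hd. specialize (Hin u). lra.
  - intros u Hu. apply continuity_pt_filterlim. apply (ex_derive_continuous h). exists (dh u). apply Hd. specialize (Hin u Hu). lra.
  - rewrite Hc2. replace (dh c * (u1 - u2) - dh u0 * (u1 - u2)) with ((dh c - dh u0) * (u1 - u2)) by ring.
    rewrite Rabs_mult. apply Rmult_le_compat_r. apply Rabs_pos. left. apply Hd'.
    specialize (Hin c Hc1). change (Rabs (c - u0) < d). lra.
Qed.

Section SDcalc.
Variables x0 y0 : R.
Notation SD := (SD x0 y0).

Lemma SD_const c : SD (fun _ _ => c) 0 0.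
Proof.
  intros eta He. exists 1; split. lra. intros. replace (c - c - 0 * (x1 - x2) - 0 * (y1 - y2)) with 0 by ring.
  rewrite Rabs_R0. pose proof (Rabs_pos (x1 - x2)). pose proof (Rabs_pos (y1 - y2)). pnra.
Qed.
Lemma SD_x : SD (fun x _ => x) 1 0.
Proof.
  intros eta He. exists 1; split. lra. intros. replace (x1 - x2 - 1 * (x1 - x2) - 0 * (y1 - y2)) with 0 by ring.
  rewrite Rabs_R0. pose proof (Rabs_pos (x1 - x2)). pose proof (Rabs_pos (y1 - y2)). pnra.
Qed.
Lemma SD_y : SD (fun _ y => y) 0 1.
Proof.
  intros eta He. exists 1; split. lra. intros. replace (y1 - y2 - 0 * (x1 - x2) - 1 * (y1 - y2)) with 0 by ring.
  rewrite Rabs_R0. pose proof (Rabs_pos (x1 - x2)). pose proof (Rabs_pos (y1 - y2)). pnra.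
Qed.
Lemma SD_plus f g fx fy gx gy : SD f fx fy -> SD g gx gy -> SD (fun x y => f x y + g x y) (fx + gx) (fy + gy).
Proof.
  intros Hf Hg eta He. destruct (Hf (eta / 2)) as [r1 [Hr1 H1]]. lra. destruct (Hg (eta / 2)) as [r2 [Hr2 H2]]. lra.
  exists (Rmin r1 r2). split. now apply Rmin_pos. intros x1 y1 x2 y2 A B C D.
  assert (Rmin r1 r2 <= r1) by apply Rmin_l. assert (Rmin r1 r2 <= r2) by apply Rmin_r.
  specialize (H1 x1 y1 x2 y2 ltac:(lra) ltac:(lra) ltac:(lra) ltac:(lra)).
  specialize (H2 x1 y1 x2 y2 ltac:(lra) ltac:(lra) ltac:(lra) ltac:(lra)).
  unabs H1. unabs H2. apply Rabs_le. lra.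
Qed.
Lemma SD_lip f fx fy : SD f fx fy -> exists L r, 0 < L /\ 0 < r /\ forall x1 y1 x2 y2,
  Rabs (x1 - x0) <= r -> Rabs (y1 - y0) <= r -> Rabs (x2 - x0) <= r -> Rabs (y2 - y0) <= r ->
  Rabs (f x1 y1 - f x2 y2) <= L * (Rabs (x1 - x2) + Rabs (y1 - y2)).
Proof.
  intros Hf. destruct (Hf 1) as [r [Hr H]]. lra. exists (Rabs fx + Rabs fy + 1), r.
  pose proof (Rabs_pos fx). pose proof (Rabs_pos fy). split. lra. split; auto.
  intros x1 y1 x2 y2 A B C D. specialize (H x1 y1 x2 y2 A B C D).
  replace (f x1 y1 - f x2 y2) with ((f x1 y1 - f x2 y2 - fx * (x1 - x2) - fy * (y1 - y2)) + (fx * (x1 - x2) + fy * (y1 - y2))) by ring.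
  triang. assert (Rabs (fx * (x1 - x2) + fy * (y1 - y2)) <= Rabs fx * Rabs (x1 - x2) + Rabs fy * Rabs (y1 - y2)).
  { rewrite <- !Rabs_mult. apply Rabs_triang. }
  pose proof (Rabs_pos (x1 - x2)). pose proof (Rabs_pos (y1 - y2)). pnra.
Qed.
Lemma SD_ext f g fx fy fx' fy' : SD f fx fy -> (forall x y, f x y = g x y) -> fx = fx' -> fy = fy' -> SD g fx' fy'.
Proof.
  intros H E <- <-. intros eta He. destruct (H eta He) as [r [Hr Hx]]. exists r; split; auto. intros. rewrite <- !E. auto.
Qed.
Lemma SD_comp h h' f fx fy : SD1 (f x0 y0) h h' -> SD f fx fy -> SD (fun x y => h (f x y)) (h' * fx) (h' * fy).
Proof.
  intros Hh Hf eta He. destruct (SD_lip f fx fy Hf) as [L [r0 [HL [Hr0 Hlip]]]].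
  destruct (Hh (eta / (2 * L))) as [r1 [Hr1 H1]]. apply Rdiv_lt_0_compat; lra.
  pose proof (Rabs_pos h') as Hh'.
  destruct (Hf (eta / (2 * (Rabs h' + 1)))) as [r2 [Hr2 H2]]. apply Rdiv_lt_0_compat; lra.
  set (r3 := Rmin (r1 / (2 * L)) (Rmin r0 r2)).
  assert (A1 : r3 <= r1 / (2 * L)) by apply Rmin_l.
  assert (A2 : r3 <= r0) by (min_le).
  assert (A3 : r3 <= r2) by (min_le).
  assert (A0 : 0 < r3) by (unfold r3; repeat apply Rmin_pos; auto; apply Rdiv_lt_0_compat; lra).
  exists r3; split; auto. intros x1 y1 x2 y2 HA HB HC HD.
  assert (Hr : L * (2 * r3) <= r1).
  { apply Rle_trans with (L * (2 * (r1 / (2 * L)))). pnra. right; field; lra. }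
  assert (Hz : Rabs (x0 - x0) <= r3 /\ Rabs (y0 - y0) <= r3) by (rewrite !Rminus_diag, Rabs_R0; lra).
  assert (B1 := Hlip x1 y1 x0 y0 ltac:(lra) ltac:(lra) ltac:(lra) ltac:(lra)).
  assert (B2 := Hlip x2 y2 x0 y0 ltac:(lra) ltac:(lra) ltac:(lra) ltac:(lra)).
  assert (B3 := Hlip x1 y1 x2 y2 ltac:(lra) ltac:(lra) ltac:(lra) ltac:(lra)).
  specialize (H1 (f x1 y1) (f x2 y2) ltac:(pnra) ltac:(pnra)).
  specialize (H2 x1 y1 x2 y2 ltac:(lra) ltac:(lra) ltac:(lra) ltac:(lra)).
  set (D := Rabs (x1 - x2) + Rabs (y1 - y2)) in *.
  assert (HD0 : 0 <= D) by (unfold D; pose proof (Rabs_pos (x1 - x2)); pose proof (Rabs_pos (y1 - y2)); lra).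
  replace (h (f x1 y1) - h (f x2 y2) - h' * fx * (x1 - x2) - h' * fy * (y1 - y2)) with
    ((h (f x1 y1) - h (f x2 y2) - h' * (f x1 y1 - f x2 y2)) + h' * (f x1 y1 - f x2 y2 - fx * (x1 - x2) - fy * (y1 - y2))) by ring.
  triang. rewrite Rabs_mult.
  assert (Rabs (h (f x1 y1) - h (f x2 y2) - h' * (f x1 y1 - f x2 y2)) <= eta / 2 * D).
  { eapply Rle_trans. apply H1. apply Rle_trans with (eta / (2 * L) * (L * D)). apply Rmult_le_compat_l; auto. left; apply Rdiv_lt_0_compat; lra.
    right; field; lra. }
  assert (Rabs h' * Rabs (f x1 y1 - f x2 y2 - fx * (x1 - x2) - fy * (y1 - y2)) <= eta / 2 * D).
  { apply Rle_trans with ((Rabs h' + 1) * (eta / (2 * (Rabs h' + 1)) * D)). apply Rmult_le_compat; auto using Rabs_pos; lra. right; field; lra. }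
  lra.
Qed.
Lemma SD_scal c f fx fy : SD f fx fy -> SD (fun x y => c * f x y) (c * fx) (c * fy).
Proof.
  intros H. apply (SD_comp (fun u => c * u) c); auto. intros eta He. exists 1; split. lra. intros.
  replace (c * u1 - c * u2 - c * (u1 - u2)) with 0 by ring. rewrite Rabs_R0. pose proof (Rabs_pos (u1 - u2)). pnra.
Qed.
Lemma SD_sq f fx fy : SD f fx fy -> SD (fun x y => f x y * f x y) (2 * f x0 y0 * fx) (2 * f x0 y0 * fy).
Proof.
  intros H. apply (SD_comp (fun u => u * u) (2 * f x0 y0)); auto.
  apply (SD1_C1 (f x0 y0) (fun u => u * u) (fun u => 2 * u) 1). lra.
  intros u _. auto_derive; auto. ring.
  assert (C : cont (fun u => 2 * u)) by ct. apply C.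
Qed.
(* Products reduce to squares by polarization. *)
Lemma SD_mult f g fx fy gx gy : SD f fx fy -> SD g gx gy ->
  SD (fun x y => f x y * g x y) (fx * g x0 y0 + f x0 y0 * gx) (fy * g x0 y0 + f x0 y0 * gy).
Proof.
  intros Hf Hg. pose proof (SD_sq _ _ _ (SD_plus _ _ _ _ _ _ Hf Hg)) as H1.
  pose proof (SD_sq _ _ _ (SD_plus _ _ _ _ _ _ Hf (SD_scal (-1) _ _ _ Hg))) as H2.
  pose proof (SD_plus _ _ _ _ _ _ (SD_scal (/ 4) _ _ _ H1) (SD_scal (- / 4) _ _ _ H2)) as H3.
  eapply SD_ext. apply H3. all: simpl; intros; field.
Qed.
Lemma SD_inv f fx fy : f x0 y0 <> 0 -> SD f fx fy -> SD (fun x y => / f x y) (- fx / f x0 y0 ^ 2) (- fy / f x0 y0 ^ 2).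
Proof.
  intros N H. eapply SD_ext. apply (SD_comp (fun u => / u) (- / f x0 y0 ^ 2)). 2: exact H.
  apply (SD1_C1 (f x0 y0) (fun u => / u) (fun u => - / u ^ 2) (Rabs (f x0 y0) / 2)).
  pose proof (Rabs_pos_lt _ N); lra.
  intros u Hu. assert (u <> 0). { intros ->. rewrite Rminus_0_l, Rabs_Ropp in Hu. pose proof (Rabs_pos_lt _ N); lra. }
  auto_derive; auto. field; auto.
  apply (ex_derive_continuous (fun u => - / u ^ 2)). auto_derive. rewrite Rmult_1_r. now apply Rmult_integral_contrapositive.
  reflexivity. all: field; auto.
Qed.
End SDcalc.

(** * Frequency and normalised delay as functions of the first harmonic *)

Section NuKap.
Variables be w th : R.
Hypothesis be1 : 1 < be.
Hypothesis w0 : 0 < w.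
Hypothesis w2 : w * w = be * be - 1.
Hypothesis th0 : 0 < th < PI.
Hypothesis costh : be * cos th = -1.
Hypothesis sinth : be * sin th = w.

(** The solution of [(1 + i nu) e^(i kap) = x + i y]: the modulus determines [nu], and [qf] is the
    resulting value of [cos kap]. *)
Definition nuf x y := sqrt (x * x + y * y - 1).
Definition qf x y := (x + nuf x y * y) * / (x * x + y * y).
Definition kapf x y := acos (qf x y).

Lemma nuf0 : nuf (- be) 0 = w.
Proof.
  unfold nuf. replace (- be * - be + 0 * 0 - 1) with (w * w) by lra. apply sqrt_square; lra.
Qed.
Lemma qf0 : qf (- be) 0 = - / be.
Proof. unfold qf. field. lra. Qed.
Lemma kapf0 : kapf (- be) 0 = th.
Proof.
  unfold kapf. rewrite qf0. replace (- / be) with (cos th). apply acos_cos; lra.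
  apply Rmult_eq_reg_l with be; [|lra]. rewrite costh. field; lra.
Qed.

Lemma SD_nuf : SD (- be) 0 nuf (- (be / w)) 0.
Proof.
  pose proof (SD_x (- be) 0) as Hx. pose proof (SD_y (- be) 0) as Hy.
  pose proof (SD_plus _ _ _ _ _ _ _ _ (SD_plus _ _ _ _ _ _ _ _ (SD_sq _ _ _ _ _ Hx) (SD_sq _ _ _ _ _ Hy)) (SD_const (- be) 0 (-1))) as H.
  eapply SD_ext. apply (SD_comp _ _ sqrt (/ (2 * sqrt (- be * - be + 0 * 0 + -1)))). 2: exact H.
  - cbv beta. replace (- be * - be + 0 * 0 + -1) with (w * w) by lra.
    apply (SD1_C1 (w * w) sqrt (fun u => / (2 * sqrt u)) (w * w / 2)). pnra.
    intros u Hu. unabs Hu. assert (0 < u) by pnra. auto_derive; auto.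
    field. pose proof (sqrt_lt_R0 u H0). lra.
    apply (ex_derive_continuous (fun u => / (2 * sqrt u))). auto_derive. split. pnra.
    rewrite sqrt_square by lra. split; lra.
  - intros x y. unfold nuf. f_equal.
  - replace (- be * - be + 0 * 0 + -1) with (w * w) by lra. rewrite sqrt_square by lra. field. lra.
  - cbv beta; ring.
Qed.

Lemma SD_kapf : SD (- be) 0 kapf (/ (be * w)) (- / be).
Proof.
  pose proof (SD_x (- be) 0) as Hx. pose proof (SD_y (- be) 0) as Hy.
  pose proof (SD_plus _ _ _ _ _ _ _ _ Hx (SD_mult _ _ _ _ _ _ _ _ SD_nuf Hy)) as H1.
  pose proof (SD_plus _ _ _ _ _ _ _ _ (SD_sq _ _ _ _ _ Hx) (SD_sq _ _ _ _ _ Hy)) as H2.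
  apply SD_inv in H2; [|pnra].
  pose proof (SD_mult _ _ _ _ _ _ _ _ H1 H2) as H. cbv beta in H. rewrite nuf0 in H.
  assert (Hib : 0 < / be < 1) by (split; [apply Rinv_0_lt_compat; lra | rewrite <- Rinv_1; apply Rinv_lt_contravar; lra]).
  assert (Hsq : sqrt (1 - (- / be)²) = w / be).
  { replace (1 - (- / be)²) with ((w / be) * (w / be)). apply sqrt_square. apply Rlt_le, Rdiv_lt_0_compat; lra.
    unfold Rsqr. replace (w / be * (w / be)) with (w * w / (be * be)) by (field; lra). rewrite w2. field; lra. }
  eapply SD_ext. apply (SD_comp _ _ acos (- / sqrt (1 - (- / be)²))). 2: exact H.
  - cbv beta. replace ((- be + nuf (- be) 0 * 0) * / (- be * - be + 0 * 0)) with (- / be) by (rewrite nuf0; field; lra).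
    apply (SD1_C1 (- / be) acos (fun u => - / sqrt (1 - u²)) (Rmin (/ be / 2) ((1 - / be) / 2))). apply Rmin_pos; lra.
    intros u Hu. assert (A1 : Rmin (/ be / 2) ((1 - / be) / 2) <= / be / 2) by apply Rmin_l.
    assert (A2 : Rmin (/ be / 2) ((1 - / be) / 2) <= (1 - / be) / 2) by apply Rmin_r.
    unabs Hu. assert (Hu' : -1 < u < 1) by lra.
    apply is_derive_Reals. pose proof (derive_pt_acos u Hu') as E.
    replace (- / sqrt (1 - u²)) with (-1 / sqrt (1 - u²)) by (unfold Rdiv; ring). rewrite <- E. apply derive_pt_eq_1 with (derivable_pt_acos u Hu'). reflexivity.
    apply (ex_derive_continuous (fun u => - / sqrt (1 - u²))). unfold Rsqr. auto_derive. unfold Rsqr in Hsq. split. pnra.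
    split; auto. replace (1 + - (- / be * - / be)) with (1 - - / be * - / be) by ring. rewrite Hsq. apply Rgt_not_eq, Rdiv_lt_0_compat; lra.
  - intros x y. reflexivity.
  - rewrite Hsq. cbv beta. field. lra.
  - rewrite Hsq. field. lra.
Qed.

(** With [k = 2 pi n] this is the delay multiplied by [d], whose monotonicity along the branch
    decides the direction. *)
Definition mf k x y := (kapf x y + k) * / nuf x y.

Lemma SD_mf k : SD (- be) 0 (mf k) (/ (be * w * w) + (th + k) * be / (w * w * w)) (- / (be * w)).
Proof.
  pose proof (SD_plus _ _ _ _ _ _ _ _ SD_kapf (SD_const (- be) 0 k)) as H1.
  pose proof (SD_inv _ _ _ _ _ ltac:(rewrite nuf0; lra) SD_nuf) as H2.
  pose proof (SD_mult _ _ _ _ _ _ _ _ H1 H2) as H. cbv beta in H. rewrite nuf0, kapf0 in H.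
  eapply SD_ext. apply H. reflexivity. all: field; lra.
Qed.

Lemma nk_char nu kap x y : 0 < nu -> 0 < kap < PI -> cos kap - nu * sin kap = x -> sin kap + nu * cos kap = y ->
  nu = nuf x y /\ kap = kapf x y.
Proof.
  intros Hn Hk <- <-. pose proof (sin2_cos2 kap) as E. unfold Rsqr in E. set (c := cos kap) in *. set (n := sin kap) in *.
  assert (E2 : (c - nu * n) * (c - nu * n) + (n + nu * c) * (n + nu * c) = 1 + nu * nu).
  { replace ((c - nu * n) * (c - nu * n) + (n + nu * c) * (n + nu * c)) with ((n * n + c * c) * (1 + nu * nu)) by ring. rewrite E; ring. }
  assert (E3 : nuf (c - nu * n) (n + nu * c) = nu).
  { unfold nuf. rewrite E2. replace (1 + nu * nu - 1) with (nu * nu) by ring. apply sqrt_square; lra. }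
  split; auto. unfold kapf, qf. rewrite E2, E3.
  replace ((c - nu * n + nu * (n + nu * c)) * / (1 + nu * nu)) with c by (field; pnra).
  unfold c. now rewrite acos_cos by lra.
Qed.

(** The second hypothesis says that [sin kap] is nonnegative, so that the arc cosine picks the right
    angle. *)
Lemma nk_sol x y : 1 < x * x + y * y -> nuf x y * x <= y ->
  cos (kapf x y) - nuf x y * sin (kapf x y) = x /\ sin (kapf x y) + nuf x y * cos (kapf x y) = y.
Proof.
  intros H1 H2. set (v := nuf x y) in *.
  assert (Hv : v * v = x * x + y * y - 1) by (unfold v, nuf; apply sqrt_sqrt; lra).
  set (s := x * x + y * y) in *. assert (Hs : 0 < s) by lra.
  assert (Hq : qf x y = (x + v * y) / s) by reflexivity.
  assert (Hq2 : (x + v * y) * (x + v * y) + (y - v * x) * (y - v * x) = s * s).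
  { replace ((x + v * y) * (x + v * y) + (y - v * x) * (y - v * x)) with ((1 + v * v) * s) by (unfold s; ring).
    rewrite Hv. unfold s; ring. }
  assert (Hqb : -1 <= qf x y <= 1).
  { assert (HX : Rabs (x + v * y) <= Rabs s).
    { apply Rsqr_le_abs_0. unfold Rsqr. pose proof (Rle_0_sqr (y - v * x)) as Z. unfold Rsqr in Z. lra. }
    rewrite (Rabs_pos_eq s) in HX by lra. unabs HX.
    rewrite Hq. split; apply Rmult_le_reg_r with s; auto; unfold Rdiv; rewrite Rmult_assoc, Rinv_l by lra; lra. }
  assert (Ec : cos (kapf x y) = (x + v * y) / s) by (unfold kapf; rewrite cos_acos; auto).
  assert (Es : sin (kapf x y) = (y - v * x) / s).
  { unfold kapf. rewrite sin_acos by auto. rewrite Hq. unfold Rsqr.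
    replace (1 - (x + v * y) / s * ((x + v * y) / s)) with ((y - v * x) / s * ((y - v * x) / s)).
    apply sqrt_square. apply Rmult_le_pos. lra. left; now apply Rinv_0_lt_compat.
    replace ((y - v * x) / s * ((y - v * x) / s)) with ((y - v * x) * (y - v * x) / (s * s)) by (field; lra).
    replace ((y - v * x) * (y - v * x)) with (s * s - (x + v * y) * (x + v * y)) by lra. field; lra. }
  rewrite Ec, Es. assert (Hv' : v * v = s - 1) by lra. split.
  - replace ((x + v * y) / s - v * ((y - v * x) / s)) with (x * (1 + v * v) / s) by (field; lra). rewrite Hv'. field; lra.
  - replace ((y - v * x) / s + v * ((x + v * y) / s)) with (y * (1 + v * v) / s) by (field; lra). rewrite Hv'. field; lra.
Qed.

Lemma nk_near : exists r L, 0 < r /\ 0 < L /\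
  (forall x y, Rabs (x + be) <= r -> Rabs y <= r -> 1 < x * x + y * y /\ nuf x y * x <= y /\ w / 2 <= nuf x y /\ 0 < kapf x y < PI) /\
  (forall x1 y1 x2 y2, Rabs (x1 + be) <= r -> Rabs y1 <= r -> Rabs (x2 + be) <= r -> Rabs y2 <= r ->
    Rabs (nuf x1 y1 - nuf x2 y2) <= L * (Rabs (x1 - x2) + Rabs (y1 - y2)) /\
    Rabs (kapf x1 y1 - kapf x2 y2) <= L * (Rabs (x1 - x2) + Rabs (y1 - y2))).
Proof.
  destruct (SD_lip _ _ _ _ _ SD_nuf) as [L1 [r1 [HL1 [Hr1 H1]]]].
  destruct (SD_lip _ _ _ _ _ SD_kapf) as [L2 [r2 [HL2 [Hr2 H2]]]].
  set (L := L1 + L2).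
  set (m := Rmin (w / 2) (Rmin (th / 2) ((PI - th) / 2))).
  assert (Hm : 0 < m) by (unfold m; repeat apply Rmin_pos; lra).
  assert (Hm1 : m <= w / 2) by apply Rmin_l.
  assert (Hm2 : m <= th / 2) by (min_le).
  assert (Hm3 : m <= (PI - th) / 2) by (min_le).
  set (r := Rmin (Rmin r1 r2) (Rmin (m / (2 * L)) (Rmin m ((be - 1) / 2)))).
  assert (Hr : 0 < r). { unfold r; repeat apply Rmin_pos; try lra. apply Rdiv_lt_0_compat; unfold L; lra. }
  assert (A1 : r <= r1) by (eapply Rle_trans; [apply Rmin_l | apply Rmin_l]).
  assert (A2 : r <= r2) by (eapply Rle_trans; [apply Rmin_l | apply Rmin_r]).
  assert (A3 : r <= m / (2 * L)) by (min_le).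
  assert (A4 : r <= m) by (eapply Rle_trans; [apply Rmin_r | min_le]).
  assert (A5 : r <= (be - 1) / 2) by (eapply Rle_trans; [apply Rmin_r | min_le]).
  assert (HL : L * (2 * r) <= m).
  { apply Rle_trans with (L * (2 * (m / (2 * L)))). apply Rmult_le_compat_l. unfold L; lra. lra. right; field. unfold L; lra. }
  assert (Hlip : forall x1 y1 x2 y2, Rabs (x1 + be) <= r -> Rabs y1 <= r -> Rabs (x2 + be) <= r -> Rabs y2 <= r ->
    Rabs (nuf x1 y1 - nuf x2 y2) <= L * (Rabs (x1 - x2) + Rabs (y1 - y2)) /\
    Rabs (kapf x1 y1 - kapf x2 y2) <= L * (Rabs (x1 - x2) + Rabs (y1 - y2))).
  { intros x1 y1 x2 y2 B1 B2 B3 B4.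
    assert (HD : 0 <= Rabs (x1 - x2) + Rabs (y1 - y2)).
    { pose proof (Rabs_pos (x1 - x2)). pose proof (Rabs_pos (y1 - y2)). lra. }
    assert (C1 := H1 x1 y1 x2 y2). assert (C2 := H2 x1 y1 x2 y2).
    replace (x1 - - be) with (x1 + be) in * by ring. replace (x2 - - be) with (x2 + be) in * by ring. rewrite !Rminus_0_r in *.
    specialize (C1 ltac:(lra) ltac:(lra) ltac:(lra) ltac:(lra)). specialize (C2 ltac:(lra) ltac:(lra) ltac:(lra) ltac:(lra)).
    unfold L. split; pnra. }
  exists r, L. split; auto. split. unfold L; lra. split; auto.
  intros x y Hx Hy.
  destruct (Hlip x y (- be) 0 Hx Hy) as [C1 C2]. replace (- be + be) with 0 by ring. rewrite Rabs_R0; lra. rewrite Rabs_R0; lra.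
  rewrite nuf0 in C1. rewrite kapf0 in C2. replace (x - - be) with (x + be) in * by ring. rewrite Rminus_0_r in *.
  assert (C3 : L * (Rabs (x + be) + Rabs y) <= m).
  { eapply Rle_trans; [|apply HL]. apply Rmult_le_compat_l. unfold L; lra. lra. }
  assert (C1' : Rabs (nuf x y - w) <= m) by lra. assert (C2' : Rabs (kapf x y - th) <= m) by lra.
  unabs C1'. unabs C2'. unabs Hx. unabs Hy.
  split. pnra. split. pnra. lra.
Qed.
End NuKap.

(** * The bifurcating branch *)

Lemma lip_of_deriv f f' M : (forall t, is_derive f t (f' t)) -> (forall t, Rabs (f' t) <= M) ->
  forall a b, Rabs (f a - f b) <= M * Rabs (a - b).
Proof.
  intros Hd HM a b. destruct (MVT_gen f b a f') as [c [_ E]].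
  intros; apply Hd. intros. apply continuity_pt_filterlim. apply (is_derive_cont f f' Hd).
  rewrite E, Rabs_mult. apply Rmult_le_compat_r. apply Rabs_pos. auto.
Qed.
Lemma cos_lip a b : Rabs (cos a - cos b) <= Rabs (a - b).
Proof.
  rewrite <- (Rmult_1_l (Rabs (a - b))). apply (lip_of_deriv cos (fun t => - sin t)).
  intros t. auto_derive; auto. ring. intros t. rewrite Rabs_Ropp. apply Rabs_le, SIN_bound.
Qed.
Lemma sin_lip a b : Rabs (sin a - sin b) <= Rabs (a - b).
Proof.
  rewrite <- (Rmult_1_l (Rabs (a - b))). apply (lip_of_deriv sin cos).
  intros t. auto_derive; auto. ring. intros t. apply Rabs_le, COS_bound.
Qed.

(** Boundedness and Lipschitz dependence in one predicate stable under sums and products, so that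
    the constants of a polynomial expression need not be written down. *)
Definition good (d B L u1 u2 : R) : Prop := Rabs u1 <= B /\ Rabs u2 <= B /\ Rabs (u1 - u2) <= L * d.

Lemma good_plus d B1 L1 u1 u2 B2 L2 v1 v2 : good d B1 L1 u1 u2 -> good d B2 L2 v1 v2 ->
  good d (B1 + B2) (L1 + L2) (u1 + v1) (u2 + v2).
Proof.
  intros (A1 & A2 & A3) (C1 & C2 & C3).
  repeat split; [ pose proof (Rabs_triang u1 v1); lra | pose proof (Rabs_triang u2 v2); lra |].
  replace (u1 + v1 - (u2 + v2)) with ((u1 - u2) + (v1 - v2)) by ring. pose proof (Rabs_triang (u1 - u2) (v1 - v2)). lra.
Qed.
Lemma good_mult d B1 L1 u1 u2 B2 L2 v1 v2 : good d B1 L1 u1 u2 -> good d B2 L2 v1 v2 ->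
  good d (B1 * B2) (B1 * L2 + B2 * L1) (u1 * v1) (u2 * v2).
Proof.
  intros (A1 & A2 & A3) (C1 & C2 & C3).
  repeat split; [ rewrite Rabs_mult; apply Rmult_le_compat; auto using Rabs_pos | rewrite Rabs_mult; apply Rmult_le_compat; auto using Rabs_pos |].
  replace (u1 * v1 - u2 * v2) with (u1 * (v1 - v2) + v2 * (u1 - u2)) by ring.
  triang. rewrite !Rabs_mult.
  assert (Rabs u1 * Rabs (v1 - v2) <= B1 * (L2 * d)) by (apply Rmult_le_compat; auto using Rabs_pos).
  assert (Rabs v2 * Rabs (u1 - u2) <= B2 * (L1 * d)) by (apply Rmult_le_compat; auto using Rabs_pos). lra.
Qed.
Lemma good_const d c : 0 <= d -> good d (Rabs c) 0 c c.
Proof. intros. repeat split; try lra. rewrite Rminus_diag, Rabs_R0; lra. Qed.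

Lemma mul_le1 e x : 0 <= e <= 1 -> 0 <= x -> e * x <= x.
Proof. intros; pnra. Qed.

Section PartA.
Variables be w th : R.
Hypothesis be1 : 1 < be.
Hypothesis w0 : 0 < w.
Hypothesis w2 : w * w = be * be - 1.
Hypothesis th0 : 0 < th < PI.
Hypothesis costh : be * cos th = -1.
Hypothesis sinth : be * sin th = w.
Variables (n0 : R) (n3 : R -> R) (Ln : R).
Hypothesis n3c : cont n3.
Hypothesis n3b : forall z, Rabs z <= 1 -> Rabs (n3 z) <= Ln.
Hypothesis n3l : forall y z, Rabs y <= 1 -> Rabs z <= 1 -> Rabs (n3 y - n3 z) <= Ln * Rabs (y - z).

(* The Taylor form of the nonlinearity at the equilibrium; [y^3 n3 y] is the remainder. *)
Definition fN y := - be * y + n0 * (y * y) + y * (y * (y * n3 y)).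

(** For [v = e (c + e y)] one has [fN v = - be v + e^2 (n0 c^2 + e HtF e c y)]. The division by
    powers of [e] is done algebraically, so that [e = 0] is an ordinary parameter value. *)
Definition HtF e c y := 2 * n0 * (c * y) + n0 * (e * (y * y)) + (c + e * y) * ((c + e * y) * ((c + e * y) * n3 (e * (c + e * y)))).

Lemma Ln_pos : 0 <= Ln.
Proof. eapply Rle_trans; [|apply (n3b 0)]. apply Rabs_pos. rewrite Rabs_R0; lra. Qed.

Lemma HtF_good rho : 0 <= rho -> exists B L, 0 < B /\ 0 < L /\ forall d e1 e2 c1 c2 y1 y2,
  0 <= d -> good d 1 1 e1 e2 -> good d 1 1 c1 c2 -> good d rho 1 y1 y2 ->
  Rabs (e1 * (c1 + e1 * y1)) <= 1 -> Rabs (e2 * (c2 + e2 * y2)) <= 1 ->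
  good d B L (HtF e1 c1 y1) (HtF e2 c2 y2).
Proof.
  intros Hrho.
  assert (X : exists B L, forall d e1 e2 c1 c2 y1 y2,
  0 <= d -> good d 1 1 e1 e2 -> good d 1 1 c1 c2 -> good d rho 1 y1 y2 ->
  Rabs (e1 * (c1 + e1 * y1)) <= 1 -> Rabs (e2 * (c2 + e2 * y2)) <= 1 ->
  good d B L (HtF e1 c1 y1) (HtF e2 c2 y2)).
  (* The constants are left open and found by unification from the shape of [HtF]; absolute values
     plus one make them positive afterwards. *)
  { do 2 eexists. intros d e1 e2 c1 c2 y1 y2 Hd He Hc Hy Z1 Z2.
    pose proof (good_plus _ _ _ _ _ _ _ _ _ Hc (good_mult _ _ _ _ _ _ _ _ _ He Hy)) as Hp.
    pose proof (good_mult _ _ _ _ _ _ _ _ _ He Hp) as Hz.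
    match type of Hz with good _ ?B ?L _ _ =>
      assert (Hn : good d Ln (Ln * L) (n3 (e1 * (c1 + e1 * y1))) (n3 (e2 * (c2 + e2 * y2)))) end.
    { destruct Hz as [_ [_ Hz]]. repeat split; auto. eapply Rle_trans. apply n3l; auto. rewrite Rmult_assoc. apply Rmult_le_compat_l; auto. apply Ln_pos. }
    unfold HtF. apply good_plus; [apply good_plus|].
    apply good_mult. now apply good_const. apply good_mult; eassumption.
    apply good_mult. now apply good_const. apply good_mult. eassumption. apply good_mult; eassumption.
    apply good_mult. eassumption. apply good_mult. eassumption. apply good_mult; eassumption. }
  destruct X as [B [L X]]. exists (Rabs B + 1), (Rabs L + 1).
  pose proof (Rabs_pos B). pose proof (Rabs_pos L). split; [lra|]. split; [lra|]. intros.
  pose proof (Rle_abs B). pose proof (Rle_abs L).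
  destruct (X d e1 e2 c1 c2 y1 y2) as (A1 & A2 & A3); auto. repeat split; try lra. pnra.
Qed.

Variables K K' : (R -> R) -> R -> R.
Hypothesis HK : forall g, cont g -> per g -> K0_spec be w th g (K g) (K' g) /\
  forall M, 0 < M -> (forall t, Rabs (g t) <= M) -> forall t, Rabs (K g t) <= CK be w * M /\ Rabs (K' g t) <= CK' be w * M.

(** At [e = 0] the map [Phi] is the constant function [n0 cos^2], up to a shift; the summand 1
    leaves room for small [e]. *)
Definition R0 := Rabs n0 + 1.
Definition rho := CK be w * R0.
Definition rho' := CK' be w * R0.
Definition ball g := cont g /\ per g /\ forall t, Rabs (g t) <= R0.

Lemma R0_pos : 0 < R0. Proof. unfold R0; pose proof (Rabs_pos n0); lra. Qed.
Lemma CK_pos : 0 < CK be w.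
Proof. unfold CK, CD. pose proof (pow2_ge_0 (2 * be / (w * w))). lra. Qed.
Lemma CK'_pos : 0 < CK' be w.
Proof. unfold CK'. pose proof CK_pos. apply Rdiv_lt_0_compat; pnra. Qed.
Lemma rho_pos : 0 < rho. Proof. apply Rmult_lt_0_compat; [apply CK_pos | apply R0_pos]. Qed.
Lemma rho'_pos : 0 < rho'. Proof. apply Rmult_lt_0_compat; [apply CK'_pos | apply R0_pos]. Qed.

Lemma ball_K g : ball g -> (forall t, is_derive (K g) t (K' g t)) /\ cont (K' g) /\ cont (K g) /\ per (K g) /\
  pA (K g) 1 = 0 /\ pB (K g) 1 = 0 /\ (forall t, Rabs (K g t) <= rho) /\ (forall t, Rabs (K' g t) <= rho').
Proof.
  intros (Hc & Hp & Hb). destruct (HK g Hc Hp) as [[(H1 & H2 & H3 & H4 & H5) _] H6].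
  specialize (H6 R0 R0_pos Hb). repeat (split; auto). exact (is_derive_cont _ _ H1). all: intros t; apply H6.
Qed.
Lemma ball_K_lip g1 g2 delta : ball g1 -> ball g2 -> 0 < delta -> (forall t, Rabs (g1 t - g2 t) <= delta) ->
  forall t, Rabs (K g1 t - K g2 t) <= CK be w * delta /\ Rabs (K' g1 t - K' g2 t) <= CK' be w * delta.
Proof.
  intros (H1 & H2 & _) (H3 & H4 & _) Hd H. eapply K0_lip; eauto.
Qed.

Definition HtS e g s := HtF e (cos s) (K g s).
Definition aF e g := / PI * pA (HtS e g) 1.
Definition bF e g := / PI * pB (HtS e g) 1.
Definition xF e g := - be + e * e * aF e g.
Definition yF e g := - (e * e * bF e g).
Definition nuE e g := nuf (xF e g) (yF e g).
Definition kapE e g := kapf (xF e g) (yF e g).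
Definition HS e g s := n0 * (cos s * cos s) + e * HtS e g s.
(** For [psi = K g] the equation with [nu] and [kap] is rewritten with the critical operator on the
    left. The differences of frequency and shift move to the right-hand side, which then has to
    agree with [g]. *)
Definition Phi e g s := HS e g (s - kapE e g) + (w - nuE e g) * K' g s + be * (K g (s - th) - K g (s - kapE e g)).

Lemma cont_HtS e g : ball g -> cont (HtS e g).
Proof.
  intros Hb. destruct (ball_K g Hb) as (_ & _ & Hc & _). unfold HtS, HtF. ct.
Qed.
Lemma K'_per g : ball g -> per (K' g).
Proof.
  intros Hb. destruct (ball_K g Hb) as (H1 & _ & _ & H2 & _). intros t.
  assert (A : is_derive (fun s => K g (s + tau2)) t (K' g (t + tau2))).
  { eapply is_derive_eq. apply (D_comp (K g) (fun s => s + tau2)). apply H1. apply D_plus. apply D_id. apply D_const. ring. }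
  apply (is_derive_ext _ (K g)) in A; [|intros s; apply H2].
  rewrite <- (is_derive_unique _ _ _ A). apply is_derive_unique, H1.
Qed.
Lemma cos_per2 t : cos (t + tau2) = cos t.
Proof. rewrite cos_plus, cos_2PI, sin_2PI. ring. Qed.
Lemma per_HtS e g : ball g -> per (HtS e g).
Proof.
  intros Hb. destruct (ball_K g Hb) as (_ & _ & _ & Hp & _). intros t. unfold HtS. now rewrite cos_per2, Hp.
Qed.
Lemma cont_Phi e g : ball g -> cont (Phi e g).
Proof.
  intros Hb. destruct (ball_K g Hb) as (_ & H1 & H2 & _). pose proof (cont_HtS e g Hb). unfold Phi, HS. ct.
Qed.
Lemma per_Phi e g : ball g -> per (Phi e g).
Proof.
  intros Hb. destruct (ball_K g Hb) as (_ & _ & _ & Hp & _). pose proof (per_HtS e g Hb) as H1. pose proof (K'_per g Hb) as H2.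
  intros t. unfold Phi, HS.
  replace (t + tau2 - kapE e g) with (t - kapE e g + tau2) by ring.
  replace (t + tau2 - th) with (t - th + tau2) by ring. rewrite H1, !Hp, H2, cos_per2. reflexivity.
Qed.

Lemma div_PI_le x M : Rabs x <= tau2 * M -> Rabs (/ PI * x) <= 2 * M.
Proof.
  pose proof PI_RGT_0. intros H0. rewrite Rabs_mult, (Rabs_pos_eq (/ PI)) by (left; now apply Rinv_0_lt_compat).
  apply Rmult_le_reg_l with PI; auto. rewrite <- Rmult_assoc, Rinv_r, Rmult_1_l by lra. lra.
Qed.

(** Keeps the argument of [n3] in [[-1, 1]], where its bounds are available. *)
Definition small e := 0 <= e <= 1 /\ e * (1 + rho) <= 1.

Lemma abs_cos t : Rabs (cos t) <= 1. Proof. apply Rabs_le, COS_bound. Qed.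
Lemma abs_sin t : Rabs (sin t) <= 1. Proof. apply Rabs_le, SIN_bound. Qed.

Lemma small_arg e c y : small e -> Rabs c <= 1 -> Rabs y <= rho -> Rabs (e * (c + e * y)) <= 1.
Proof.
  intros [He1 He2] Hc Hy. rewrite Rabs_mult, (Rabs_pos_eq e) by lra.
  eapply Rle_trans; [|apply He2]. apply Rmult_le_compat_l. lra. triang.
  rewrite Rabs_mult, (Rabs_pos_eq e) by lra. pose proof (Rabs_pos y). pnra.
Qed.

(** Every dependence on [g] carries a factor [e]: [HtS] is multiplied by [e], the shift difference
    involves [kap - th], and [nu], [kap] see [g] only through [e^2]. Hence [Phi] contracts for small
    [e]; allowing two values of [e] in the same estimate also gives the Lipschitz dependence of the
    fixed point. *)
Lemma Phi_estimates : exists e1 C, 0 < e1 /\ 0 < C /\ (forall e, 0 <= e <= e1 -> small e) /\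
  (forall e g, 0 <= e <= e1 -> ball g -> 1 < xF e g * xF e g + yF e g * yF e g /\ nuE e g * xF e g <= yF e g /\ w / 2 <= nuE e g /\ 0 < kapE e g < PI) /\
  forall ea eb ga gb delta, 0 <= ea <= e1 -> 0 <= eb <= e1 -> ball ga -> ball gb -> 0 < delta ->
  (forall t, Rabs (ga t - gb t) <= delta) ->
  Rabs (aF ea ga) <= C /\ Rabs (bF ea ga) <= C /\
  Rabs (aF ea ga - aF eb gb) <= C * (Rabs (ea - eb) + delta) /\
  Rabs (bF ea ga - bF eb gb) <= C * (Rabs (ea - eb) + delta) /\
  Rabs (nuE ea ga - nuE eb gb) <= C * ((ea + eb) * (Rabs (ea - eb) + delta)) /\
  Rabs (kapE ea ga - kapE eb gb) <= C * ((ea + eb) * (Rabs (ea - eb) + delta)) /\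
  forall t, Rabs (Phi ea ga t - Phi eb gb t) <= C * ((ea + eb) * delta + 2 * Rabs (ea - eb)).
Proof.
  destruct (HtF_good rho (Rlt_le _ _ rho_pos)) as [B [L [HB [HL HG]]]].
  destruct (nk_near be w th be1 w0 w2 th0 costh sinth) as [r [LN [Hr [HLN [HN1 HN2]]]]].
  pose proof rho_pos as Hrho. pose proof rho'_pos as Hrho'. pose proof CK_pos as HCK. pose proof CK'_pos as HCK'.
  pose proof PI_RGT_0 as HPI.
  (* The first bound is [small], the second keeps [(xF, yF)] in the neighbourhood of [(- be, 0)]
     provided by [nk_near]. *)
  set (e1 := Rmin (/ (1 + rho)) (r / (2 * B))).
  assert (He1 : 0 < e1). { apply Rmin_pos. apply Rinv_0_lt_compat; lra. apply Rdiv_lt_0_compat; lra. }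
  assert (He1a : e1 <= / (1 + rho)) by apply Rmin_l.
  assert (He1b : e1 <= r / (2 * B)) by apply Rmin_r.
  assert (Hsm : forall e, 0 <= e <= e1 -> small e).
  { intros e He. assert (e * (1 + rho) <= 1).
    { apply Rle_trans with (/ (1 + rho) * (1 + rho)). pnra. rewrite Rinv_l; lra. }
    split; auto. pnra. }
  assert (Hgood : forall ea eb ga gb delta k1 k2 dk, 0 <= ea <= e1 -> 0 <= eb <= e1 -> ball ga -> ball gb -> 0 < delta ->
     (forall t, Rabs (ga t - gb t) <= delta) -> Rabs (k1 - k2) <= dk -> forall s,
     good (Rabs (ea - eb) + (dk + (CK be w * delta + rho' * dk))) B L (HtS ea ga (s - k1)) (HtS eb gb (s - k2))).
  { intros ea eb ga gb delta k1 k2 dk Ha Hb Ga Gb Hd Hdel Hk s.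
    destruct (ball_K ga Ga) as (D1 & _ & _ & _ & _ & _ & R1 & R1'). destruct (ball_K gb Gb) as (_ & _ & _ & _ & _ & _ & R2 & _).
    pose proof (Rabs_pos (ea - eb)). pose proof (Rabs_pos (k1 - k2)).
    assert (Hs12 : Rabs (s - k1 - (s - k2)) <= dk). { replace (s - k1 - (s - k2)) with (- (k1 - k2)) by ring. now rewrite Rabs_Ropp. }
    assert (0 <= CK be w * delta) by pnra. assert (0 <= rho' * dk) by pnra.
    assert (Ea := Hsm ea Ha). assert (Eb := Hsm eb Hb).
    unfold HtS. apply HG; try (apply small_arg; auto using abs_cos). lra.
    - destruct Ea as [Ea _]. destruct Eb as [Eb _]. repeat split; try (rewrite Rabs_pos_eq; lra). lra.
    - repeat split; try apply abs_cos. pose proof (cos_lip (s - k1) (s - k2)). lra.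
    - repeat split; auto. replace (K ga (s - k1) - K gb (s - k2)) with ((K ga (s - k1) - K ga (s - k2)) + (K ga (s - k2) - K gb (s - k2))) by ring.
      pose proof (Rabs_triang (K ga (s - k1) - K ga (s - k2)) (K ga (s - k2) - K gb (s - k2))).
      pose proof (lip_of_deriv _ _ _ D1 R1' (s - k1) (s - k2)).
      destruct (ball_K_lip ga gb delta Ga Gb Hd Hdel (s - k2)) as [X _].
      assert (rho' * Rabs (s - k1 - (s - k2)) <= rho' * dk) by (apply Rmult_le_compat_l; lra). lra. }
  assert (HtB : forall e g, 0 <= e <= e1 -> ball g -> forall s, Rabs (HtS e g s) <= B).
  { intros e g He Hg s. destruct (Hgood e e g g 1 0 0 0 He He Hg Hg ltac:(lra)) with (s := s) as [X _].
    intros t. rewrite Rminus_diag, Rabs_R0; lra. rewrite Rminus_diag, Rabs_R0; lra. now rewrite Rminus_0_r in X. }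
  assert (Hab : forall e g, 0 <= e <= e1 -> ball g -> Rabs (aF e g) <= 2 * B /\ Rabs (bF e g) <= 2 * B).
  { intros e g He Hg. destruct (coef_bound (HtS e g) B 1 (cont_HtS e g Hg) (HtB e g He Hg)) as [X1 X2].
    split; apply div_PI_le; auto. }
  assert (Hab2 : forall ea eb ga gb delta, 0 <= ea <= e1 -> 0 <= eb <= e1 -> ball ga -> ball gb -> 0 < delta ->
     (forall t, Rabs (ga t - gb t) <= delta) ->
     Rabs (aF ea ga - aF eb gb) <= 2 * (L * (Rabs (ea - eb) + CK be w * delta)) /\
     Rabs (bF ea ga - bF eb gb) <= 2 * (L * (Rabs (ea - eb) + CK be w * delta))).
  { intros ea eb ga gb delta Ha Hb Ga Gb Hd Hdel.
    assert (HD : forall s, Rabs (HtS ea ga s + -1 * HtS eb gb s) <= L * (Rabs (ea - eb) + CK be w * delta)).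
    { intros s. destruct (Hgood ea eb ga gb delta 0 0 0 Ha Hb Ga Gb Hd Hdel) with (s := s) as (_ & _ & X).
      rewrite Rminus_diag, Rabs_R0; lra. rewrite Rminus_0_r in X. replace (HtS ea ga s + -1 * HtS eb gb s) with (HtS ea ga s - HtS eb gb s) by ring.
      eapply Rle_trans. apply X. right; ring. }
    assert (C1 := cont_HtS ea ga Ga). assert (C2 := cont_HtS eb gb Gb).
    destruct (coef_bound (fun s => HtS ea ga s + -1 * HtS eb gb s) _ 1 ltac:(ct) HD) as [X1 X2].
    rewrite fA_lin in X1 by auto. rewrite fB_lin in X2 by auto.
    unfold aF, bF. rewrite <- !Rmult_minus_distr_l. split; apply div_PI_le.
    replace (pA (HtS ea ga) 1 - pA (HtS eb gb) 1) with (pA (HtS ea ga) 1 + -1 * pA (HtS eb gb) 1) by ring. auto.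
    replace (pB (HtS ea ga) 1 - pB (HtS eb gb) 1) with (pB (HtS ea ga) 1 + -1 * pB (HtS eb gb) 1) by ring. auto. }
  assert (Hxy : forall e g, 0 <= e <= e1 -> ball g -> Rabs (xF e g + be) <= e * (2 * B) /\ Rabs (yF e g) <= e * (2 * B)).
  { intros e g He Hg. destruct (Hab e g He Hg) as [X1 X2]. destruct (Hsm e He) as [He' _]. unfold xF, yF.
    replace (- be + e * e * aF e g + be) with (e * e * aF e g) by ring. rewrite Rabs_Ropp, !Rabs_mult, (Rabs_pos_eq e) by lra.
    pose proof (Rabs_pos (aF e g)). pose proof (Rabs_pos (bF e g)).
    rewrite !Rmult_assoc. split; apply Rmult_le_compat_l; pnra. }
  assert (Hxyr : forall e g, 0 <= e <= e1 -> ball g -> Rabs (xF e g + be) <= r /\ Rabs (yF e g) <= r).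
  { intros e g He Hg. destruct (Hxy e g He Hg). assert (e * (2 * B) <= r).
    { apply Rle_trans with (r / (2 * B) * (2 * B)). pnra. right; field; lra. } lra. }
  set (CW := 4 * B + 2 * L * (1 + CK be w)).
  assert (HCW : 0 < CW) by (unfold CW; pnra).
  set (N := LN * (2 * CW)). assert (HN : 0 < N) by (unfold N; pnra).
  set (N' := LN * (4 * B)). assert (HN' : 0 < N') by (unfold N'; pnra).
  assert (Hnk : forall ea eb ga gb delta, 0 <= ea <= e1 -> 0 <= eb <= e1 -> ball ga -> ball gb -> 0 < delta ->
     (forall t, Rabs (ga t - gb t) <= delta) ->
     Rabs (nuE ea ga - nuE eb gb) <= N * ((ea + eb) * (Rabs (ea - eb) + delta)) /\
     Rabs (kapE ea ga - kapE eb gb) <= N * ((ea + eb) * (Rabs (ea - eb) + delta))).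
  { intros ea eb ga gb delta Ha Hb Ga Gb Hd Hdel.
    destruct (Hab ea ga Ha Ga) as [A1 A2]. destruct (Hab2 ea eb ga gb delta Ha Hb Ga Gb Hd Hdel) as [A3 A4].
    destruct (Hsm ea Ha) as [Ea _]. destruct (Hsm eb Hb) as [Eb _].
    pose proof (Rabs_pos (ea - eb)) as P0. set (D := Rabs (ea - eb)) in *.
    (* [ea^2 u - eb^2 v] splits into [(ea + eb) (ea - eb) u] and [eb^2 (u - v)]; both contain the
       factor [ea + eb]. *)
    assert (HX : forall u v, Rabs u <= 2 * B -> Rabs (u - v) <= 2 * (L * (D + CK be w * delta)) ->
       Rabs (ea * ea * u - eb * eb * v) <= CW * ((ea + eb) * (D + delta))).
    { intros u v U1 U2. replace (ea * ea * u - eb * eb * v) with ((ea + eb) * (ea - eb) * u + eb * eb * (u - v)) by ring.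
      triang. rewrite !Rabs_mult, (Rabs_pos_eq (ea + eb)), (Rabs_pos_eq eb) by lra. fold D.
      assert (Q1 : (ea + eb) * D * Rabs u <= (ea + eb) * (D * (2 * B))) by (rewrite Rmult_assoc; apply Rmult_le_compat_l; [lra|]; apply Rmult_le_compat_l; lra).
      assert (Q2 : eb * eb * Rabs (u - v) <= (ea + eb) * (2 * (L * (D + CK be w * delta)))).
      { apply Rmult_le_compat; auto using Rabs_pos; pnra. }
      apply Rle_trans with ((ea + eb) * (D * (2 * B) + 2 * (L * (D + CK be w * delta)))). lra.
      replace (CW * ((ea + eb) * (D + delta))) with ((ea + eb) * (CW * (D + delta))) by ring. apply Rmult_le_compat_l. lra.
      unfold CW. assert (0 <= L * D) by pnra. assert (0 <= L * CK be w * D) by (apply Rmult_le_pos; pnra). assert (0 <= L * delta) by pnra. assert (0 <= B * delta) by pnra. pnra. }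
    pose proof (HX (aF ea ga) (aF eb gb) A1 A3) as X1. pose proof (HX (bF ea ga) (bF eb gb) A2 A4) as X2.
    destruct (Hxyr ea ga Ha Ga) as [r1 r2]. destruct (Hxyr eb gb Hb Gb) as [r3 r4].
    destruct (HN2 _ _ _ _ r1 r2 r3 r4) as [Y1 Y2].
    assert (Y : LN * (Rabs (xF ea ga - xF eb gb) + Rabs (yF ea ga - yF eb gb)) <= N * ((ea + eb) * (D + delta))).
    { unfold N. rewrite (Rmult_assoc LN). apply Rmult_le_compat_l. lra. unfold xF, yF.
      replace (- be + ea * ea * aF ea ga - (- be + eb * eb * aF eb gb)) with (ea * ea * aF ea ga - eb * eb * aF eb gb) by ring.
      replace (- (ea * ea * bF ea ga) - - (eb * eb * bF eb gb)) with (- (ea * ea * bF ea ga - eb * eb * bF eb gb)) by ring. rewrite Rabs_Ropp. lra. }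
    unfold nuE, kapE. lra. }
  assert (Hnk0 : forall e g, 0 <= e <= e1 -> ball g -> Rabs (nuE e g - w) <= N' * e /\ Rabs (kapE e g - th) <= N' * e).
  { intros e g He Hg. destruct (Hxyr e g He Hg) as [r1 r2]. destruct (Hxy e g He Hg) as [X1 X2].
    destruct (HN2 (xF e g) (yF e g) (- be) 0 r1 r2) as [Y1 Y2]. rewrite Rplus_opp_l, Rabs_R0; lra. rewrite Rabs_R0; lra.
    rewrite (nuf0 be w) in Y1 by auto. rewrite (kapf0 be th) in Y2 by auto. replace (xF e g - - be) with (xF e g + be) in * by ring. rewrite Rminus_0_r in *.
    assert (LN * (Rabs (xF e g + be) + Rabs (yF e g)) <= N' * e).
    { unfold N'. rewrite Rmult_assoc. apply Rmult_le_compat_l. lra. lra. }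
    unfold nuE, kapE. lra. }
  set (C := (2 * Rabs n0 * N + B + L * (1 + N + CK be w + rho' * N) + N * rho' + N' * CK' be w + be * (rho' * N + CK' be w * N')) + 2 * B + 2 * L * (1 + CK be w) + N).
  pose proof (Rabs_pos n0) as Hn0.
  assert (P1 : 0 <= Rabs n0 * N) by pnra. assert (P2 : 0 <= L * N) by pnra. assert (P3 : 0 <= L * CK be w) by pnra.
  assert (P4 : 0 <= rho' * N) by pnra. assert (P5 : 0 <= L * (rho' * N)) by pnra. assert (P6 : 0 <= N' * CK' be w) by pnra.
  assert (P7 : 0 <= be * (rho' * N + CK' be w * N')) by pnra.
  exists e1, C. split; auto. split. unfold C; pnra. split; auto. split.
  { intros e g He Hg. destruct (Hxyr e g He Hg) as [r1 r2]. apply (HN1 _ _ r1 r2). }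
  intros ea eb ga gb delta Ha Hb Ga Gb Hd Hdel.
  destruct (Hab ea ga Ha Ga) as [A1 A2]. destruct (Hab2 ea eb ga gb delta Ha Hb Ga Gb Hd Hdel) as [A3 A4].
  destruct (Hnk ea eb ga gb delta Ha Hb Ga Gb Hd Hdel) as [A5 A6].
  destruct (Hsm ea Ha) as [Ea _]. destruct (Hsm eb Hb) as [Eb _].
  pose proof (Rabs_pos (ea - eb)) as P0. set (D := Rabs (ea - eb)) in *.
  assert (HNC : N <= C) by (unfold C; lra).
  assert (HSD : 0 <= (ea + eb) * (D + delta)) by (apply Rmult_le_pos; lra).
  assert (HLC : 2 * (L * (D + CK be w * delta)) <= C * (D + delta)).
  { apply Rle_trans with (2 * L * (1 + CK be w) * (D + delta)). assert (0 <= L * delta) by pnra. assert (0 <= L * CK be w * D) by pnra. pnra.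
    apply Rmult_le_compat_r. lra. unfold C; lra. }
  assert (HNC2 : N * ((ea + eb) * (D + delta)) <= C * ((ea + eb) * (D + delta))) by (apply Rmult_le_compat_r; auto).
  assert (HBC : 2 * B <= C) by (unfold C; lra).
  repeat split; try lra.
  intros s. set (q := (ea + eb) * delta + 2 * D).
  assert (Q0 : 0 <= q) by (unfold q; pnra).
  assert (Qk : (ea + eb) * (D + delta) <= q) by (unfold q; pnra).
  assert (Qe : eb * delta <= q) by (unfold q; pnra). assert (QD : D <= q) by (unfold q; pnra).
  set (k1 := kapE ea ga) in *. set (k2 := kapE eb gb) in *.
  assert (Kd : Rabs (k1 - k2) <= N * q) by pnra. assert (Nd : Rabs (nuE ea ga - nuE eb gb) <= N * q) by pnra.
  destruct (Hnk0 eb gb Hb Gb) as [Nw Nt]. fold k2 in Nt.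
  destruct (ball_K ga Ga) as (D1 & _ & _ & _ & _ & _ & R1 & R1'). destruct (ball_K gb Gb) as (D2 & _ & _ & _ & _ & _ & R2 & R2').
  pose proof (ball_K_lip ga gb delta Ga Gb Hd Hdel) as KL.
  assert (T1 : Rabs (n0 * (cos (s - k1) * cos (s - k1)) - n0 * (cos (s - k2) * cos (s - k2))) <= 2 * Rabs n0 * N * q).
  { replace (n0 * (cos (s - k1) * cos (s - k1)) - n0 * (cos (s - k2) * cos (s - k2))) with (n0 * ((cos (s - k1) - cos (s - k2)) * (cos (s - k1) + cos (s - k2)))) by ring.
    rewrite !Rabs_mult. pose proof (cos_lip (s - k1) (s - k2)) as X. replace (s - k1 - (s - k2)) with (- (k1 - k2)) in X by ring. rewrite Rabs_Ropp in X.
    pose proof (Rabs_triang (cos (s - k1)) (cos (s - k2))). pose proof (abs_cos (s - k1)). pose proof (abs_cos (s - k2)).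
    replace (2 * Rabs n0 * N * q) with (Rabs n0 * (N * q * 2)) by ring. apply Rmult_le_compat_l; auto.
    apply Rmult_le_compat; auto using Rabs_pos; lra. }
  assert (T2 : Rabs (ea * HtS ea ga (s - k1) - eb * HtS eb gb (s - k2)) <= (B + L * (1 + N + CK be w + rho' * N)) * q).
  { replace (ea * HtS ea ga (s - k1) - eb * HtS eb gb (s - k2)) with ((ea - eb) * HtS ea ga (s - k1) + eb * (HtS ea ga (s - k1) - HtS eb gb (s - k2))) by ring.
    triang. rewrite !Rabs_mult, (Rabs_pos_eq eb) by lra. fold D.
    destruct (Hgood ea eb ga gb delta k1 k2 (N * q) Ha Hb Ga Gb Hd Hdel Kd s) as (X1 & _ & X3). fold D in X3.
    assert (Y1 : D * Rabs (HtS ea ga (s - k1)) <= q * B) by (apply Rmult_le_compat; auto using Rabs_pos).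
    assert (Y2 : eb * Rabs (HtS ea ga (s - k1) - HtS eb gb (s - k2)) <= L * ((1 + N + CK be w + rho' * N) * q)).
    { apply Rle_trans with (eb * (L * (D + (N * q + (CK be w * delta + rho' * (N * q)))))). apply Rmult_le_compat_l; lra.
      rewrite <- (Rmult_assoc eb), (Rmult_comm eb), Rmult_assoc. apply Rmult_le_compat_l. lra.
      assert (Z0 : 0 <= N * q) by (apply Rmult_le_pos; lra). pose proof (mul_le1 eb _ Eb Z0) as Z1. pose proof (mul_le1 eb _ Eb P0) as Z2.
      assert (Z3 : CK be w * (eb * delta) <= CK be w * q) by (apply Rmult_le_compat_l; lra).
      assert (Z4 : rho' * (eb * (N * q)) <= rho' * (N * q)) by (apply Rmult_le_compat_l; lra). lra. }
    lra. }
  assert (T3 : Rabs ((w - nuE ea ga) * K' ga s - (w - nuE eb gb) * K' gb s) <= (N * rho' + N' * CK' be w) * q).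
  { replace ((w - nuE ea ga) * K' ga s - (w - nuE eb gb) * K' gb s) with (- (nuE ea ga - nuE eb gb) * K' ga s + - (nuE eb gb - w) * (K' ga s - K' gb s)) by ring.
    triang. rewrite !Rabs_mult, !Rabs_Ropp.
    assert (Rabs (nuE ea ga - nuE eb gb) * Rabs (K' ga s) <= N * q * rho') by (apply Rmult_le_compat; auto using Rabs_pos).
    assert (Rabs (nuE eb gb - w) * Rabs (K' ga s - K' gb s) <= N' * eb * (CK' be w * delta)). { apply Rmult_le_compat; auto using Rabs_pos. apply KL. }
    assert (N' * CK' be w * (eb * delta) <= N' * CK' be w * q) by (apply Rmult_le_compat_l; auto). lra. }
  (* The difference in [g] is evaluated at two points at distance [|k2 - th| = O(eb)]; its
     derivative is at most [CK' * delta], which produces [eb * delta]. *)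
  assert (T4 : Rabs ((K ga (s - th) - K ga (s - k1)) - (K gb (s - th) - K gb (s - k2))) <= (rho' * N + CK' be w * N') * q).
  { replace ((K ga (s - th) - K ga (s - k1)) - (K gb (s - th) - K gb (s - k2))) with
     ((K ga (s - k2) - K ga (s - k1)) + ((K ga (s - th) - K gb (s - th)) - (K ga (s - k2) - K gb (s - k2)))) by ring.
    triang.
    assert (Z1 := lip_of_deriv _ _ _ D1 R1' (s - k2) (s - k1)). replace (s - k2 - (s - k1)) with (k1 - k2) in Z1 by ring.
    assert (Z2 := lip_of_deriv (fun t => K ga t - K gb t) (fun t => K' ga t - K' gb t) (CK' be w * delta)
      (fun t => D_minus _ _ _ _ _ (D1 t) (D2 t)) (fun t => proj2 (KL t)) (s - th) (s - k2)).
    replace (s - th - (s - k2)) with (k2 - th) in Z2 by ring.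
    assert (rho' * Rabs (k1 - k2) <= rho' * (N * q)) by (apply Rmult_le_compat_l; lra).
    assert (CK' be w * delta * Rabs (k2 - th) <= CK' be w * N' * q).
    { apply Rle_trans with (CK' be w * delta * (N' * eb)). apply Rmult_le_compat_l; [apply Rmult_le_pos; lra | lra].
      replace (CK' be w * delta * (N' * eb)) with (CK' be w * N' * (eb * delta)) by ring. apply Rmult_le_compat_l; [apply Rmult_le_pos; lra | lra]. }
    lra. }
  set (G1 := K ga (s - th) - K ga (s - k1)) in *. set (G2 := K gb (s - th) - K gb (s - k2)) in *.
  assert (T5 : Rabs (be * (G1 - G2)) <= be * ((rho' * N + CK' be w * N') * q)) by (rewrite Rabs_mult, (Rabs_pos_eq be) by lra; apply Rmult_le_compat_l; lra).
  unfold Phi, HS. fold k1 k2. fold G1 G2.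
  match goal with |- Rabs ?u <= _ => replace u with ((n0 * (cos (s - k1) * cos (s - k1)) - n0 * (cos (s - k2) * cos (s - k2))) + (ea * HtS ea ga (s - k1) - eb * HtS eb gb (s - k2)) +
    ((w - nuE ea ga) * K' ga s - (w - nuE eb gb) * K' gb s) + be * (G1 - G2)) by ring end.
  triang. eapply Rle_trans. apply Rplus_le_compat_r, Rabs_triang.
  eapply Rle_trans. apply Rplus_le_compat_r, Rplus_le_compat_r, Rabs_triang.
  assert (C * q = (2 * Rabs n0 * N) * q + (B + L * (1 + N + CK be w + rho' * N)) * q + (N * rho' + N' * CK' be w) * q + be * ((rho' * N + CK' be w * N') * q) + (2 * B + 2 * L * (1 + CK be w) + N) * q) by (unfold C; ring).
  assert (0 <= (2 * B + 2 * L * (1 + CK be w) + N) * q) by (apply Rmult_le_pos; lra). lra.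
Qed.

(** [Phi] with free frequency and shift, for a periodic solution whose [nu] and [kap] are not yet
    known to be [nuE] and [kapE]. *)
Definition PhiG e g nu kap s := HS e g (s - kap) + (w - nu) * K' g s + be * (K g (s - th) - K g (s - kap)).

(** A square contains only the harmonics 0 and 2; therefore the bifurcation equation starts at order
    [e^2]. *)
Lemma cos_sq_harm : pA (fun s => cos s * cos s) 1 = 0 /\ pB (fun s => cos s * cos s) 1 = 0.
Proof.
  assert (E : forall s, cos s * cos s = / 2 * (ck 1 0 s + ck 1 2 s)).
  { intros s. rewrite !ck1. simpl. rewrite Rmult_0_l, cos_0. replace ((1 + 1) * s) with (2 * s) by ring. rewrite cos_2a_cos. field. }
  split.
  - unfold fA. rewrite (RI_ext _ (fun s => / 2 * (ck 1 0 s * ck 1 1 s) + / 2 * (ck 1 2 s * ck 1 1 s))).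
    rewrite RI_plus, !RI_scal by (ct; auto using cont_ck). rewrite !(int_ckck tau2 1 tau2_pos nu1) by lia. ring.
    intros s. rewrite E. ring.
  - unfold fB. rewrite (RI_ext _ (fun s => / 2 * (ck 1 0 s * sk 1 1 s) + / 2 * (ck 1 2 s * sk 1 1 s))).
    rewrite RI_plus, !RI_scal by (ct; auto using cont_ck, cont_sk). rewrite !(int_cksk tau2 1 tau2_pos nu1). ring.
    intros s. rewrite E. ring.
Qed.

Lemma cont_HS e g : ball g -> cont (HS e g).
Proof. intros Hb. pose proof (cont_HtS e g Hb). unfold HS. ct. Qed.
Lemma per_HS e g : ball g -> per (HS e g).
Proof. intros Hb t. unfold HS. now rewrite cos_per2, (per_HtS e g Hb). Qed.
Lemma HS_harm e g : ball g -> pA (HS e g) 1 = PI * (e * aF e g) /\ pB (HS e g) 1 = PI * (e * bF e g).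
Proof.
  intros Hb. pose proof (cont_HtS e g Hb) as C. pose proof PI_RGT_0. destruct cos_sq_harm as [E1 E2].
  assert (C2 : cont (fun s => cos s * cos s)) by ct.
  assert (X : HS e g = fun s => (0 + n0 * (cos s * cos s)) + e * HtS e g s).
  { apply functional_extensionality; intros s. unfold HS; ring. }
  assert (C0 : cont (fun s => 0 + n0 * (cos s * cos s))) by ct.
  assert (Z : pA (fun _ => 0) 1 = 0 /\ pB (fun _ => 0) 1 = 0).
  { split; unfold fA, fB; rewrite (RI_ext _ (fun _ => 0)) by (intros; ring); rewrite RI_const; ring. }
  destruct Z as [Z1 Z2].
  rewrite X. rewrite fA_lin, fB_lin by auto.
  rewrite (fA_lin tau2 1 (fun _ => 0)), (fB_lin tau2 1 (fun _ => 0)) by (auto; apply cont_const).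
  rewrite E1, E2, Z1, Z2. unfold aF, bF. split; field; lra.
Qed.

(** [K g], its shifts and its derivative have no first harmonic, so only the nonlinear term
    contributes. *)
Lemma PhiG_harm e g nu kap : ball g -> forall s,
  P1 (PhiG e g nu kap) s = e * (aF e g * cos (s - kap) + bF e g * sin (s - kap)).
Proof.
  intros Hb s. destruct (ball_K g Hb) as (Dg & Cg' & Cg & Pg & A0 & B0 & _). pose proof PI_RGT_0.
  pose proof (cont_HS e g Hb) as CH. pose proof (per_HS e g Hb) as PH. destruct (HS_harm e g Hb) as [EA EB].
  destruct (coef_shift (HS e g) kap 1 CH PH) as [S1 S2].
  destruct (coef_shift (K g) kap 1 Cg Pg) as [S3 S4]. destruct (coef_shift (K g) th 1 Cg Pg) as [S5 S6].
  rewrite A0, B0 in S3, S4, S5, S6. rewrite EA, EB in S1, S2.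
  assert (H0 : K g 0 = K g tau2) by (rewrite <- (Pg 0); f_equal; ring).
  destruct (coef_deriv tau2 1 nu1 (K g) (K' g) Dg Cg' H0 1) as [S7 S8]. rewrite A0 in S8. rewrite B0 in S7.
  assert (X : PhiG e g nu kap = fun s => ((HS e g (s - kap) + (w - nu) * K' g s) + be * K g (s - th)) + (- be) * K g (s - kap)).
  { apply functional_extensionality; intros t. unfold PhiG; ring. }
  unfold P1. rewrite X. rewrite !fA_lin, !fB_lin by ct. rewrite S1, S2, S3, S4, S5, S6, S7, S8.
  change (INR 1) with 1. rewrite ?Rmult_1_l. rewrite cos_minus, sin_minus. field. lra.
Qed.

Definition vE e g s := e * cos s + e * e * K g s.
Definition vE' e g s := - e * sin s + e * e * K' g s.

Lemma fN_vE e g s : fN (vE e g s) = - be * vE e g s + e * e * HS e g s.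
Proof.
  unfold fN, vE, HS, HtS, HtF. replace (e * cos s + e * e * K g s) with (e * (cos s + e * K g s)) by ring. ring.
Qed.

(* The harmonic balance: the first harmonic of the equation is the bifurcation equation
   [(1 + i nu) e^(i kap) = - be + e^2 (a - i b)], the complement is the fixed point equation. *)
Lemma vE_solves e g nu kap : ball g -> (forall s, PhiG e g nu kap s = g s) ->
  cos kap - nu * sin kap = xF e g -> sin kap + nu * cos kap = yF e g ->
  forall s, nu * vE' e g s + vE e g s = fN (vE e g (s - kap)).
Proof.
  intros Hb Hfix Hx Hy s. destruct Hb as (Cg & Pg & Bg) eqn:E0. destruct (HK g Cg Pg) as [[_ HL] _]. specialize (HL s).
  assert (X : PhiG e g nu kap = g) by (apply functional_extensionality; auto).
  pose proof (PhiG_harm e g nu kap Hb s) as HP. rewrite X in HP. rewrite HP in HL. rewrite <- (Hfix s) in HL. unfold PhiG, L0 in HL.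
  rewrite fN_vE. unfold vE, vE'.
  assert (Es : sin s = sin (s - kap) * cos kap + cos (s - kap) * sin kap).
  { rewrite <- sin_plus. f_equal; ring. }
  assert (Ec : cos s = cos (s - kap) * cos kap - sin (s - kap) * sin kap).
  { rewrite <- cos_plus. f_equal; ring. }
  rewrite Es, Ec. unfold xF, yF in *.
  set (c := cos (s - kap)) in *. set (n := sin (s - kap)) in *.
  assert (Q : e * (c * (cos kap - nu * sin kap) - n * (sin kap + nu * cos kap) + be * c) = e * e * (e * (aF e g * c + bF e g * n))).
  { rewrite Hx, Hy. ring. }
  assert (HL' : nu * K' g s + K g s + be * K g (s - kap) = HS e g (s - kap) - e * (aF e g * c + bF e g * n)) by lra.
  assert (HL2 : e * e * (nu * K' g s + K g s + be * K g (s - kap)) = e * e * (HS e g (s - kap) - e * (aF e g * c + bF e g * n))) by (rewrite HL'; reflexivity).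
  lra.
Qed.

(** * Fixed points of the contraction *)

Section Fixed.
Variables e1 C : R.
Hypothesis e1p : 0 < e1.
Hypothesis Cp : 0 < C.
Hypothesis Hsmall : forall e, 0 <= e <= e1 -> small e.
Hypothesis Hest : forall ea eb ga gb delta, 0 <= ea <= e1 -> 0 <= eb <= e1 -> ball ga -> ball gb -> 0 < delta ->
  (forall t, Rabs (ga t - gb t) <= delta) ->
  forall t, Rabs (Phi ea ga t - Phi eb gb t) <= C * ((ea + eb) * delta + 2 * Rabs (ea - eb)).
(** Makes the contraction factor [C (ea + eb)] at most one half. *)
Definition e2 := Rmin e1 (/ (4 * C)).

Lemma e2_pos : 0 < e2.
Proof. apply Rmin_pos; auto. apply Rinv_0_lt_compat; lra. Qed.
Lemma e2_e1 e : 0 <= e <= e2 -> 0 <= e <= e1.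
Proof. intros H. assert (e2 <= e1) by apply Rmin_l. lra. Qed.
Lemma e2_C e : 0 <= e <= e2 -> C * e <= / 4.
Proof.
  intros H. assert (e2 <= / (4 * C)) by apply Rmin_r. apply Rle_trans with (C * / (4 * C)). apply Rmult_le_compat_l; lra. right; field; lra.
Qed.

Lemma Phi_step ea eb ga gb delta : 0 <= ea <= e2 -> 0 <= eb <= e2 -> ball ga -> ball gb -> 0 < delta ->
  (forall t, Rabs (ga t - gb t) <= delta) -> forall t, Rabs (Phi ea ga t - Phi eb gb t) <= delta / 2 + 2 * C * Rabs (ea - eb).
Proof.
  intros Ha Hb Ga Gb Hd H t. eapply Rle_trans. apply (Hest ea eb ga gb delta); auto using e2_e1.
  pose proof (e2_C ea Ha). pose proof (e2_C eb Hb).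
  replace (C * ((ea + eb) * delta + 2 * Rabs (ea - eb))) with ((C * ea + C * eb) * delta + 2 * C * Rabs (ea - eb)) by ring.
  apply Rplus_le_compat_r. apply Rle_trans with ((/ 4 + / 4) * delta). apply Rmult_le_compat_r; lra. lra.
Qed.

Lemma xF_0 g : xF 0 g = - be. Proof. unfold xF; ring. Qed.
Lemma yF_0 g : yF 0 g = 0. Proof. unfold yF; ring. Qed.
Lemma nuE_0 g : nuE 0 g = w.
Proof. unfold nuE. rewrite xF_0, yF_0. now apply nuf0. Qed.
Lemma kapE_0 g : kapE 0 g = th.
Proof. unfold kapE. rewrite xF_0, yF_0. now apply (kapf0 be th). Qed.

(** Comparison with [e = 0], where the value is bounded by [|n0|]; the difference is at most
    [3 C e <= 3 / 4], taking [delta = 1] for two equal functions. *)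
Lemma ball_Phi e g : 0 <= e <= e2 -> ball g -> ball (Phi e g).
Proof.
  intros He Hb. split. now apply cont_Phi. split. now apply per_Phi. intros t.
  pose proof e2_pos as Hp.
  assert (H0 : 0 <= 0 <= e1) by lra.
  pose proof (Hest e 0 g g 1 (e2_e1 e He) H0 Hb Hb ltac:(lra)) as X.
  assert (Z : forall t, Rabs (g t - g t) <= 1) by (intros s; rewrite Rminus_diag, Rabs_R0; lra).
  specialize (X Z t). rewrite Rminus_0_r, (Rabs_pos_eq e) in X by lra. pose proof (e2_C e He).
  assert (Y : Rabs (Phi 0 g t) <= Rabs n0).
  { unfold Phi, HS. rewrite kapE_0, nuE_0.
    replace (n0 * (cos (t - th) * cos (t - th)) + 0 * HtS 0 g (t - th) + (w - w) * K' g t + be * (K g (t - th) - K g (t - th))) with (n0 * (cos (t - th) * cos (t - th))) by ring.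
    rewrite !Rabs_mult. pose proof (abs_cos (t - th)). pose proof (Rabs_pos (cos (t - th))). pose proof (Rabs_pos n0).
    rewrite <- (Rmult_1_r (Rabs n0)) at 2. apply Rmult_le_compat_l; auto. pnra. }
  replace (Phi e g t) with ((Phi e g t - Phi 0 g t) + Phi 0 g t) by ring.
  triang. unfold R0. lra.
Qed.

Lemma half_pow_small M eps : 0 < M -> 0 < eps -> exists n, M * (/ 2) ^ n <= eps.
Proof.
  intros HM He. destruct (pow_lt_1_zero (/ 2)) with (y := eps / M) as [N HN].
  rewrite Rabs_pos_eq; lra. now apply Rdiv_lt_0_compat. exists N. specialize (HN N (le_n _)).
  pose proof (Rle_abs ((/ 2) ^ N)). apply Rle_trans with (M * (eps / M)). apply Rmult_le_compat_l; lra. right; field; lra.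
Qed.

(** No supremum is formed: the trivial bound [2 R0] is passed repeatedly through [Phi_step], and
    [4 C |ea - eb|] is the fixed point of the recursion [b -> b / 2 + 2 C |ea - eb|]. *)
Lemma fixed_lip ea eb ga gb : 0 <= ea <= e2 -> 0 <= eb <= e2 -> ball ga -> ball gb ->
  (forall t, Phi ea ga t = ga t) -> (forall t, Phi eb gb t = gb t) ->
  forall t, Rabs (ga t - gb t) <= 4 * C * Rabs (ea - eb).
Proof.
  intros Ha Hb Ga Gb Fa Fb. pose proof R0_pos as HR. pose proof (Rabs_pos (ea - eb)) as HD.
  assert (H : forall n t, Rabs (ga t - gb t) <= 2 * R0 * (/ 2) ^ n + 4 * C * Rabs (ea - eb)).
  { induction n; intros t.
    - destruct Ga as (_ & _ & Ga). destruct Gb as (_ & _ & Gb). specialize (Ga t). specialize (Gb t).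
      simpl. assert (0 <= 4 * C * Rabs (ea - eb)) by pnra. unabs Ga. unabs Gb. apply Rabs_le; lra.
    - assert (Hd : 0 < 2 * R0 * (/ 2) ^ n + 4 * C * Rabs (ea - eb)).
      { assert (0 < (/ 2) ^ n) by (apply pow_lt; lra). assert (0 < 2 * R0 * (/ 2) ^ n) by (apply Rmult_lt_0_compat; lra). assert (0 <= 4 * C * Rabs (ea - eb)) by pnra. lra. }
      rewrite <- Fa, <- Fb. eapply Rle_trans. apply (Phi_step ea eb ga gb _ Ha Hb Ga Gb Hd IHn). simpl. lra. }
  intros t. apply le_epsilon. intros eps He. destruct (half_pow_small (2 * R0) eps) as [n Hn]; auto. lra.
  specialize (H n t). lra.
Qed.

Lemma fixed_exists e : 0 <= e <= e2 -> exists g, ball g /\ forall t, Phi e g t = g t.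
Proof.
  intros He. pose proof R0_pos as HR.
  set (G := fix G n := match n with O => (fun _ : R => 0) | S n => Phi e (G n) end).
  assert (HG : forall n, ball (G n)).
  { induction n; simpl. repeat split. apply cont_const. intros t; rewrite Rabs_R0; lra. now apply ball_Phi. }
  assert (Hstep : forall n t, Rabs (G (S n) t - G n t) <= 2 * R0 * (/ 2) ^ n).
  { induction n; intros t.
    - destruct (HG 1%nat) as (_ & _ & B). specialize (B t). simpl in *. rewrite Rminus_0_r. lra.
    - change (Rabs (Phi e (G (S n)) t - Phi e (G n) t) <= 2 * R0 * (/ 2) ^ S n).
      assert (Hd : 0 < 2 * R0 * (/ 2) ^ n) by (apply Rmult_lt_0_compat; [lra | apply pow_lt; lra]).
      eapply Rle_trans. apply (Phi_step e e _ _ _ He He (HG _) (HG _) Hd IHn). rewrite Rminus_diag, Rabs_R0. simpl. lra. }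
  assert (Htail : forall n k t, Rabs (G (k + n)%nat t - G n t) <= 4 * R0 * ((/ 2) ^ n - (/ 2) ^ (k + n))).
  { intros n k t. induction k; simpl Nat.add. rewrite !Rminus_diag, Rabs_R0; lra.
    replace (G (S (k + n)) t - G n t) with ((G (S (k + n)) t - G (k + n)%nat t) + (G (k + n)%nat t - G n t)) by ring.
    triang. specialize (Hstep (k + n)%nat t). simpl pow in *. lra. }
  destruct (uniform_limit G) as [g [Cg HU]].
  { intros n. apply HG. }
  { intros eps Heps. destruct (half_pow_small (4 * R0) (eps / 2)) as [N HN]; try lra. exists N.
    assert (T : forall n, (N <= n)%nat -> forall t, Rabs (G n t - G N t) <= eps / 2).
    { intros n Hn t. replace n with ((n - N) + N)%nat by lia. eapply Rle_trans. apply Htail.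
      assert (0 < (/ 2) ^ (n - N + N)) by (apply pow_lt; lra). assert (0 < 4 * R0 * (/ 2) ^ (n - N + N)) by (apply Rmult_lt_0_compat; lra). lra. }
    intros n m Hn Hm t. pose proof (T n Hn t) as T1. pose proof (T m Hm t) as T2.
    unabs T1. unabs T2. apply Rabs_le; lra. }
  assert (Pg : per g).
  { intros t. apply cond_eq. intros eps Heps. destruct (HU (eps / 3)) as [N HN]. lra. specialize (HN N (le_n _)).
    pose proof (HN t) as T1. pose proof (HN (t + tau2)) as T2. destruct (HG N) as (_ & P & _). rewrite P in T2.
    unabs T1. unabs T2. apply Rabs_def1; lra. }
  assert (Bg : forall t, Rabs (g t) <= R0).
  { intros t. apply le_epsilon. intros eps Heps. destruct (HU eps Heps) as [N HN]. specialize (HN N (le_n _) t).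
    destruct (HG N) as (_ & _ & B). specialize (B t). unabs HN. unabs B. apply Rabs_le; lra. }
  assert (Hb : ball g) by (repeat split; auto).
  exists g. split; auto. intros t. apply cond_eq. intros eps Heps. destruct (HU (eps / 4)) as [N HN]. lra.
  assert (T1 : forall s, Rabs (g s - G N s) <= eps / 4) by (intros s; rewrite Rabs_minus_sym; apply HN; auto).
  pose proof (Phi_step e e g (G N) (eps / 4) He He Hb (HG N) ltac:(lra) T1 t) as T2. rewrite Rminus_diag, Rabs_R0 in T2.
  pose proof (HN (S N) ltac:(lia) t) as T3. change (G (S N) t) with (Phi e (G N) t) in T3.
  unabs T2. unabs T3. apply Rabs_def1; lra.
Qed.
End Fixed.

Lemma P1_trig A B s : P1 (fun t => A * cos t + B * sin t) s = A * cos s + B * sin s.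
Proof.
  pose proof PI_RGT_0. unfold P1. destruct (coef_cos_sin A B 1) as [-> ->]. simpl. field. lra.
Qed.
Lemma P1_scal k g s : cont g -> P1 (fun t => k * g t) s = k * P1 g s.
Proof.
  intros Hg. unfold P1.
  assert (E1 : pA (fun t => k * g t) 1 = k * pA g 1).
  { unfold fA. rewrite (RI_ext _ (fun t => k * (g t * ck 1 1 t))) by (intros; ring). apply RI_scal. ct. apply cont_ck. }
  assert (E2 : pB (fun t => k * g t) 1 = k * pB g 1).
  { unfold fB. rewrite (RI_ext _ (fun t => k * (g t * sk 1 1 t))) by (intros; ring). apply RI_scal. ct. apply cont_sk. }
  rewrite E1, E2. ring.
Qed.
Lemma n3_bound y : Rabs y <= 1 -> Rabs (n0 * (y * y) + y * (y * (y * n3 y))) <= (Rabs n0 + Ln) * (y * y).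
Proof.
  intros Hy. triang. rewrite !Rabs_mult. rewrite Rmult_plus_distr_r.
  replace (Rabs y * (Rabs y * (Rabs y * Rabs (n3 y)))) with (Rabs y * Rabs (n3 y) * (Rabs y * Rabs y)) by ring.
  rewrite <- (Rabs_mult y y), (Rabs_pos_eq (y * y)) by pnra. apply Rplus_le_compat_l.
  apply Rmult_le_compat_r. pnra. specialize (n3b y Hy). pose proof (Rabs_pos y). pose proof (Rabs_pos (n3 y)). pnra.
Qed.

(** With [v = e cos + r], smallness of [v] and closeness of [(nu, kap)] only say that [r] is small.
    Feeding this into the equation for [r] repeatedly gives [r = O(e^2)], and only then is the
    rescaled right-hand side [gr / e^2] known to lie in [ball]. *)
Lemma periodic_unique ebar : 0 < ebar -> exists eta, 0 < eta /\ forall (v v' : R -> R) (nu kap e : R),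
  (forall t, is_derive v t (v' t)) -> cont v' -> per v -> Rabs (nu - w) <= eta -> Rabs (kap - th) <= eta ->
  (forall s, Rabs (v s) <= eta) -> 0 <= e -> pA v 1 = PI * e -> pB v 1 = 0 ->
  (forall s, nu * v' s + v s = fN (v (s - kap))) ->
  (forall s, v s = 0) \/
  (0 < e < ebar /\ exists g, ball g /\ (forall s, PhiG e g nu kap s = g s) /\ nu = nuE e g /\ kap = kapE e g /\ forall s, v s = vE e g s).
Proof.
  intros Hebar. pose proof PI_RGT_0 as HPI. pose proof CK_pos as HCK. pose proof CK'_pos as HCK'. pose proof Ln_pos as HLn.
  pose proof (Rabs_pos n0) as Hn0.
  set (Cn := Rabs n0 + Ln). set (CC := CK be w + CK' be w). set (r1 := 4 * CC * Cn).
  assert (HCn : 0 <= Cn) by (unfold Cn; lra). assert (HCC : 0 < CC) by (unfold CC; lra).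
  assert (Hr1 : 0 <= r1) by (unfold r1; apply Rmult_le_pos; lra).
  (* Sum of the constants of all later smallness conditions; dividing by [1 + Sg] once ensures [C1],
     [C2] and [C3]. *)
  set (Sg := 2 * CC * (6 * Cn + 1 + be) + 2 * r1 + 6 * Rabs n0 * r1 + 16 * Ln + (1 + be) * r1).
  assert (S1 : 0 <= 2 * CC * (6 * Cn + 1 + be)) by (apply Rmult_le_pos; lra).
  assert (S2 : 0 <= 6 * Rabs n0 * r1) by (apply Rmult_le_pos; lra).
  assert (S3 : 0 <= (1 + be) * r1) by (apply Rmult_le_pos; lra).
  set (eta0 := Rmin (Rmin 1 (ebar / 4)) (Rmin (w / 2) (Rmin (th / 2) ((PI - th) / 2)))).
  assert (H0p : 0 < eta0) by (unfold eta0; repeat apply Rmin_pos; lra).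
  assert (H01 : eta0 <= 1) by (eapply Rle_trans; [apply Rmin_l | apply Rmin_l]).
  assert (H02 : eta0 <= ebar / 4) by (eapply Rle_trans; [apply Rmin_l | apply Rmin_r]).
  assert (H03 : eta0 <= w / 2) by (min_le).
  assert (H04 : eta0 <= th / 2) by (eapply Rle_trans; [apply Rmin_r | min_le]).
  assert (H05 : eta0 <= (PI - th) / 2) by (eapply Rle_trans; [apply Rmin_r | min_le]).
  assert (HS1 : 0 < 1 + Sg) by (unfold Sg; lra).
  set (eta := eta0 / (1 + Sg)).
  assert (Hep : 0 < eta) by (apply Rdiv_lt_0_compat; lra).
  assert (HeS : eta * (1 + Sg) = eta0) by (unfold eta; field; lra).
  assert (HS0 : 0 <= Sg) by (unfold Sg; lra).
  assert (Hee0 : eta <= eta0) by pnra.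
  assert (HSe : Sg * eta <= 1) by pnra.
  assert (C1 : 2 * CC * (6 * Cn + 1 + be) * eta <= 1) by (eapply Rle_trans; [|apply HSe]; apply Rmult_le_compat_r; unfold Sg; lra).
  assert (C2 : (2 * r1) * eta <= 1) by (eapply Rle_trans; [|apply HSe]; apply Rmult_le_compat_r; unfold Sg; lra).
  assert (C3 : (6 * Rabs n0 * r1 + 16 * Ln + (1 + be) * r1) * eta <= 1) by (eapply Rle_trans; [|apply HSe]; apply Rmult_le_compat_r; unfold Sg; lra).
  clearbody eta. exists eta. split; auto.
  intros v v' nu kap e Dv Cv' Pv Hnu Hkap Hv He EA EB Heq.
  assert (Cv : cont v) by exact (is_derive_cont _ _ Dv).
  assert (He2 : e <= 2 * eta).
  { destruct (coef_bound v eta 1 Cv Hv) as [X _]. rewrite EA, Rabs_pos_eq in X by pnra. pnra. }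
  set (r := fun s => v s - e * cos s). set (r' := fun s => v' s + e * sin s).
  assert (Dr' : forall s, is_derive r s (r' s)).
  { intros s. eapply is_derive_eq. apply D_minus. apply Dv. apply D_scal. instantiate (1 := - sin s). auto_derive; auto; ring. unfold r'; ring. }
  assert (Cr' : cont r') by (unfold r'; ct). assert (Cr : cont r) by exact (is_derive_cont _ _ Dr').
  assert (Pr : per r) by (intros s; unfold r; now rewrite Pv, cos_per2).
  assert (Ar : pA r 1 = 0 /\ pB r 1 = 0).
  { destruct (coef_cos_sin 1 0 1) as [X1 X2]. simpl in X1, X2.
    assert (X : r = fun s => v s + - e * (1 * cos s + 0 * sin s)) by (apply functional_extensionality; intros s; unfold r; ring).
    rewrite X. rewrite fA_lin, fB_lin by ct. rewrite X1, X2, EA, EB. split; ring. }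
  destruct Ar as [Ar Br].
  (* The right-hand side that [r] sees when its equation is written with the critical operator; it
     is the unscaled counterpart of [PhiG]. *)
  set (gr := fun s => (n0 * (v (s - kap) * v (s - kap)) + v (s - kap) * (v (s - kap) * (v (s - kap) * n3 (v (s - kap))))) + (w - nu) * r' s + be * (r (s - th) - r (s - kap))).
  assert (Cgr : cont gr) by (unfold gr; ct).
  assert (Pr' : per r').
  { intros t. assert (A : is_derive (fun s => r (s + tau2)) t (r' (t + tau2))).
    { eapply is_derive_eq. apply (D_comp r (fun s => s + tau2)). apply Dr'. apply D_plus. apply D_id. apply D_const. ring. }
    apply (is_derive_ext _ r) in A; [|intros s; apply Pr].
    rewrite <- (is_derive_unique _ _ _ A). apply is_derive_unique, Dr'. }
  assert (Pgr : per gr).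
  { intros s. unfold gr. replace (s + tau2 - kap) with (s - kap + tau2) by ring. replace (s + tau2 - th) with (s - th + tau2) by ring.
    now rewrite Pv, Pr', !Pr. }
  set (TA := e * (1 + be * cos kap)). set (TB := e * (be * sin kap - nu)).
  assert (HL0 : forall s, gr s = L0 be w th r r' s + 1 * (TA * cos s + TB * sin s)).
  { intros s. specialize (Heq s). unfold fN in Heq. unfold gr, L0, TA, TB, r, r'. rewrite (cos_minus s kap). lra. }
  assert (CL0 : cont (L0 be w th r r')) by (unfold L0; ct).
  assert (HT : forall s, P1 gr s = TA * cos s + TB * sin s).
  { intros s. rewrite <- P1_trig. destruct (coef_L0 be w th r r' 1 Dr' Cr' Pr) as [Y1 Y2]. rewrite Ar, Br in Y1, Y2.
    assert (X : gr = fun s => L0 be w th r r' s + 1 * (TA * cos s + TB * sin s)) by (apply functional_extensionality; auto).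
    unfold P1. rewrite X. rewrite fA_lin, fB_lin by (auto; ct). rewrite Y1, Y2. ring. }
  assert (Hspec : K0_spec be w th gr r r').
  { split. repeat (split; auto). intros s. rewrite HL0, HT. ring. }
  assert (HKr : forall M, 0 < M -> (forall t, Rabs (gr t) <= M) -> forall t, Rabs (r t) <= CC * M /\ Rabs (r' t) <= CC * M).
  { intros M HM HgM t. destruct (HK gr Cgr Pgr) as [Hs Hb]. specialize (Hb M HM HgM t).
    pose proof (K0_unique be w th be1 w0 w2 gr r r' (K gr) (K' gr) Cgr Hspec Hs) as E.
    assert (E' : r' t = K' gr t).
    { destruct Hs as [[Ds _] _]. rewrite <- (is_derive_unique _ _ _ (Dr' t)), <- (is_derive_unique _ _ _ (Ds t)). apply Derive_ext; auto. }
    rewrite E, E'. unfold CC. pnra. }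
  assert (Hgr : forall m, 0 < m -> (forall s, Rabs (r s) <= m /\ Rabs (r' s) <= m) -> forall s, Rabs (gr s) <= 2 * Cn * (e * e) + (6 * Cn + 1 + be) * eta * m).
  { intros m Hm Hb s. destruct (Hb (s - kap)) as [B1 _]. pose proof (Hv (s - kap)) as B2.
    assert (B3 : Rabs (n0 * (v (s - kap) * v (s - kap)) + v (s - kap) * (v (s - kap) * (v (s - kap) * n3 (v (s - kap))))) <= Cn * (2 * (e * e) + 6 * eta * m)).
    { eapply Rle_trans. apply n3_bound. lra. fold Cn. apply Rmult_le_compat_l; auto.
      set (y := v (s - kap)) in *. replace y with (e * cos (s - kap) + r (s - kap)) by (unfold r, y; ring).
      set (c := cos (s - kap)). set (z := r (s - kap)) in *.
      assert (Hc : c * c <= 1). { pose proof (COS_bound (s - kap)). unfold c. pnra. }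
      assert (Hz : z * z <= 3 * eta * m).
      { assert (Rabs z <= 3 * eta). { unfold z, r. fold y. replace (y - e * cos (s - kap)) with (y + - (e * cos (s - kap))) by ring. triang.
          rewrite Rabs_Ropp, Rabs_mult, (Rabs_pos_eq e) by auto. pose proof (abs_cos (s - kap)). pose proof (Rabs_pos (cos (s - kap))). pnra. }
        rewrite <- (Rabs_pos_eq (z * z)) by pnra. rewrite Rabs_mult. apply Rmult_le_compat; auto using Rabs_pos. }
      assert (e * e * (c * c) <= e * e) by pnra. pose proof (Rle_0_sqr (e * c - z)) as Q. unfold Rsqr in Q. pnra. }
    destruct (Hb s) as [_ B4].
    assert (B5 : Rabs ((w - nu) * r' s) <= eta * m).
    { rewrite Rabs_mult, Rabs_minus_sym. apply Rmult_le_compat; auto using Rabs_pos. }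
    assert (B6 : Rabs (r (s - th) - r (s - kap)) <= eta * m).
    { eapply Rle_trans. apply (lip_of_deriv r r' m Dr'). intros; apply Hb. replace (s - th - (s - kap)) with (kap - th) by ring. rewrite Rmult_comm. apply Rmult_le_compat_r; lra. }
    unfold gr. triang. eapply Rle_trans. apply Rplus_le_compat_r, Rabs_triang.
    rewrite (Rabs_mult be), (Rabs_pos_eq be) by lra. assert (be * Rabs (r (s - th) - r (s - kap)) <= be * (eta * m)) by (apply Rmult_le_compat_l; lra). lra. }
  assert (He0 : 0 <= e * e) by pnra.
  (* By [Hgr] and [C1] a common bound [m] of [r] and [r'] improves to [m / 2 + r1 e^2 / 2];
     iteration removes the initial bound. *)
  assert (Hrb : forall s, Rabs (r s) <= r1 * (e * e) /\ Rabs (r' s) <= r1 * (e * e)).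
  { destruct (per_bounded r Cr Pr) as [m1 [Hm1 Hb1]]. destruct (per_bounded r' Cr' Pr') as [m2 [Hm2 Hb2]].
    assert (Hre : 0 <= r1 * (e * e)) by (apply Rmult_le_pos; auto).
    assert (H : forall n s, Rabs (r s) <= (m1 + m2) * (/ 2) ^ n + r1 * (e * e) /\ Rabs (r' s) <= (m1 + m2) * (/ 2) ^ n + r1 * (e * e)).
    { induction n; intros s. simpl. specialize (Hb1 s). specialize (Hb2 s). lra.
      set (m := (m1 + m2) * (/ 2) ^ n + r1 * (e * e)) in *.
      assert (Hm : 0 < m). { unfold m. assert (0 < (m1 + m2) * (/ 2) ^ n) by (apply Rmult_lt_0_compat; [lra | apply pow_lt; lra]). lra. }
      assert (HM : 0 < 2 * Cn * (e * e) + (6 * Cn + 1 + be) * eta * m).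
      { assert (0 <= 2 * Cn * (e * e)) by (apply Rmult_le_pos; lra). assert (0 < (6 * Cn + 1 + be) * eta * m) by (repeat apply Rmult_lt_0_compat; lra). lra. }
      pose proof (HKr _ HM (Hgr m Hm IHn) s) as X.
      assert (Y : CC * (2 * Cn * (e * e) + (6 * Cn + 1 + be) * eta * m) <= (m1 + m2) * (/ 2) ^ S n + r1 * (e * e)).
      { replace (CC * (2 * Cn * (e * e) + (6 * Cn + 1 + be) * eta * m)) with (r1 / 2 * (e * e) + (2 * CC * (6 * Cn + 1 + be) * eta) * (m / 2)) by (unfold r1; field).
        apply Rle_trans with (r1 / 2 * (e * e) + 1 * (m / 2)). apply Rplus_le_compat_l, Rmult_le_compat_r; lra. unfold m. simpl. lra. }
      lra. }
    intros s. split; apply le_epsilon; intros eps Heps; destruct (half_pow_small (m1 + m2) eps) as [n Hn]; try lra; specialize (H n s); lra. }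
  (* Zero amplitude forces [r = 0], hence the equilibrium. *)
  destruct He as [He|<-].
  2:{ left. intros s. destruct (Hrb s) as [X _]. rewrite Rmult_0_l, Rmult_0_r in X. pose proof (Rabs_pos (r s)).
      assert (Z : r s = 0) by (apply Rabs_eq_0; lra). unfold r in Z. lra. }
  right. split. lra.
  set (g := fun s => / (e * e) * gr s).
  assert (Hee : 0 < e * e) by pnra. assert (Hie : 0 < / (e * e)) by now apply Rinv_0_lt_compat.
  set (y := fun s => / (e * e) * r s). set (y' := fun s => / (e * e) * r' s).
  assert (Hy : forall s, Rabs (y s) <= r1 /\ Rabs (y' s) <= r1).
  { intros s. unfold y, y'. rewrite !Rabs_mult, (Rabs_pos_eq (/ (e * e))) by lra. destruct (Hrb s) as [X1 X2].
    split; apply Rmult_le_reg_l with (e * e); auto; rewrite <- Rmult_assoc, Rinv_r, Rmult_1_l by lra; lra. }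
  assert (Hvy : forall s, v s = e * (cos s + e * y s)) by (intros s; unfold y, r; field; lra).
  set (Hh := fun s => n0 * (cos s * cos s) + e * HtF e (cos s) (y s)).
  assert (HgH : forall s, g s = Hh (s - kap) + (w - nu) * y' s + be * (y (s - th) - y (s - kap))).
  { intros s. unfold g, gr. rewrite !Hvy. unfold Hh, HtF, y', y. unfold r. field. lra. }
  assert (Cg : cont g) by (unfold g; ct). assert (Pg : per g) by (intros s; unfold g; now rewrite Pgr).
  assert (Her1 : e * r1 <= 1) by pnra.
  (* All terms except [n0 cos^2] carry a factor [eta]; [C3] bounds their sum by 1, the slack in
     [R0]. *)
  assert (Bg : forall s, Rabs (g s) <= R0).
  { intros s. rewrite HgH. set (c := cos (s - kap)). set (z := y (s - kap)).
    assert (Hz : Rabs z <= r1) by apply Hy. assert (Hc : Rabs c <= 1) by apply abs_cos.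
    assert (Hz2 : Rabs (e * z) <= e * r1) by (rewrite Rabs_mult, (Rabs_pos_eq e) by lra; apply Rmult_le_compat_l; lra).
    set (p := c + e * z). assert (Hp : Rabs p <= 2) by (unfold p; pose proof (Rabs_triang c (e * z)); lra).
    assert (Hep1 : Rabs (e * p) <= 1). { replace (e * p) with (v (s - kap)) by (rewrite Hvy; reflexivity). pose proof (Hv (s - kap)). lra. }
    assert (E : Hh (s - kap) = n0 * (c * c) + n0 * ((e * z) * (2 * c + e * z)) + e * (p * (p * (p * n3 (e * p))))).
    { unfold Hh, HtF. fold c z p. ring. }
    assert (F1 : Rabs (n0 * (c * c)) <= Rabs n0).
    { rewrite !Rabs_mult. pose proof (Rabs_pos c). rewrite <- (Rmult_1_r (Rabs n0)) at 2. apply Rmult_le_compat_l; auto. pnra. }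
    assert (F2 : Rabs (n0 * ((e * z) * (2 * c + e * z))) <= Rabs n0 * (2 * eta * r1 * 3)).
    { rewrite Rabs_mult. apply Rmult_le_compat_l; auto. rewrite Rabs_mult. apply Rmult_le_compat; auto using Rabs_pos.
      eapply Rle_trans. apply Hz2. apply Rmult_le_compat_r; lra. triang. rewrite Rabs_mult, (Rabs_pos_eq 2) by lra. lra. }
    assert (F3 : Rabs (e * (p * (p * (p * n3 (e * p))))) <= 2 * eta * (2 * (2 * (2 * Ln)))).
    { rewrite !Rabs_mult, (Rabs_pos_eq e) by lra. specialize (n3b (e * p) Hep1).
      repeat apply Rmult_le_compat; auto using Rabs_pos; try lra; repeat apply Rmult_le_pos; auto using Rabs_pos. }
    assert (F4 : Rabs ((w - nu) * y' s) <= eta * r1). { rewrite Rabs_mult, Rabs_minus_sym. apply Rmult_le_compat; auto using Rabs_pos. apply Hy. }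
    assert (F5 : Rabs (be * (y (s - th) - z)) <= be * (eta * r1)).
    { rewrite Rabs_mult, (Rabs_pos_eq be) by lra. apply Rmult_le_compat_l. lra. unfold z.
      eapply Rle_trans. apply (lip_of_deriv y y' r1). intros t; apply D_scal, Dr'. intros; apply Hy.
      replace (s - th - (s - kap)) with (kap - th) by ring. rewrite Rmult_comm. apply Rmult_le_compat_r; lra. }
    rewrite E. unfold R0.
    repeat (eapply Rle_trans; [apply Rabs_triang|]; match goal with |- Rabs ?u + _ <= _ => idtac end;
      apply Rle_trans with (Rabs n0 + Rabs n0 * (2 * eta * r1 * 3) + 2 * eta * (2 * (2 * (2 * Ln))) + eta * r1 + be * (eta * r1)); [|lra]).
    fold z.
    pose proof (Rabs_triang (n0 * (c * c)) (n0 * ((e * z) * (2 * c + e * z)))) as G1.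
    pose proof (Rabs_triang (n0 * (c * c) + n0 * ((e * z) * (2 * c + e * z))) (e * (p * (p * (p * n3 (e * p)))))) as G2.
    pose proof (Rabs_triang (n0 * (c * c) + n0 * ((e * z) * (2 * c + e * z)) + e * (p * (p * (p * n3 (e * p))))) ((w - nu) * y' s)) as G3. lra. }
  assert (Hball : ball g) by (repeat split; auto).
  assert (Hsp2 : K0_spec be w th g y y').
  { destruct Hspec as [_ HL]. split; [split; [|split; [|split; [|split]]]|].
    - intros t; apply D_scal, Dr'.
    - unfold y'; ct.
    - intros t; unfold y; now rewrite Pr.
    - assert (X : y = fun s => 0 + / (e * e) * r s) by (apply functional_extensionality; intros s; unfold y; ring).
      rewrite X, fA_lin, Ar by (auto; apply cont_const). unfold fA. rewrite (RI_ext _ (fun _ => 0)) by (intros; ring). rewrite RI_const; ring.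
    - assert (X : y = fun s => 0 + / (e * e) * r s) by (apply functional_extensionality; intros s; unfold y; ring).
      rewrite X, fB_lin, Br by (auto; apply cont_const). unfold fB. rewrite (RI_ext _ (fun _ => 0)) by (intros; ring). rewrite RI_const; ring.
    - intros t. unfold g at 2. rewrite P1_scal by auto. specialize (HL t). unfold L0 in *. unfold g, y, y'.
      replace (w * (/ (e * e) * r' t) + / (e * e) * r t + be * (/ (e * e) * r (t - th))) with (/ (e * e) * (w * r' t + r t + be * r (t - th))) by ring. rewrite HL. ring. }
  destruct (HK g Cg Pg) as [HsK _].
  assert (Ey : forall t, y t = K g t) by (apply (K0_unique be w th be1 w0 w2 g y y' (K g) (K' g) Cg Hsp2 HsK)).
  assert (Ey' : forall t, y' t = K' g t).
  { intros t. destruct HsK as [[Ds _] _]. rewrite <- (is_derive_unique _ _ _ (Ds t)). destruct Hsp2 as [[Dy _] _]. rewrite <- (is_derive_unique _ _ _ (Dy t)). apply Derive_ext; auto. }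
  assert (Hfix : forall s, PhiG e g nu kap s = g s).
  { intros s. rewrite HgH. unfold PhiG. rewrite <- !Ey, <- Ey'. do 2 f_equal. unfold HS, HtS, Hh. now rewrite <- Ey. }
  assert (Hharm : forall s, TA * cos s + TB * sin s = e * e * (e * (aF e g * cos (s - kap) + bF e g * sin (s - kap)))).
  { intros s. rewrite <- HT. rewrite <- (PhiG_harm e g nu kap Hball s).
    replace (PhiG e g nu kap) with g by (symmetry; apply functional_extensionality; auto).
    unfold g. rewrite P1_scal by auto. field. lra. }
  (* Evaluating the harmonic identity at [kap], and for [R2] a quarter turn later, separates the two
     real equations. *)
  assert (R1 : cos kap - nu * sin kap = xF e g).
  { pose proof (Hharm kap) as X. rewrite Rminus_diag, cos_0, sin_0 in X. unfold TA, TB in X.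
    pose proof (sin2_cos2 kap) as SC. unfold Rsqr in SC. unfold xF. apply Rmult_eq_reg_l with e; [|lra].
    replace (e * (1 + be * cos kap) * cos kap + e * (be * sin kap - nu) * sin kap) with (e * (cos kap - nu * sin kap + be * (sin kap * sin kap + cos kap * cos kap))) in X by ring. rewrite SC in X. lra. }
  assert (R2 : sin kap + nu * cos kap = yF e g).
  { pose proof (Hharm (kap + PI / 2)) as X. replace (kap + PI / 2 - kap) with (PI / 2) in X by ring. rewrite cos_PI2, sin_PI2 in X.
    rewrite cos_plus, sin_plus, cos_PI2, sin_PI2 in X. unfold TA, TB in X. unfold yF. apply Rmult_eq_reg_l with e; [|lra]. lra. }
  assert (Hnk := nk_char nu kap (xF e g) (yF e g)).
  unabs Hnu. unabs Hkap.
  destruct Hnk as [N1 N2]; auto; try lra.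
  exists g. repeat split; auto; try apply Hball. intros s. rewrite Hvy, Ey. unfold vE. ring.
Qed.

(** * Second order coefficients and the direction of the bifurcation *)

Definition mr := (be * be + 2 * be - 2) / ((be + 1) * (5 * be - 4) * be).
Definition mi := 2 * w * (be - 1) / ((be + 1) * (5 * be - 4) * be).
Definition g0 s := n0 * (cos (s - th) * cos (s - th)).
(** The critical equation with right-hand side [g0], solved harmonic by harmonic: [mr + i mi] is
    [e^(-2 i th) / (1 + 2 i w + be e^(-2 i th))]. *)
Definition psi0 s := n0 / 2 * (/ (1 + be) + mr * cos (2 * s) - mi * sin (2 * s)).
Definition psi0' s := n0 * (- mr * sin (2 * s) - mi * cos (2 * s)).

Lemma cos2th : be * be * cos (2 * th) = 2 - be * be /\ be * be * sin (2 * th) = - 2 * w.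
Proof.
  rewrite cos_2a_cos, sin_2a. split.
  replace (be * be * (2 * cos th * cos th - 1)) with (2 * (be * cos th) * (be * cos th) - be * be) by ring. rewrite costh; ring.
  replace (be * be * (2 * sin th * cos th)) with (2 * (be * sin th) * (be * cos th)) by ring. rewrite costh, sinth; ring.
Qed.

Lemma harm2 (f : R -> R) A B D : (forall s, f s = A + B * cos (2 * s) + D * sin (2 * s)) -> pA f 1 = 0 /\ pB f 1 = 0.
Proof.
  intros E. assert (E' : forall s, f s = A * ck 1 0 s + (B * ck 1 2 s + D * sk 1 2 s)).
  { intros s. rewrite E, !ck1, sk1. simpl. rewrite Rmult_0_l, cos_0. replace ((1 + 1) * s) with (2 * s) by ring. ring. }
  split.
  - unfold fA. rewrite (RI_ext _ (fun s => A * (ck 1 0 s * ck 1 1 s) + (B * (ck 1 2 s * ck 1 1 s) + D * (ck 1 1 s * sk 1 2 s)))).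
    2: intros; rewrite E'; ring. rewrite !RI_plus, !RI_scal by (ct; auto using cont_ck, cont_sk).
    rewrite !(int_ckck tau2 1 tau2_pos nu1), (int_cksk tau2 1 tau2_pos nu1) by lia. ring.
  - unfold fB. rewrite (RI_ext _ (fun s => A * (ck 1 0 s * sk 1 1 s) + (B * (ck 1 2 s * sk 1 1 s) + D * (sk 1 2 s * sk 1 1 s)))).
    2: intros; rewrite E'; ring. rewrite !RI_plus, !RI_scal by (ct; auto using cont_ck, cont_sk).
    rewrite !(int_sksk tau2 1 tau2_pos nu1), !(int_cksk tau2 1 tau2_pos nu1) by lia. ring.
Qed.

Lemma mrmi : -2 * w * mi + mr + be * (mr * cos (2 * th) + mi * sin (2 * th)) = cos (2 * th) /\
  -2 * w * mr - mi + be * (mr * sin (2 * th) - mi * cos (2 * th)) = sin (2 * th).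
Proof.
  destruct cos2th as [C2 S2]. assert (Hbb : 0 < be * be) by pnra.
  replace (cos (2 * th)) with ((2 - be * be) / (be * be)) by (rewrite <- C2; field; lra).
  replace (sin (2 * th)) with ((- 2 * w) / (be * be)) by (rewrite <- S2; field; lra).
  unfold mi. set (q := 2 * (be - 1) / ((be + 1) * (5 * be - 4) * be)).
  replace (2 * w * (be - 1) / ((be + 1) * (5 * be - 4) * be)) with (w * q) by (unfold q; field; lra). split.
  - replace (-2 * w * (w * q) + mr + be * (mr * ((2 - be * be) / (be * be)) + w * q * (-2 * w / (be * be)))) with
      (-2 * (w * w) * q + mr + be * (mr * ((2 - be * be) / (be * be)) + (w * w) * q * (-2 / (be * be)))) by (field; lra).
    rewrite w2. unfold q, mr. field. lra.
  - unfold q, mr. field. lra.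
Qed.

Lemma psi0_spec : K0_spec be w th g0 psi0 psi0'.
Proof.
  destruct cos2th as [C2 S2].
  assert (Hg0 : forall s, g0 s = n0 / 2 + (n0 / 2 * cos (2 * th)) * cos (2 * s) + (n0 / 2 * sin (2 * th)) * sin (2 * s)).
  { intros s. unfold g0. replace (cos (s - th) * cos (s - th)) with ((1 + cos (2 * (s - th))) / 2) by (rewrite cos_2a_cos; field).
    replace (2 * (s - th)) with (2 * s - 2 * th) by ring. rewrite cos_minus. field. }
  destruct (harm2 g0 _ _ _ Hg0) as [G1 G2].
  destruct (harm2 psi0 (n0 / 2 * / (1 + be)) (n0 / 2 * mr) (- (n0 / 2 * mi))) as [P1' P2']. intros s; unfold psi0; ring.
  split; [split; [|split; [|split; [|split]]]|]; auto.
  - intros t. unfold psi0, psi0'. auto_derive; auto. field; lra.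
  - unfold psi0'. ct.
  - intros t. unfold psi0. replace (2 * (t + tau2)) with (2 * t + 2 * INR 2 * PI) by (simpl; ring). now rewrite cos_period, sin_period.
  - intros t. unfold P1. rewrite G1, G2, Hg0. unfold L0, psi0', psi0.
    replace (2 * (t - th)) with (2 * t - 2 * th) by ring. rewrite cos_minus, sin_minus.
    set (c := cos (2 * t)). set (s := sin (2 * t)).
    assert (Hbb : 0 < be * be) by pnra.
    destruct mrmi as [E1 E2]. set (C := cos (2 * th)) in *. set (S' := sin (2 * th)) in *.
    replace (w * (n0 * (- mr * s - mi * c)) + n0 / 2 * (/ (1 + be) + mr * c - mi * s) + be * (n0 / 2 * (/ (1 + be) + mr * (c * C + s * S') - mi * (s * C - c * S'))))
     with (n0 / 2 * ((1 + be) * / (1 + be)) + n0 / 2 * c * (-2 * w * mi + mr + be * (mr * C + mi * S')) + n0 / 2 * s * (-2 * w * mr - mi + be * (mr * S' - mi * C))) by (field; lra).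
    rewrite E1, E2. field. lra.
Qed.

(** At [e = 0] the fixed point is [g0], and [HtS] reduces to [2 n0 cos psi0 + n3 0 cos^3], whose
    first harmonic is read off. *)
Lemma ab0 g : ball g -> (forall t, Phi 0 g t = g t) -> aF 0 g = n0 * n0 * (/ (1 + be) + mr / 2) + 3 / 4 * n3 0 /\ bF 0 g = - (n0 * n0 * mi / 2).
Proof.
  intros Hb Hf.
  assert (Eg : g = g0).
  { apply functional_extensionality; intros t. rewrite <- Hf. unfold Phi, HS, g0. rewrite kapE_0, nuE_0. ring. }
  subst g. destruct (HK g0 (proj1 Hb) (proj1 (proj2 Hb))) as [HsK _].
  assert (EK : forall t, K g0 t = psi0 t) by (apply (K0_unique be w th be1 w0 w2 g0 _ _ _ _ (proj1 Hb) HsK psi0_spec)).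
  pose proof PI_RGT_0 as HPI.
  assert (EH : forall s, HtS 0 g0 s = (n0 * n0 * (/ (1 + be) + mr / 2) + 3 / 4 * n3 0) * ck 1 1 s + ((- (n0 * n0 * mi / 2)) * sk 1 1 s +
     ((n0 * n0 * mr / 2 + / 4 * n3 0) * ck 1 3 s + (- (n0 * n0 * mi / 2)) * sk 1 3 s))).
  { intros s. unfold HtS, HtF. rewrite EK. unfold psi0. rewrite !Rmult_0_l, !Rplus_0_r, !ck1, !sk1. simpl INR. rewrite !Rmult_1_l.
    replace ((1 + 1 + 1) * s) with (2 * s + s) by ring. rewrite (cos_plus (2 * s) s), (sin_plus (2 * s) s).
    rewrite cos_2a_cos, sin_2a. pose proof (sin2_cos2 s) as E. unfold Rsqr in E.
    set (c := cos s) in *. set (n := sin s) in *. assert (E' : n * n = 1 - c * c) by lra.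
    set (i := / (1 + be)).
    match goal with |- ?l = ?r => replace r with ((n0 * n0 * (i + mr / 2) + 3 / 4 * n3 0) * c - (n0 * n0 * mi / 2) * n + ((n0 * n0 * mr / 2 + / 4 * n3 0) * ((2 * c * c - 1) * c - 2 * (n * n) * c) - (n0 * n0 * mi / 2) * (2 * c * c * n + (2 * c * c - 1) * n))) by ring end.
    rewrite E'. field. }
  set (A := n0 * n0 * (/ (1 + be) + mr / 2) + 3 / 4 * n3 0) in *. set (B := - (n0 * n0 * mi / 2)) in *. set (A3 := n0 * n0 * mr / 2 + / 4 * n3 0) in *.
  assert (H1 := int_ck2 tau2 1 tau2_pos nu1 1). assert (H2 := int_sk2 tau2 1 tau2_pos nu1 1 ltac:(lia)). simpl wt in H1, H2.
  split.
  - unfold aF, fA. rewrite (RI_ext _ (fun s => A * (ck 1 1 s * ck 1 1 s) + (B * (ck 1 1 s * sk 1 1 s) + (A3 * (ck 1 3 s * ck 1 1 s) + B * (ck 1 1 s * sk 1 3 s))))).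
    2: intros; rewrite EH; ring. rewrite !RI_plus, !RI_scal by (ct; auto using cont_ck, cont_sk).
    rewrite (int_ckck tau2 1 tau2_pos nu1 3 1), !(int_cksk tau2 1 tau2_pos nu1) by lia.
    transitivity (A * (2 / tau2 * RI (fun t => ck 1 1 t * ck 1 1 t) 0 tau2)). field; lra. rewrite H1; ring.
  - unfold bF, fB. rewrite (RI_ext _ (fun s => A * (ck 1 1 s * sk 1 1 s) + (B * (sk 1 1 s * sk 1 1 s) + (A3 * (ck 1 3 s * sk 1 1 s) + B * (sk 1 3 s * sk 1 1 s))))).
    2: intros; rewrite EH; ring. rewrite !RI_plus, !RI_scal by (ct; auto using cont_ck, cont_sk).
    rewrite (int_sksk tau2 1 tau2_pos nu1 3 1), !(int_cksk tau2 1 tau2_pos nu1) by lia.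
    transitivity (B * (2 / tau2 * RI (fun t => sk 1 1 t * sk 1 1 t) 0 tau2)). field; lra. rewrite H2; ring.
Qed.

(** This is the derivative of the delay with respect to [e^2]. A nonnegative [k] only helps, because
    [a] is positive; the negative term with [b] is absorbed using nothing finer than [th >= 3 / 2],
    which holds since [cos th < 0]. *)
Lemma slope_pos k a b : 0 <= k -> n0 = (be - 1) / 2 -> n3 0 = (2 - be) / 6 ->
  a = n0 * n0 * (/ (1 + be) + mr / 2) + 3 / 4 * n3 0 -> b = - (n0 * n0 * mi / 2) ->
  0 < (/ (be * w * w) + (th + k) * be / (w * w * w)) * a + / (be * w) * b.
Proof.
  intros Hk E0 E3 Ea Eb.
  assert (Hth : 3 / 2 <= th).
  { destruct (Rle_lt_dec (PI / 2) th) as [|Hlt]. pose proof PI2_3_2; lra.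
    pose proof (cos_gt_0 th ltac:(lra) Hlt). pnra. }
  assert (Hwb : w < be) by pnra.
  set (t := be - 1). assert (Ht : 0 < t) by (unfold t; lra). assert (Ebe : be = t + 1) by (unfold t; ring).
  set (D := 8 * (t + 2) * (5 * t + 1) * (t + 1)).
  assert (HD : 0 < D) by (unfold D; repeat apply Rmult_lt_0_compat; lra).
  (* In the variable [t = be - 1] the numerator of [a] has positive coefficients only. *)
  set (An := 6 * t * t * t * t + 5 * t * t * t + 6 * t * t + 11 * t + 2).
  assert (HAn : 0 < An).
  { unfold An. assert (0 < t * t) by pnra. assert (0 < t * t * t) by pnra. assert (0 < t * t * t * t) by pnra. lra. }
  assert (EaD : a = An / D).
  { rewrite Ea, E0, E3. unfold mr, An, D. rewrite Ebe. field. lra. }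
  assert (EbD : b = - w * (2 * t * t * t / D)).
  { rewrite Eb, E0. unfold mi, D. rewrite Ebe. field. lra. }
  rewrite EaD, EbD.
  assert (Hw3 : 0 < w * w * w) by (repeat apply Rmult_lt_0_compat; lra).
  assert (Q : 1 / (w * w) <= be / (w * w * w)).
  { apply Rmult_le_reg_r with (w * w * w); auto. replace (1 / (w * w) * (w * w * w)) with w by (field; lra).
    replace (be / (w * w * w) * (w * w * w)) with be by (field; lra). lra. }
  assert (Q1 : 3 / 2 * (1 / (w * w)) <= (th + k) * be / (w * w * w)).
  { replace ((th + k) * be / (w * w * w)) with ((th + k) * (be / (w * w * w))) by (unfold Rdiv; ring). apply Rmult_le_compat; [lra | apply Rlt_le, Rdiv_lt_0_compat; pnra | lra | exact Q]. }
  assert (Q2 : 0 < / (be * w * w)) by (apply Rinv_0_lt_compat; repeat apply Rmult_lt_0_compat; lra).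
  assert (HAD : 0 < An / D) by now apply Rdiv_lt_0_compat.
  assert (Q3 : 3 / 2 * (1 / (w * w)) * (An / D) <= (th + k) * be / (w * w * w) * (An / D)) by (apply Rmult_le_compat_r; lra).
  assert (Q4 : 0 < / (be * w * w) * (An / D)) by now apply Rmult_lt_0_compat.
  assert (Q5 : / (be * w) * (w * (2 * t * t * t / D)) <= 3 / 2 * (1 / (w * w)) * (An / D)).
  { assert (Hww : w * w = t * (t + 2)) by (rewrite w2, Ebe; ring). rewrite Hww.
    replace (/ (be * w) * (w * (2 * t * t * t / D))) with ((2 * t * t * t) * / be * / D) by (field; lra).
    replace (3 / 2 * (1 / (t * (t + 2))) * (An / D)) with (3 / 2 * An / (t * (t + 2)) * / D) by (field; lra).
    apply Rmult_le_compat_r. left; now apply Rinv_0_lt_compat.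
    assert (Htt : 0 < t * (t + 2)) by pnra.
    apply Rmult_le_reg_r with (be * (t * (t + 2))). pnra.
    replace (2 * t * t * t * / be * (be * (t * (t + 2)))) with (2 * t * t * t * (t * (t + 2))) by (field; lra).
    replace (3 / 2 * An / (t * (t + 2)) * (be * (t * (t + 2)))) with (3 / 2 * An * be) by (field; lra).
    rewrite Ebe. unfold An. assert (0 < t * t) by pnra. assert (0 < t * t * t) by pnra. assert (0 < t * t * t * t) by pnra. assert (0 < t * t * t * t * t) by pnra. lra. }
  lra.
Qed.

(** The clause with [s0] compares two arbitrary members of the family. Against [e = 0] it gives the
    direction; between neighbours it is the source of orbital stability. *)
Lemma family_of_operator k : 0 <= k -> n0 = (be - 1) / 2 -> n3 0 = (2 - be) / 6 ->
  exists (eb L s0 : R) (psi dpsi : R -> R -> R) (nu kap : R -> R), 0 < eb <= 1 /\ 0 < L /\ 0 < s0 /\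
  (forall e, 0 <= e <= eb ->
     (forall t, is_derive (psi e) t (dpsi e t)) /\ cont (dpsi e) /\ per (psi e) /\
     (forall t, Rabs (psi e t) <= L) /\ (forall t, Rabs (dpsi e t) <= L) /\ w / 2 <= nu e /\ 0 < kap e < PI /\
     forall s, nu e * (- e * sin s + e * e * dpsi e s) + (e * cos s + e * e * psi e s)
        = fN (e * cos (s - kap e) + e * e * psi e (s - kap e))) /\
  (forall ea ec, 0 <= ea <= eb -> 0 <= ec <= eb ->
     (forall t, Rabs (psi ea t - psi ec t) <= L * Rabs (ea - ec)) /\
     (forall t, Rabs (dpsi ea t - dpsi ec t) <= L * Rabs (ea - ec)) /\
     Rabs (nu ea - nu ec) <= L * ((ea + ec) * Rabs (ea - ec)) /\
     Rabs (kap ea - kap ec) <= L * ((ea + ec) * Rabs (ea - ec))) /\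
  nu 0 = w /\ kap 0 = th /\
  (forall ea ec, 0 <= ea <= ec -> ec <= eb -> s0 * ((ec - ea) * (ec + ea)) <= (kap ec + k) * / nu ec - (kap ea + k) * / nu ea) /\
  (exists eta, 0 < eta /\ forall (v v' : R -> R) (nu' kap' e : R),
     (forall t, is_derive v t (v' t)) -> cont v' -> per v -> Rabs (nu' - w) <= eta -> Rabs (kap' - th) <= eta ->
     (forall s, Rabs (v s) <= eta) -> 0 <= e -> pA v 1 = PI * e -> pB v 1 = 0 ->
     (forall s, nu' * v' s + v s = fN (v (s - kap'))) ->
     (forall s, v s = 0) \/ (0 < e < eb /\ nu' = nu e /\ kap' = kap e /\ forall s, v s = e * cos s + e * e * psi e s)).
Proof.
  intros Hk En0 En3.
  destruct Phi_estimates as [e1 [C [He1 [HC [Hsm [Hdom Hest]]]]]].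
  assert (Hest' : forall ea eb ga gb delta, 0 <= ea <= e1 -> 0 <= eb <= e1 -> ball ga -> ball gb -> 0 < delta ->
    (forall t, Rabs (ga t - gb t) <= delta) ->
    forall t, Rabs (Phi ea ga t - Phi eb gb t) <= C * ((ea + eb) * delta + 2 * Rabs (ea - eb))).
  { intros. now apply Hest. }
  set (e2' := e2 e1 C). assert (He2 : 0 < e2') by now apply e2_pos.
  assert (H21 : forall e, 0 <= e <= e2' -> 0 <= e <= e1) by (intros; now apply (e2_e1 e1 C)).
  assert (X : forall e, exists g, 0 <= e <= e2' -> ball g /\ forall t, Phi e g t = g t).
  { intros e. destruct (classic (0 <= e <= e2')) as [H|H].
    destruct (fixed_exists e1 C He1 HC Hest' e H) as [g Hg]. exists g; auto. exists (fun _ => 0). tauto. }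
  set (G := fun e => proj1_sig (constructive_indefinite_description _ (X e))).
  assert (HG : forall e, 0 <= e <= e2' -> ball (G e) /\ forall t, Phi e (G e) t = G e t).
  { intros e. exact (proj2_sig (constructive_indefinite_description _ (X e))). }
  clearbody G.
  assert (HGlip : forall ea ec, 0 <= ea <= e2' -> 0 <= ec <= e2' -> forall t, Rabs (G ea t - G ec t) <= 4 * C * Rabs (ea - ec)).
  { intros ea ec Ha Hc. destruct (HG ea Ha). destruct (HG ec Hc). now apply (fixed_lip e1 C HC Hest'). }
  assert (HGeq : forall e g, 0 <= e <= e2' -> ball g -> (forall t, Phi e g t = g t) -> g = G e).
  { intros e g He Hb Hf. destruct (HG e He) as [B F]. apply functional_extensionality; intros t. apply Rminus_diag_uniq.
    pose proof (fixed_lip e1 C HC Hest' e e g (G e) He He Hb B Hf F t) as Z. rewrite Rminus_diag, Rabs_R0, Rmult_0_r in Z.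
    apply Rabs_eq_0. pose proof (Rabs_pos (g t - G e t)). lra. }
  pose proof CK_pos as HCK. pose proof CK'_pos as HCK'. pose proof rho_pos as Hrho. pose proof rho'_pos as Hrho'.
  set (D := 1 + 4 * C). assert (HD : 1 < D) by (unfold D; lra).
  (* [delta] must be positive, so the coincident case is separate *)
  assert (Hlip : forall ea ec, 0 <= ea <= e2' -> 0 <= ec <= e2' ->
     Rabs (aF ea (G ea) - aF ec (G ec)) <= C * D * Rabs (ea - ec) /\ Rabs (bF ea (G ea) - bF ec (G ec)) <= C * D * Rabs (ea - ec) /\
     Rabs (nuE ea (G ea) - nuE ec (G ec)) <= C * D * ((ea + ec) * Rabs (ea - ec)) /\
     Rabs (kapE ea (G ea) - kapE ec (G ec)) <= C * D * ((ea + ec) * Rabs (ea - ec)) /\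
     forall t, Rabs (K (G ea) t - K (G ec) t) <= CK be w * (4 * C) * Rabs (ea - ec) /\ Rabs (K' (G ea) t - K' (G ec) t) <= CK' be w * (4 * C) * Rabs (ea - ec)).
  { intros ea ec Ha Hc. destruct (Req_dec ea ec) as [->|N].
    { rewrite !Rminus_diag, Rabs_R0, !Rmult_0_r. repeat split; try lra; rewrite Rminus_diag, Rabs_R0; lra. }
    destruct (HG ea Ha) as [Ba _]. destruct (HG ec Hc) as [Bc _].
    assert (Hp : 0 < Rabs (ea - ec)) by (apply Rabs_pos_lt; lra).
    assert (Hd : 0 < 4 * C * Rabs (ea - ec)) by (apply Rmult_lt_0_compat; lra).
    destruct (Hest ea ec (G ea) (G ec) _ (H21 ea Ha) (H21 ec Hc) Ba Bc Hd (HGlip ea ec Ha Hc)) as (_ & _ & A1 & A2 & A3 & A4 & _).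
    replace (Rabs (ea - ec) + 4 * C * Rabs (ea - ec)) with (D * Rabs (ea - ec)) in * by (unfold D; ring).
    repeat split; try lra; destruct (ball_K_lip (G ea) (G ec) _ Ba Bc Hd (HGlip ea ec Ha Hc) t); lra. }
  assert (Habs : forall e, 0 <= e <= e2' -> Rabs (aF e (G e)) <= C /\ Rabs (bF e (G e)) <= C).
  { intros e He. destruct (HG e He) as [B _]. assert (Z : forall t, Rabs (G e t - G e t) <= 1) by (intros; rewrite Rminus_diag, Rabs_R0; lra).
    destruct (Hest e e (G e) (G e) 1 (H21 e He) (H21 e He) B B ltac:(lra) Z) as (A1 & A2 & _). auto. }
  destruct (HG 0 ltac:(lra)) as [B0 F0]. destruct (ab0 (G 0) B0 F0) as [Ea Eb].
  set (a0 := aF 0 (G 0)) in *. set (b0 := bF 0 (G 0)) in *.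
  set (gx := / (be * w * w) + (th + k) * be / (w * w * w)).
  assert (Hslope : 0 < gx * a0 + / (be * w) * b0) by (apply (slope_pos k a0 b0 Hk En0 En3 Ea Eb)).
  set (sl := gx * a0 + / (be * w) * b0) in *.
  set (gy := - / (be * w)) in *.
  set (Gm := Rabs gx + Rabs gy). assert (HGm : 0 <= Gm) by (unfold Gm; pose proof (Rabs_pos gx); pose proof (Rabs_pos gy); lra).
  (* With this tolerance the error of strict differentiability costs at most a quarter of the
     slope. *)
  set (eta := sl / (16 * C + 4)). assert (Heta : 0 < eta) by (apply Rdiv_lt_0_compat; lra).
  destruct (SD_mf be w th be1 w0 w2 th0 costh k eta Heta) as [r [Hr HSD]].
  (* The third bound keeps [(xF, yF)] in the region of strict differentiability, the fourth makes
     the variation of [aF] and [bF] along the branch cost at most another quarter of the slope. *)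
  set (eb := Rmin (Rmin e2' 1) (Rmin (r / C) (sl / (8 * (Gm + 1) * (C * D))))).
  assert (HCD : 0 < C * D) by (apply Rmult_lt_0_compat; lra).
  assert (Heb : 0 < eb). { unfold eb. apply Rmin_pos; apply Rmin_pos; [exact He2 | lra | apply Rdiv_lt_0_compat; lra | apply Rdiv_lt_0_compat; [lra | apply Rmult_lt_0_compat; lra]]. }
  assert (Heb1 : eb <= e2') by (eapply Rle_trans; [apply Rmin_l | apply Rmin_l]).
  assert (Heb2 : eb <= 1) by (eapply Rle_trans; [apply Rmin_l | apply Rmin_r]).
  assert (Heb3 : eb <= r / C) by (min_le).
  assert (Heb4 : eb <= sl / (8 * (Gm + 1) * (C * D))) by (min_le).
  assert (HebC : C * eb <= r). { apply Rle_trans with (C * (r / C)). apply Rmult_le_compat_l; lra. right; field; lra. }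
  assert (HebG : 8 * (Gm + 1) * (C * D) * eb <= sl).
  { apply Rle_trans with (8 * (Gm + 1) * (C * D) * (sl / (8 * (Gm + 1) * (C * D)))). apply Rmult_le_compat_l. apply Rmult_le_pos; lra. auto. right; field. split; lra. }
  assert (Hmono : forall ea ec, 0 <= ea <= ec -> ec <= eb ->
     sl / 4 * ((ec - ea) * (ec + ea)) <= (kapE ec (G ec) + k) * / nuE ec (G ec) - (kapE ea (G ea) + k) * / nuE ea (G ea)).
  { intros ea ec Ha Hc.
    assert (Ha' : 0 <= ea <= e2') by lra. assert (Hc' : 0 <= ec <= e2') by lra.
    destruct (Hlip ec ea Hc' Ha') as (L1 & L2 & _). destruct (Hlip ec 0 Hc' ltac:(lra)) as (L3 & L4 & _). fold a0 b0 in L3, L4.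
    rewrite Rminus_0_r, (Rabs_pos_eq ec) in L3, L4 by lra. rewrite (Rabs_pos_eq (ec - ea)) in L1, L2 by lra.
    destruct (Habs ea Ha') as [A1 A2]. destruct (Habs ec Hc') as [A3 A4]. destruct (Habs 0 ltac:(lra)) as [A5 A6]. fold a0 in A5. fold b0 in A6.
    set (P := (ec - ea) * (ec + ea)). assert (HP : 0 <= P) by (unfold P; apply Rmult_le_pos; lra).
    (* The increment of [e^2 z(e)] is [(ec^2 - ea^2) z(0)] up to a relative error of order [eb], the
       same factor [P] standing on both sides. *)
    assert (Hone : forall x z u : R, Rabs (z - x) <= C * D * (ec - ea) -> Rabs (z - u) <= C * D * ec ->
       Rabs (ec * ec * z - ea * ea * x - P * u) <= 2 * (C * D) * eb * P).
    { intros x z u U1 U2. replace (ec * ec * z - ea * ea * x - P * u) with (P * (z - u) + ea * ea * (z - x)) by (unfold P; ring).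
      triang. rewrite !(Rabs_mult _ (_ - _)), (Rabs_pos_eq P), (Rabs_pos_eq (ea * ea)) by pnra.
      assert (P * Rabs (z - u) <= P * (C * D * eb)) by (apply Rmult_le_compat_l; [auto|]; apply Rle_trans with (C * D * ec); [auto|]; apply Rmult_le_compat_l; lra).
      assert (ea * ea * Rabs (z - x) <= ea * ea * (C * D * (ec - ea))) by (apply Rmult_le_compat_l; pnra).
      assert (ea * ea * (ec - ea) <= eb * P). { unfold P. apply Rle_trans with (eb * (ea * (ec - ea))). rewrite Rmult_assoc. apply Rmult_le_compat_r. apply Rmult_le_pos; lra. lra.
        apply Rmult_le_compat_l. lra. rewrite Rmult_comm. apply Rmult_le_compat_l; lra. }
      assert (C * D * (ea * ea * (ec - ea)) <= C * D * (eb * P)) by (apply Rmult_le_compat_l; lra). lra. }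
    pose proof (Hone _ _ a0 L1 L3) as Da. pose proof (Hone _ _ b0 L2 L4) as Db.
    assert (Hbnd : forall e x, 0 <= e <= eb -> Rabs x <= C -> Rabs (e * e * x) <= r).
    { intros e x He Hx. rewrite !Rabs_mult, (Rabs_pos_eq e) by lra. apply Rle_trans with (C * eb); auto.
      pose proof (Rabs_pos x). assert (e * e <= eb) by pnra. rewrite Rmult_comm. apply Rmult_le_compat; pnra. }
    specialize (HSD (xF ec (G ec)) (yF ec (G ec)) (xF ea (G ea)) (yF ea (G ea))).
    assert (Ex : forall e, xF e (G e) - - be = e * e * aF e (G e)) by (intros; unfold xF; ring).
    assert (Ey : forall e, yF e (G e) - 0 = - (e * e * bF e (G e))) by (intros; unfold yF; ring).
    rewrite !Ex, !Ey, !Rabs_Ropp in HSD.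
    specialize (HSD (Hbnd ec _ ltac:(lra) A3) (Hbnd ec _ ltac:(lra) A4) (Hbnd ea _ ltac:(lra) A1) (Hbnd ea _ ltac:(lra) A2)).
    fold gx gy in HSD.
    replace (xF ec (G ec) - xF ea (G ea)) with (P * a0 + (ec * ec * aF ec (G ec) - ea * ea * aF ea (G ea) - P * a0)) in HSD by (unfold xF; ring).
    replace (yF ec (G ec) - yF ea (G ea)) with (- (P * b0 + (ec * ec * bF ec (G ec) - ea * ea * bF ea (G ea) - P * b0))) in HSD by (unfold yF; ring).
    set (da := ec * ec * aF ec (G ec) - ea * ea * aF ea (G ea) - P * a0) in *. set (db := ec * ec * bF ec (G ec) - ea * ea * bF ea (G ea) - P * b0) in *.
    unfold mf in HSD. change (nuf (xF ec (G ec)) (yF ec (G ec))) with (nuE ec (G ec)) in HSD. change (nuf (xF ea (G ea)) (yF ea (G ea))) with (nuE ea (G ea)) in HSD.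
    change (kapf (xF ec (G ec)) (yF ec (G ec))) with (kapE ec (G ec)) in HSD. change (kapf (xF ea (G ea)) (yF ea (G ea))) with (kapE ea (G ea)) in HSD.
    rewrite Rabs_Ropp in HSD.
    set (M := (kapE ec (G ec) + k) * / nuE ec (G ec) - (kapE ea (G ea) + k) * / nuE ea (G ea)) in *.
    set (q := 2 * (C * D) * eb * P) in *.
    assert (Hq0 : 0 <= q) by (unfold q; repeat apply Rmult_le_pos; lra).
    assert (Z1 : Rabs (P * a0 + da) + Rabs (P * b0 + db) <= 2 * C * P + 2 * q).
    { pose proof (Rabs_triang (P * a0) da). pose proof (Rabs_triang (P * b0) db). rewrite Rabs_mult, (Rabs_pos_eq P) in * by auto. pnra. }
    assert (Hqs : (Gm + 1) * q <= sl / 4 * P).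
    { unfold q. replace ((Gm + 1) * (2 * (C * D) * eb * P)) with (8 * (Gm + 1) * (C * D) * eb * P / 4) by field.
      apply (Rmult_le_compat_r P) in HebG; auto. lra. }
    assert (Hq4 : q <= sl / 4 * P) by pnra.
    assert (Z2 : eta * (Rabs (P * a0 + da) + Rabs (P * b0 + db)) <= sl / 4 * P).
    { assert (He2q : eta <= sl / 4 / C). { unfold eta. unfold Rdiv. rewrite Rmult_assoc. apply Rmult_le_compat_l. lra. rewrite <- Rinv_mult. apply Rinv_le_contravar; lra. }
      apply Rle_trans with (eta * (2 * C * P + 2 * q)). apply Rmult_le_compat_l; lra.
      assert (q <= C * P). { unfold q. assert (8 * (C * D) * eb <= sl). { apply Rle_trans with (8 * (Gm + 1) * (C * D) * eb); auto. apply Rmult_le_compat_r. lra. apply Rmult_le_compat_r. lra. lra. }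
        assert (sl <= Gm * C). { unfold sl. apply Rle_trans with (Rabs gx * C + Rabs gy * C). apply Rplus_le_compat.
          eapply Rle_trans. apply Rle_abs. rewrite Rabs_mult. apply Rmult_le_compat_l; auto using Rabs_pos.
          eapply Rle_trans. apply Rle_abs. rewrite Rabs_mult. replace (Rabs (/ (be * w))) with (Rabs gy) by (unfold gy; apply Rabs_Ropp). apply Rmult_le_compat_l; auto using Rabs_pos.
          unfold Gm; lra. }
        assert (2 * (C * D) * eb <= C).
        { apply Rmult_le_reg_l with (4 * (Gm + 1)). lra. apply Rle_trans with sl. lra. assert (0 <= Gm * C) by (apply Rmult_le_pos; lra). lra. }
        apply Rmult_le_compat_r; auto. }
      apply Rle_trans with (eta * (4 * C * P)). apply Rmult_le_compat_l; lra.
      unfold eta. apply Rle_trans with (sl / (16 * C + 4) * ((4 * C + 1) * P)). apply Rmult_le_compat_l; [exact (Rlt_le _ _ Heta)|]. apply Rmult_le_compat_r; lra.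
      right; field; lra. }
    assert (Z3 : Rabs (gx * da) <= Rabs gx * q) by (rewrite Rabs_mult; apply Rmult_le_compat_l; auto using Rabs_pos).
    assert (Z4 : Rabs (gy * db) <= Rabs gy * q) by (rewrite Rabs_mult; apply Rmult_le_compat_l; auto using Rabs_pos).
    assert (Z5 : Rabs gx * q + Rabs gy * q <= sl / 4 * P). { apply Rle_trans with ((Gm + 1) * q); auto. unfold Gm. lra. }
    assert (Esl : sl * P = gx * (P * a0) - gy * (P * b0)) by (unfold sl, gy; ring).
    unabs HSD. unabs Z3. unabs Z4. lra. }
  set (L := C * D + CK be w * (4 * C) + CK' be w * (4 * C) + rho + rho').
  assert (P1L : 0 < CK be w * (4 * C)) by (apply Rmult_lt_0_compat; lra). assert (P2L : 0 < CK' be w * (4 * C)) by (apply Rmult_lt_0_compat; lra).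
  exists eb, L, (sl / 4), (fun e => K (G e)), (fun e => K' (G e)), (fun e => nuE e (G e)), (fun e => kapE e (G e)).
  split; [lra|]. split; [unfold L; lra|]. split; [lra|]. split; [|split; [|split; [|split; [|split]]]].
  - intros e He. destruct (HG e ltac:(lra)) as [Bg Fg]. destruct (ball_K (G e) Bg) as (K1 & K2 & K3 & K4 & K5 & K6 & K7 & K8).
    destruct (Hdom e (G e) (H21 e ltac:(lra)) Bg) as (D1 & D2 & D3 & D4).
    split; [exact K1|]. split; [exact K2|]. split; [exact K4|].
    split. intros t; specialize (K7 t); unfold L; lra. split. intros t; specialize (K8 t); unfold L; lra.
    split; [exact D3|]. split; [exact D4|].
    destruct (nk_sol _ _ D1 D2) as [R1 R2].
    intros s. apply (vE_solves e (G e) (nuE e (G e)) (kapE e (G e)) Bg Fg R1 R2 s).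
  - intros ea ec Ha Hc. destruct (Hlip ea ec ltac:(lra) ltac:(lra)) as (_ & _ & L3 & L4 & L5).
    pose proof (Rabs_pos (ea - ec)) as Hp. assert (Hq : 0 <= (ea + ec) * Rabs (ea - ec)) by (apply Rmult_le_pos; lra).
    assert (M1 : forall c x, c <= L -> 0 <= x -> c * x <= L * x) by (intros; apply Rmult_le_compat_r; auto).
    repeat split; try (intros t; destruct (L5 t)).
    eapply Rle_trans; [eassumption|]. apply M1; auto; unfold L; lra.
    eapply Rle_trans; [eassumption|]. apply M1; auto; unfold L; lra.
    eapply Rle_trans; [eassumption|]. apply M1; auto; unfold L; lra.
    eapply Rle_trans; [eassumption|]. apply M1; auto; unfold L; lra.
  - apply nuE_0.
  - apply kapE_0.
  - exact Hmono.
  - destruct (periodic_unique eb Heb) as [et [Het HU]]. exists et. split; auto.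
    intros v v' nu' kap' e H1 H2 H3 H4 H5 H6 H7 H8 H9 H10.
    destruct (HU v v' nu' kap' e H1 H2 H3 H4 H5 H6 H7 H8 H9 H10) as [Z|[He [g [Bg [Fg [N1 [N2 Ev]]]]]]]; [left; auto|right].
    assert (Fg' : forall t, Phi e g t = g t) by (intros t; rewrite <- (Fg t); unfold Phi, PhiG; rewrite N1, N2; reflexivity).
    assert (Eg := HGeq e g ltac:(lra) Bg Fg'). subst g. repeat split; try lra; auto.
Qed.
End PartA.

(** * Decay for the linearised equation *)

Section Symbol.
Variables be w th m : R.
Hypothesis be1 : 1 < be.
Hypothesis w0 : 0 < w.
Hypothesis w2 : w * w = be * be - 1.
Hypothesis th0 : 0 < th < PI.
Hypothesis costh : be * cos th = -1.
Hypothesis sinth : be * sin th = w.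
Hypothesis mw : m * w = th.

(* The characteristic function [lambda + m + m be e^(-lambda)] at [lambda = sg + i y]. *)
Definition Lr sg y := sg + m + m * be * exp (- sg) * cos y.
Definition Li sg y := y - m * be * exp (- sg) * sin y.

Lemma m_pos : 0 < m.
Proof. apply Rmult_lt_reg_r with w; auto. rewrite mw; lra. Qed.
Lemma mbe2 : m * be * (m * be) = m * m + th * th.
Proof. replace (m * be * (m * be)) with (m * m * (be * be)) by ring. replace (be * be) with (1 + w * w) by lra. rewrite <- mw. ring. Qed.

Lemma abs_le_sqrt a b x : x <= 0 \/ x * x <= a * a + b * b -> x <= sqrt (a * a + b * b).
Proof.
  intros [H|H]. apply Rle_trans with 0; auto. apply sqrt_pos.
  apply Rsqr_incr_0_var; [|apply sqrt_pos]. unfold Rsqr. rewrite sqrt_sqrt; pnra.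
Qed.

Definition Lmod sg y := sqrt (Lr sg y * Lr sg y + Li sg y * Li sg y).

Lemma exp_neg_le sg : 0 <= sg -> 0 < exp (- sg) <= 1.
Proof. intros. split. apply exp_pos. rewrite <- exp_0. destruct H. left; apply exp_increasing; lra. subst; rewrite Ropp_0; lra. Qed.

(** The triangle inequality for [lambda + m] and [m be e^(-lambda)], with [e^(-sg) <= 1]. *)
Lemma Lmod_modulus sg y : 0 <= sg -> sqrt ((sg + m) * (sg + m) + y * y) - m * be <= Lmod sg y.
Proof.
  intros Hs. pose proof m_pos as Hm. destruct (exp_neg_le sg Hs) as [E1 E2].
  set (S := sqrt ((sg + m) * (sg + m) + y * y)).
  assert (HS : S * S = (sg + m) * (sg + m) + y * y) by (apply sqrt_sqrt; pnra). assert (HS0 : 0 <= S) by apply sqrt_pos.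
  set (q := m * be * exp (- sg)). assert (Hmb : 0 < m * be) by pnra. assert (Hq : 0 <= q <= m * be) by (unfold q; split; [apply Rmult_le_pos; lra|]; rewrite <- (Rmult_1_r (m * be)) at 2; apply Rmult_le_compat_l; lra).
  apply Rle_trans with (S - q). lra. apply abs_le_sqrt.
  unfold Lr, Li. fold q. pose proof (sin2_cos2 y) as E. unfold Rsqr in E.
  set (c := cos y) in *. set (n := sin y) in *. right.
  replace ((sg + m + q * c) * (sg + m + q * c) + (y - q * n) * (y - q * n)) with (S * S + q * q * (n * n + c * c) + 2 * q * ((sg + m) * c - y * n)) by (rewrite HS; ring). rewrite E.
  enough (- S <= (sg + m) * c - y * n) by pnra.
  assert (((sg + m) * c - y * n) * ((sg + m) * c - y * n) <= S * S).
  { rewrite HS. pose proof (Rle_0_sqr ((sg + m) * n + y * c)) as Z. unfold Rsqr in Z.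
    assert (((sg + m) * (sg + m) + y * y) * (n * n + c * c) = ((sg + m) * c - y * n) * ((sg + m) * c - y * n) + ((sg + m) * n + y * c) * ((sg + m) * n + y * c)) by ring.
    rewrite E in H. lra. }
  destruct (Rle_lt_dec (- S) ((sg + m) * c - y * n)); auto. pnra.
Qed.

(* [e^(iy) Delta] has the same modulus and a transparent imaginary part. *)
Lemma Lmod_im sg y : (sg + m) * sin y + y * cos y <= Lmod sg y /\ (sg + m) * cos y - y * sin y + m * be * exp (- sg) <= Lmod sg y.
Proof.
  set (q := m * be * exp (- sg)). pose proof (sin2_cos2 y) as E. unfold Rsqr in E.
  assert (X : Lr sg y * Lr sg y + Li sg y * Li sg y = ((sg + m) * sin y + y * cos y) * ((sg + m) * sin y + y * cos y) + ((sg + m) * cos y - y * sin y + q) * ((sg + m) * cos y - y * sin y + q)).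
  { unfold Lr, Li. fold q. set (c := cos y) in *. set (n := sin y) in *.
    transitivity ((sg + m) * (sg + m) + y * y + q * q * (n * n + c * c) + 2 * q * ((sg + m) * c - y * n)). ring.
    transitivity (((sg + m) * (sg + m) + y * y) * (n * n + c * c) + q * q + 2 * q * ((sg + m) * c - y * n)). rewrite E; ring. ring. }
  unfold Lmod. rewrite X. split; apply abs_le_sqrt; right; match goal with |- _ <= ?a * ?a + ?b * ?b => pose proof (Rle_0_sqr a); pose proof (Rle_0_sqr b); unfold Rsqr in *; lra end.
Qed.

(** Quantitative form of: [i th] is simple and the only root with nonnegative real and imaginary
    part. For [y >= th] the modulus of [lambda + m] is large enough; below [th] it is not, and the
    rotated parts of [Lmod_im] are used. There [th < PI] enters, which singles out the first
    bifurcation value. *)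
Lemma Lmod_lower : exists c, 0 < c /\ forall sg y, 0 <= sg -> 0 <= y -> c * (sg + Rabs (y - th)) <= Lmod sg y.
Proof.
  pose proof m_pos as Hm. assert (Hmb : 0 < m * be) by pnra. pose proof mbe2 as Hb2. pose proof PI_RGT_0.
  assert (HmB : m <= m * be) by pnra. assert (HtB : th <= m * be) by pnra.
  (* Close to [y = 0] the rotated real part is at least [m / 8]. Elsewhere the rotated imaginary
     part works, because [th cos y + m sin y = m be sin (th - y)] is nonnegative. *)
  assert (H1 : exists c1, 0 < c1 /\ forall sg y, 0 <= sg -> 0 <= y <= th -> c1 * (th - y) <= Lmod sg y).
  { set (y1 := Rmin (PI / 4) (Rmin (m / 2) th)).
    assert (Hy1 : 0 < y1) by (unfold y1; repeat apply Rmin_pos; lra).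
    assert (Hy1a : y1 <= PI / 4) by apply Rmin_l.
    assert (Hy1b : y1 <= m / 2) by (min_le).
    assert (Hy1c : y1 <= th) by (min_le).
    assert (Hs1 : 0 < sin y1) by (apply sin_gt_0; lra). assert (Hst : 0 < sin th) by (apply sin_gt_0; lra).
    set (s1 := Rmin (sin y1) (sin th)). assert (Hs1p : 0 < s1) by (apply Rmin_pos; auto).
    exists (Rmin (m / th * s1) (m / 8 / th)). split. apply Rmin_pos; repeat apply Rdiv_lt_0_compat; try lra. apply Rmult_lt_0_compat; auto. apply Rdiv_lt_0_compat; lra.
    intros sg y Hs Hy. destruct (Rle_lt_dec y1 y) as [Hle|Hlt].
    - apply Rle_trans with (m / th * s1 * (th - y)). apply Rmult_le_compat_r. lra. apply Rmin_l.
      destruct (Lmod_im sg y) as [Q _]. eapply Rle_trans; [|apply Q].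
      assert (Hsy : s1 <= sin y).
      { destruct (Rle_lt_dec y (PI / 2)). apply Rle_trans with (sin y1). apply Rmin_l. apply sin_incr_1; lra.
        apply Rle_trans with (sin th). apply Rmin_r. apply sin_decr_1; lra. }
      assert (Hyt : 0 <= sin (th - y)) by (apply sin_ge_0; lra).
      rewrite sin_minus in Hyt.
      assert (E1 : sin th = th / (m * be)). { apply Rmult_eq_reg_l with be; [|lra]. rewrite sinth. rewrite <- mw. field. lra. }
      assert (E2 : cos th = - m / (m * be)). { apply Rmult_eq_reg_l with be; [|lra]. rewrite costh. field. lra. }
      rewrite E1, E2 in Hyt.
      assert (Hyt2 : 0 <= th * cos y + m * sin y).
      { replace (th * cos y + m * sin y) with (m * be * (th / (m * be) * cos y - - m / (m * be) * sin y)) by (field; lra). apply Rmult_le_pos; lra. }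
      assert (Hf : th * (m * sin y + y * cos y) = y * (th * cos y + m * sin y) + (th - y) * m * sin y) by ring.
      apply Rmult_le_reg_l with th. lra. replace (th * (m / th * s1 * (th - y))) with ((th - y) * m * s1) by (field; lra).
      assert (0 <= sg * sin y) by (apply Rmult_le_pos; lra).
      assert (0 <= y * (th * cos y + m * sin y)) by (apply Rmult_le_pos; lra).
      assert ((th - y) * m * s1 <= (th - y) * m * sin y). { apply Rmult_le_compat_l. apply Rmult_le_pos; lra. auto. }
      assert (0 <= th * (sg * sin y)) by (apply Rmult_le_pos; lra). lra.
    - apply Rle_trans with (m / 8 / th * (th - y)). apply Rmult_le_compat_r. lra. apply Rmin_r.
      destruct (Lmod_im sg y) as [_ Q]. eapply Rle_trans; [|apply Q].
      apply Rle_trans with (m / 8). apply Rle_trans with (m / 8 / th * th). apply Rmult_le_compat_l. apply Rlt_le, Rdiv_lt_0_compat; lra. lra. right; field; lra.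
      assert (Hc : 5 / 8 <= cos y).
      { apply Rle_trans with (cos (PI / 4)). rewrite cos_PI4. apply Rmult_le_reg_r with (sqrt 2). apply sqrt_lt_R0; lra.
        unfold Rdiv at 2. rewrite Rmult_1_l, Rinv_l. 2: apply Rgt_not_eq, sqrt_lt_R0; lra.
        assert (sqrt 2 <= 8 / 5). { apply Rsqr_incr_0_var; [|lra]. unfold Rsqr. rewrite sqrt_sqrt; lra. } lra. apply cos_decr_1; lra. }
      pose proof (SIN_bound y). destruct (exp_neg_le sg Hs). assert (0 <= m * be * exp (- sg)) by (apply Rmult_le_pos; lra).
      assert (y * sin y <= m / 2) by pnra. assert (5 / 8 * m <= (sg + m) * cos y) by pnra. lra. }
  destruct H1 as [c1 [Hc1 H1]].
  (* Since [(m be)^2 = m^2 + th^2], the square of the modulus of [lambda + m] is compared with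
     [(m be + c ...)^2] by expansion around [i th]. *)
  assert (H2 : exists c2, 0 < c2 /\ forall sg y, 0 <= sg -> 0 <= y -> c2 * (sg + (y - th)) <= Lmod sg y \/ (y <= th /\ c2 * sg - (th - y) <= Lmod sg y)).
  { set (c2 := Rmin (m / (m * be)) (th / (2 * (m * be)))).
    exists (Rmin (1/2) (Rmin (m / (m + m * be)) (th / (th + m + m * be)))).
    split. repeat apply Rmin_pos; try lra; apply Rdiv_lt_0_compat; lra.
    intros sg y Hs Hy. set (c := Rmin (1/2) _).
    assert (Hc0 : 0 < c) by (unfold c; repeat apply Rmin_pos; try lra; apply Rdiv_lt_0_compat; lra).
    assert (Hca : c <= 1 / 2) by apply Rmin_l.
    assert (Hcb : c <= m / (m + m * be)) by (min_le).
    assert (Hcc : c <= th / (th + m + m * be)) by (min_le).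
    assert (Hcb' : c * (m + m * be) <= m). { apply Rle_trans with (m / (m + m * be) * (m + m * be)). apply Rmult_le_compat_r; lra. right; field; lra. }
    assert (Hcc' : c * (th + m + m * be) <= th). { apply Rle_trans with (th / (th + m + m * be) * (th + m + m * be)). apply Rmult_le_compat_r; lra. right; field; lra. }
    assert (Z1 : 0 <= c * m) by (apply Rmult_le_pos; lra). assert (Z2 : 0 <= c * (m * be)) by (apply Rmult_le_pos; lra). assert (Z3 : 0 <= c * th) by (apply Rmult_le_pos; lra).
    assert (Q := Lmod_modulus sg y Hs).
    destruct (Rle_lt_dec th y) as [Hty|Hty].
    - left. eapply Rle_trans; [|apply Q].
      enough (m * be + c * (sg + (y - th)) <= sqrt ((sg + m) * (sg + m) + y * y)) by lra. apply abs_le_sqrt. right.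
      set (u := y - th). assert (Hu : 0 <= u) by (unfold u; lra). replace y with (th + u) by (unfold u; ring).
      replace ((m * be + c * (sg + u)) * (m * be + c * (sg + u))) with (m * be * (m * be) + 2 * (m * be) * c * (sg + u) + c * c * ((sg + u) * (sg + u))) by ring.
      rewrite Hb2. replace ((sg + m) * (sg + m) + (th + u) * (th + u)) with (m * m + th * th + 2 * m * sg + 2 * th * u + sg * sg + u * u) by ring.
      assert (m * be * c * sg <= m * sg) by (apply Rmult_le_compat_r; lra).
      assert (m * be * c * u <= th * u) by (apply Rmult_le_compat_r; lra).
      assert (c * c <= 1 / 4) by pnra.
      assert (c * c * ((sg + u) * (sg + u)) <= 1 / 4 * ((sg + u) * (sg + u))) by (apply Rmult_le_compat_r; pnra).
      pose proof (Rle_0_sqr (sg - u)) as Y1. pose proof (Rle_0_sqr sg) as Y2. pose proof (Rle_0_sqr u) as Y3. unfold Rsqr in *. lra.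
    - right. split. lra. eapply Rle_trans; [|apply Q].
      enough (m * be + c * sg - (th - y) <= sqrt ((sg + m) * (sg + m) + y * y)) by lra. apply abs_le_sqrt.
      set (u := th - y). assert (Hu : 0 <= u <= th) by (unfold u; lra). replace y with (th - u) by (unfold u; ring).
      destruct (Rle_lt_dec (m * be + c * sg - u) 0); auto. right.
      replace ((m * be + c * sg - u) * (m * be + c * sg - u)) with (m * be * (m * be) + 2 * (m * be) * c * sg + c * c * (sg * sg) - 2 * (m * be) * u - 2 * c * sg * u + u * u) by ring.
      rewrite Hb2. assert (m * be * c * sg <= m * sg) by (apply Rmult_le_compat_r; lra). assert (c * c <= 1) by pnra.
      pose proof (Rle_0_sqr sg) as Y2. unfold Rsqr in Y2. assert (c * c * (sg * sg) <= 1 * (sg * sg)) by (apply Rmult_le_compat_r; lra). assert (0 <= c * sg * u) by (repeat apply Rmult_le_pos; lra).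
      assert (th * u <= m * be * u) by (apply Rmult_le_compat_r; lra). pose proof (Rle_0_sqr u) as Y3. unfold Rsqr in Y3. lra. }
  destruct H2 as [c2 [Hc2 H2]].
  (* Below [th], adding [c1] times the modulus bound and [c2 + 1] times [H1] cancels the negative
     multiple of [th - y]. *)
  set (c3 := c1 * c2 / (c1 + (c2 + 1))). assert (Hc3 : 0 < c3) by (apply Rdiv_lt_0_compat; pnra).
  exists (Rmin c2 (Rmin (c1 / 2) (c3 / 2))). split. repeat apply Rmin_pos; lra.
  intros sg y Hs Hy.
  assert (HL0 : 0 <= Lmod sg y) by apply sqrt_pos.
  assert (Ra : Rmin c2 (Rmin (c1 / 2) (c3 / 2)) <= c2) by apply Rmin_l.
  assert (Rb : Rmin c2 (Rmin (c1 / 2) (c3 / 2)) <= c1 / 2) by (min_le).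
  assert (Rc : Rmin c2 (Rmin (c1 / 2) (c3 / 2)) <= c3 / 2) by (min_le).
  set (c := Rmin c2 _) in *.
  destruct (Rle_lt_dec th y) as [Hty|Hty].
  - rewrite Rabs_pos_eq by lra. destruct (H2 sg y Hs Hy) as [Q|[Q1 Q2]].
    apply Rle_trans with (c2 * (sg + (y - th))); auto. apply Rmult_le_compat_r; lra.
    replace y with th in * by lra. apply Rle_trans with (c2 * sg). rewrite Rminus_diag, Rplus_0_r. apply Rmult_le_compat_r; lra. lra.
  - rewrite Rabs_left by lra. pose proof (H1 sg y Hs ltac:(lra)) as Q1.
    assert (Q2 : c2 * sg - (c2 + 1) * (th - y) <= Lmod sg y).
    { destruct (H2 sg y Hs Hy) as [Q|[_ Q]]; pnra. }
    assert (0 < c2 + 1) by lra.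
    assert (Q3 : c1 * c2 * sg <= (c1 + (c2 + 1)) * Lmod sg y) by pnra.
    assert (Q4 : c3 * sg <= Lmod sg y).
    { apply Rmult_le_reg_l with (c1 + (c2 + 1)). lra. replace ((c1 + (c2 + 1)) * (c3 * sg)) with (c1 * c2 * sg) by (unfold c3; field; lra). auto. }
    replace (c * (sg + - (y - th))) with (c * sg + c * (th - y)) by ring.
    assert (c * sg <= c3 / 2 * sg) by (apply Rmult_le_compat_r; lra). assert (c * (th - y) <= c1 / 2 * (th - y)) by (apply Rmult_le_compat_r; lra). lra.
Qed.
End Symbol.

(** The derivative is only required inside: a solution need not be differentiable at time 0, where
    the history ends. *)
Lemma MVT_open (g g' : R -> R) a b : a < b -> cont g -> (forall t, a < t < b -> is_derive g t (g' t)) ->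
  exists c, a < c < b /\ g b - g a = g' c * (b - a).
Proof.
  intros Hab Hc Hd.
  assert (pr1 : forall c, a < c < b -> derivable_pt g c) by (intros c Hc'; exists (g' c); apply is_derive_Reals; auto).
  assert (pr2 : forall c, a < c < b -> derivable_pt id c) by (intros; apply derivable_pt_id).
  destruct (MVT g id a b pr1 pr2 Hab) as [c [P E]].
  intros; now apply cont_pt. intros; apply cont_pt. apply cont_id.
  exists c; split; auto.
  replace (derive_pt g c (pr1 c P)) with (g' c) in E by (symmetry; apply derive_pt_eq_0, is_derive_Reals; auto).
  replace (derive_pt id c (pr2 c P)) with 1 in E by (symmetry; apply derive_pt_eq_0, derivable_pt_lim_id).
  unfold id in E. lra.
Qed.
Lemma const_open (g : R -> R) a t : cont g -> (forall t, a < t -> is_derive g t 0) -> a <= t -> g t = g a.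
Proof.
  intros Hc Hd [Ht|<-]; auto. destruct (MVT_open g (fun _ => 0) a t Ht Hc) as [c [_ E]]. intros; apply Hd; lra. lra.
Qed.

(* Delayed Gronwall estimate; the derivative bound is only required while the solution stays below [Kmax]. *)
Lemma delay_growth (y : R -> R) B D a ph Kmax : cont y -> 0 <= B -> 0 <= D -> 0 <= a -> 0 <= ph ->
  (forall s, -1 <= s <= 0 -> Rabs (y s) <= B) -> (B + ph * D) * exp (a * D) < Kmax ->
  (forall t Y, 0 < t < D -> (forall s, -1 <= s <= t -> Rabs (y s) <= Y) -> Y <= Kmax -> exists l, is_derive y t l /\ Rabs l <= a * Y + ph) ->
  forall t, 0 <= t <= D -> Rabs (y t) <= (B + ph * t) * exp (a * t).
Proof.
  intros Cy HB HD Ha Hph Hh HK Hder.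
  (* The slack [d] makes the comparison strict at time 0, so that the bound can be pushed beyond any
     time up to which it holds; it tends to 0 at the end. *)
  assert (Main : forall d, 0 < d -> (B + d + ph * D) * exp (a * D) <= Kmax -> forall t, 0 <= t <= D -> Rabs (y t) <= (B + d + ph * t) * exp (a * t)).
  { intros d Hd HKd. set (M := fun t => (B + d + ph * t) * exp (a * t)).
    set (M' := fun t => ph * exp (a * t) + a * M t).
    assert (DM : forall t, is_derive M t (M' t)). { intros t. unfold M', M. auto_derive; auto. ring. }
    assert (CM : cont M) by exact (is_derive_cont _ _ DM).
    assert (Mmono : forall s t, 0 <= s <= t -> M s <= M t).
    { intros s t Hst. unfold M. apply Rmult_le_compat. pnra. left; apply exp_pos. pnra.
      destruct (Rle_lt_or_eq_dec (a * s) (a * t)) as [H|H]. pnra. left; now apply exp_increasing. rewrite H; lra. }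
    assert (M0 : B < M 0) by (unfold M; rewrite !Rmult_0_r, exp_0; lra).
    assert (Hex : forall t, 0 < t -> 1 <= exp (a * t)). { intros t Ht. rewrite <- exp_0. destruct (Rle_lt_or_eq_dec 0 (a * t)) as [H|H]. pnra. left; now apply exp_increasing. rewrite <- H; lra. }
    (* sup of the times up to which the strict bound holds *)
    set (E := fun t => 0 <= t <= D /\ forall s, 0 <= s <= t -> Rabs (y s) <= M s).
    destruct (completeness E) as [T [HT1 HT2]].
    { exists D. intros t [Ht _]. lra. }
    { exists 0. split. lra. intros s Hs. replace s with 0 by lra. specialize (Hh 0 ltac:(lra)). lra. }
    assert (HT0 : 0 <= T). { apply HT1. split. lra. intros s Hs. replace s with 0 by lra. specialize (Hh 0 ltac:(lra)). lra. }
    assert (HTD : T <= D) by (apply HT2; intros t [Ht _]; lra).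
    assert (Hbelow : forall s, 0 <= s < T -> Rabs (y s) <= M s).
    { intros s Hs. destruct (classic (exists t, E t /\ s < t)) as [[t [[_ Et] Hst]]|N]. apply Et; lra.
      assert (T <= s). { apply HT2. intros t Et. destruct (Rle_lt_dec t s); auto. exfalso; apply N; exists t; auto. } lra. }
    assert (HTT : Rabs (y T) < M T).
    { assert (Hsg : forall sg, sg = 1 \/ sg = -1 -> sg * y T < M T).
      { intros sg Hsg. destruct HT0 as [HT0|HT0].
        2:{ rewrite <- HT0. specialize (Hh 0 ltac:(lra)). unabs Hh. destruct Hsg as [-> | ->]; lra. }
        assert (Hg : M 0 - sg * y 0 <= M T - sg * y T).
        { destruct (Rle_lt_dec (M 0 - sg * y 0) (M T - sg * y T)) as [|Hlt]; auto. exfalso.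
          assert (Hdy : forall t, 0 < t < T -> is_derive y t (Derive y t) /\ Rabs (Derive y t) <= a * M t + ph).
          { intros t Ht. destruct (Hder t (M t)) as [l [Hl1 Hl2]]. lra.
            - intros s Hs. destruct (Rle_lt_dec s 0). apply Rle_trans with B. apply Hh; lra. apply Rle_trans with (M 0). lra. apply Mmono; lra.
              apply Rle_trans with (M s). apply Hbelow; lra. apply Mmono; lra.
            - apply Rle_trans with (M D). apply Mmono; lra. exact HKd.
            - rewrite (is_derive_unique _ _ _ Hl1). auto. }
          destruct (MVT_open (fun t => M t - sg * y t) (fun t => M' t - sg * Derive y t) 0 T HT0) as [c [Hc Ec]].
          ct. intros t Ht. apply D_minus. apply DM. apply D_scal. apply Hdy; auto.
          destruct (Hdy c Hc) as [_ Hb]. unabs Hb. specialize (Hex c ltac:(lra)).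
          assert (0 <= M' c - sg * Derive y c). { unfold M'. assert (ph <= ph * exp (a * c)) by pnra. destruct Hsg as [-> | ->]; lra. }
          assert (0 <= (M' c - sg * Derive y c) * (T - 0)) by (apply Rmult_le_pos; lra). lra. }
        specialize (Hh 0 ltac:(lra)). unabs Hh. destruct Hsg as [-> | ->]; lra. }
      apply Rabs_def1. specialize (Hsg 1 ltac:(auto)); lra. specialize (Hsg (-1) ltac:(auto)); lra. }
    assert (HTD' : T = D).
    { destruct (Rle_lt_or_eq_dec T D HTD) as [Hlt|]; auto. exfalso.
      assert (Cg : cont (fun t => M t - Rabs (y t))) by ct.
      destruct (proj1 (cont_eps _) Cg T (M T - Rabs (y T))) as [r [Hr Hx]]. lra.
      set (t := T + Rmin (r / 2) (D - T)).
      assert (0 < Rmin (r / 2) (D - T)) by (apply Rmin_pos; lra). assert (Rmin (r / 2) (D - T) <= r / 2) by apply Rmin_l. assert (Rmin (r / 2) (D - T) <= D - T) by apply Rmin_r.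
      assert (Et : E t). { split. unfold t; lra. intros s Hs. destruct (Rlt_le_dec s T). apply Hbelow; lra.
        specialize (Hx s). rewrite Rabs_pos_eq in Hx by lra. specialize (Hx ltac:(unfold t in Hs; lra)). apply Rabs_def2 in Hx. lra. }
      specialize (HT1 t Et). unfold t in HT1. lra. }
    intros t Ht. destruct (Rle_lt_or_eq_dec t T) as [H| ->]. lra. apply Hbelow; lra. left; exact HTT. }
  intros t Ht. apply le_epsilon. intros eps He.
  assert (HeD : 0 < exp (a * D)) by apply exp_pos.
  set (d := Rmin ((Kmax - (B + ph * D) * exp (a * D)) / exp (a * D)) (eps / exp (a * D))).
  assert (Hd : 0 < d) by (apply Rmin_pos; apply Rdiv_lt_0_compat; lra).
  assert (d1 : d * exp (a * D) <= Kmax - (B + ph * D) * exp (a * D)).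
  { apply Rle_trans with ((Kmax - (B + ph * D) * exp (a * D)) / exp (a * D) * exp (a * D)). apply Rmult_le_compat_r. lra. apply Rmin_l. right; field; lra. }
  assert (d2 : d * exp (a * D) <= eps).
  { apply Rle_trans with (eps / exp (a * D) * exp (a * D)). apply Rmult_le_compat_r. lra. apply Rmin_r. right; field; lra. }
  specialize (Main d Hd ltac:(lra) t Ht).
  assert (exp (a * t) <= exp (a * D)). { destruct (Rle_lt_or_eq_dec (a * t) (a * D)) as [H|H]. pnra. left; now apply exp_increasing. rewrite H; lra. }
  assert (d * exp (a * t) <= d * exp (a * D)) by (apply Rmult_le_compat_l; lra). lra.
Qed.

(** * The critical projection of a segment *)

Section Window.
Variables be w th m : R.
Hypothesis be1 : 1 < be.
Hypothesis w0 : 0 < w.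
Hypothesis th0 : 0 < th < PI.
Hypothesis costh : be * cos th = -1.
Hypothesis sinth : be * sin th = w.
Hypothesis mw : m * w = th.

(* [Ic x t] and [Is x t] are the integrals of [cos (th (s - t + 1)) * x s] and [sin (th (s - t + 1)) * x s]
   over [t - 1 <= s <= t]. *)
Definition Wc x t := RI (fun s => cos (th * s) * x s) (t - 1) t.
Definition Ws x t := RI (fun s => sin (th * s) * x s) (t - 1) t.
Definition Ic x t := cos (th * (t - 1)) * Wc x t + sin (th * (t - 1)) * Ws x t.
Definition Is x t := cos (th * (t - 1)) * Ws x t - sin (th * (t - 1)) * Wc x t.
(** [Z1 + i Z2] is the pairing of the segment at time [t] with the adjoint eigenfunction; by [D_Z]
    it satisfies [Z' = i th Z + F]. *)
Definition Z1 x t := x t - m * be * Ic x t.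
Definition Z2 x t := m * be * Is x t.

Lemma Ic_int x t : cont x -> Ic x t = RI (fun s => cos (th * (s - t + 1)) * x s) (t - 1) t.
Proof.
  intros Hx. unfold Ic, Wc, Ws. rewrite <- !RI_scal, <- RI_plus by ct. apply RI_ext. intros s.
  replace (th * (s - t + 1)) with (th * s - th * (t - 1)) by ring. rewrite cos_minus. ring.
Qed.
Lemma Is_int x t : cont x -> Is x t = RI (fun s => sin (th * (s - t + 1)) * x s) (t - 1) t.
Proof.
  intros Hx. unfold Is, Wc, Ws. rewrite <- !RI_scal, <- RI_minus by ct. apply RI_ext. intros s.
  replace (th * (s - t + 1)) with (th * s - th * (t - 1)) by ring. rewrite sin_minus. ring.
Qed.
Lemma D_Ic x t : cont x -> is_derive (Ic x) t (th * Is x t + cos th * x t - x (t - 1)).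
Proof.
  intros Hx. assert (Cc : cont (fun s => cos (th * s) * x s)) by ct. assert (Cs : cont (fun s => sin (th * s) * x s)) by ct.
  eapply is_derive_eq. unfold Ic. apply D_plus; apply D_mult.
  instantiate (1 := - th * sin (th * (t - 1))). auto_derive; auto; unfold Rminus; ring. now apply (D_window (fun s => cos (th * s) * x s)).
  instantiate (1 := th * cos (th * (t - 1))). auto_derive; auto; unfold Rminus; ring. now apply (D_window (fun s => sin (th * s) * x s)).
  unfold Is. cbv beta.
  assert (Ec : cos th = cos (th * t) * cos (th * (t - 1)) + sin (th * t) * sin (th * (t - 1))) by (rewrite <- cos_minus; f_equal; ring).
  pose proof (sin2_cos2 (th * (t - 1))) as E. unfold Rsqr in E. rewrite Ec.
  set (C0 := cos (th * (t - 1))) in *. set (S0 := sin (th * (t - 1))) in *.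
  transitivity (th * (C0 * Ws x t - S0 * Wc x t) + (cos (th * t) * C0 + sin (th * t) * S0) * x t - (S0 * S0 + C0 * C0) * x (t - 1)). ring.
  rewrite E. ring.
Qed.
Lemma D_Is x t : cont x -> is_derive (Is x) t (- th * Ic x t + sin th * x t).
Proof.
  intros Hx. assert (Cc : cont (fun s => cos (th * s) * x s)) by ct. assert (Cs : cont (fun s => sin (th * s) * x s)) by ct.
  eapply is_derive_eq. unfold Is. apply D_minus; apply D_mult.
  instantiate (1 := - th * sin (th * (t - 1))). auto_derive; auto; unfold Rminus; ring. now apply (D_window (fun s => sin (th * s) * x s)).
  instantiate (1 := th * cos (th * (t - 1))). auto_derive; auto; unfold Rminus; ring. now apply (D_window (fun s => cos (th * s) * x s)).
  unfold Ic. cbv beta.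
  replace (sin th) with (sin (th * t) * cos (th * (t - 1)) - cos (th * t) * sin (th * (t - 1))) by (rewrite <- sin_minus; f_equal; ring). ring.
Qed.
Lemma cont_Ic x : cont x -> cont (Ic x).
Proof. intros H. exact (is_derive_cont _ _ (fun t => D_Ic x t H)). Qed.
Lemma cont_Is x : cont x -> cont (Is x).
Proof. intros H. exact (is_derive_cont _ _ (fun t => D_Is x t H)). Qed.

Lemma D_Z x t F : cont x -> is_derive x t (- m * (x t + be * x (t - 1)) + F) ->
  is_derive (Z1 x) t (F - th * Z2 x t) /\ is_derive (Z2 x) t (th * Z1 x t).
Proof.
  intros Hx Hd. split; eapply is_derive_eq.
  - unfold Z1. apply D_minus. apply Hd. apply D_scal. now apply D_Ic.
  - unfold Z2. replace (m * be * (th * Is x t + cos th * x t - x (t - 1))) with (th * (m * be * Is x t) + m * (be * cos th) * x t - m * be * x (t - 1)) by ring.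
    rewrite costh. ring.
  - unfold Z2. apply D_scal. now apply D_Is.
  - unfold Z1. replace (m * be * (- th * Ic x t + sin th * x t)) with (- th * (m * be * Ic x t) + m * (be * sin th) * x t) by ring.
    rewrite sinth, mw. ring.
Qed.

Lemma window_bound (x : R -> R) t B : cont x -> (forall s, t - 1 <= s <= t -> Rabs (x s) <= B) -> Rabs (Ic x t) <= B /\ Rabs (Is x t) <= B.
Proof.
  intros Hx HB. rewrite Ic_int, Is_int by auto.
  replace B with ((t - (t - 1)) * B) at 1 2 by ring. split; (apply RI_abs; [lra | ct |]); intros s Hs; rewrite Rabs_mult; specialize (HB s Hs); pose proof (Rabs_pos (x s)).
  pose proof (abs_cos (th * (s - t + 1))). pose proof (Rabs_pos (cos (th * (s - t + 1)))). pnra.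
  pose proof (abs_sin (th * (s - t + 1))). pose proof (Rabs_pos (sin (th * (s - t + 1)))). pnra.
Qed.
Lemma Ic_lin x y a t : cont x -> cont y -> Ic (fun s => x s + a * y s) t = Ic x t + a * Ic y t.
Proof.
  intros. rewrite !Ic_int by ct. rewrite <- RI_scal, <- RI_plus by ct. apply RI_ext; intros; ring.
Qed.
Lemma Is_lin x y a t : cont x -> cont y -> Is (fun s => x s + a * y s) t = Is x t + a * Is y t.
Proof.
  intros. rewrite !Is_int by ct. rewrite <- RI_scal, <- RI_plus by ct. apply RI_ext; intros; ring.
Qed.

End Window.

(** * The renewal equation on the Fourier side *)

Section L2core.
Variables be w th m : R.
Hypothesis be1 : 1 < be.
Hypothesis w0 : 0 < w.
Hypothesis w2 : w * w = be * be - 1.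
Hypothesis th0 : 0 < th < PI.
Hypothesis costh : be * cos th = -1.
Hypothesis sinth : be * sin th = w.
Hypothesis mw : m * w = th.

(* The symbol of the renewal equation is [(lambda + 1) Delta (lambda) / (lambda^2 + th^2)]:
   the two critical roots are divided out. *)
Lemma hat_alg (lam E phi c s g : C) :
  (lam * c = RtoC th * s + (RtoC (cos th) - E) * phi)%C ->
  (lam * s = - RtoC th * c + RtoC (sin th) * phi)%C ->
  (phi = RtoC (m * be) * c - RtoC (m * be / th) * s + g)%C ->
  ((lam + 1) * (lam + RtoC m + RtoC (m * be) * E) * phi = (lam * lam + RtoC th * RtoC th) * g)%C.
Proof.
  intros H1 H2 H3.
  assert (A1 : ((lam * lam + RtoC th * RtoC th) * c = (RtoC th * RtoC (sin th) + lam * (RtoC (cos th) - E)) * phi)%C).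
  { replace ((lam * lam + RtoC th * RtoC th) * c)%C with (lam * (lam * c) + RtoC th * RtoC th * c)%C by ring. rewrite H1.
    replace (lam * (RtoC th * s + (RtoC (cos th) - E) * phi) + RtoC th * RtoC th * c)%C with (RtoC th * (lam * s) + lam * (RtoC (cos th) - E) * phi + RtoC th * RtoC th * c)%C by ring. rewrite H2. ring. }
  assert (A2 : ((lam * lam + RtoC th * RtoC th) * s = (lam * RtoC (sin th) - RtoC th * (RtoC (cos th) - E)) * phi)%C).
  { replace ((lam * lam + RtoC th * RtoC th) * s)%C with (lam * (lam * s) + RtoC th * RtoC th * s)%C by ring. rewrite H2.
    replace (lam * (- RtoC th * c + RtoC (sin th) * phi) + RtoC th * RtoC th * s)%C with (- RtoC th * (lam * c) + lam * RtoC (sin th) * phi + RtoC th * RtoC th * s)%C by ring. rewrite H1. ring. }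
  assert (K1 : (RtoC (m * be) * RtoC (cos th) = RtoC (- m))%C).
  { rewrite <- RtoC_mult. f_equal. rewrite Rmult_assoc, costh. ring. }
  assert (K2 : (RtoC (m * be) * RtoC (sin th) = RtoC th)%C).
  { rewrite <- RtoC_mult. f_equal. rewrite Rmult_assoc, sinth. exact mw. }
  assert (K3 : (RtoC (m * be / th) * RtoC th = RtoC (m * be))%C).
  { rewrite <- RtoC_mult. f_equal. field. lra. }
  assert (K4 : (RtoC (m * be / th) * RtoC (sin th) = 1)%C).
  { rewrite <- RtoC_mult. replace (m * be / th * sin th) with 1; auto. replace (m * be / th * sin th) with (m * (be * sin th) / th) by (field; lra). rewrite sinth, mw. field; lra. }
  assert (H3' : ((lam * lam + RtoC th * RtoC th) * g = (lam * lam + RtoC th * RtoC th) * phi - RtoC (m * be) * ((lam * lam + RtoC th * RtoC th) * c) + RtoC (m * be / th) * ((lam * lam + RtoC th * RtoC th) * s))%C).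
  { rewrite H3 at 1. ring. }
  rewrite H3', A1, A2.
  replace ((lam * lam + RtoC th * RtoC th) * phi - RtoC (m * be) * ((RtoC th * RtoC (sin th) + lam * (RtoC (cos th) - E)) * phi) + RtoC (m * be / th) * ((lam * RtoC (sin th) - RtoC th * (RtoC (cos th) - E)) * phi))%C
    with (((lam * lam + RtoC th * RtoC th) - RtoC th * (RtoC (m * be) * RtoC (sin th)) - lam * (RtoC (m * be) * RtoC (cos th)) + lam * RtoC (m * be) * E
     + lam * (RtoC (m * be / th) * RtoC (sin th)) - (RtoC (m * be / th) * RtoC th) * RtoC (cos th) + (RtoC (m * be / th) * RtoC th) * E) * phi)%C by ring.
  rewrite K1, K2, K3, K4, K1, RtoC_opp. ring.
Qed.

(** [e^(-lambda)] at [lambda = sg + i y]. *)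
Definition Ed (sg y : R) : C := (exp (- sg) * cos y, - (exp (- sg) * sin y)).

Lemma Cmod_Delta sg y : Cmod ((sg, y) + RtoC m + RtoC (m * be) * Ed sg y)%C = Lmod be m sg y.
Proof.
  unfold Cmod, Lmod, Lr, Li. f_equal. simpl. ring.
Qed.

(** The factor [lambda - i th] cancels against the lower bound of the symbol; [lambda + i th] is at
    most [4 (sg + 1 + y)] because [th < 4], and [lambda + 1] is at least [(sg + 1 + y) / 2]. Hence
    8, uniformly up to the imaginary axis. *)
Lemma Cmod_quot c sg y (phi g : C) : 0 < c -> 0 < sg -> 0 <= y -> c * (sg + Rabs (y - th)) <= Lmod be m sg y ->
  (((sg, y) + 1) * ((sg, y) + RtoC m + RtoC (m * be) * Ed sg y) * phi = ((sg, y) * (sg, y) + RtoC th * RtoC th) * g)%C ->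
  Cmod phi <= 8 / c * Cmod g.
Proof.
  intros Hc Hs Hy HL HE.
  assert (HE' := f_equal Cmod HE). rewrite !Cmod_mult, Cmod_Delta in HE'.
  replace ((sg, y) * (sg, y) + RtoC th * RtoC th)%C with (((sg, y) - Ci * RtoC th) * ((sg, y) + Ci * RtoC th))%C in HE'.
  2:{ apply injective_projections; simpl; ring. }
  rewrite Cmod_mult in HE'.
  assert (B1 : Cmod ((sg, y) - Ci * RtoC th)%C <= sg + Rabs (y - th)).
  { replace ((sg, y) - Ci * RtoC th)%C with (RtoC sg + Ci * RtoC (y - th))%C by (apply injective_projections; simpl; ring).
    eapply Rle_trans. apply Cmod_triangle. rewrite Cmod_mult, !Cmod_R. rewrite (Rabs_pos_eq sg) by lra.
    replace (Cmod Ci) with 1. lra. unfold Cmod; simpl. replace (0 * (0 * 1) + 1 * (1 * 1)) with 1 by ring. symmetry; apply sqrt_1. }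
  assert (B2 : Cmod ((sg, y) + Ci * RtoC th)%C <= sg + (y + th)).
  { replace ((sg, y) + Ci * RtoC th)%C with (RtoC sg + Ci * RtoC (y + th))%C by (apply injective_projections; simpl; ring).
    eapply Rle_trans. apply Cmod_triangle. rewrite Cmod_mult, !Cmod_R. rewrite (Rabs_pos_eq sg), (Rabs_pos_eq (y + th)) by lra.
    replace (Cmod Ci) with 1. lra. unfold Cmod; simpl. replace (0 * (0 * 1) + 1 * (1 * 1)) with 1 by ring. symmetry; apply sqrt_1. }
  assert (B3 : (sg + 1 + y) / 2 <= Cmod ((sg, y) + 1)%C).
  { unfold Cmod. simpl. apply Rsqr_incr_0_var; [|apply sqrt_pos]. unfold Rsqr. rewrite sqrt_sqrt by pnra. pose proof (Rle_0_sqr (sg + 1 - y)) as Z. unfold Rsqr in Z. pnra. }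
  pose proof (Cmod_ge_0 phi) as P1. pose proof (Cmod_ge_0 g) as P2. pose proof (Rabs_pos (y - th)) as P3. pose proof PI_4.
  set (a := sg + Rabs (y - th)) in *. assert (Ha : 0 < a) by (unfold a; lra).
  assert (L1 : (sg + 1 + y) / 2 * (c * a) * Cmod phi <= Cmod ((sg, y) + 1)%C * Lmod be m sg y * Cmod phi).
  { apply Rmult_le_compat_r; auto. apply Rmult_le_compat; try lra. apply Rmult_le_pos; lra. }
  assert (L2 : Cmod ((sg, y) - Ci * RtoC th)%C * Cmod ((sg, y) + Ci * RtoC th)%C * Cmod g <= a * (4 * (sg + 1 + y)) * Cmod g).
  { apply Rmult_le_compat_r; auto. apply Rmult_le_compat; auto using Cmod_ge_0. lra. }
  assert (L3 : (sg + 1 + y) / 2 * (c * a) * Cmod phi <= a * (4 * (sg + 1 + y)) * Cmod g) by lra.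
  apply Rmult_le_reg_l with ((sg + 1 + y) / 2 * (c * a)). apply Rmult_lt_0_compat. lra. now apply Rmult_lt_0_compat.
  replace ((sg + 1 + y) / 2 * (c * a) * (8 / c * Cmod g)) with (a * (4 * (sg + 1 + y)) * Cmod g) by (field; lra). auto.
Qed.

(** Vanishing near both ends replaces periodicity: the delayed function is integrated over the same
    support. *)
Lemma coef_delay P nu (f : R -> R) k : 0 < P -> cont f -> (forall t, -1 <= t <= 0 -> f t = 0) -> (forall t, P - 1 <= t <= P -> f t = 0) ->
  fA P nu (fun t => f (t - 1)) k = cos (INR k * nu) * fA P nu f k - sin (INR k * nu) * fB P nu f k /\
  fB P nu (fun t => f (t - 1)) k = sin (INR k * nu) * fA P nu f k + cos (INR k * nu) * fB P nu f k.
Proof.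
  intros HP Cf Z1 Z2.
  assert (X : forall h, cont h -> RI (fun t => f (t - 1) * h t) 0 P = RI (fun s => f s * h (s + 1)) 0 P).
  { intros h Ch. assert (C : cont (fun s => f s * h (s + 1))) by ct.
    transitivity (RI (fun s => f s * h (s + 1)) (0 - 1) (P - 1)).
    { rewrite <- (RI_shift (fun s => f s * h (s + 1)) 0 P 1) by auto. apply RI_ext. intros t. do 2 f_equal. ring. }
    assert (Q : forall a b, a <= b -> (forall t, a <= t <= b -> f t = 0) -> RI (fun s => f s * h (s + 1)) a b = 0).
    { intros a b Hab Hz. transitivity (RI (fun _ => 0) a b); [|rewrite RI_const; ring]. apply RInt_ext.
      intros t Ht. rewrite Rmin_left, Rmax_right in Ht by auto. rewrite Hz by lra. apply Rmult_0_l. }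
    rewrite <- (RI_chasles _ (0 - 1) 0 (P - 1)), <- (RI_chasles _ 0 (P - 1) P) by auto.
    rewrite (Q (0 - 1) 0), (Q (P - 1) P); auto; try lra. intros; apply Z1; lra. }
  split.
  - unfold fA at 1. rewrite X by apply cont_ck. unfold fA, fB. rewrite <- !RI_scal, <- RI_minus by (ct; auto using cont_ck, cont_sk).
    apply RI_ext. intros t. unfold ck, sk. replace (INR k * nu * (t + 1)) with (INR k * nu * t + INR k * nu) by ring. rewrite cos_plus. ring.
  - unfold fB at 1. rewrite X by apply cont_sk. unfold fA, fB. rewrite <- !RI_scal, <- RI_plus by (ct; auto using cont_ck, cont_sk).
    apply RI_ext. intros t. unfold ck, sk. replace (INR k * nu * (t + 1)) with (INR k * nu * t + INR k * nu) by ring. rewrite sin_plus. ring.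
Qed.

(** The coefficients of [f] are controlled by those of the residual [G], but [f] is only continuous
    and need not have summable coefficients. Parseval is therefore applied to [u = f - G], a
    combination of the differentiable window integrals. *)
Lemma L2_core c P nu sg (f Cf Sf : R -> R) : 0 < c -> (forall sg y, 0 <= sg -> 0 <= y -> c * (sg + Rabs (y - th)) <= Lmod be m sg y) ->
  2 < P -> nu * P = 2 * PI -> 0 < sg -> cont f ->
  (forall t, is_derive Cf t (- sg * Cf t + th * Sf t + cos th * f t - exp (- sg) * f (t - 1))) ->
  (forall t, is_derive Sf t (- sg * Sf t - th * Cf t + sin th * f t)) ->
  (forall t, -1 <= t <= 0 -> f t = 0) -> (forall t, P - 1 <= t <= P -> f t = 0) ->
  Cf 0 = 0 -> Cf P = 0 -> Sf 0 = 0 -> Sf P = 0 ->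
  RI (fun t => f t ^ 2) 0 P <= 2 * ((8 / c + 1) ^ 2 + 1) * RI (fun t => (f t - (m * be * Cf t - m * be / th * Sf t)) ^ 2) 0 P.
Proof.
  intros Hc HL HP HnuP Hsg Hf HC HS Hz1 Hz2 C0 CP S0 SP.
  assert (P0 : 0 < P) by lra. assert (Hnu := nu_pos P nu P0 HnuP).
  assert (CCf : cont Cf) by exact (is_derive_cont _ _ HC). assert (CSf : cont Sf) by exact (is_derive_cont _ _ HS).
  set (u := fun t => m * be * Cf t - m * be / th * Sf t).
  set (C' := fun t => - sg * Cf t + th * Sf t + cos th * f t - exp (- sg) * f (t - 1)).
  set (S' := fun t => - sg * Sf t - th * Cf t + sin th * f t).
  assert (CC' : cont C') by (unfold C'; ct). assert (CS' : cont S') by (unfold S'; ct).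
  set (u' := fun t => m * be * C' t - m * be / th * S' t).
  assert (Du : forall t, is_derive u t (u' t)).
  { intros t. unfold u, u'. apply D_minus; apply D_scal. apply HC. apply HS. }
  assert (Cu' : cont u') by (unfold u'; ct). assert (Cu : cont u) by exact (is_derive_cont _ _ Du).
  set (G := fun t => f t - u t). assert (CG : cont G) by (unfold G; ct).
  assert (Hu0 : u 0 = u P) by (unfold u; rewrite C0, CP, S0, SP; reflexivity).
  destruct (summable_C1 P nu P0 HnuP u u' Du Cu' Hu0) as [Ks HK].
  set (hat := fun h k => (fA P nu h k, - fB P nu h k) : C).
  assert (Hmain : forall k, Cmod (hat f k) <= 8 / c * Cmod (hat G k)).
  { intros k. set (y := INR k * nu). assert (Hy : 0 <= y) by (unfold y; pose proof (pos_INR k); apply Rmult_le_pos; lra).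
    destruct (coef_deriv P nu HnuP Cf C' HC CC' ltac:(rewrite C0, CP; reflexivity) k) as [c1 c2].
    destruct (coef_deriv P nu HnuP Sf S' HS CS' ltac:(rewrite S0, SP; reflexivity) k) as [s1 s2].
    destruct (coef_delay P nu f k P0 Hf Hz1 Hz2) as [d1 d2]. fold y in c1, c2, s1, s2, d1, d2.
    assert (XC : C' = fun t => ((- sg * Cf t + th * Sf t) + cos th * f t) + (- exp (- sg)) * f (t - 1)).
    { apply functional_extensionality; intros t; unfold C'; ring. }
    assert (XS : S' = fun t => (- sg * Sf t + - th * Cf t) + sin th * f t).
    { apply functional_extensionality; intros t; unfold S'; ring. }
    assert (LA : forall h a, cont h -> fA P nu (fun t => a * h t) k = a * fA P nu h k).
    { intros h a Ch. unfold fA. rewrite <- RI_scal by (ct; apply cont_ck). apply RI_ext; intros; ring. }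
    assert (LB : forall h a, cont h -> fB P nu (fun t => a * h t) k = a * fB P nu h k).
    { intros h a Ch. unfold fB. rewrite <- RI_scal by (ct; apply cont_sk). apply RI_ext; intros; ring. }
    rewrite XC in c1, c2. rewrite XS in s1, s2.
    rewrite !fA_lin, LA, d1 in c1 by ct. rewrite !fB_lin, LB, d2 in c2 by ct.
    rewrite !fA_lin, LA in s1 by ct. rewrite !fB_lin, LB in s2 by ct.
    assert (g1 : fA P nu G k = fA P nu f k - (m * be * fA P nu Cf k - m * be / th * fA P nu Sf k)).
    { replace G with (fun t => (f t + (- (m * be)) * Cf t) + (m * be / th) * Sf t) by (apply functional_extensionality; intros t; unfold G, u; ring).
      rewrite !fA_lin by ct. ring. }
    assert (g2 : fB P nu G k = fB P nu f k - (m * be * fB P nu Cf k - m * be / th * fB P nu Sf k)).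
    { replace G with (fun t => (f t + (- (m * be)) * Cf t) + (m * be / th) * Sf t) by (apply functional_extensionality; intros t; unfold G, u; ring).
      rewrite !fB_lin by ct. ring. }
    apply (Cmod_quot c sg y (hat f k) (hat G k) Hc Hsg Hy (HL sg y ltac:(lra) Hy)).
    apply (hat_alg (sg, y) (Ed sg y) (hat f k) (hat Cf k) (hat Sf k) (hat G k)); unfold hat.
    - apply injective_projections; simpl; lra.
    - apply injective_projections; simpl; lra.
    - rewrite g1, g2. apply injective_projections; simpl; ring. }
  assert (Hmod : forall h k, Cmod (hat h k) ^ 2 = fA P nu h k ^ 2 + fB P nu h k ^ 2).
  { intros h k. unfold hat, Cmod. rewrite pow2_sqrt by (apply Rplus_le_le_0_compat; apply pow2_ge_0). simpl. ring. }
  assert (Hc8 : 0 < 8 / c) by (apply Rdiv_lt_0_compat; lra).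
  (* The triangle inequality for [u = f - G] turns [8 / c] into [8 / c + 1]. *)
  assert (Hcoef : forall k, fA P nu u k ^ 2 + fB P nu u k ^ 2 <= (8 / c + 1) ^ 2 * (fA P nu G k ^ 2 + fB P nu G k ^ 2)).
  { intros k. rewrite <- !Hmod. rewrite <- Rpow_mult_distr. apply pow_incr. split. apply Cmod_ge_0.
    replace (hat u k) with (hat f k - hat G k)%C.
    2:{ unfold hat. replace G with (fun t => f t + -1 * u t) by (apply functional_extensionality; intros t; unfold G; ring).
      rewrite fA_lin, fB_lin by auto. apply injective_projections; simpl; ring. }
    eapply Rle_trans. apply Cmod_triangle. rewrite Cmod_opp. specialize (Hmain k). lra. }
  pose proof (parseval_le P nu P0 HnuP u G _ Ks Cu CG (pow2_ge_0 _) HK Hcoef) as HP2.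
  apply Rle_trans with (2 * (RI (fun t => u t ^ 2) 0 P + RI (fun t => G t ^ 2) 0 P)).
  - rewrite <- RI_plus, <- RI_scal by ct. apply RI_le; try ct. lra. intros t _. unfold G.
    pose proof (pow2_ge_0 (u t - (f t - u t))). simpl in *. lra.
  - fold (u). change (RI (fun t => (f t - (m * be * Cf t - m * be / th * Sf t)) ^ 2) 0 P) with (RI (fun t => G t ^ 2) 0 P).
    set (I := RI (fun t => G t ^ 2) 0 P) in *. lra.
Qed.
End L2core.

Definition clip u := Rmax 0 (Rmin 1 u).
Lemma clip_bounds u : 0 <= clip u <= 1.
Proof. unfold clip, Rmax, Rmin. destruct (Rle_dec 1 u); destruct (Rle_dec _ _); lra. Qed.
Lemma clip_0 u : u <= 0 -> clip u = 0.
Proof. intros. unfold clip. rewrite Rmin_right, Rmax_left; lra. Qed.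
Lemma clip_1 u : 1 <= u -> clip u = 1.
Proof. intros. unfold clip. rewrite Rmin_left, Rmax_right; lra. Qed.

Lemma exp_le x y : x <= y -> exp x <= exp y.
Proof. intros [H| ->]. left; now apply exp_increasing. lra. Qed.
Lemma sq_le_of_amgm a J : 0 <= a -> 0 <= J -> (forall k, 0 < k -> a <= / 2 * (k + / k * J)) -> a * a <= J.
Proof.
  intros [Ha|<-] HJ H; [|lra].
  specialize (H a Ha). apply Rmult_le_reg_l with (/ a). now apply Rinv_0_lt_compat. replace (/ a * (a * a)) with a by (field; lra). lra.
Qed.

(** * From growth bounds to exponential decay *)

Section Decay.
Variables be w th m : R.
Hypothesis be1 : 1 < be.
Hypothesis w0 : 0 < w.
Hypothesis w2 : w * w = be * be - 1.
Hypothesis th0 : 0 < th < PI.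
Hypothesis costh : be * cos th = -1.
Hypothesis sinth : be * sin th = w.
Hypothesis mw : m * w = th.
Notation Ic := (Ic th).
Notation Is := (Is th).
Notation Z1 := (Z1 be th m).
Notation Z2 := (Z2 be th m).

Definition hsol x := cont x /\ (forall t, 0 < t -> is_derive x t (- m * (x t + be * x (t - 1)))) /\ Z1 x 0 = 0 /\ Z2 x 0 = 0.

Lemma m_pos' : 0 < m.
Proof. apply (m_pos w th m); auto. Qed.
Lemma mbe_pos : 0 < m * be.
Proof. pose proof m_pos'. pnra. Qed.

(** Without forcing the projection only rotates, so [Z1^2 + Z2^2] stays zero, and the solution
    satisfies an integral equation over its last window. *)
Lemma hsol_Z x : hsol x -> forall t, 0 <= t -> x t = m * be * Ic x t /\ Is x t = 0.
Proof.
  intros (Cx & Dx & H1 & H2) t Ht. pose proof mbe_pos as Hmb.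
  assert (C1 : cont (Z1 x)) by (unfold Z1; pose proof (cont_Ic th x Cx); ct).
  assert (C2 : cont (Z2 x)) by (unfold Z2; pose proof (cont_Is th x Cx); ct).
  assert (E : (fun t => Z1 x t * Z1 x t + Z2 x t * Z2 x t) t = (fun t => Z1 x t * Z1 x t + Z2 x t * Z2 x t) 0).
  { apply (const_open (fun t => Z1 x t * Z1 x t + Z2 x t * Z2 x t) 0 t); auto. ct. intros s Hs.
    assert (Dx' : is_derive x s (- m * (x s + be * x (s - 1)) + 0)) by (eapply is_derive_eq; [apply Dx; auto | ring]).
    destruct (D_Z be w th m costh sinth mw x s 0 Cx Dx') as [D1 D2].
    eapply is_derive_eq. apply D_plus; apply D_mult; [exact D1 | exact D1 | exact D2 | exact D2]. ring. }
  cbv beta in E. rewrite H1, H2 in E.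
  assert (Z1 x t = 0) by pnra. assert (Z2 x t = 0) by pnra. unfold Z1, Z2 in *. split. lra.
  apply Rmult_eq_reg_l with (m * be); lra.
Qed.

Lemma Ic_shift x s t : cont x -> Ic (fun u => x (u + s)) t = Ic x (t + s).
Proof.
  intros Cx. rewrite !Ic_int by ct.
  assert (E := RI_shift (fun v => cos (th * (v - (t + s) + 1)) * x v) (t - 1) t (- s) ltac:(ct)).
  replace (t - 1 - - s) with (t + s - 1) in E by ring. replace (t - - s) with (t + s) in E by ring. rewrite <- E.
  apply RI_ext. intros u. replace (u - - s) with (u + s) by ring. do 3 f_equal. ring.
Qed.
Lemma Is_shift x s t : cont x -> Is (fun u => x (u + s)) t = Is x (t + s).
Proof.
  intros Cx. rewrite !Is_int by ct.
  assert (E := RI_shift (fun v => sin (th * (v - (t + s) + 1)) * x v) (t - 1) t (- s) ltac:(ct)).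
  replace (t - 1 - - s) with (t + s - 1) in E by ring. replace (t - - s) with (t + s) in E by ring. rewrite <- E.
  apply RI_ext. intros u. replace (u - - s) with (u + s) by ring. do 3 f_equal. ring.
Qed.
Lemma hsol_shift x s : hsol x -> 0 <= s -> hsol (fun t => x (t + s)).
Proof.
  intros Hx Hs. pose proof (hsol_Z x Hx s Hs) as [E1 E2]. destruct Hx as (Cx & Dx & _ & _).
  split; [ct|]. split; [|split].
  - intros t Ht. replace (t - 1 + s) with (t + s - 1) by ring. eapply is_derive_eq.
    apply (D_comp x (fun t => t + s)). apply Dx; lra. apply D_plus. apply D_id. apply D_const. ring.
  - unfold Z1. rewrite Ic_shift by auto. rewrite Rplus_0_l. lra.
  - unfold Z2. rewrite Is_shift by auto. rewrite Rplus_0_l, E2. ring.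
Qed.

Definition KE c := 4 * ((8 / c + 1) ^ 2 + 1) * (m * be + m * be / th) ^ 2.

(** For the truncated solution the residual is a commutator with the cutoff, supported where the
    cutoff varies: at the start, controlled by [B], and at the end, controlled by [eps]. The
    constant depends neither on [sg] nor on [Q]. *)
Lemma cutoff_energy c x sg Q B eps : 0 < c -> (forall sg y, 0 <= sg -> 0 <= y -> c * (sg + Rabs (y - th)) <= Lmod be m sg y) ->
  hsol x -> 0 < sg -> 3 <= Q -> 0 <= B -> 0 <= eps -> (forall s, -1 <= s <= 2 -> Rabs (x s) <= B) ->
  (forall t s, Q <= t <= Q + 2 -> t - 1 <= s <= t -> Rabs (x s) <= eps * exp (sg * t)) ->
  RI (fun t => exp (- sg * t) ^ 2 * x t ^ 2) 1 Q <= KE c * (B ^ 2 + eps ^ 2).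
Proof.
  intros Hc HL Hx Hsg HQ HB Heps Hb Htail. pose proof (hsol_Z x Hx) as HZ. destruct Hx as (Cx & Dx & _ & _).
  pose proof mbe_pos as Hmb.
  (* The truncation vanishes from [Q + 1] on and its window integrals from [Q + 2 = P - 1] on, as
     [L2_core] demands. *)
  set (P := Q + 3). set (nu := 2 * PI / P). assert (HnuP : nu * P = 2 * PI) by (unfold nu; field; unfold P; lra).
  set (chi := fun t => clip t * clip (Q + 1 - t)).
  assert (Cchi : cont chi) by (unfold chi, clip; ct).
  assert (Hchi : forall t, 0 <= chi t <= 1).
  { intros t. unfold chi. pose proof (clip_bounds t). pose proof (clip_bounds (Q + 1 - t)). pnra. }
  assert (Hchi1 : forall t, 1 <= t <= Q -> chi t = 1) by (intros t Ht; unfold chi; rewrite !clip_1; lra).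
  assert (Hchi0 : forall t, t <= 0 \/ Q + 1 <= t -> chi t = 0).
  { intros t [Ht|Ht]; unfold chi. rewrite (clip_0 t) by lra; ring. rewrite (clip_0 (Q + 1 - t)) by lra; ring. }
  set (X := fun t => chi t * x t). assert (CX : cont X) by (unfold X; ct).
  assert (X0 : forall t, t <= 0 \/ Q + 1 <= t -> X t = 0) by (intros t Ht; unfold X; rewrite Hchi0; auto; ring).
  set (f := fun t => exp (- sg * t) * X t). set (Cf := fun t => exp (- sg * t) * Ic X t). set (Sf := fun t => exp (- sg * t) * Is X t).
  assert (CIc := cont_Ic th X CX). assert (CIs := cont_Is th X CX).
  assert (De : forall t, is_derive (fun t => exp (- sg * t)) t (- sg * exp (- sg * t))) by (intros t; auto_derive; auto; ring).
  assert (Ee : forall t, exp (- sg * t) = exp (- sg) * exp (- sg * (t - 1))) by (intros t; rewrite <- exp_plus; f_equal; ring).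
  assert (Hz0 : forall t, t <= 0 \/ Q + 2 <= t -> Ic X t = 0 /\ Is X t = 0).
  { intros t Ht. destruct (window_bound th X t 0 CX) as [A1 A2]. intros s Hs. rewrite X0 by lra. rewrite Rabs_R0; lra.
    split; apply Rabs_eq_0; apply Rle_antisym; auto using Rabs_pos. }
  assert (Core := L2_core be w th m th0 costh sinth mw c P nu sg f Cf Sf Hc HL ltac:(unfold P; lra) HnuP Hsg ltac:(unfold f; ct)).
  specialize (Core ltac:(intros t; eapply is_derive_eq; [unfold Cf; apply D_mult; [apply De | now apply D_Ic] | unfold Cf, Sf, f; replace (exp (- sg) * (exp (- sg * (t - 1)) * X (t - 1))) with (exp (- sg * t) * X (t - 1)) by (rewrite (Ee t); ring); ring])).
  specialize (Core ltac:(intros t; eapply is_derive_eq; [unfold Sf; apply D_mult; [apply De | now apply D_Is] | unfold Cf, Sf, f; ring])).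
  specialize (Core ltac:(intros t Ht; unfold f; rewrite X0 by lra; ring) ltac:(intros t Ht; unfold f; rewrite X0 by (unfold P in Ht; lra); ring)).
  specialize (Core ltac:(unfold Cf; rewrite (proj1 (Hz0 0 ltac:(lra))); ring) ltac:(unfold Cf; rewrite (proj1 (Hz0 P ltac:(unfold P; lra))); ring)).
  specialize (Core ltac:(unfold Sf; rewrite (proj2 (Hz0 0 ltac:(lra))); ring) ltac:(unfold Sf; rewrite (proj2 (Hz0 P ltac:(unfold P; lra))); ring)).
  set (G := fun t => f t - (m * be * Cf t - m * be / th * Sf t)) in *.
  assert (CG : cont G) by (unfold G, f, Cf, Sf; ct).
  set (CGc := m * be + m * be / th).
  assert (Hmbt : 0 < m * be / th) by (apply Rdiv_lt_0_compat; lra).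
  (* Subtracting [chi t] times the equation satisfied by [x] leaves [(chi s - chi t) x s] under the
     integrals. *)
  assert (HGD : forall t d, 0 <= t -> (forall s, t - 1 <= s <= t -> Rabs ((chi s - chi t) * x s) <= d) -> Rabs (G t) <= exp (- sg * t) * (CGc * d)).
  { intros t d Ht Hd. destruct (HZ t Ht) as [E1 E2].
    assert (EG : G t = exp (- sg * t) * (- (m * be) * Ic (fun s => X s + - chi t * x s) t + m * be / th * Is (fun s => X s + - chi t * x s) t)).
    { rewrite Ic_lin, Is_lin by auto. unfold G, f, Cf, Sf, X at 1. rewrite E2. rewrite E1 at 1. ring. }
    rewrite EG, Rabs_mult, (Rabs_pos_eq (exp _)) by (left; apply exp_pos). apply Rmult_le_compat_l. left; apply exp_pos.
    destruct (window_bound th (fun s => X s + - chi t * x s) t d) as [A1 A2]. ct. intros s Hs. replace (X s + - chi t * x s) with ((chi s - chi t) * x s) by (unfold X; ring). auto.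
    triang. rewrite !Rabs_mult, Rabs_Ropp. rewrite (Rabs_pos_eq (m * be)), (Rabs_pos_eq (m * be / th)) by lra.
    unfold CGc. assert (m * be * Rabs (Ic (fun s => X s + - chi t * x s) t) <= m * be * d) by (apply Rmult_le_compat_l; lra).
    assert (m * be / th * Rabs (Is (fun s => X s + - chi t * x s) t) <= m * be / th * d) by (apply Rmult_le_compat_l; lra). lra. }
  assert (Hchid : forall s t, Rabs (chi s - chi t) <= 1).
  { intros s t. pose proof (Hchi s). pose proof (Hchi t). apply Rabs_le; lra. }
  assert (HCG0 : 0 <= CGc) by (unfold CGc; lra).
  assert (G1 : forall t, 0 <= t <= 2 -> G t ^ 2 <= (CGc * B) ^ 2).
  { intros t Ht. rewrite <- pow2_abs. apply pow_incr. split. apply Rabs_pos.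
    eapply Rle_trans. apply (HGD t B); [lra|]. intros s Hs. rewrite Rabs_mult. rewrite <- (Rmult_1_l B). apply Rmult_le_compat; auto using Rabs_pos. apply Hb; lra.
    rewrite <- (Rmult_1_l (CGc * B)) at 2. apply Rmult_le_compat_r. now apply Rmult_le_pos. rewrite <- exp_0. apply exp_le. pnra. }
  assert (G2 : forall t, 2 <= t <= Q -> G t ^ 2 <= 0).
  { intros t Ht. assert (E : Rabs (G t) <= exp (- sg * t) * (CGc * 0)).
    { apply HGD. lra. intros s Hs. rewrite !Hchi1 by lra. rewrite Rminus_diag, Rmult_0_l, Rabs_R0. lra. }
    rewrite !Rmult_0_r in E. rewrite <- pow2_abs. pose proof (Rabs_pos (G t)). pnra. }
  assert (G3 : forall t, Q <= t <= Q + 2 -> G t ^ 2 <= (CGc * eps) ^ 2).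
  { intros t Ht. rewrite <- pow2_abs. apply pow_incr. split. apply Rabs_pos.
    eapply Rle_trans. apply (HGD t (eps * exp (sg * t))); [lra|]. intros s Hs. rewrite Rabs_mult. rewrite <- (Rmult_1_l (eps * _)). apply Rmult_le_compat; auto using Rabs_pos.
    replace (exp (- sg * t) * (CGc * (eps * exp (sg * t)))) with (CGc * eps * (exp (- sg * t) * exp (sg * t))) by ring.
    rewrite <- exp_plus. replace (- sg * t + sg * t) with 0 by ring. rewrite exp_0. lra. }
  assert (G4 : forall t, Q + 2 <= t <= P -> G t ^ 2 <= 0).
  { intros t Ht. assert (E : Rabs (G t) <= exp (- sg * t) * (CGc * 0)).
    { apply HGD. lra. intros s Hs. rewrite !Hchi0 by lra. rewrite Rminus_diag, Rmult_0_l, Rabs_R0. lra. }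
    rewrite !Rmult_0_r in E. rewrite <- pow2_abs. pose proof (Rabs_pos (G t)). pnra. }
  assert (IG : RI (fun t => G t ^ 2) 0 P <= 2 * (CGc * B) ^ 2 + 2 * (CGc * eps) ^ 2).
  { rewrite <- (RI_chasles _ 0 2 P), <- (RI_chasles _ 2 Q P), <- (RI_chasles _ Q (Q + 2) P) by ct.
    assert (I1 : RI (fun t => G t ^ 2) 0 2 <= RI (fun _ => (CGc * B) ^ 2) 0 2) by (apply RI_le; [lra | ct | ct | auto]).
    assert (I2 : RI (fun t => G t ^ 2) 2 Q <= RI (fun _ => 0) 2 Q) by (apply RI_le; [lra | ct | ct | auto]).
    assert (I3 : RI (fun t => G t ^ 2) Q (Q + 2) <= RI (fun _ => (CGc * eps) ^ 2) Q (Q + 2)) by (apply RI_le; [lra | ct | ct | auto]).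
    assert (I4 : RI (fun t => G t ^ 2) (Q + 2) P <= RI (fun _ => 0) (Q + 2) P) by (apply RI_le; [unfold P; lra | ct | ct | auto]).
    rewrite RI_const in I1, I2, I3, I4. lra. }
  apply Rle_trans with (RI (fun t => f t ^ 2) 0 P).
  - assert (Cf2 : cont (fun t => f t ^ 2)) by (unfold f; ct).
    rewrite <- (RI_chasles _ 0 1 P), <- (RI_chasles _ 1 Q P) by auto.
    assert (J1 : 0 <= RI (fun t => f t ^ 2) 0 1) by (apply RI_ge0; auto; [lra | intros; apply pow2_ge_0]).
    assert (J2 : 0 <= RI (fun t => f t ^ 2) Q P) by (apply RI_ge0; auto; [unfold P; lra | intros; apply pow2_ge_0]).
    assert (J3 : RI (fun t => exp (- sg * t) ^ 2 * x t ^ 2) 1 Q <= RI (fun t => f t ^ 2) 1 Q).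
    { apply RI_le; [lra | ct | auto |]. intros t Ht. unfold f, X. rewrite Hchi1 by auto. right; ring. }
    lra.
  - eapply Rle_trans. apply Core. unfold KE. fold CGc.
    assert (0 <= 2 * ((8 / c + 1) ^ 2 + 1)) by (pose proof (pow2_ge_0 (8 / c + 1)); lra).
    apply Rle_trans with (2 * ((8 / c + 1) ^ 2 + 1) * (2 * (CGc * B) ^ 2 + 2 * (CGc * eps) ^ 2)). apply Rmult_le_compat_l; auto. right; ring.
Qed.

Definition aG := m * (1 + be).
(** The constant [M] is uniform over all solutions without critical component, which allows
    restarting from any later segment. *)
Definition Gr sg := exists M, 0 < M /\ forall x, hsol x -> forall B, 0 <= B -> (forall s, -1 <= s <= 0 -> Rabs (x s) <= B) ->
  forall t, 0 <= t -> Rabs (x t) <= M * B * exp (sg * t).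

Lemma aG_pos : 0 < aG.
Proof. unfold aG. pose proof m_pos'. pnra. Qed.

Lemma hsol_gronwall x B : hsol x -> 0 <= B -> (forall s, -1 <= s <= 0 -> Rabs (x s) <= B) ->
  forall t, 0 <= t -> Rabs (x t) <= B * exp (aG * t).
Proof.
  intros (Cx & Dx & _) HB Hb t Ht. pose proof m_pos' as Hm. pose proof aG_pos as Ha.
  rewrite <- (Rplus_0_r B) at 1. rewrite <- (Rmult_0_l t).
  apply (delay_growth x B t aG 0 ((B + 0 * t) * exp (aG * t) + 1)); auto; try lra.
  intros s Y Hs HY _. exists (- m * (x s + be * x (s - 1))). split. apply Dx; lra.
  rewrite Rplus_0_r. assert (A1 := HY s ltac:(lra)). assert (A2 := HY (s - 1) ltac:(lra)).
  unabs A1. unabs A2. unfold aG.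
  assert (0 <= m * (Y - x s)) by (apply Rmult_le_pos; lra). assert (0 <= m * (Y + x s)) by (apply Rmult_le_pos; lra).
  assert (0 <= m * be * (Y - x (s - 1))) by (apply Rmult_le_pos; pnra). assert (0 <= m * be * (Y + x (s - 1))) by (apply Rmult_le_pos; pnra).
  apply Rabs_le; lra.
Qed.

(** The integral equation bounds a value by the energy of the preceding window, by
    Cauchy-Schwarz. *)
Lemma hsol_pointwise x t : hsol x -> 0 <= t -> x t ^ 2 <= (m * be) ^ 2 * RI (fun s => x s ^ 2) (t - 1) t.
Proof.
  intros Hx Ht. destruct (hsol_Z x Hx t Ht) as [E _]. destruct Hx as (Cx & _). pose proof mbe_pos as Hmb.
  rewrite E, Rpow_mult_distr. apply Rmult_le_compat_l. apply pow2_ge_0.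
  set (J := RI (fun s => x s ^ 2) (t - 1) t).
  assert (HJ : 0 <= J) by (apply RI_ge0; [lra | ct | intros; apply pow2_ge_0]).
  rewrite <- pow2_abs. simpl. rewrite Rmult_1_r. apply sq_le_of_amgm; auto. apply Rabs_pos.
  intros k Hk. rewrite Ic_int by auto. eapply Rle_trans. apply (RI_amgm _ _ _ _ k); [lra | lra | ct | ct].
  fold J. apply Rmult_le_compat_l. lra. apply Rplus_le_compat_r. rewrite <- (Rmult_1_r k) at 2. apply Rmult_le_compat_l. lra.
  apply Rle_trans with (RI (fun _ => 1) (t - 1) t); [|rewrite RI_const; lra]. apply RI_le; [lra | ct | ct |].
  intros s _. pose proof (COS_bound (th * (s - t + 1))). pnra.
Qed.

(** The growth constant only serves to make the tail at [Q] negligible, so it does not appear in the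
    bound. This independence lets the same step be repeated. *)
Lemma Gr_energy c sg : 0 < c -> (forall sg y, 0 <= sg -> 0 <= y -> c * (sg + Rabs (y - th)) <= Lmod be m sg y) ->
  0 <= sg -> Gr sg -> forall x B, hsol x -> 0 <= B -> (forall s, -1 <= s <= 0 -> Rabs (x s) <= B) -> forall T, 3 <= T ->
  RI (fun t => exp (- sg * t) ^ 2 * x t ^ 2) 1 T <= KE c * (B * exp (aG * 2)) ^ 2.
Proof.
  intros Hc HL Hsg [M [HM HG]] x B Hx HB Hb T HT. pose proof aG_pos as Ha. pose proof mbe_pos as Hmb.
  assert (HKE : 0 <= KE c). { unfold KE. pose proof (pow2_ge_0 (8 / c + 1)). apply Rmult_le_pos; [lra | apply pow2_ge_0]. }
  assert (Cx : cont x) by apply Hx.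
  set (B2 := B * exp (aG * 2)). assert (HB2 : 0 <= B2) by (apply Rmult_le_pos; [auto | left; apply exp_pos]).
  assert (HbB : forall s, -1 <= s <= 2 -> Rabs (x s) <= B2).
  { intros s Hs. unfold B2. destruct (Rle_lt_dec s 0). apply Rle_trans with B. apply Hb; lra.
    rewrite <- (Rmult_1_r B) at 1. apply Rmult_le_compat_l; auto. rewrite <- exp_0. apply exp_le. lra.
    eapply Rle_trans. apply (hsol_gronwall x B Hx HB Hb); lra. apply Rmult_le_compat_l; auto. apply exp_le. pnra. }
  assert (Hone : forall sg1 eps, sg < sg1 -> 0 < eps -> RI (fun t => exp (- sg1 * t) ^ 2 * x t ^ 2) 1 T <= KE c * (B2 ^ 2 + eps ^ 2)).
  { intros sg1 eps Hs1 Heps. set (d := sg1 - sg). assert (Hd : 0 < d) by (unfold d; lra).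
    (* From here on [exp (d t) >= d t] exceeds [M B / eps], so the surplus of [sg1] over [sg]
       absorbs the growth constant. *)
    set (Q := T + (M * B) / (d * eps)). assert (HMB : 0 <= M * B) by (apply Rmult_le_pos; lra).
    assert (Hde : 0 < d * eps) by (apply Rmult_lt_0_compat; lra).
    assert (HQ : 0 <= M * B / (d * eps)) by (apply Rmult_le_pos; [auto | left; now apply Rinv_0_lt_compat]).
    assert (Htail : forall t s, Q <= t <= Q + 2 -> t - 1 <= s <= t -> Rabs (x s) <= eps * exp (sg1 * t)).
    { intros t s Ht Hs. assert (0 <= s) by (unfold Q in Ht; lra). eapply Rle_trans. apply (HG x Hx B HB Hb s); auto.
      replace (eps * exp (sg1 * t)) with (eps * exp (d * t) * exp (sg * t)) by (rewrite Rmult_assoc, <- exp_plus; do 2 f_equal; unfold d; ring).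
      apply Rmult_le_compat; auto. left; apply exp_pos.
      - pose proof (exp_ineq1_le (d * t)). apply Rle_trans with (eps * (d * t)).
        apply Rle_trans with (eps * (d * (M * B / (d * eps)))). right; field; lra. apply Rmult_le_compat_l. lra. apply Rmult_le_compat_l. lra. unfold Q in Ht; lra.
        apply Rmult_le_compat_l; lra.
      - apply exp_le. pnra. }
    assert (E := cutoff_energy c x sg1 Q B2 eps Hc HL Hx ltac:(lra) ltac:(unfold Q; lra) HB2 ltac:(lra) HbB Htail).
    eapply Rle_trans; [|apply E]. rewrite <- (RI_chasles _ 1 T Q) by ct.
    assert (0 <= RI (fun t => exp (- sg1 * t) ^ 2 * x t ^ 2) T Q).
    { apply RI_ge0; [unfold Q; lra | ct |]. intros; apply Rmult_le_pos; apply pow2_ge_0. } lra. }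
  assert (Htwo : forall sg1, sg < sg1 -> RI (fun t => exp (- sg1 * t) ^ 2 * x t ^ 2) 1 T <= KE c * B2 ^ 2).
  { intros sg1 Hs1. apply le_epsilon. intros e He. set (eps := Rmin 1 (e / (KE c + 1))).
    assert (Heps : 0 < eps) by (apply Rmin_pos; [lra | apply Rdiv_lt_0_compat; lra]).
    assert (eps <= 1) by apply Rmin_l. assert (Hee : eps <= e / (KE c + 1)) by apply Rmin_r.
    eapply Rle_trans. apply (Hone sg1 eps Hs1 Heps). rewrite Rmult_plus_distr_l. apply Rplus_le_compat_l.
    apply Rle_trans with ((KE c + 1) * (e / (KE c + 1))). apply Rmult_le_compat; [auto | apply pow2_ge_0 | lra | pnra]. right; field; lra. }
  apply le_epsilon. intros e He. set (K := KE c * B2 ^ 2) in *.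
  assert (HK : 0 <= K) by (apply Rmult_le_pos; [auto | apply pow2_ge_0]).
  assert (HT0 : 0 < T) by lra.
  (* On [[1, T]] the weights of exponents [sg] and [sg + d] then differ by a factor at most
     [1 + e / (K + 1)]. *)
  set (d := ln (1 + e / (K + 1)) / (2 * T)).
  assert (He1 : 0 < e / (K + 1)) by (apply Rdiv_lt_0_compat; lra).
  assert (Hd : 0 < d). { apply Rdiv_lt_0_compat; [|lra]. rewrite <- ln_1. apply ln_increasing; lra. }
  assert (Hcmp : RI (fun t => exp (- sg * t) ^ 2 * x t ^ 2) 1 T <= (1 + e / (K + 1)) * RI (fun t => exp (- (sg + d) * t) ^ 2 * x t ^ 2) 1 T).
  { rewrite <- RI_scal by ct. apply RI_le; [lra | ct | ct |]. intros t Ht. rewrite <- Rmult_assoc. apply Rmult_le_compat_r. apply pow2_ge_0.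
    replace (exp (- sg * t)) with (exp (d * t) * exp (- (sg + d) * t)) by (rewrite <- exp_plus; f_equal; ring).
    rewrite Rpow_mult_distr. apply Rmult_le_compat_r. apply pow2_ge_0. simpl. rewrite Rmult_1_r, <- exp_plus.
    rewrite <- (exp_ln (1 + e / (K + 1))) by lra. apply exp_le. replace (ln (1 + e / (K + 1))) with (d * (2 * T)) by (unfold d; field; lra). pnra. }
  eapply Rle_trans. apply Hcmp. specialize (Htwo (sg + d) ltac:(lra)).
  apply Rle_trans with ((1 + e / (K + 1)) * K). apply Rmult_le_compat_l; lra.
  replace ((1 + e / (K + 1)) * K) with (K + e * (K / (K + 1))) by (field; lra). apply Rplus_le_compat_l.
  rewrite <- (Rmult_1_r e) at 2. apply Rmult_le_compat_l. lra. apply Rmult_le_reg_r with (K + 1). lra. unfold Rdiv. rewrite Rmult_assoc, Rinv_l; lra.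
Qed.

Lemma abs_le_of_sq x y : 0 <= y -> x ^ 2 <= y ^ 2 -> Rabs x <= y.
Proof.
  intros Hy H. rewrite <- (Rabs_pos_eq y Hy). apply Rsqr_le_abs_0. unfold Rsqr. simpl in H. lra.
Qed.
Lemma Gr_mono s1 s2 : s1 <= s2 -> Gr s1 -> Gr s2.
Proof.
  intros Hs [M [HM H]]. exists M; split; auto. intros x Hx B HB Hb t Ht. eapply Rle_trans. apply (H x Hx B HB Hb t Ht).
  apply Rmult_le_compat_l. apply Rmult_le_pos; lra. apply exp_le. pnra.
Qed.
Lemma exp_sq_le a b : a <= b -> exp a ^ 2 <= exp b ^ 2.
Proof. intros H. apply pow_incr. split. left; apply exp_pos. now apply exp_le. Qed.

Lemma sq2_ge0 a b : 0 <= a ^ 2 * b ^ 2.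
Proof. rewrite <- Rpow_mult_distr. apply pow2_ge_0. Qed.
Lemma sq3_ge0 a b c : 0 <= a ^ 2 * (b ^ 2 * c ^ 2).
Proof. rewrite <- !Rpow_mult_distr. apply pow2_ge_0. Qed.

(* Datko's argument, with a step that does not depend on the growth rate. *)
Lemma Gr_step c : 0 < c -> (forall sg y, 0 <= sg -> 0 <= y -> c * (sg + Rabs (y - th)) <= Lmod be m sg y) ->
  exists eta, 0 < eta /\ forall sg, 0 <= sg -> Gr sg -> Gr (sg - eta).
Proof.
  intros Hc HL. pose proof aG_pos as Ha. pose proof mbe_pos as Hmb.
  assert (HKE : 0 <= KE c). { unfold KE. pose proof (pow2_ge_0 (8 / c + 1)). apply Rmult_le_pos; [lra | apply pow2_ge_0]. }
  set (ka := KE c * exp (aG * 2) ^ 2). assert (Hka : 0 <= ka) by (apply Rmult_le_pos; [auto | apply pow2_ge_0]).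
  set (M1 := exp (aG * 2) + m * be * (ka + 1)).
  assert (HM1 : 0 < M1). { unfold M1. pose proof (exp_pos (aG * 2)). assert (0 < m * be * (ka + 1)) by (apply Rmult_lt_0_compat; lra). lra. }
  set (Qc := M1 ^ 2 * (m * be) ^ 2). assert (HQc : 0 <= Qc) by (apply Rmult_le_pos; apply pow2_ge_0).
  (* The number of windows after which the average energy forces the amplitude below a quarter. *)
  destruct (nfloor_ex (16 * Qc * ka)) as [n0 Hn0]. apply Rmult_le_pos; lra.
  set (n := S n0). assert (Hn : 16 * Qc * ka <= INR n) by (unfold n; rewrite S_INR; lra).
  assert (Hn1 : 1 <= INR n) by (unfold n; rewrite S_INR; pose proof (pos_INR n0); lra).
  (* One unit more than [1 + 2 n], so that a whole segment ending at [T1] lies beyond it. *)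
  set (T1 := 2 + 2 * INR n). assert (HT1 : 0 < T1) by (unfold T1; lra).
  assert (Hln : 0 < ln 4) by (rewrite <- ln_1; apply ln_increasing; lra).
  exists (ln 4 / T1). split. now apply Rdiv_lt_0_compat.
  intros sg Hsg HG.
  assert (HE : forall x B, hsol x -> 0 <= B -> (forall s, -1 <= s <= 0 -> Rabs (x s) <= B) -> forall T, 3 <= T ->
    RI (fun t => exp (- sg * t) ^ 2 * x t ^ 2) 1 T <= ka * B ^ 2).
  { intros x B Hx HB Hb T HT. eapply Rle_trans. apply (Gr_energy c sg Hc HL Hsg HG x B Hx HB Hb T HT). unfold ka. right; ring. }
  assert (Hpt : forall x a t, hsol x -> 0 <= t -> a <= t - 1 -> x t ^ 2 <= (m * be) ^ 2 * (exp (sg * t) ^ 2 * RI (fun s => exp (- sg * s) ^ 2 * x s ^ 2) a t)).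
  { intros x a t Hx Ht Hat. assert (Cx : cont x) by apply Hx. eapply Rle_trans. apply hsol_pointwise; auto. apply Rmult_le_compat_l. apply pow2_ge_0.
    rewrite <- RI_scal by ct.
    rewrite <- (RI_chasles _ a (t - 1) t) by ct.
    assert (0 <= RI (fun s => exp (sg * t) ^ 2 * (exp (- sg * s) ^ 2 * x s ^ 2)) a (t - 1)).
    { apply RI_ge0; [lra | ct | intros; auto using sq2_ge0, sq3_ge0]. }
    assert (RI (fun s => x s ^ 2) (t - 1) t <= RI (fun s => exp (sg * t) ^ 2 * (exp (- sg * s) ^ 2 * x s ^ 2)) (t - 1) t).
    { apply RI_le; [lra | ct | ct |]. intros s Hs. rewrite <- Rmult_assoc. rewrite <- (Rmult_1_l (x s ^ 2)) at 1. apply Rmult_le_compat_r. apply pow2_ge_0.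
      rewrite <- Rpow_mult_distr, <- exp_plus. rewrite <- (pow1 2), <- exp_0. apply exp_sq_le. pnra. }
    lra. }
  (* The energy bound restores the pointwise estimate with a constant [M1] that no longer depends on
     the given growth constant. *)
  assert (HM : forall x B, hsol x -> 0 <= B -> (forall s, -1 <= s <= 0 -> Rabs (x s) <= B) -> forall t, 0 <= t -> Rabs (x t) <= M1 * B * exp (sg * t)).
  { intros x B Hx HB Hb t Ht. assert (Cx : cont x) by apply Hx.
    assert (He : 1 <= exp (sg * t)) by (rewrite <- exp_0; apply exp_le; pnra).
    assert (P1 : 0 <= m * be * (ka + 1)) by (apply Rmult_le_pos; lra). pose proof (exp_pos (aG * 2)) as P2.
    destruct (Rle_lt_dec 2 t).
    - apply Rle_trans with (m * be * (ka + 1) * B * exp (sg * t)).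
      2:{ apply Rmult_le_compat_r. lra. apply Rmult_le_compat_r. auto. unfold M1; lra. }
      apply abs_le_of_sq. apply Rmult_le_pos; [apply Rmult_le_pos; lra | lra]. eapply Rle_trans. apply (Hpt x 1 t Hx Ht ltac:(lra)).
      replace ((m * be * (ka + 1) * B * exp (sg * t)) ^ 2) with ((m * be) ^ 2 * (exp (sg * t) ^ 2 * ((ka + 1) ^ 2 * B ^ 2))) by ring.
      apply Rmult_le_compat_l. apply pow2_ge_0. apply Rmult_le_compat_l. apply pow2_ge_0.
      apply Rle_trans with (ka * B ^ 2). 2:{ apply Rmult_le_compat_r. apply pow2_ge_0. pnra. }
      eapply Rle_trans. 2: apply (HE x B Hx HB Hb (t + 1)); lra.
      rewrite <- (RI_chasles _ 1 t (t + 1)) by ct. assert (0 <= RI (fun s => exp (- sg * s) ^ 2 * x s ^ 2) t (t + 1)).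
      { apply RI_ge0; [lra | ct | intros; auto using sq2_ge0, sq3_ge0]. } lra.
    - eapply Rle_trans. apply (hsol_gronwall x B Hx HB Hb t Ht). rewrite Rmult_comm.
      apply Rle_trans with (exp (aG * 2) * B). apply Rmult_le_compat_r; auto. apply exp_le. pnra.
      apply Rle_trans with (M1 * B * 1). rewrite Rmult_1_r. apply Rmult_le_compat_r; auto. unfold M1; lra. apply Rmult_le_compat_l; auto. apply Rmult_le_pos; lra. }
  (* Restarting at time [s]: the segment there is bounded by the energy on [[s - 2, s]], and [HM]
     propagates it to [t]. *)
  assert (HD : forall x s t, hsol x -> 3 <= s <= t -> exp (- sg * t) ^ 2 * x t ^ 2 <= Qc * RI (fun r => exp (- sg * r) ^ 2 * x r ^ 2) (s - 2) s).
  { intros x s t Hx Hst. assert (Cx : cont x) by apply Hx. set (I := RI _ (s - 2) s).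
    assert (HI : 0 <= I). { apply RI_ge0; [lra | ct | intros; auto using sq2_ge0, sq3_ge0]. }
    set (Bs := m * be * exp (sg * s) * sqrt I).
    assert (HBs : 0 <= Bs). { unfold Bs. pose proof (exp_pos (sg * s)). pose proof (sqrt_pos I). apply Rmult_le_pos; [apply Rmult_le_pos; lra | lra]. }
    assert (Hbs : forall r, -1 <= r <= 0 -> Rabs (x (r + s)) <= Bs).
    { intros r Hr. apply abs_le_of_sq; auto. eapply Rle_trans. apply (Hpt x (s - 2) (r + s) Hx); lra.
      replace (Bs ^ 2) with ((m * be) ^ 2 * (exp (sg * s) ^ 2 * (sqrt I * sqrt I))) by (unfold Bs; ring). rewrite sqrt_sqrt by auto.
      apply Rmult_le_compat_l. apply pow2_ge_0. apply Rmult_le_compat. apply pow2_ge_0.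
      apply RI_ge0; [lra | ct | intros; auto using sq2_ge0, sq3_ge0]. apply exp_sq_le. pnra.
      unfold I. rewrite <- (RI_chasles _ (s - 2) (r + s) s) by ct.
      assert (0 <= RI (fun r => exp (- sg * r) ^ 2 * x r ^ 2) (r + s) s). { apply RI_ge0; [lra | ct | intros; auto using sq2_ge0, sq3_ge0]. } lra. }
    assert (E := HM (fun u => x (u + s)) Bs (hsol_shift x s Hx ltac:(lra)) HBs Hbs (t - s) ltac:(lra)).
    cbv beta in E. replace (t - s + s) with t in E by ring.
    assert (E2 : x t ^ 2 <= (M1 * Bs * exp (sg * (t - s))) ^ 2). { rewrite <- pow2_abs. apply pow_incr. split; auto using Rabs_pos. }
    apply Rle_trans with (exp (- sg * t) ^ 2 * (M1 * Bs * exp (sg * (t - s))) ^ 2). apply Rmult_le_compat_l; auto. apply pow2_ge_0.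
    replace (exp (- sg * t) ^ 2 * (M1 * Bs * exp (sg * (t - s))) ^ 2) with (Qc * (exp (- sg * t) * exp (sg * s) * exp (sg * (t - s))) ^ 2 * (sqrt I * sqrt I)) by (unfold Qc, Bs; ring).
    rewrite sqrt_sqrt by auto. rewrite <- !exp_plus. replace (- sg * t + sg * s + sg * (t - s)) with 0 by ring. rewrite exp_0. right; ring. }
  (* Summing [HD] over [k] adjacent windows of length 2 bounds [k] copies of the same value by the
     total energy. *)
  assert (HS : forall x, hsol x -> forall k t, 1 + 2 * INR k <= t -> INR k * (exp (- sg * t) ^ 2 * x t ^ 2) <= Qc * RI (fun r => exp (- sg * r) ^ 2 * x r ^ 2) 1 (1 + 2 * INR k)).
  { intros x Hx. assert (Cx : cont x) by apply Hx. induction k; intros t Ht.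
    - simpl INR. rewrite Rmult_0_r, Rplus_0_r, RI_0. lra.
    - rewrite S_INR in *. pose proof (pos_INR k). specialize (IHk t ltac:(lra)).
      assert (E := HD x (1 + 2 * (INR k + 1)) t Hx ltac:(lra)). replace (1 + 2 * (INR k + 1) - 2) with (1 + 2 * INR k) in E by ring.
      rewrite <- (RI_chasles _ 1 (1 + 2 * INR k) (1 + 2 * (INR k + 1))) by ct. lra. }
  assert (H4 : forall x B, hsol x -> 0 <= B -> (forall s, -1 <= s <= 0 -> Rabs (x s) <= B) -> forall t, 1 + 2 * INR n <= t -> Rabs (x t) <= B / 4 * exp (sg * t)).
  { intros x B Hx HB Hb t Ht. assert (E1 := HS x Hx n t Ht). assert (E2 := HE x B Hx HB Hb (1 + 2 * INR n) ltac:(lra)).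
    pose proof (exp_pos (sg * t)) as Hp. apply abs_le_of_sq. apply Rmult_le_pos; lra.
    set (q := exp (- sg * t) ^ 2 * x t ^ 2) in *.
    assert (Eq : x t ^ 2 = exp (sg * t) ^ 2 * q).
    { unfold q. rewrite <- Rmult_assoc, <- Rpow_mult_distr, <- exp_plus. replace (sg * t + - sg * t) with 0 by ring. rewrite exp_0. ring. }
    assert (Hq : q <= B ^ 2 / 16).
    { assert (INR n * q <= Qc * (ka * B ^ 2)) by (eapply Rle_trans; [apply E1 | apply Rmult_le_compat_l; auto]).
      assert (HB2 := pow2_ge_0 B). assert (Qc * (ka * B ^ 2) <= INR n * (B ^ 2 / 16)). { replace (Qc * (ka * B ^ 2)) with (16 * Qc * ka * (B ^ 2 / 16)) by field. apply Rmult_le_compat_r; lra. }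
      apply Rmult_le_reg_l with (INR n); lra. }
    rewrite Eq. replace ((B / 4 * exp (sg * t)) ^ 2) with (exp (sg * t) ^ 2 * (B ^ 2 / 16)) by field. apply Rmult_le_compat_l; auto. apply pow2_ge_0. }
  exists (4 * M1). split. lra. intros x Hx B HB Hb t Ht.
  assert (Hk : forall k r, -1 <= r <= 0 -> Rabs (x (r + INR k * T1)) <= B * (exp (sg * T1) / 4) ^ k).
  { induction k; intros r Hr. simpl. rewrite Rmult_0_l, Rplus_0_r, Rmult_1_r. auto.
    assert (HBk : 0 <= B * (exp (sg * T1) / 4) ^ k). { apply Rmult_le_pos; auto. apply pow_le. pose proof (exp_pos (sg * T1)); lra. }
    assert (Hkp : 0 <= INR k * T1) by (apply Rmult_le_pos; [apply pos_INR | lra]).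
    assert (E := H4 (fun u => x (u + INR k * T1)) _ (hsol_shift x _ Hx Hkp) HBk IHk (r + T1) ltac:(unfold T1; lra)). cbv beta in E.
    replace (r + T1 + INR k * T1) with (r + INR (S k) * T1) in E by (rewrite S_INR; ring). eapply Rle_trans. apply E.
    replace (B * (exp (sg * T1) / 4) ^ S k) with (B * (exp (sg * T1) / 4) ^ k / 4 * exp (sg * T1)) by (simpl; field).
    apply Rmult_le_compat_l. lra. apply exp_le. pnra. }
  destruct (nfloor_ex (t / T1)) as [k [Hk1 Hk2]]. apply Rmult_le_pos; [auto | left; now apply Rinv_0_lt_compat].
  assert (Et : t = t / T1 * T1) by (field; lra).
  assert (Hkt : INR k * T1 <= t) by (rewrite Et; apply Rmult_le_compat_r; lra).
  assert (HBk : 0 <= B * (exp (sg * T1) / 4) ^ k). { apply Rmult_le_pos; auto. apply pow_le. pose proof (exp_pos (sg * T1)); lra. }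
  assert (Hkp : 0 <= INR k * T1) by (apply Rmult_le_pos; [apply pos_INR | lra]).
  assert (E := HM (fun u => x (u + INR k * T1)) _ (hsol_shift x _ Hx Hkp) HBk (Hk k) (t - INR k * T1) ltac:(lra)). cbv beta in E.
  replace (t - INR k * T1 + INR k * T1) with t in E by ring. eapply Rle_trans. apply E.
  assert (Hpow : (exp (sg * T1) / 4) ^ k = exp (sg * (INR k * T1) - INR k * ln 4)).
  { unfold Rdiv. rewrite Rpow_mult_distr. unfold Rminus. rewrite exp_plus. f_equal.
    rewrite <- (Rpower_pow k (exp (sg * T1))) by apply exp_pos. unfold Rpower. rewrite ln_exp. f_equal; ring.
    rewrite <- (Rpower_pow k (/ 4)) by lra. unfold Rpower. rewrite ln_Rinv by lra. f_equal; ring. }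
  rewrite Hpow. replace (M1 * (B * exp (sg * (INR k * T1) - INR k * ln 4)) * exp (sg * (t - INR k * T1))) with (M1 * B * exp (sg * t - INR k * ln 4)).
  2:{ replace (sg * t - INR k * ln 4) with ((sg * (INR k * T1) - INR k * ln 4) + sg * (t - INR k * T1)) by ring. rewrite (exp_plus (_ - _)). ring. }
  replace (4 * M1 * B * exp ((sg - ln 4 / T1) * t)) with (M1 * B * exp (ln 4 + (sg - ln 4 / T1) * t)) by (rewrite exp_plus, exp_ln by lra; ring).
  apply Rmult_le_compat_l. apply Rmult_le_pos; lra. apply exp_le.
  replace ((sg - ln 4 / T1) * t) with (sg * t - ln 4 * (t / T1)) by (field; lra). pnra.
Qed.

(** Gronwall gives the exponent [aG]; finitely many steps of fixed length bring it down to 0, and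
    one more below. The step is available for every nonnegative exponent, which is the range of
    [Lmod_lower]. *)
Theorem hsol_decay : exists M eta, 0 < M /\ 0 < eta /\ forall x, hsol x -> forall B, 0 <= B -> (forall s, -1 <= s <= 0 -> Rabs (x s) <= B) ->
  forall t, 0 <= t -> Rabs (x t) <= M * B * exp (- eta * t).
Proof.
  destruct (Lmod_lower be w th m be1 w0 w2 th0 costh sinth mw) as [c [Hc HL]].
  destruct (Gr_step c Hc HL) as [eta [He Hstep]]. pose proof aG_pos as Ha.
  assert (H0 : Gr aG).
  { exists 1. split. lra. intros x Hx B HB Hb t Ht. rewrite Rmult_1_l. now apply hsol_gronwall. }
  assert (Hj : forall j, Gr (Rmax 0 (aG - INR j * eta))).
  { induction j. apply (Gr_mono aG); auto. simpl. eapply Rle_trans; [|apply Rmax_r]. lra.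
    apply (Gr_mono (Rmax 0 (aG - INR j * eta) - eta)). 2: apply Hstep; auto; apply Rmax_l.
    rewrite S_INR. unfold Rmax. destruct (Rle_dec _ _); destruct (Rle_dec _ _); lra. }
  destruct (nfloor_ex (aG / eta)) as [j [_ Hj2]]. apply Rlt_le, Rdiv_lt_0_compat; auto.
  assert (aG <= INR (S j) * eta). { rewrite S_INR. apply Rle_trans with (aG / eta * eta). right; field; lra. apply Rmult_le_compat_r; lra. }
  assert (HG0 : Gr 0). { specialize (Hj (S j)). rewrite Rmax_left in Hj; auto. lra. }
  apply Hstep in HG0; [|lra]. destruct HG0 as [M [HM H1]]. exists M, eta. repeat split; auto.
  intros x Hx B HB Hb t Ht. specialize (H1 x Hx B HB Hb t Ht). now replace (0 - eta) with (- eta) in H1 by ring.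
Qed.
End Decay.

(** * Orbital stability of the branch *)

Lemma RI_ext_in (f g : R -> R) a b : a <= b -> (forall x, a < x < b -> f x = g x) -> RI f a b = RI g a b.
Proof. unfold RI; intros H E. apply RInt_ext. rewrite Rmin_left, Rmax_right by auto. apply E. Qed.
Lemma cont_RI f a : cont f -> cont (fun t => RI f a t).
Proof. intros Hf. apply (is_derive_cont _ f). intros; now apply RI_prim. Qed.

(** * Linear solutions with prescribed history, by the method of steps *)

Section LinEx.
Variables (m be : R) (h : R -> R).
Hypothesis Ch : cont h.
(* One application of the variation of constants formula extends the solution by one delay. *)
Definition stepS (x : R -> R) (t : R) : R :=
  exp (- m * Rmax t 0) * h (Rmin t 0) - m * be * exp (- m * Rmax t 0) * RI (fun s => exp (m * s) * x (s - 1)) 0 (Rmax t 0).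
Fixpoint itS (k : nat) : R -> R := match k with O => fun t => h (Rmin t 0) | S j => stepS (itS j) end.
Lemma cont_stepS x : cont x -> cont (stepS x).
Proof.
  intros Hx. assert (cont (fun t => Rmax t 0)) by (apply cont_max; ct). assert (cont (fun t => Rmin t 0)) by (apply cont_min; ct).
  assert (cont (fun t => RI (fun s => exp (m * s) * x (s - 1)) 0 (Rmax t 0))).
  { apply (cont_comp (fun t => RI (fun s => exp (m * s) * x (s - 1)) 0 t) (fun t => Rmax t 0)); auto. apply cont_RI. ct. }
  unfold stepS. apply cont_minus; [|ct]. apply cont_mult. ct. now apply (cont_comp h).
Qed.
Lemma cont_itS k : cont (itS k).
Proof. induction k; simpl. apply (cont_comp h (fun t => Rmin t 0)); auto. apply cont_min; ct. now apply cont_stepS. Qed.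
Lemma stepS_agree x y T : (forall t, t <= T -> x t = y t) -> forall t, t <= T + 1 -> stepS x t = stepS y t.
Proof.
  intros H t Ht. unfold stepS. f_equal. f_equal. apply RI_ext_in. apply Rmax_r. intros s Hs. f_equal. apply H.
  unfold Rmax in Hs; destruct (Rle_dec t 0); lra.
Qed.
Lemma itS_agree k : forall t, t <= INR k -> itS (S k) t = itS k t.
Proof.
  induction k; intros t Ht.
  - simpl in *. unfold stepS. rewrite Rmax_right, Rmin_left, Rmult_0_r, exp_0, RI_0 by lra. ring.
  - change (stepS (itS (S k)) t = stepS (itS k) t). rewrite S_INR in Ht. now apply (stepS_agree _ _ (INR k)).
Qed.
Lemma itS_agree_le j k t : (k <= j)%nat -> t <= INR k -> itS j t = itS k t.
Proof.
  induction 1; intros Ht; auto. rewrite itS_agree; auto. apply Rle_trans with (INR k); auto. now apply le_INR.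
Qed.
(** The iterate of index [k] is final up to time [k], and [up t] is an integer above [t]. *)
Definition limS (t : R) : R := itS (Z.to_nat (up t)) t.
Lemma limS_eq j t : t <= INR j -> limS t = itS j t.
Proof.
  intros Ht. unfold limS. set (k := Z.to_nat (up t)).
  assert (Hk : t <= INR k). { unfold k. rewrite INR_IZR_INZ. destruct (archimed t) as [H1 _]. apply Rle_trans with (IZR (up t)). lra. apply IZR_le. lia. }
  destruct (Nat.le_ge_cases k j). symmetry; now apply itS_agree_le. now apply itS_agree_le.
Qed.
(** Provides the decaying component when a given function is split by its critical projection. *)
Lemma linear_exists : exists x : R -> R, cont x /\ (forall t, t <= 0 -> x t = h t) /\
  forall t, 0 < t -> is_derive x t (- m * (x t + be * x (t - 1))).
Proof.
  exists limS.
  assert (C : cont limS).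
  { intros t. destruct (nfloor_ex (Rmax (t + 1) 0) (Rmax_r _ _)) as [j [_ Hj]].
    apply (continuous_ext_loc _ (itS (S j))). 2: apply cont_itS.
    exists (mkposreal 1 Rlt_0_1). intros y Hy. symmetry. apply limS_eq. rewrite S_INR.
    assert (t + 1 <= Rmax (t + 1) 0) by apply Rmax_l.
    change (Rabs (y - t) < 1) in Hy. apply Rabs_def2 in Hy. lra. }
  assert (E : forall t, limS t = stepS limS t).
  { intros t. destruct (nfloor_ex (Rmax t 0) (Rmax_r _ _)) as [j [_ Hj]]. assert (t <= Rmax t 0) by apply Rmax_l.
    rewrite (limS_eq (S j)) by (rewrite S_INR; lra). change (stepS (itS j) t = stepS limS t).
    apply (stepS_agree _ _ (INR j)); [|lra]. intros s Hs. symmetry. now apply limS_eq. }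
  split; [exact C|]. split.
  - intros t Ht. rewrite E. unfold stepS. rewrite Rmax_right, Rmin_left, Rmult_0_r, exp_0, RI_0 by lra. ring.
  - intros t Ht.
    apply (is_derive_ext_loc (fun t => exp (- m * t) * h 0 - m * be * exp (- m * t) * RI (fun s => exp (m * s) * limS (s - 1)) 0 t)).
    { exists (mkposreal t Ht). intros y Hy. change (Rabs (y - t) < t) in Hy. apply Rabs_def2 in Hy.
      rewrite (E y). unfold stepS. now rewrite Rmax_left, Rmin_right by lra. }
    assert (Dx : is_derive (fun t => exp (- m * t)) t (- m * exp (- m * t))).
    { eapply is_derive_eq. apply (is_derive_comp exp (fun t => - m * t)). apply is_derive_exp. apply D_scal. apply D_id. unfold scal; simpl; unfold mult; simpl; ring. }
    eapply is_derive_eq. apply D_minus. apply D_mult. apply Dx. apply D_const. apply D_mult. apply D_scal, Dx.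
    apply (RI_prim (fun s => exp (m * s) * limS (s - 1))). ct.
    rewrite (E t). unfold stepS. rewrite Rmax_left, Rmin_right by lra.
    assert (Hex : exp (- m * t) * exp (m * t) = 1) by (rewrite <- exp_plus, <- exp_0; f_equal; ring).
    transitivity (- m * (exp (- m * t) * h 0 - m * be * exp (- m * t) * RI (fun s : R => exp (m * s) * limS (s - 1)) 0 t) - m * be * (exp (- m * t) * exp (m * t)) * limS (t - 1)). ring.
    rewrite Hex. ring.
Qed.
End LinEx.

(** * The forced linear equation *)

Section Inhom.
Variables be w th m : R.
Hypothesis be1 : 1 < be.
Hypothesis w0 : 0 < w.
Hypothesis w2 : w * w = be * be - 1.
Hypothesis th0 : 0 < th < PI.
Hypothesis costh : be * cos th = -1.
Hypothesis sinth : be * sin th = w.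
Hypothesis mw : m * w = th.

(** The critical oscillation [Re ((q1 + i q2) e^(i (th t + vt)))]. *)
Definition lq (q1 q2 vt t : R) : R := q1 * cos (th * t + vt) - q2 * sin (th * t + vt).
Lemma cont_lq q1 q2 vt : cont (lq q1 q2 vt).
Proof. unfold lq. ct. Qed.
Lemma lq_abs q1 q2 vt t : Rabs (lq q1 q2 vt t) <= Rabs q1 + Rabs q2.
Proof.
  unfold lq. pose proof (abs_cos (th * t + vt)). pose proof (abs_sin (th * t + vt)).
  triang. rewrite Rabs_Ropp, !Rabs_mult. pose proof (Rabs_pos q1). pose proof (Rabs_pos q2). pnra.
Qed.
Lemma m_gt0 : 0 < m.
Proof. apply Rmult_lt_reg_r with w; lra. Qed.

Lemma Ic_lq q1 q2 vt : m * be * Ic th (lq q1 q2 vt) 0 =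
  / 2 * (q1 * (cos vt - m * cos vt + th * sin vt) - q2 * (sin vt - m * sin vt - th * cos vt)).
Proof.
  rewrite Ic_int by apply cont_lq.
  set (G := fun s => q1 / 2 * (sin (2 * th * s + (th + vt)) / (2 * th) + s * cos (vt - th)) - q2 / 2 * (- cos (2 * th * s + (th + vt)) / (2 * th) + s * sin (vt - th))).
  rewrite (RI_ext _ (fun s => q1 / 2 * (cos (2 * th * s + (th + vt)) + cos (vt - th)) - q2 / 2 * (sin (2 * th * s + (th + vt)) + sin (vt - th)))).
  2:{ intros s. unfold lq. replace (2 * th * s + (th + vt)) with (th * (s - 0 + 1) + (th * s + vt)) by ring.
      replace (vt - th) with ((th * s + vt) - th * (s - 0 + 1)) by ring. set (X := th * s + vt). set (Y := th * (s - 0 + 1)). rewrite cos_plus, cos_minus, sin_plus, sin_minus. field. }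
  rewrite (RI_derive G).
  - unfold G. replace (2 * th * 0 + (th + vt)) with (vt + th) by ring. replace (2 * th * (0 - 1) + (th + vt)) with (vt - th) by ring.
    rewrite !cos_plus, !cos_minus, !sin_plus, !sin_minus.
    replace (th * sin vt) with (m * (be * sin th) * sin vt) by (rewrite sinth, mw; ring). replace (th * cos vt) with (m * (be * sin th) * cos vt) by (rewrite sinth, mw; ring).
    replace (cos vt - m * cos vt) with (m * (be * sin th) / th * cos vt + m * (be * cos th) * cos vt) by (rewrite sinth, mw, costh; field; lra).
    replace (sin vt - m * sin vt) with (m * (be * sin th) / th * sin vt + m * (be * cos th) * sin vt) by (rewrite sinth, mw, costh; field; lra). field; lra.
  - intros s. unfold G. auto_derive; [lra|]. field; lra.
  - ct.
Qed.
Lemma Is_lq q1 q2 vt : m * be * Is th (lq q1 q2 vt) 0 =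
  / 2 * (q1 * (sin vt + m * sin vt + th * cos vt) + q2 * (cos vt + m * cos vt - th * sin vt)).
Proof.
  rewrite Is_int by apply cont_lq.
  set (G := fun s => q1 / 2 * (- cos (2 * th * s + (th + vt)) / (2 * th) - s * sin (vt - th)) - q2 / 2 * (s * cos (vt - th) - sin (2 * th * s + (th + vt)) / (2 * th))).
  rewrite (RI_ext _ (fun s => q1 / 2 * (sin (2 * th * s + (th + vt)) - sin (vt - th)) - q2 / 2 * (cos (vt - th) - cos (2 * th * s + (th + vt))))).
  2:{ intros s. unfold lq. replace (2 * th * s + (th + vt)) with (th * (s - 0 + 1) + (th * s + vt)) by ring.
      replace (vt - th) with ((th * s + vt) - th * (s - 0 + 1)) by ring. set (X := th * s + vt). set (Y := th * (s - 0 + 1)). rewrite cos_plus, cos_minus, sin_plus, sin_minus. field. }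
  rewrite (RI_derive G).
  - unfold G. replace (2 * th * 0 + (th + vt)) with (vt + th) by ring. replace (2 * th * (0 - 1) + (th + vt)) with (vt - th) by ring.
    rewrite !cos_plus, !cos_minus, !sin_plus, !sin_minus.
    replace (th * sin vt) with (m * (be * sin th) * sin vt) by (rewrite sinth, mw; ring). replace (th * cos vt) with (m * (be * sin th) * cos vt) by (rewrite sinth, mw; ring).
    replace (cos vt + m * cos vt) with (m * (be * sin th) / th * cos vt - m * (be * cos th) * cos vt) by (rewrite sinth, mw, costh; field; lra).
    replace (sin vt + m * sin vt) with (m * (be * sin th) / th * sin vt - m * (be * cos th) * sin vt) by (rewrite sinth, mw, costh; field; lra). field; lra.
  - intros s. unfold G. auto_derive; [lra|]. field; lra.
  - ct.
Qed.
(** [|Delta'(i th)|^2], as [Delta'(i th) = 1 + m + i th]. Accordingly [q1f + i q2f] is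
    [2 (A1 + i A2) / Delta'(i th)], the amplitude of the oscillation with prescribed projection. *)
Definition qN : R := (1 + m) * (1 + m) + th * th.
Definition q1f (A1 A2 : R) : R := 2 * ((1 + m) * A1 + th * A2) / qN.
Definition q2f (A1 A2 : R) : R := 2 * ((1 + m) * A2 - th * A1) / qN.
Lemma qN_ge1 : 1 <= qN.
Proof. pose proof m_gt0. unfold qN. pnra. Qed.
Lemma Z_lq A1 A2 vt :
  Z1 be th m (lq (q1f A1 A2) (q2f A1 A2) vt) 0 = A1 * cos vt - A2 * sin vt /\
  Z2 be th m (lq (q1f A1 A2) (q2f A1 A2) vt) 0 = A1 * sin vt + A2 * cos vt.
Proof.
  pose proof qN_ge1. unfold Z1, Z2. rewrite Ic_lq, Is_lq. unfold lq. rewrite Rmult_0_r, Rplus_0_l.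
  set (q1 := q1f A1 A2). set (q2 := q2f A1 A2).
  assert (E1 : (1 + m) * q1 - th * q2 = 2 * A1) by (unfold q1, q2, q1f, q2f, qN in *; field; lra).
  assert (E2 : (1 + m) * q2 + th * q1 = 2 * A2) by (unfold q1, q2, q1f, q2f, qN in *; field; lra).
  replace A1 with (((1 + m) * q1 - th * q2) / 2) by lra. replace A2 with (((1 + m) * q2 + th * q1) / 2) by lra. split; field.
Qed.
Definition Cq : R := 2 * (1 + m + th).
Lemma Cq_ge1 : 1 <= Cq. Proof. pose proof m_gt0. unfold Cq. lra. Qed.
Lemma q_bound A1 A2 om : Rabs A1 <= om -> Rabs A2 <= om -> Rabs (q1f A1 A2) <= Cq * om /\ Rabs (q2f A1 A2) <= Cq * om.
Proof.
  intros H1 H2. pose proof qN_ge1 as HN. pose proof m_gt0. assert (0 <= om) by (from_abs H1).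
  assert (G : forall z, Rabs z <= (1 + m + th) * om -> Rabs (2 * z / qN) <= Cq * om).
  { intros z Hz. unfold Rdiv. rewrite Rabs_mult, (Rabs_pos_eq (/ qN)) by (left; apply Rinv_0_lt_compat; lra).
    apply Rle_trans with (Rabs (2 * z) * 1). apply Rmult_le_compat_l. apply Rabs_pos. rewrite <- Rinv_1. apply Rinv_le_contravar; lra.
    rewrite Rabs_mult, (Rabs_pos_eq 2) by lra. unfold Cq. lra. }
  unabs H1. unabs H2.
  split; apply G; apply Rabs_le; pnra.
Qed.
Lemma Z_lin x y a t : cont x -> cont y ->
  Z1 be th m (fun s => x s + a * y s) t = Z1 be th m x t + a * Z1 be th m y t /\
  Z2 be th m (fun s => x s + a * y s) t = Z2 be th m x t + a * Z2 be th m y t.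
Proof. intros Hx Hy. unfold Z1, Z2. rewrite Ic_lin, Is_lin by auto. split; ring. Qed.
Lemma Z_bound x t B : cont x -> (forall s, t - 1 <= s <= t -> Rabs (x s) <= B) ->
  Rabs (Z1 be th m x t) <= (1 + m * be) * B /\ Rabs (Z2 be th m x t) <= (1 + m * be) * B.
Proof.
  intros Hx HB. destruct (window_bound th x t B Hx HB) as [H1 H2]. pose proof m_gt0. assert (0 < m * be) by (apply Rmult_lt_0_compat; lra).
  assert (H3 := HB t ltac:(lra)). assert (0 <= B) by (from_abs H3).
  unabs H1. unabs H2. unabs H3. unfold Z1, Z2. split; apply Rabs_le; pnra.
Qed.
Lemma Z_ext x y t : cont x -> cont y -> (forall s, t - 1 <= s <= t -> x s = y s) ->
  Z1 be th m x t = Z1 be th m y t /\ Z2 be th m x t = Z2 be th m y t.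
Proof.
  intros Hx Hy E. destruct (Z_lin x y (-1) t Hx Hy) as [E1 E2].
  destruct (Z_bound (fun s => x s + -1 * y s) t 0) as [B1 B2]. ct. intros s Hs. rewrite (E s Hs). replace (y s + -1 * y s) with 0 by ring. rewrite Rabs_R0; lra.
  rewrite Rmult_0_r in *. unabs B1. unabs B2. split; lra.
Qed.

Definition aL : R := m * (1 + be).
Lemma aL_pos : 0 < aL.
Proof. unfold aL. apply Rmult_lt_0_compat. apply m_gt0. lra. Qed.
Lemma lin_rhs_abs a b Y : Rabs a <= Y -> Rabs b <= Y -> Rabs (- m * (a + be * b)) <= aL * Y.
Proof.
  intros H1 H2. pose proof m_gt0. rewrite Rabs_mult, Rabs_Ropp, Rabs_pos_eq by lra. unfold aL. rewrite Rmult_assoc. apply Rmult_le_compat_l. lra.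
  unabs H1. unabs H2. apply Rabs_le. pnra.
Qed.

(** Split [y] into the critical oscillation with the same projection, a homogeneous solution without
    critical component, which decays, and a remainder with zero history driven by the forcing. *)
Lemma inhom_bound : exists M eta, 0 < M /\ 0 < eta /\ forall (D : R) (y F : R -> R) (H om Ph : R), 1 <= D -> cont y -> 0 <= H -> 0 <= om -> 0 <= Ph ->
  (forall t, 0 < t -> is_derive y t (- m * (y t + be * y (t - 1)) + F t)) -> (forall t, 0 < t < D -> Rabs (F t) <= Ph) ->
  (forall t, -1 <= t <= 0 -> Rabs (y t) <= H) -> Rabs (Z1 be th m y 0) <= om -> Rabs (Z2 be th m y 0) <= om ->
  forall t, D - 1 <= t <= D -> Rabs (y t) <= M * exp (- eta * (D - 1)) * (H + 2 * Cq * om) + 2 * Cq * om + Ph * D * exp (aL * D).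
Proof.
  destruct (hsol_decay be w th m be1 w0 w2 th0 costh sinth mw) as [M [eta [HM [He Hdec]]]].
  exists M, eta. repeat split; auto. intros D y F H om Ph HD Cy HH Hom HPh Hy HF Hh HZ1 HZ2.
  set (z1 := Z1 be th m y 0) in *. set (z2 := Z2 be th m y 0) in *. pose proof Cq_ge1 as HCq. pose proof aL_pos as HaL.
  set (l := lq (q1f z1 z2) (q2f z1 z2) 0). assert (Cl : cont l) by apply cont_lq.
  destruct (q_bound z1 z2 om HZ1 HZ2) as [Hq1 Hq2].
  assert (Hl : forall t, Rabs (l t) <= 2 * Cq * om). { intros t. eapply Rle_trans. apply lq_abs. lra. }
  assert (Hlz : Z1 be th m l 0 = z1 /\ Z2 be th m l 0 = z2).
  { destruct (Z_lq z1 z2 0) as [E1 E2]. rewrite cos_0, sin_0 in *. fold l in E1, E2. split; lra. }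
  assert (Ld : forall t, is_derive l t (- m * (l t + be * l (t - 1)))).
  { intros t. unfold l, lq. set (q1 := q1f z1 z2). set (q2 := q2f z1 z2). auto_derive. trivial.
    replace (th * (t - 1) + 0) with (th * t + 0 - th) by ring. rewrite cos_minus, sin_minus.
    transitivity (- m * (q1 * cos (th * t + 0) - q2 * sin (th * t + 0) + (q1 * (cos (th * t + 0) * (be * cos th) + sin (th * t + 0) * (be * sin th)) - q2 * (sin (th * t + 0) * (be * cos th) - cos (th * t + 0) * (be * sin th))))).
    2: ring. rewrite costh, sinth. rewrite <- mw. ring. }
  (* Removing the oscillation [l] from the history makes its projection zero, so [hsol_decay]
     applies. *)
  destruct (linear_exists m be (fun s => y s + -1 * l s) ltac:(ct)) as [x [Cx [Hx0 Hxd]]].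
  assert (Hs : hsol be th m x).
  { split; auto. split; auto. destruct (Z_ext x (fun s => y s + -1 * l s) 0 Cx ltac:(ct)) as [E1 E2]. intros; apply Hx0; lra.
    rewrite E1, E2. destruct (Z_lin y l (-1) 0 Cy Cl) as [E3 E4]. rewrite E3, E4. fold z1 z2. destruct Hlz. split; lra. }
  assert (Hxb := Hdec x Hs (H + 2 * Cq * om)).
  set (u := fun t => y t - l t - x t).
  assert (Hu : forall t, 0 <= t <= D -> Rabs (u t) <= (0 + Ph * t) * exp (aL * t)).
  { apply (delay_growth u 0 D aL Ph ((0 + Ph * D) * exp (aL * D) + 1)); try lra. unfold u; ct.
    - intros s Hs'. unfold u. rewrite Hx0 by lra. replace (y s - l s - (y s + -1 * l s)) with 0 by ring. rewrite Rabs_R0; lra.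
    - intros t Y Ht HY _. exists (- m * (u t + be * u (t - 1)) + F t). split.
      + unfold u at 1. eapply is_derive_eq. apply D_minus. apply D_minus. apply Hy; lra. apply Ld. apply Hxd; lra. unfold u; ring.
      + triang. apply Rplus_le_compat. apply lin_rhs_abs; apply HY; lra. now apply HF. }
  intros t Ht. assert (Ht0 : 0 <= t <= D) by lra. specialize (Hu t Ht0).
  assert (0 <= Cq * om) by (apply Rmult_le_pos; lra).
  assert (Hxt : Rabs (x t) <= M * (H + 2 * Cq * om) * exp (- eta * t)).
  { apply Hxb; try lra. intros s Hs'. rewrite Hx0 by lra. specialize (Hh s Hs'). specialize (Hl s). replace (y s + -1 * l s) with (y s + - l s) by ring. triang.
    rewrite Rabs_Ropp. lra. }
  assert (Hxt2 : M * (H + 2 * Cq * om) * exp (- eta * t) <= M * exp (- eta * (D - 1)) * (H + 2 * Cq * om)).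
  { replace (M * (H + 2 * Cq * om) * exp (- eta * t)) with (M * exp (- eta * t) * (H + 2 * Cq * om)) by ring.
    apply Rmult_le_compat_r. lra. apply Rmult_le_compat_l. lra. apply exp_le. pnra. }
  assert (Hut : (0 + Ph * t) * exp (aL * t) <= Ph * D * exp (aL * D)).
  { apply Rmult_le_compat. pnra. left; apply exp_pos. pnra. apply exp_le. pnra. }
  specialize (Hl t). replace (y t) with (u t + l t + x t) by (unfold u; ring).
  triang. eapply Rle_trans. apply Rplus_le_compat_r, Rabs_triang. lra.
Qed.
End Inhom.

Lemma cos_sub_quad a d : Rabs (cos (a + d) - cos a + d * sin a) <= d * d.
Proof.
  assert (G : forall d, 0 <= d -> forall a, Rabs (cos (a + d) - cos a + d * sin a) <= d * d).
  { clear. intros d Hd a. destruct (Req_dec d 0) as [->|Hn].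
    rewrite Rplus_0_r. replace (cos a - cos a + 0 * sin a) with 0 by ring. rewrite Rabs_R0. lra.
    destruct (MVT_open (fun t => cos (a + t) + t * sin a) (fun t => - sin (a + t) + sin a) 0 d) as [c [Hc E]]. lra. ct.
    { intros t _. auto_derive; auto. ring. }
    rewrite Rplus_0_r in E. replace (cos (a + d) - cos a + d * sin a) with (cos (a + d) + d * sin a - (cos a + 0 * sin a)) by ring. rewrite E.
    rewrite Rabs_mult, (Rabs_pos_eq (d - 0)) by lra. rewrite Rminus_0_r. apply Rmult_le_compat_r; auto.
    replace (- sin (a + c) + sin a) with (sin a - sin (a + c)) by ring. eapply Rle_trans. apply sin_lip. replace (a - (a + c)) with (- c) by ring. rewrite Rabs_Ropp, Rabs_pos_eq; lra. }
  destruct (Rle_lt_dec 0 d) as [H|H]. now apply G.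
  specialize (G (- d) ltac:(lra) (- a)). rewrite sin_neg in G. replace (- a + - d) with (- (a + d)) in G by ring. rewrite !cos_neg in G.
  replace (cos (a + d) - cos a + - d * - sin a) with (cos (a + d) - cos a + d * sin a) in G by ring. lra.
Qed.

(** * The branch in the time scale where the delay is 1 *)

Section Fam.
Variables be w th m : R.
Hypothesis be1 : 1 < be.
Hypothesis w0 : 0 < w.
Hypothesis w2 : w * w = be * be - 1.
Hypothesis th0 : 0 < th < PI.
Hypothesis costh : be * cos th = -1.
Hypothesis sinth : be * sin th = w.
Hypothesis mw : m * w = th.
Variables (n0 : R) (n3 : R -> R) (Ln : R).
Hypothesis n3b : forall z, Rabs z <= 1 -> Rabs (n3 z) <= Ln.
Hypothesis n3l : forall y z, Rabs y <= 1 -> Rabs z <= 1 -> Rabs (n3 y - n3 z) <= Ln * Rabs (y - z).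
Variables (eb L s0 : R) (psi dpsi : R -> R -> R) (nu kap : R -> R).
Hypothesis Heb : 0 < eb <= 1.
Hypothesis HL : 0 < L.
Hypothesis Hs0 : 0 < s0.
Hypothesis Hfam : forall e, 0 <= e <= eb ->
  (forall t : R, is_derive (psi e) t (dpsi e t)) /\ cont (dpsi e) /\ per (psi e) /\
  (forall t, Rabs (psi e t) <= L) /\ (forall t, Rabs (dpsi e t) <= L) /\ w / 2 <= nu e /\ 0 < kap e < PI /\
  (forall s, nu e * (- e * sin s + e * e * dpsi e s) + (e * cos s + e * e * psi e s) =
           fN be n0 n3 (e * cos (s - kap e) + e * e * psi e (s - kap e))).
Hypothesis Hlip : forall ea ec, 0 <= ea <= eb -> 0 <= ec <= eb ->
  (forall t, Rabs (psi ea t - psi ec t) <= L * Rabs (ea - ec)) /\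
  (forall t, Rabs (dpsi ea t - dpsi ec t) <= L * Rabs (ea - ec)) /\
  Rabs (nu ea - nu ec) <= L * ((ea + ec) * Rabs (ea - ec)) /\ Rabs (kap ea - kap ec) <= L * ((ea + ec) * Rabs (ea - ec)).
Hypothesis Hnu0 : nu 0 = w.
Hypothesis Hkap0 : kap 0 = th.
(** The delay of the member [e] for [n = 0], times [d]; in the scale of unit delay it multiplies the
    right-hand side of the equation. *)
Definition mE (e : R) : R := kap e * / nu e.
Hypothesis Hmono : forall ea ec, 0 <= ea <= ec -> ec <= eb -> s0 * ((ec - ea) * (ec + ea)) <= mE ec - mE ea.

Definition Yp (e p : R) : R := e * cos p + e * e * psi e p.
Definition X (e t : R) : R := Yp e (kap e * t).
Definition dX (e t : R) : R := kap e * (- e * sin (kap e * t) + e * e * dpsi e (kap e * t)).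

Lemma mE0 : mE 0 = m.
Proof. unfold mE. rewrite Hnu0, Hkap0, <- mw. field; lra. Qed.
Lemma Yp_D e p : 0 <= e <= eb -> is_derive (Yp e) p (- e * sin p + e * e * dpsi e p).
Proof.
  intros He. destruct (Hfam e He) as (D & _). eapply is_derive_eq. apply D_plus. apply D_scal. apply is_derive_cos. apply D_scal. apply D. ring.
Qed.
Lemma X_D e t : 0 <= e <= eb -> is_derive (X e) t (dX e t).
Proof.
  intros He. unfold X. eapply is_derive_eq. apply (D_comp (Yp e) (fun t => kap e * t)). now apply Yp_D. apply D_scal, D_id. unfold dX. ring.
Qed.
Lemma cont_X e : 0 <= e <= eb -> cont (X e).
Proof. intros He. apply (is_derive_cont _ (dX e)). intros; now apply X_D. Qed.
Lemma X_eq e t : 0 <= e <= eb -> dX e t = mE e * (fN be n0 n3 (X e (t - 1)) - X e t).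
Proof.
  intros He. destruct (Hfam e He) as (_ & _ & _ & _ & _ & Hn & Hk & E). specialize (E (kap e * t)). unfold X, Yp.
  replace (kap e * (t - 1)) with (kap e * t - kap e) by ring. rewrite <- E. unfold dX, mE. field; lra.
Qed.
Lemma Yp_abs e p : 0 <= e <= eb -> Rabs (Yp e p) <= (1 + L) * e.
Proof.
  intros He. destruct (Hfam e He) as (_ & _ & _ & B & _). specialize (B p). pose proof (abs_cos p) as Hc. unfold Yp.
  unabs B. unabs Hc. apply Rabs_le. assert (0 <= e * e <= e) by pnra. pnra.
Qed.
Lemma X_abs e t : 0 <= e <= eb -> Rabs (X e t) <= (1 + L) * e.
Proof. apply Yp_abs. Qed.
Lemma kap_th e : 0 <= e <= eb -> Rabs (kap e - th) <= L * (e * e).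
Proof.
  intros He. destruct (Hlip e 0 He ltac:(lra)) as (_ & _ & _ & K). rewrite Hkap0, Rplus_0_r, Rminus_0_r, (Rabs_pos_eq e) in K by lra. exact K.
Qed.
Lemma dX_approx e t : 0 <= e <= eb -> Rabs (dX e t + e * th * sin (kap e * t)) <= 5 * L * (e * e).
Proof.
  intros He. destruct (Hfam e He) as (_ & _ & _ & _ & B & _ & Hk & _). specialize (B (kap e * t)). assert (K := kap_th e He). pose proof PI_4.
  pose proof (abs_sin (kap e * t)) as Hs. replace (dX e t + e * th * sin (kap e * t)) with (- ((kap e - th) * sin (kap e * t) * e) + kap e * (e * e) * dpsi e (kap e * t)) by (unfold dX; ring).
  triang. rewrite Rabs_Ropp, !Rabs_mult, (Rabs_pos_eq e), (Rabs_pos_eq (kap e)) by lra.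
  assert (0 <= e * e) by pnra. assert (L * (e * e) * e <= L * (e * e)). { rewrite <- (Rmult_1_r (L * (e * e))) at 2. apply Rmult_le_compat_l; pnra. }
  assert (Rabs (kap e - th) * Rabs (sin (kap e * t)) * e <= L * (e * e) * e). { apply Rmult_le_compat_r. lra. pose proof (Rabs_pos (kap e - th)). pnra. }
  assert (kap e * (e * e) * Rabs (dpsi e (kap e * t)) <= 4 * (e * e) * L). { apply Rmult_le_compat. pnra. apply Rabs_pos. pnra. auto. }
  lra.
Qed.
Lemma mE_ge e : 0 <= e <= eb -> m <= mE e.
Proof. intros He. assert (H := Hmono 0 e ltac:(lra) ltac:(lra)). rewrite mE0 in H. assert (0 <= s0 * ((e - 0) * (e + 0))) by (apply Rmult_le_pos; pnra). lra. Qed.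
Definition Cm : R := L * (2 / w) + 4 * L * (4 / (w * w)).
Lemma Cm_pos : 0 < Cm.
Proof. unfold Cm. assert (0 < 2 / w) by (apply Rdiv_lt_0_compat; lra). assert (0 < 4 / (w * w)) by (apply Rdiv_lt_0_compat; pnra). pnra. Qed.
Lemma mE_lip ea ec : 0 <= ea <= eb -> 0 <= ec <= eb -> Rabs (mE ea - mE ec) <= Cm * ((ea + ec) * Rabs (ea - ec)).
Proof.
  intros Ha Hc. destruct (Hlip ea ec Ha Hc) as (_ & _ & N & K). set (d := (ea + ec) * Rabs (ea - ec)) in *.
  destruct (Hfam ea Ha) as (_ & _ & _ & _ & _ & Na & Ka & _). destruct (Hfam ec Hc) as (_ & _ & _ & _ & _ & Nc & Kc & _). pose proof PI_4.
  replace (mE ea - mE ec) with ((kap ea - kap ec) * / nu ea + kap ec * (- (nu ea - nu ec)) * (/ nu ea * / nu ec)) by (unfold mE; field; lra).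
  assert (Ia : 0 < / nu ea <= 2 / w). { split. apply Rinv_0_lt_compat; lra. replace (2 / w) with (/ (w / 2)) by (field; lra). apply Rinv_le_contravar; lra. }
  assert (Ic : 0 < / nu ec <= 2 / w). { split. apply Rinv_0_lt_compat; lra. replace (2 / w) with (/ (w / 2)) by (field; lra). apply Rinv_le_contravar; lra. }
  triang. rewrite !Rabs_mult, Rabs_Ropp, (Rabs_pos_eq (/ nu ea)), (Rabs_pos_eq (/ nu ec)), (Rabs_pos_eq (kap ec)) by lra.
  unfold Cm. rewrite Rmult_plus_distr_r. apply Rplus_le_compat.
  - replace (L * (2 / w) * d) with (L * d * (2 / w)) by ring. apply Rmult_le_compat; try lra. apply Rabs_pos.
  - replace (4 * L * (4 / (w * w)) * d) with (4 * (L * d) * ((2 / w) * (2 / w))) by (field; lra). apply Rmult_le_compat; try nra.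
    apply Rmult_le_pos. lra. apply Rabs_pos. apply Rmult_le_compat; try lra. apply Rabs_pos.
Qed.

Definition Cf : R := 2 * Rabs n0 + 4 * Ln.
Lemma Ln_ge0 : 0 <= Ln.
Proof. eapply Rle_trans. apply Rabs_pos. apply (n3b 0). rewrite Rabs_R0. lra. Qed.
Lemma Cf_pos : 0 <= Cf.
Proof. unfold Cf. pose proof Ln_ge0. pose proof (Rabs_pos n0). lra. Qed.
Lemma fN_quad a b Y : Rabs a <= Y -> Rabs b <= Y -> Y <= 1 -> Rabs (fN be n0 n3 a - fN be n0 n3 b + be * (a - b)) <= Cf * Y * Rabs (a - b).
Proof.
  intros Ha Hb HY. assert (HY0 : 0 <= Y) by (from_abs Ha). pose proof Ln_ge0.
  assert (Na := n3b a ltac:(lra)). assert (Nl := n3l a b ltac:(lra) ltac:(lra)). set (d := Rabs (a - b)) in *. assert (0 <= d) by apply Rabs_pos.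
  replace (fN be n0 n3 a - fN be n0 n3 b + be * (a - b)) with ((a - b) * (n0 * (a + b) + n3 a * (a * a + a * b + b * b)) + (b * b * b) * (n3 a - n3 b)) by (unfold fN; ring).
  assert (Hab : Rabs (a + b) <= 2 * Y) by (triang; lra).
  assert (Hq : Rabs (a * a + a * b + b * b) <= 3 * Y). { unabs Ha. unabs Hb. apply Rabs_le. split; pnra. }
  assert (Hc : Rabs (b * b * b) <= Y). { rewrite !Rabs_mult. pose proof (Rabs_pos b). assert (Rabs b * Rabs b <= 1) by pnra. pnra. }
  triang. rewrite (Rabs_mult (a - b)), (Rabs_mult (b * b * b)). fold d.
  assert (Rabs (n0 * (a + b) + n3 a * (a * a + a * b + b * b)) <= Rabs n0 * (2 * Y) + Ln * (3 * Y)).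
  { triang. rewrite !Rabs_mult. apply Rplus_le_compat; apply Rmult_le_compat; auto using Rabs_pos; lra. }
  assert (d * Rabs (n0 * (a + b) + n3 a * (a * a + a * b + b * b)) <= d * (Rabs n0 * (2 * Y) + Ln * (3 * Y))) by (apply Rmult_le_compat_l; auto).
  assert (Rabs (b * b * b) * Rabs (n3 a - n3 b) <= Y * (Ln * d)) by (apply Rmult_le_compat; auto using Rabs_pos).
  unfold Cf. lra.
Qed.

Lemma psi_lip e p p' : 0 <= e <= eb -> Rabs (psi e p - psi e p') <= L * Rabs (p - p').
Proof.
  intros He. destruct (Hfam e He) as (D & _ & _ & _ & B & _). apply (lip_of_deriv (psi e) (dpsi e)); auto.
Qed.
Lemma Yp_diff ea ec p p' : 0 <= ea <= eb -> 0 <= ec <= eb ->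
  Rabs (Yp ea p - Yp ec p') <= (1 + 3 * L) * (Rabs (ea - ec) + ec * Rabs (p - p')).
Proof.
  intros Ha Hc. destruct (Hlip ea ec Ha Hc) as (P & _). specialize (P p). assert (P2 := psi_lip ec p p' Hc).
  destruct (Hfam ea Ha) as (_ & _ & _ & B & _). specialize (B p). pose proof (abs_cos p). pose proof (cos_lip p p').
  set (d := Rabs (ea - ec)) in *. set (q := Rabs (p - p')) in *. assert (0 <= d) by apply Rabs_pos. assert (0 <= q) by apply Rabs_pos.
  replace (Yp ea p - Yp ec p') with ((ea - ec) * (cos p + (ea + ec) * psi ea p) + ec * ((cos p - cos p') + ec * ((psi ea p - psi ec p) + (psi ec p - psi ec p')))) by (unfold Yp; ring).
  triang. rewrite !Rabs_mult, (Rabs_pos_eq ec) by lra. fold d.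
  assert (E1 : Rabs (cos p + (ea + ec) * psi ea p) <= 1 + 2 * L).
  { triang. rewrite Rabs_mult, (Rabs_pos_eq (ea + ec)) by lra. pose proof (Rabs_pos (psi ea p)). pnra. }
  assert (E2 : Rabs ((cos p - cos p') + ec * ((psi ea p - psi ec p) + (psi ec p - psi ec p'))) <= q + ec * (L * d + L * q)).
  { triang. apply Rplus_le_compat; auto. rewrite Rabs_mult, (Rabs_pos_eq ec) by lra. apply Rmult_le_compat_l. lra.
    triang. lra. }
  assert (d * Rabs (cos p + (ea + ec) * psi ea p) <= d * (1 + 2 * L)) by (apply Rmult_le_compat_l; auto).
  assert (ec * Rabs ((cos p - cos p') + ec * ((psi ea p - psi ec p) + (psi ec p - psi ec p'))) <= ec * (q + ec * (L * d + L * q))) by (apply Rmult_le_compat_l; lra).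
  assert (0 <= L * d) by pnra. assert (0 <= L * q) by pnra. assert (0 <= ec * (L * q)) by pnra.
  assert (ec * (ec * (L * d)) <= L * d). { assert (ec * ec <= 1) by pnra. pnra. }
  assert (ec * (ec * (L * q)) <= ec * (L * q)) by pnra. pnra.
Qed.

Lemma e1_range e q1 : 0 < e -> 2 * e <= eb -> Rabs q1 <= e / 2 -> e / 2 <= e + q1 <= 3 / 2 * e.
Proof. intros He H2 Hq. unabs Hq. lra. Qed.

Definition CR (Ca : R) : R := (1 + 3 * L) * (Ca + 3 * L) + (Ca + 4 * L) + 7 * L + 4 * L * (2 + 3 * L).
Lemma CR_pos Ca : 0 <= Ca -> 0 < CR Ca.
Proof. intros H. unfold CR. assert (0 < (1 + 3 * L) * (Ca + 3 * L)) by (apply Rmult_lt_0_compat; lra). assert (0 < 4 * L * (2 + 3 * L)) by (apply Rmult_lt_0_compat; lra). lra. Qed.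

(** Changing the amplitude by [q1] and the phase by [q2 / e] changes the orbit by [lq] to first
    order; dividing by [e] compensates the amplitude in front of the cosine. The bound [q2 = O(e^2)]
    keeps the phase change of order [e], so that the quadratic error gains a factor [e]. *)
Lemma shift_residual Ca e q1 q2 vt t : 0 <= Ca -> 0 < e -> 2 * e <= eb -> Rabs q1 <= e / 2 -> Rabs q2 <= Ca * (e * e) -> Rabs t <= 1 ->
  Rabs (Yp e (vt + kap e * t) - Yp (e + q1) (vt + q2 / e + kap (e + q1) * t) + lq th q1 q2 vt t) <= CR Ca * (e * (Rabs q1 + Rabs q2)).
Proof.
  intros HCa He H2 Hq1 Hq2 Ht. assert (Hr := e1_range e q1 He H2 Hq1). set (e1 := e + q1) in *.
  set (a1 := Rabs q1) in *. set (a2 := Rabs q2) in *. assert (Ha1 : 0 <= a1) by apply Rabs_pos. assert (Ha2 : 0 <= a2) by apply Rabs_pos.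
  destruct (Hlip e1 e ltac:(lra) ltac:(lra)) as (P & _ & _ & K). replace (e1 - e) with q1 in * by (unfold e1; ring). fold a1 in P, K.
  assert (K' : Rabs (kap e1 - kap e) <= 3 * L * (e * a1)). { eapply Rle_trans. apply K. assert (0 <= L * a1) by pnra. pnra. }
  set (dk := (kap e1 - kap e) * t).
  assert (Hdk : Rabs dk <= 3 * L * (e * a1)). { unfold dk. rewrite Rabs_mult. pose proof (Rabs_pos (kap e1 - kap e)). pnra. }
  set (dl := q2 / e + dk). set (ph := vt + kap e * t). set (ph' := th * t + vt).
  replace (vt + q2 / e + kap e1 * t) with (ph + dl) by (unfold ph, dl, dk; ring).
  assert (Hq2e : Rabs (q2 / e) = a2 / e). { unfold Rdiv. rewrite Rabs_mult, (Rabs_pos_eq (/ e)); auto. left; now apply Rinv_0_lt_compat. }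
  assert (Hq2e2 : a2 / e <= Ca * e). { apply Rmult_le_reg_r with e; auto. unfold Rdiv. rewrite Rmult_assoc, Rinv_l by lra. lra. }
  assert (HLe : 0 <= L * e) by pnra. assert (Hea1 : 0 <= e * a1) by pnra. assert (HLa : 0 <= L * a1) by pnra.
  assert (Hdl1 : Rabs dl <= (Ca + 3 * L) * e). { unfold dl. triang. rewrite Hq2e. assert (L * (e * a1) <= L * e * 1) by pnra. lra. }
  assert (Hdl2 : e * Rabs dl <= (1 + 3 * L) * (a1 + a2)).
  { apply Rle_trans with (e * (a2 / e + 3 * L * (e * a1))). apply Rmult_le_compat_l. lra. unfold dl. triang. rewrite Hq2e; lra.
    replace (e * (a2 / e + 3 * L * (e * a1))) with (a2 + 3 * ((L * a1) * (e * e))) by (field; lra). assert (e * e <= 1) by pnra. assert (0 <= L * a2) by pnra. pnra. }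
  assert (Hph : Rabs (ph' - ph) <= L * e).
  { replace (ph' - ph) with (- ((kap e - th) * t)) by (unfold ph, ph'; ring). rewrite Rabs_Ropp, Rabs_mult. assert (Hk := kap_th e ltac:(lra)).
    pose proof (Rabs_pos (kap e - th)). assert (L * (e * e) <= L * e) by pnra. pnra. }
  (* Six contributions: Taylor error of the cosine, drift of [kap], displacement of the angle in the
     two linear terms, and the variation of the [psi] term in amplitude and in phase. *)
  replace (Yp e ph - Yp e1 (ph + dl) + lq th q1 q2 vt t) with
    (- e * (cos (ph + dl) - cos ph + dl * sin ph) + e * dk * sin ph + q1 * (cos ph' - cos (ph + dl)) - q2 * (sin ph' - sin ph)
     + (- q1 * (e + e1)) * psi e ph + (e1 * e1) * (- (psi e1 ph - psi e ph) + - (psi e1 (ph + dl) - psi e1 ph))).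
  2:{ unfold Yp, lq. fold ph'. unfold dl. replace e1 with (e + q1) by reflexivity. field; lra. }
  assert (B1 : Rabs (- e * (cos (ph + dl) - cos ph + dl * sin ph)) <= (1 + 3 * L) * (Ca + 3 * L) * (e * (a1 + a2))).
  { rewrite Rabs_mult, Rabs_Ropp, (Rabs_pos_eq e) by lra. apply Rle_trans with (e * (dl * dl)). apply Rmult_le_compat_l. lra. apply cos_sub_quad.
    replace (dl * dl) with (Rabs dl * Rabs dl) by (rewrite <- Rabs_mult; apply Rabs_pos_eq; pnra).
    replace ((1 + 3 * L) * (Ca + 3 * L) * (e * (a1 + a2))) with (((1 + 3 * L) * (a1 + a2)) * ((Ca + 3 * L) * e)) by ring. rewrite <- Rmult_assoc.
    apply Rmult_le_compat; auto using Rabs_pos. apply Rmult_le_pos. lra. apply Rabs_pos. }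
  assert (B2 : Rabs (e * dk * sin ph) <= 3 * L * (e * (a1 + a2))).
  { rewrite !Rabs_mult, (Rabs_pos_eq e) by lra. pose proof (abs_sin ph). pose proof (Rabs_pos dk). assert (e * Rabs dk * Rabs (sin ph) <= e * Rabs dk * 1) by (apply Rmult_le_compat_l; pnra).
    assert (e * Rabs dk <= e * (3 * L * (e * a1))) by (apply Rmult_le_compat_l; lra). assert (e * (3 * L * (e * a1)) <= 3 * L * (e * a1)) by pnra. pnra. }
  assert (B3 : Rabs (q1 * (cos ph' - cos (ph + dl))) <= (Ca + 4 * L) * (e * a1)).
  { rewrite Rabs_mult. fold a1. replace ((Ca + 4 * L) * (e * a1)) with (a1 * ((Ca + 4 * L) * e)) by ring. apply Rmult_le_compat_l; auto.
    eapply Rle_trans. apply cos_lip. replace (ph' - (ph + dl)) with ((ph' - ph) + - dl) by ring. triang. rewrite Rabs_Ropp. lra. }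
  assert (B4 : Rabs (q2 * (sin ph' - sin ph)) <= L * (e * a2)).
  { rewrite Rabs_mult. fold a2. pose proof (sin_lip ph' ph). assert (a2 * Rabs (sin ph' - sin ph) <= a2 * (L * e)) by (apply Rmult_le_compat_l; lra). lra. }
  assert (B5 : Rabs ((- q1 * (e + e1)) * psi e ph) <= 3 * L * (e * a1)).
  { destruct (Hfam e ltac:(lra)) as (_ & _ & _ & B & _). specialize (B ph). rewrite !Rabs_mult, Rabs_Ropp, (Rabs_pos_eq (e + e1)) by lra. fold a1.
    pose proof (Rabs_pos (psi e ph)). assert (a1 * (e + e1) * Rabs (psi e ph) <= (a1 * (3 * e)) * L) by (apply Rmult_le_compat; try lra; pnra). lra. }
  assert (B6 : Rabs ((e1 * e1) * (- (psi e1 ph - psi e ph) + - (psi e1 (ph + dl) - psi e1 ph))) <= 4 * L * (2 + 3 * L) * (e * (a1 + a2))).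
  { rewrite Rabs_mult, (Rabs_pos_eq (e1 * e1)) by pnra. specialize (P ph). assert (P2 := psi_lip e1 (ph + dl) ph ltac:(lra)). replace (ph + dl - ph) with dl in P2 by ring.
    assert (Hs : Rabs (- (psi e1 ph - psi e ph) + - (psi e1 (ph + dl) - psi e1 ph)) <= L * (a1 + Rabs dl)).
    { triang. rewrite !Rabs_Ropp. lra. }
    apply Rle_trans with (4 * (e * e) * (L * (a1 + Rabs dl))). apply Rmult_le_compat; auto using Rabs_pos; pnra.
    replace (4 * (e * e) * (L * (a1 + Rabs dl))) with (4 * L * (e * (e * a1 + e * Rabs dl))) by ring.
    replace (4 * L * (2 + 3 * L) * (e * (a1 + a2))) with (4 * L * (e * ((2 + 3 * L) * (a1 + a2)))) by ring. apply Rmult_le_compat_l. lra. apply Rmult_le_compat_l. lra.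
    assert (e * a1 <= a1) by pnra. lra. }
  assert (e * (a1 + a2) = e * a1 + e * a2) by ring. assert (0 <= e * a2) by pnra.
  assert (0 <= (Ca + 4 * L) * (e * a2)) by (apply Rmult_le_pos; lra). assert (0 <= L * (e * a2)) by (apply Rmult_le_pos; lra). assert (0 <= L * (e * a1)) by (apply Rmult_le_pos; lra).
  triang. eapply Rle_trans. apply Rplus_le_compat; [|apply B6].
  triang. apply Rplus_le_compat; [|apply B5].
  unfold Rminus at 1. triang. rewrite Rabs_Ropp. apply Rplus_le_compat; [|apply B4].
  triang. apply Rplus_le_compat; [|apply B3]. triang. apply Rplus_le_compat; [apply B1 | apply B2].
  unfold CR. lra.
Qed.

(** * One step of the comparison with the branch *)

Section Dev.
Variables (eps e sg D : R) (x : R -> R).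
Hypothesis Heps : 0 < eps.
Hypothesis Heps2 : 4 * eps <= eb.
Hypothesis Hsmall : (2 * (1 + L) + 1) * eps <= 1.
Hypothesis Her : Rabs (e - eps) <= eps / 2.
Hypothesis HD : 1 <= D.
Hypothesis Cx : cont x.
Hypothesis Dx : forall t, 0 < t -> is_derive x t (mE eps * (fN be n0 n3 (x (t - 1)) - x t)).
Let y (t : R) : R := x t - X e (sg + t).
(** Relative mismatch of delays: inserted into the equation of the member [eps], the orbit of the
    member [e] leaves the defect [mu * dX e]. *)
Let mu : R := (mE eps - mE e) / mE e.
Let r : R := e - eps.

Lemma e_range : eps / 2 <= e <= 2 * eps /\ 0 < e <= eb.
Proof. unabs Her. lra. Qed.
(** The difference between the true linear coefficient and [m], plus the nonlinear remainder; both
    are small relative to [y], unlike the defect [mu * dX e]. *)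
Definition F1 (t : R) : R := (m - mE eps) * (y t + be * y (t - 1)) +
  mE eps * (fN be n0 n3 (x (t - 1)) - fN be n0 n3 (X e (sg + (t - 1))) + be * y (t - 1)).
Lemma m_pos2 : 0 < m.
Proof. apply Rmult_lt_reg_r with w; lra. Qed.
Lemma mE_range e' : 0 <= e' <= eb -> m <= mE e' <= m + Cm * (e' * e') /\ mE e' <= m + Cm.
Proof.
  intros He'. assert (H1 := mE_ge e' He'). assert (H2 := mE_lip e' 0 He' ltac:(lra)). rewrite mE0, Rplus_0_r, Rminus_0_r, (Rabs_pos_eq e') in H2 by lra.
  unabs H2. pose proof Cm_pos. assert (e' * e' <= 1) by pnra. pnra.
Qed.
Lemma cont_y : cont y.
Proof. unfold y. assert (cont (fun t => X e (sg + t))). { apply (cont_comp (X e) (fun t => sg + t)); [|ct]. apply cont_X. destruct e_range; lra. } ct. Qed.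
Lemma D_y t : 0 < t -> is_derive y t (- m * (y t + be * y (t - 1)) + (F1 t + mu * dX e (sg + t))).
Proof.
  intros Ht. destruct e_range as [_ He]. unfold y at 1. eapply is_derive_eq. apply D_minus. now apply Dx.
  apply (D_comp (X e) (fun t => sg + t)). apply X_D; lra. apply D_plus. apply D_const. apply D_id.
  assert (E := X_eq e (sg + t) ltac:(lra)). replace (sg + t - 1) with (sg + (t - 1)) in E by ring.
  destruct (mE_range e ltac:(lra)) as [[Hm _] _]. pose proof m_pos2.
  unfold F1. replace (mu * dX e (sg + t)) with (mE eps * (fN be n0 n3 (X e (sg + (t - 1))) - X e (sg + t)) - dX e (sg + t)) by (unfold mu; rewrite E; field; lra).
  unfold y. ring.
Qed.
Definition CF : R := Cm * (1 + be) + (m + Cm) * Cf * (2 * (1 + L) + 1).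
Lemma CF_pos : 0 <= CF.
Proof. unfold CF. pose proof Cm_pos. pose proof Cf_pos. pose proof m_pos2. assert (0 <= Cm * (1 + be)) by pnra. assert (0 <= (m + Cm) * Cf * (2 * (1 + L) + 1)) by (apply Rmult_le_pos; [pnra | lra]). lra. Qed.
Lemma F1_bound t Y : Rabs (y t) <= Y -> Rabs (y (t - 1)) <= Y -> Y <= eps -> Rabs (F1 t) <= CF * eps * Y.
Proof.
  intros H1 H2 HY. assert (HY0 : 0 <= Y) by (from_abs H1).
  destruct e_range as [He1 He2]. destruct (mE_range eps ltac:(lra)) as [Hm1 Hm2]. pose proof m_pos2. pose proof Cm_pos. pose proof Cf_pos.
  assert (HX := X_abs e (sg + (t - 1)) ltac:(lra)).
  assert (HX2 : Rabs (X e (sg + (t - 1))) <= (2 * (1 + L) + 1) * eps) by pnra.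
  assert (Hx2 : Rabs (x (t - 1)) <= (2 * (1 + L) + 1) * eps).
  { replace (x (t - 1)) with (X e (sg + (t - 1)) + y (t - 1)) by (unfold y; ring). triang. pnra. }
  assert (HQ := fN_quad _ _ _ Hx2 HX2 Hsmall). fold (y (t - 1)) in HQ.
  unfold F1. triang. rewrite !Rabs_mult, (Rabs_pos_eq (mE eps)) by lra.
  assert (Rabs (m - mE eps) <= Cm * eps). { rewrite Rabs_minus_sym, Rabs_pos_eq by lra. assert (eps * eps <= eps) by pnra. pnra. }
  assert (Rabs (y t + be * y (t - 1)) <= (1 + be) * Y). { triang. rewrite Rabs_mult, (Rabs_pos_eq be) by lra. pnra. }
  assert (Rabs (m - mE eps) * Rabs (y t + be * y (t - 1)) <= Cm * eps * ((1 + be) * Y)) by (apply Rmult_le_compat; auto using Rabs_pos).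
  set (q := Rabs (fN be n0 n3 (x (t - 1)) - fN be n0 n3 (X e (sg + (t - 1))) + be * y (t - 1))) in *.
  assert (Hq : q <= Cf * ((2 * (1 + L) + 1) * eps) * Y). { eapply Rle_trans. apply HQ. apply Rmult_le_compat_l; auto. apply Rmult_le_pos; auto. apply Rmult_le_pos; lra. }
  assert (mE eps * q <= (m + Cm) * (Cf * ((2 * (1 + L) + 1) * eps) * Y)). { apply Rmult_le_compat; try lra. apply Rabs_pos. }
  unfold CF. lra.
Qed.
Definition Cmu : R := 3 * Cm / m.
Definition cmu : R := s0 / (m + Cm).
Lemma Cmu_pos : 0 < Cmu /\ 0 < cmu.
Proof. pose proof Cm_pos. pose proof m_pos2. unfold Cmu, cmu. split; apply Rdiv_lt_0_compat; lra. Qed.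
(** The sign in the second part is the stabilising effect: the delay grows with the amplitude, so
    the mismatch always opposes the defect [r]. *)
Lemma mu_bound : Rabs mu <= Cmu * eps * Rabs r /\ mu * r <= - (cmu * eps * (r * r)).
Proof.
  destruct e_range as [He1 He2]. destruct (mE_range e ltac:(lra)) as [[Hm1 _] Hm2]. pose proof m_pos2. pose proof Cm_pos. pose proof (Rabs_pos r).
  assert (I0 : 0 < / mE e) by (apply Rinv_0_lt_compat; lra).
  split.
  - unfold mu, Rdiv. rewrite Rabs_mult, (Rabs_pos_eq (/ mE e)) by lra. assert (I : / mE e <= / m) by (apply Rinv_le_contravar; lra).
    assert (H2 := mE_lip eps e ltac:(lra) ltac:(lra)). rewrite (Rabs_minus_sym eps e) in H2. fold r in H2.
    apply Rle_trans with ((Cm * (3 * eps * Rabs r)) * / m). 2: unfold Cmu, Rdiv; right; ring.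
    apply Rmult_le_compat; auto using Rabs_pos. lra. eapply Rle_trans. apply H2. apply Rmult_le_compat_l. lra. apply Rmult_le_compat_r; lra.
  - assert (Hs : s0 * eps * (r * r) <= (mE e - mE eps) * r).
    { unfold r. destruct (Rle_lt_dec eps e) as [Hl|Hl].
      - assert (M := Hmono eps e ltac:(lra) ltac:(lra)). assert (s0 * ((e - eps) * (e + eps)) * (e - eps) <= (mE e - mE eps) * (e - eps)) by (apply Rmult_le_compat_r; lra).
        assert (0 <= s0 * ((e - eps) * (e - eps)) * e). { apply Rmult_le_pos; [|lra]. apply Rmult_le_pos; pnra. } lra.
      - assert (M := Hmono e eps ltac:(lra) ltac:(lra)). assert (s0 * ((eps - e) * (eps + e)) * (eps - e) <= (mE eps - mE e) * (eps - e)) by (apply Rmult_le_compat_r; lra).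
        assert (0 <= s0 * ((e - eps) * (e - eps)) * e). { apply Rmult_le_pos; [|lra]. apply Rmult_le_pos; pnra. } lra. }
    replace (mu * r) with (- ((mE e - mE eps) * r * / mE e)) by (unfold mu; field; lra). apply Ropp_le_contravar.
    apply Rle_trans with (s0 * eps * (r * r) * / mE e). 2: apply Rmult_le_compat_r; lra.
    replace (cmu * eps * (r * r)) with (s0 * eps * (r * r) * / (m + Cm)) by (unfold cmu; field; lra). apply Rmult_le_compat_l. apply Rmult_le_pos; pnra. apply Rinv_le_contravar; lra.
Qed.
Definition CdX : R := 2 * (4 + 5 * L).
Lemma dX_bound t : Rabs (dX e t) <= CdX * eps.
Proof.
  destruct e_range as [He1 He2]. assert (H := dX_approx e t ltac:(lra)). pose proof PI_4. pose proof (abs_sin (kap e * t)) as Hs.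
  replace (dX e t) with ((dX e t + e * th * sin (kap e * t)) + - (e * th * sin (kap e * t))) by ring. triang.
  rewrite Rabs_Ropp, (Rabs_mult (e * th)), (Rabs_pos_eq (e * th)) by pnra. assert (e * th * Rabs (sin (kap e * t)) <= e * 4). { rewrite Rmult_assoc. apply Rmult_le_compat_l. lra. rewrite <- (Rmult_1_r 4). apply Rmult_le_compat; try lra. apply Rabs_pos. }
  assert (5 * L * (e * e) <= 5 * L * (2 * eps)) by (apply Rmult_le_compat_l; pnra). unfold CdX. lra.
Qed.

Definition CG : R := (1 + Cmu * CdX * D) * exp ((aL be m + CF) * D).
Lemma CG_ge1 : 1 <= CG.
Proof.
  pose proof Cmu_pos. assert (0 < CdX) by (unfold CdX; lra). pose proof CF_pos. assert (0 < aL be m) by (unfold aL; pose proof m_pos2; pnra).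
  unfold CG. rewrite <- (Rmult_1_r 1) at 1. apply Rmult_le_compat; try lra. assert (0 <= Cmu * CdX * D) by (apply Rmult_le_pos; pnra). lra.
  rewrite <- exp_0 at 1. apply exp_le. pnra.
Qed.
Variables H om : R.
Hypothesis HH : 0 <= H.
Hypothesis Hom : 0 <= om.
Hypothesis Hh : forall t, -1 <= t <= 0 -> Rabs (y t) <= H.
Hypothesis HGs : CG * (H + eps * eps * Rabs r) < eps.
(** The defect forces [y] by [O(eps^2 |r|)]. The cap in [delay_growth] is [eps], the range in which
    [F1_bound] is valid. *)
Lemma y_growth t : -1 <= t <= D -> Rabs (y t) <= CG * (H + eps * eps * Rabs r).
Proof.
  intros Ht. pose proof CG_ge1 as HCG. destruct Cmu_pos as [HCmu _]. pose proof (Rabs_pos r) as Hr. pose proof CF_pos as HCF. assert (HCd : 0 < CdX) by (unfold CdX; lra).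
  assert (Hee : 0 <= eps * eps * Rabs r) by (apply Rmult_le_pos; pnra).
  destruct (Rle_lt_dec t 0). { eapply Rle_trans. apply Hh; lra. pnra. }
  assert (Ha : 0 < aL be m) by (unfold aL; pose proof m_pos2; pnra).
  set (ph := Cmu * CdX * (eps * eps * Rabs r)). assert (Hph : 0 <= ph) by (apply Rmult_le_pos; pnra).
  assert (Hmono' : forall s, 0 <= s <= D -> (H + ph * s) * exp ((aL be m + CF) * s) <= CG * (H + eps * eps * Rabs r)).
  { intros s Hs. unfold CG. replace ((1 + Cmu * CdX * D) * exp ((aL be m + CF) * D) * (H + eps * eps * Rabs r)) with (((1 + Cmu * CdX * D) * (H + eps * eps * Rabs r)) * exp ((aL be m + CF) * D)) by ring.
    assert (ph * s <= ph * D) by pnra. assert (0 <= ph * s) by pnra. assert (0 <= Cmu * CdX * D * H) by (apply Rmult_le_pos; auto; apply Rmult_le_pos; pnra).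
    apply Rmult_le_compat. lra. left; apply exp_pos. unfold ph in *. lra. apply exp_le. pnra. }
  eapply Rle_trans. 2: apply (Hmono' t); lra.
  apply (delay_growth y H D (aL be m + CF) ph eps); try lra. apply cont_y. auto.
  - eapply Rle_lt_trans. apply (Hmono' D); lra. auto.
  - intros s Y Hs HY HYe. exists (- m * (y s + be * y (s - 1)) + (F1 s + mu * dX e (sg + s))). split. apply D_y; lra.
    assert (Y1 := HY s ltac:(lra)). assert (Y2 := HY (s - 1) ltac:(lra)). assert (0 <= Y) by (from_abs Y1).
    triang. assert (B1 := lin_rhs_abs be w th m be1 w0 th0 mw _ _ _ Y1 Y2). assert (B2 := F1_bound s Y Y1 Y2 HYe).
    assert (B3 : Rabs (mu * dX e (sg + s)) <= ph).
    { rewrite Rabs_mult. destruct mu_bound as [M _]. assert (Dd := dX_bound (sg + s)). apply Rle_trans with (Cmu * eps * Rabs r * (CdX * eps)). apply Rmult_le_compat; auto using Rabs_pos. unfold ph. right; ring. }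
    assert (B4 : Rabs (F1 s + mu * dX e (sg + s)) <= CF * Y + ph). { triang. assert (CF * eps * Y <= CF * Y). { apply Rmult_le_compat_r; auto. pnra. } lra. }
    lra.
Qed.

Hypothesis HDc : cos (th * D) = 1.
Hypothesis HDs : sin (th * D) = 0.
Let vt : R := kap e * (sg + D).
Definition CZ : R := CF * CG + Cmu * (5 * L + 4 * (L * D)) * 4.
Lemma CZ_pos : 0 <= CZ.
Proof. pose proof CF_pos. pose proof CG_ge1. pose proof Cmu_pos. unfold CZ. apply Rplus_le_le_0_compat. pnra. apply Rmult_le_pos; [|lra]. apply Rmult_le_pos. lra. pnra. Qed.
(** Up to higher order the forcing oscillates exactly at the critical frequency: replacing [kap e]
    by [th] over the time [D] costs [O(e^2)] in the phase. *)
Lemma F_resonant t : 0 < t < D -> Rabs (F1 t + mu * dX e (sg + t) + mu * (e * th * sin (vt - th * (D - t)))) <= CZ * (eps * (H + eps * eps * Rabs r)).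
Proof.
  intros Ht. destruct e_range as [He1 He2]. pose proof CG_ge1 as HCG. destruct Cmu_pos as [HCmu _]. pose proof (Rabs_pos r) as Hr. pose proof CF_pos as HCF.
  assert (Hee : 0 <= eps * eps * Rabs r) by (apply Rmult_le_pos; pnra). set (U := H + eps * eps * Rabs r) in *.
  assert (B1 := F1_bound t (CG * U) (y_growth t ltac:(lra)) (y_growth (t - 1) ltac:(lra)) ltac:(lra)).
  assert (B2 : Rabs (dX e (sg + t) + e * th * sin (vt - th * (D - t))) <= (5 * L + 4 * (L * D)) * (e * e)).
  { replace (dX e (sg + t) + e * th * sin (vt - th * (D - t))) with ((dX e (sg + t) + e * th * sin (kap e * (sg + t))) + e * (th * (sin (vt - th * (D - t)) - sin (kap e * (sg + t))))) by ring.
    triang. assert (E1 := dX_approx e (sg + t) ltac:(lra)). rewrite (Rabs_mult e), (Rabs_mult th), (Rabs_pos_eq e), (Rabs_pos_eq th) by lra.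
    assert (E2 : Rabs (sin (vt - th * (D - t)) - sin (kap e * (sg + t))) <= L * D * (e * e)).
    { eapply Rle_trans. apply sin_lip. replace (vt - th * (D - t) - kap e * (sg + t)) with ((kap e - th) * (D - t)) by (unfold vt; ring).
      rewrite Rabs_mult, (Rabs_pos_eq (D - t)) by lra. assert (Hk := kap_th e ltac:(lra)). replace (L * D * (e * e)) with (L * (e * e) * D) by ring. apply Rmult_le_compat; try lra. apply Rabs_pos. }
    pose proof PI_4. set (q := Rabs (sin (vt - th * (D - t)) - sin (kap e * (sg + t)))) in *. assert (0 <= q) by apply Rabs_pos.
    assert (th * q <= 4 * q) by (apply Rmult_le_compat_r; lra). assert (0 <= th * q) by pnra. assert (e * (th * q) <= th * q) by pnra. lra. }
  replace (F1 t + mu * dX e (sg + t) + mu * (e * th * sin (vt - th * (D - t)))) with (F1 t + mu * (dX e (sg + t) + e * th * sin (vt - th * (D - t)))) by ring.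
  triang. rewrite (Rabs_mult mu). destruct mu_bound as [M _].
  set (K := 5 * L + 4 * (L * D)) in *. assert (HK : 0 <= K) by (unfold K; pnra).
  assert (B3 : Rabs mu * Rabs (dX e (sg + t) + e * th * sin (vt - th * (D - t))) <= (Cmu * eps * Rabs r) * (K * (4 * (eps * eps)))).
  { apply Rmult_le_compat; auto using Rabs_pos. eapply Rle_trans. apply B2. apply Rmult_le_compat_l; pnra. }
  unfold CZ. fold K. replace ((CF * CG + Cmu * K * 4) * (eps * U)) with (CF * eps * (CG * U) + Cmu * K * 4 * (eps * U)) by ring.
  replace ((Cmu * eps * Rabs r) * (K * (4 * (eps * eps)))) with (Cmu * K * 4 * (eps * (eps * eps * Rabs r))) in B3 by ring.
  assert (Cmu * K * 4 * (eps * (eps * eps * Rabs r)) <= Cmu * K * 4 * (eps * U)).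
  { apply Rmult_le_compat_l. apply Rmult_le_pos; [pnra | lra]. apply Rmult_le_compat_l. lra. unfold U. lra. }
  lra.
Qed.
(** In the frame rotating with frequency [th] only the forcing remains. Its product with the
    eigenfunction is a constant, which accumulates over [D], plus an oscillation of frequency
    [2 th], which contributes nothing because [D] is a multiple of the period. *)
Lemma resonance : Rabs (Z1 be th m y D - (Z1 be th m y 0 - mu * (e * th * (D / 2) * sin vt))) <= D * (CZ * (eps * (H + eps * eps * Rabs r))) /\
  Rabs (Z2 be th m y D - (Z2 be th m y 0 + mu * (e * th * (D / 2) * cos vt))) <= D * (CZ * (eps * (H + eps * eps * Rabs r))).
Proof.
  assert (Cy := cont_y). assert (CI1 := cont_Ic th y Cy). assert (CI2 := cont_Is th y Cy).
  assert (C1 : cont (Z1 be th m y)) by (unfold Z1; ct). assert (C2 : cont (Z2 be th m y)) by (unfold Z2; ct).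
  set (F := fun t => F1 t + mu * dX e (sg + t)).
  assert (DZ : forall t, 0 < t < D -> is_derive (Z1 be th m y) t (F t - th * Z2 be th m y t) /\ is_derive (Z2 be th m y) t (th * Z1 be th m y t)).
  { intros t Ht. apply (D_Z be w th m costh sinth mw y t (F t) Cy). apply D_y; lra. }
  set (U := CZ * (eps * (H + eps * eps * Rabs r))).
  assert (Dc : forall t, is_derive (fun t => cos (th * (D - t))) t (th * sin (th * (D - t)))) by (intros; auto_derive; auto; unfold Rminus; ring).
  assert (Ds : forall t, is_derive (fun t => sin (th * (D - t))) t (- th * cos (th * (D - t)))) by (intros; auto_derive; auto; unfold Rminus; ring).
  assert (G : forall (g : R -> R) (l : R -> R), cont g -> (forall t, 0 < t < D -> is_derive g t (l t) /\ Rabs (l t) <= U) -> Rabs (g D - g 0) <= D * U).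
  { intros g l Cg Hg. destruct (MVT_open g l 0 D ltac:(lra) Cg) as [c [Hc E]]. intros; now apply Hg. rewrite E, Rminus_0_r, Rabs_mult, (Rabs_pos_eq D) by lra.
    rewrite Rmult_comm. apply Rmult_le_compat_l. lra. now apply Hg. }
  assert (Hres : forall t c, 0 < t < D -> Rabs c <= 1 -> Rabs (c * (F t + mu * (e * th * sin (vt - th * (D - t))))) <= U).
  { intros t c Ht Hc. rewrite Rabs_mult. assert (B := F_resonant t Ht). fold (F t) U in B. pose proof (Rabs_pos (F t + mu * (e * th * sin (vt - th * (D - t))))). pnra. }
  split.
  (* The rotated projection minus an explicit primitive of the resonant forcing: what remains has
     derivative at most [U], and the mean value theorem replaces integration. *)
  - assert (E := G (fun t => (cos (th * (D - t)) * Z1 be th m y t - sin (th * (D - t)) * Z2 be th m y t) - mu * e * (- (th / 2 * t * sin vt) + / 4 * cos (vt - 2 * th * (D - t))))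
       (fun t => cos (th * (D - t)) * (F t + mu * (e * th * sin (vt - th * (D - t))))) ltac:(ct)). cbv beta in E.
    match type of E with ?P -> _ => assert (HP : P) end.
    { intros t Ht. split. 2: apply Hres; auto using abs_cos. destruct (DZ t Ht) as [d1 d2].
      assert (d3 : is_derive (fun t => - (th / 2 * t * sin vt) + / 4 * cos (vt - 2 * th * (D - t))) t (- (th / 2 * sin vt) - th / 2 * sin (vt - 2 * th * (D - t)))) by (auto_derive; auto; unfold Rminus; field).
      eapply is_derive_eq. apply D_minus. apply D_minus. apply D_mult; [apply Dc | apply d1]. apply D_mult; [apply Ds | apply d2]. apply D_scal, d3.
      replace (vt - 2 * th * (D - t)) with ((vt - th * (D - t)) - th * (D - t)) by ring. replace (sin vt) with (sin ((vt - th * (D - t)) + th * (D - t))) by (f_equal; ring).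
      set (b := th * (D - t)). set (a := vt - b). clearbody a. rewrite (sin_plus a b), (sin_minus a b). field. }
    specialize (E HP). clear HP. replace (th * (D - D)) with 0 in E by ring. replace (2 * th * (D - D)) with 0 in E by ring. replace (th * (D - 0)) with (th * D) in E by ring.
    replace (2 * th * (D - 0)) with (th * D + th * D) in E by ring. rewrite cos_0, sin_0, HDc, HDs, Rminus_0_r in E.
    rewrite (cos_minus vt), cos_plus, sin_plus, HDc, HDs in E. eapply Rle_trans. 2: apply E. right; f_equal; field.
  - assert (E := G (fun t => (sin (th * (D - t)) * Z1 be th m y t + cos (th * (D - t)) * Z2 be th m y t) - mu * e * (th / 2 * t * cos vt - / 4 * sin (vt - 2 * th * (D - t))))
       (fun t => sin (th * (D - t)) * (F t + mu * (e * th * sin (vt - th * (D - t))))) ltac:(ct)). cbv beta in E.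
    match type of E with ?P -> _ => assert (HP : P) end.
    { intros t Ht. split. 2: apply Hres; auto using abs_sin. destruct (DZ t Ht) as [d1 d2].
      assert (d3 : is_derive (fun t => th / 2 * t * cos vt - / 4 * sin (vt - 2 * th * (D - t))) t (th / 2 * cos vt - th / 2 * cos (vt - 2 * th * (D - t)))) by (auto_derive; auto; unfold Rminus; field).
      eapply is_derive_eq. apply D_minus. apply D_plus. apply D_mult; [apply Ds | apply d1]. apply D_mult; [apply Dc | apply d2]. apply D_scal, d3.
      replace (vt - 2 * th * (D - t)) with ((vt - th * (D - t)) - th * (D - t)) by ring. replace (cos vt) with (cos ((vt - th * (D - t)) + th * (D - t))) by (f_equal; ring).
      set (b := th * (D - t)). set (a := vt - b). clearbody a. rewrite (cos_plus a b), (cos_minus a b). field. }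
    specialize (E HP). clear HP. replace (th * (D - D)) with 0 in E by ring. replace (2 * th * (D - D)) with 0 in E by ring. replace (th * (D - 0)) with (th * D) in E by ring.
    replace (2 * th * (D - 0)) with (th * D + th * D) in E by ring. rewrite cos_0, sin_0, HDc, HDs, Rminus_0_r in E.
    rewrite (sin_minus vt), cos_plus, sin_plus, HDc, HDs in E. eapply Rle_trans. 2: apply E. right; f_equal; field.
Qed.

Hypothesis HZ1 : Rabs (Z1 be th m y 0) <= om.
Hypothesis HZ2 : Rabs (Z2 be th m y 0) <= om.
Hypothesis Hinh : forall (y F : R -> R) (H om Ph : R), cont y -> 0 <= H -> 0 <= om -> 0 <= Ph ->
  (forall t, 0 < t -> is_derive y t (- m * (y t + be * y (t - 1)) + F t)) -> (forall t, 0 < t < D -> Rabs (F t) <= Ph) ->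
  (forall t, -1 <= t <= 0 -> Rabs (y t) <= H) -> Rabs (Z1 be th m y 0) <= om -> Rabs (Z2 be th m y 0) <= om ->
  forall t, D - 1 <= t <= D -> Rabs (y t) <= / 4 * (H + 2 * Cq th m * om) + 2 * Cq th m * om + Ph * D * exp (aL be m * D).
Definition CQ : R := 4 * Cq th m * (1 + D * CZ) + 40 * D * Cmu.
Let U : R := om + eps * H + eps * eps * Rabs r.
Hypothesis HU1 : U <= eps * eps.
Hypothesis HU2 : CQ * U <= eps / 4.
Hypothesis Hmus : Cmu * 32 * D * (eps * eps) <= 1.
Definition CP : R := (CF * CG + Cmu * CdX) * D * exp (aL be m * D).
Definition CRQ : R := CR (4 * CQ) * 2 * CQ.
Definition CS : R := 3 * Cq th m + CP + CQ + CRQ * (2 + m * be).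
Definition cS : R := cmu * (th * th) / (2 * qN th m).

(** [A1 + i A2] is the projection at time [D] turned back by the phase [vt], so that its parts
    measure amplitude and phase errors relative to the orbit. *)
Let A1 : R := cos vt * Z1 be th m y D + sin vt * Z2 be th m y D.
Let A2 : R := - sin vt * Z1 be th m y D + cos vt * Z2 be th m y D.
Let q1 : R := q1f th m A1 A2.
Let q2 : R := q2f th m A1 A2.
(** [U] with one more factor [eps] on [|r|]. The amplitude gains only [cS eps^2 |r|] per step, so
    its error must be of third order in [eps]; for [H] and [om] the coarser [U] is enough. *)
Let V : R := om + eps * H + eps * eps * eps * Rabs r.
Lemma V_le_U : 0 <= V /\ V <= U /\ 0 <= eps * H /\ 0 <= eps * eps * Rabs r /\ eps <= 1.
Proof.
  pose proof (Rabs_pos r). assert (0 <= eps * eps * Rabs r) by (apply Rmult_le_pos; pnra). assert (eps <= 1) by lra. assert (0 <= eps * H) by pnra.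
  assert (0 <= eps * eps * eps * Rabs r <= eps * eps * Rabs r). { rewrite (Rmult_assoc (eps * eps)), (Rmult_comm eps (Rabs r)), <- Rmult_assoc. pnra. } unfold V, U. lra.
Qed.
Lemma CQ_pos : 4 * Cq th m <= CQ /\ 1 <= Cq th m.
Proof.
  assert (HCq := Cq_ge1 w th m w0 th0 mw). pose proof CZ_pos. pose proof Cmu_pos. split; auto. unfold CQ.
  assert (0 <= D * CZ) by pnra. assert (0 <= 40 * D * Cmu) by pnra. pnra.
Qed.

(** By [resonance], [A2] is [mu e th D / 2] up to [O(V)] and [A1] is [O(V)]. Dividing by
    [Delta'(i th)] gives the main term of [q1]; in the second bound the two main terms cost 32 and
    8, hence the 40 in [CQ]. *)
Lemma q_est : Rabs (q1 - mu * (e * (th * th) * D / qN th m)) <= CQ * V /\ Rabs q1 + Rabs q2 <= CQ * U.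
Proof.
  destruct resonance as [R1 R2]. destruct e_range as [He1 He2]. assert (HN := qN_ge1 w th m w0 th0 mw). destruct CQ_pos as [HCQ HCq]. destruct V_le_U as (HV0 & HVU & HeH & Her2 & He).
  pose proof CZ_pos as HCZ. pose proof m_pos2 as Hm. destruct mu_bound as [Mb _]. destruct Cmu_pos as [HCmu _]. pose proof PI_4.
  set (E := om + D * (CZ * (eps * (H + eps * eps * Rabs r)))) in *. set (G := e * th * (D / 2)) in *.
  assert (HDCZ : 0 <= D * CZ) by pnra.
  assert (HE : E <= (1 + D * CZ) * V). { unfold E, V. replace (D * (CZ * (eps * (H + eps * eps * Rabs r)))) with (D * CZ * (eps * H + eps * eps * eps * Rabs r)) by ring. pnra. }
  assert (HG : 0 <= G <= 4 * (eps * D)). { unfold G. split. apply Rmult_le_pos; pnra. replace (4 * (eps * D)) with ((2 * eps * 4) * (D / 2)) by field. apply Rmult_le_compat_r. lra. apply Rmult_le_compat; lra. }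
  assert (E1 : Rabs (Z1 be th m y D + mu * (G * sin vt)) <= E).
  { replace (Z1 be th m y D + mu * (G * sin vt)) with ((Z1 be th m y D - (Z1 be th m y 0 - mu * (G * sin vt))) + Z1 be th m y 0) by ring. triang. unfold E. lra. }
  assert (E2 : Rabs (Z2 be th m y D - mu * (G * cos vt)) <= E).
  { replace (Z2 be th m y D - mu * (G * cos vt)) with ((Z2 be th m y D - (Z2 be th m y 0 + mu * (G * cos vt))) + Z2 be th m y 0) by ring. triang. unfold E. lra. }
  assert (HE0 : 0 <= E) by (from_abs E1).
  assert (Hcs : forall c s a b, Rabs c <= 1 -> Rabs s <= 1 -> Rabs a <= E -> Rabs b <= E -> Rabs (c * a + s * b) <= 2 * E).
  { intros c s a b Hc Hs Ha Hb. triang. rewrite !Rabs_mult. pose proof (Rabs_pos a). pose proof (Rabs_pos b). pnra. }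
  assert (F1' : Rabs A1 <= 2 * E).
  { replace A1 with (cos vt * (Z1 be th m y D + mu * (G * sin vt)) + sin vt * (Z2 be th m y D - mu * (G * cos vt))) by (unfold A1; ring). apply Hcs; auto using abs_cos, abs_sin. }
  assert (F2' : Rabs (A2 - mu * G) <= 2 * E).
  { assert (Hone : mu * G = mu * G * (sin vt * sin vt + cos vt * cos vt)) by (assert (Q := sin2_cos2 vt); unfold Rsqr in Q; rewrite Q; ring).
    rewrite Hone. replace (A2 - mu * G * (sin vt * sin vt + cos vt * cos vt)) with (- sin vt * (Z1 be th m y D + mu * (G * sin vt)) + cos vt * (Z2 be th m y D - mu * (G * cos vt))) by (unfold A2; ring). apply Hcs; auto using abs_cos. rewrite Rabs_Ropp. apply abs_sin. }
  destruct (q_bound w th m w0 th0 mw A1 (A2 - mu * G) _ F1' F2') as [Q1 Q2].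
  assert (Eq1 : q1 = q1f th m A1 (A2 - mu * G) + mu * (e * (th * th) * D / qN th m)) by (unfold q1, q1f, G; field; lra).
  assert (Eq2 : q2 = q2f th m A1 (A2 - mu * G) + mu * (2 * (1 + m) * G / qN th m)) by (unfold q2, q2f, G; field; lra).
  assert (HQE : Cq th m * (2 * E) <= 2 * Cq th m * (1 + D * CZ) * V). { replace (2 * Cq th m * (1 + D * CZ) * V) with (Cq th m * (2 * ((1 + D * CZ) * V))) by ring. apply Rmult_le_compat_l; lra. }
  assert (HDC : 0 <= 40 * D * Cmu) by pnra.
  assert (HcD : 0 <= Cq th m * (1 + D * CZ)) by pnra.
  assert (HcV : 0 <= Cq th m * (1 + D * CZ) * V) by pnra.
  split.
  - rewrite Eq1. replace (q1f th m A1 (A2 - mu * G) + mu * (e * (th * th) * D / qN th m) - mu * (e * (th * th) * D / qN th m)) with (q1f th m A1 (A2 - mu * G)) by ring.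
    assert (0 <= 40 * D * Cmu * V) by pnra. unfold CQ. lra.
  - assert (I : 0 < / qN th m <= 1). { split. apply Rinv_0_lt_compat; lra. rewrite <- Rinv_1. apply Rinv_le_contravar; lra. }
    assert (T1 : Rabs (mu * (e * (th * th) * D / qN th m)) <= 32 * D * Cmu * (eps * eps * Rabs r)).
    { rewrite Rabs_mult. replace (32 * D * Cmu * (eps * eps * Rabs r)) with ((Cmu * eps * Rabs r) * (2 * eps * 16 * D * 1)) by ring. apply Rmult_le_compat; auto using Rabs_pos.
      assert (0 <= e * (th * th) * D) by (apply Rmult_le_pos; pnra). unfold Rdiv. rewrite Rabs_pos_eq by pnra. apply Rmult_le_compat; try lra. apply Rmult_le_compat_r. lra. apply Rmult_le_compat; pnra. }
    assert (T2 : Rabs (mu * (2 * (1 + m) * G / qN th m)) <= 8 * D * Cmu * (eps * eps * Rabs r)).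
    { rewrite Rabs_mult. replace (8 * D * Cmu * (eps * eps * Rabs r)) with ((Cmu * eps * Rabs r) * (2 * (4 * (eps * D)))) by ring. apply Rmult_le_compat; auto using Rabs_pos.
      replace (2 * (1 + m) * G / qN th m) with (2 * (((1 + m) / qN th m) * G)) by (field; lra).
      assert (J : 0 <= (1 + m) / qN th m <= 1). { split. apply Rmult_le_pos; lra. apply Rmult_le_reg_r with (qN th m). lra. unfold Rdiv. rewrite Rmult_assoc, Rinv_l by lra. unfold qN. pnra. }
      rewrite Rabs_pos_eq. apply Rmult_le_compat_l. lra. pnra. apply Rmult_le_pos. lra. pnra. }
    assert (N1 : Rabs q1 <= Cq th m * (2 * E) + 32 * D * Cmu * (eps * eps * Rabs r)). { rewrite Eq1. triang. lra. }
    assert (N2 : Rabs q2 <= Cq th m * (2 * E) + 8 * D * Cmu * (eps * eps * Rabs r)). { rewrite Eq2. triang. lra. }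
    assert (HeU : eps * eps * Rabs r <= U) by (unfold U; lra).
    assert (40 * D * Cmu * (eps * eps * Rabs r) <= 40 * D * Cmu * U) by (apply Rmult_le_compat_l; lra).
    assert (4 * Cq th m * (1 + D * CZ) * V <= 4 * Cq th m * (1 + D * CZ) * U) by (apply Rmult_le_compat_l; lra).
    unfold CQ. lra.
Qed.

(** The main term of [q1] is a nonnegative multiple of [mu], which has sign opposite to [r]; with
    [e >= eps / 2] and [D >= 1] this gives the rate [cS]. *)
Lemma amplitude_contracts : Rabs (e + q1 - eps) <= (1 - cS * (eps * eps)) * Rabs r + CQ * V.
Proof.
  destruct q_est as [Q1 _]. set (g := e * (th * th) * D / qN th m) in *. assert (HN := qN_ge1 w th m w0 th0 mw). destruct e_range as [He1 He2].
  destruct Cmu_pos as [HCmu Hcmu]. destruct mu_bound as [Mb Ms]. pose proof PI_4.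
  assert (I : 0 < / qN th m <= 1). { split. apply Rinv_0_lt_compat; lra. rewrite <- Rinv_1. apply Rinv_le_contravar; lra. }
  assert (Hg : 0 <= g <= 32 * D * eps).
  { unfold g, Rdiv. split. apply Rmult_le_pos. apply Rmult_le_pos; pnra. lra. replace (32 * D * eps) with (2 * eps * 16 * D * 1) by ring.
    apply Rmult_le_compat; try lra. apply Rmult_le_pos; pnra. apply Rmult_le_compat_r. lra. apply Rmult_le_compat; pnra. }
  assert (Hg2 : cS * (eps * eps) <= cmu * eps * g).
  { replace (cS * (eps * eps)) with (cmu * eps * (eps / 2 * (th * th) * 1 * / qN th m)) by (unfold cS; field; lra). apply Rmult_le_compat_l. pnra. unfold g, Rdiv.
    apply Rmult_le_compat_r. lra. apply Rmult_le_compat; try lra. apply Rmult_le_pos; pnra. apply Rmult_le_compat_r; pnra. }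
  replace (e + q1 - eps) with ((r + mu * g) + (q1 - mu * g)) by (unfold r; ring). triang. apply Rplus_le_compat; auto.
  (* The correction does not overshoot, so [r + mu * g] keeps the sign of [r]. *)
  assert (Hmg : Rabs (mu * g) <= Rabs r).
  { rewrite Rabs_mult, (Rabs_pos_eq g) by lra. apply Rle_trans with (Cmu * eps * Rabs r * (32 * D * eps)). apply Rmult_le_compat; try lra. apply Rabs_pos.
    replace (Cmu * eps * Rabs r * (32 * D * eps)) with ((Cmu * 32 * D * (eps * eps)) * Rabs r) by ring. pose proof (Rabs_pos r). pnra. }
  assert (Hsg : (r + mu * g) * r <= (1 - cS * (eps * eps)) * (r * r)).
  { assert (mu * r * g <= - (cmu * eps * (r * r)) * g) by (apply Rmult_le_compat_r; lra). assert (cS * (eps * eps) * (r * r) <= cmu * eps * g * (r * r)) by (apply Rmult_le_compat_r; pnra). lra. }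
  destruct (Req_dec r 0) as [E0|Hr0].
  { rewrite E0 in *. rewrite Rabs_R0 in *. assert (E1 : mu * g = 0). { pose proof (Rabs_pos (mu * g)). destruct (Req_dec (mu * g) 0) as [|Hz]; auto. apply Rabs_pos_lt in Hz. lra. } rewrite E1, Rplus_0_r, Rabs_R0. lra. }
  assert (Har : 0 < Rabs r) by (now apply Rabs_pos_lt).
  assert (Hss : 0 <= (r + mu * g) * r).
  { replace ((r + mu * g) * r) with (r * r + mu * g * r) by ring. assert (Hx : Rabs (mu * g * r) <= r * r). { rewrite Rabs_mult. replace (r * r) with (Rabs r * Rabs r) by (rewrite <- Rabs_mult; apply Rabs_pos_eq; pnra). pnra. } unabs Hx. lra. }
  apply Rmult_le_reg_r with (Rabs r); auto. rewrite <- Rabs_mult, Rabs_pos_eq by auto. replace ((1 - cS * (eps * eps)) * Rabs r * Rabs r) with ((1 - cS * (eps * eps)) * (r * r)). auto.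
  rewrite (Rmult_assoc _ (Rabs r)), <- Rabs_mult, (Rabs_pos_eq (r * r)) by pnra. reflexivity.
Qed.

(* The residual [h] of the decomposition [x = X e (sg + .) + h] only needs a small critical projection [(Z1, Z2)]:
   one Newton step in [(e, sg)] reproduces this, since the projection of [X e (sg + .)] is linear up to [O (e^2)]. *)
Lemma step : exists e1 sg1, Rabs (e1 - eps) <= (1 - cS * (eps * eps)) * Rabs r + CQ * V /\
  (forall t, -1 <= t <= 0 -> Rabs (x (t + D) - X e1 (sg1 + t)) <= H / 4 + CS * U) /\
  Rabs (Z1 be th m (fun t => x (t + D) - X e1 (sg1 + t)) 0) <= CS * (eps * U) /\
  Rabs (Z2 be th m (fun t => x (t + D) - X e1 (sg1 + t)) 0) <= CS * (eps * U).
Proof.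
  destruct q_est as [_ Q2]. destruct e_range as [He1 He2]. destruct CQ_pos as [HCQ HCq]. destruct V_le_U as (HV0 & HVU & HeH & Her2 & He).
  pose proof CG_ge1 as HCG. destruct Cmu_pos as [HCmu _]. pose proof CF_pos as HCF. pose proof m_pos2 as Hm. assert (HCd : 0 < CdX) by (unfold CdX; lra).
  pose proof (Rabs_pos q1) as Ha1. pose proof (Rabs_pos q2) as Ha2. pose proof (Rabs_pos r) as Hr.
  assert (Hq1 : Rabs q1 <= e / 2) by lra. assert (Hq1' : Rabs q1 <= eps / 4) by lra. unabs Hq1'. assert (Hr1 : 0 < e + q1 <= eb) by lra.
  assert (Hq2 : Rabs q2 <= 4 * CQ * (e * e)).
  { assert (CQ * U <= CQ * (eps * eps)) by (apply Rmult_le_compat_l; lra). assert (CQ * (eps * eps) <= CQ * (4 * (e * e))) by (apply Rmult_le_compat_l; pnra). lra. }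
  set (e1 := e + q1) in *. destruct (Hfam e1 ltac:(lra)) as (_ & _ & _ & _ & _ & _ & Hk1 & _).
  (* The new phase is [vt + q2 / e] at the end of the step, expressed as a time on the new orbit. *)
  set (sg1 := (vt + q2 / e) / kap e1). exists e1, sg1.
  assert (Cy := cont_y). assert (CX1 : cont (fun t => X e1 (sg1 + t))). { apply (cont_comp (X e1) (fun t => sg1 + t)); [|ct]. apply cont_X. lra. }
  assert (CxD : cont (fun t => x (t + D))) by (apply (cont_comp x (fun t => t + D)); [auto|ct]).
  assert (CyD : cont (fun t => y (t + D))) by (apply (cont_comp y (fun t => t + D)); [auto|ct]).
  set (l := lq th q1 q2 vt). assert (Cl : cont l) by apply cont_lq.
  (* The new deviation is [y (t + D) - l t + Rs t]. Since [l] has the projection of [y] at time [D],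
     only [Rs] is left in the new projection, and [shift_residual] makes it [O(eps U)]. *)
  set (Rs := fun t => x (t + D) - X e1 (sg1 + t) + -1 * (y (t + D) + -1 * l t)). assert (CRs : cont Rs) by (unfold Rs; ct).
  assert (HRs : forall t, -1 <= t <= 0 -> Rabs (Rs t) <= CRQ * (eps * U)).
  { intros t Ht. replace (Rs t) with (Yp e (vt + kap e * t) - Yp e1 (vt + q2 / e + kap e1 * t) + l t).
    - eapply Rle_trans. apply (shift_residual (4 * CQ) e q1 q2 vt t); try lra. apply Rabs_le; lra.
      unfold CRQ. replace (CR (4 * CQ) * 2 * CQ * (eps * U)) with (CR (4 * CQ) * (2 * eps * (CQ * U))) by ring. apply Rmult_le_compat_l. left; apply CR_pos; lra.
      apply Rmult_le_compat; lra.
    - unfold Rs, y, X. replace (kap e * (sg + (t + D))) with (vt + kap e * t) by (unfold vt; ring).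
      replace (kap e1 * (sg1 + t)) with (vt + q2 / e + kap e1 * t) by (unfold sg1; field; lra). ring. }
  assert (HCRQ : 0 <= CRQ). { unfold CRQ. assert (0 < CR (4 * CQ)) by (apply CR_pos; lra). apply Rmult_le_pos; pnra. }
  assert (Hmb : 0 < m * be) by pnra.
  assert (HCP : 0 <= CP). { unfold CP. apply Rmult_le_pos; [|left; apply exp_pos]. apply Rmult_le_pos; [|lra]. pnra. }
  split. exact amplitude_contracts. split.
  - intros t Ht. replace (x (t + D) - X e1 (sg1 + t)) with (y (t + D) + - l t + Rs t) by (unfold Rs; ring).
    assert (Hl : Rabs (l t) <= CQ * U) by (eapply Rle_trans; [apply lq_abs | lra]).
    specialize (HRs t Ht).
    assert (Hy : Rabs (y (t + D)) <= H / 4 + 3 * Cq th m * U + CP * U).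
    { eapply Rle_trans. apply (Hinh y (fun t => F1 t + mu * dX e (sg + t)) H om ((CF * CG + Cmu * CdX) * U)); auto; try lra.
      - apply Rmult_le_pos; pnra.
      - exact D_y.
      - intros s Hs. triang. rewrite Rabs_mult. destruct mu_bound as [Mb _]. assert (Dd := dX_bound (sg + s)).
        assert (B1 := F1_bound s _ (y_growth s ltac:(lra)) (y_growth (s - 1) ltac:(lra)) ltac:(lra)).
        assert (Rabs mu * Rabs (dX e (sg + s)) <= Cmu * eps * Rabs r * (CdX * eps)) by (apply Rmult_le_compat; auto using Rabs_pos).
        assert (E1 : CF * eps * (CG * (H + eps * eps * Rabs r)) <= CF * CG * U).
        { replace (CF * eps * (CG * (H + eps * eps * Rabs r))) with (CF * CG * (eps * H + eps * eps * eps * Rabs r)) by ring. apply Rmult_le_compat_l. pnra. unfold V in HVU. lra. }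
        assert (E2 : Cmu * eps * Rabs r * (CdX * eps) <= Cmu * CdX * U). { replace (Cmu * eps * Rabs r * (CdX * eps)) with (Cmu * CdX * (eps * eps * Rabs r)) by ring. apply Rmult_le_compat_l. pnra. unfold U; lra. }
        lra.
      - assert (om <= U) by (unfold U; lra). assert (Cq th m * om <= Cq th m * U) by (apply Rmult_le_compat_l; lra). unfold CP. assert (0 <= Cq th m * U) by (apply Rmult_le_pos; lra). lra. }
    assert (CRQ * (eps * U) <= CRQ * U). { apply Rmult_le_compat_l; auto. pnra. }
    triang. eapply Rle_trans. apply Rplus_le_compat_r, Rabs_triang. rewrite Rabs_Ropp.
    assert (0 <= CRQ * U) by (apply Rmult_le_pos; lra). assert (0 <= CRQ * (m * be) * U) by (apply Rmult_le_pos; pnra).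
    unfold CS. lra.
  - set (y1 := fun t => x (t + D) - X e1 (sg1 + t)).
    assert (Ey : y1 = fun t => Rs t + 1 * (y (t + D) + -1 * l t)). { apply functional_extensionality; intros t. unfold y1, Rs. ring. }
    destruct (Z_lin be th m Rs (fun t => y (t + D) + -1 * l t) 1 0 CRs ltac:(ct)) as [L1 L2].
    destruct (Z_lin be th m (fun t => y (t + D)) l (-1) 0 CyD Cl) as [L3 L4].
    destruct (Z_lq be w th m w0 th0 costh sinth mw A1 A2 vt) as [L5 L6]. fold q1 q2 l in L5, L6.
    assert (Hone : sin vt * sin vt + cos vt * cos vt = 1) by (assert (Q := sin2_cos2 vt); exact Q).
    assert (L7 : Z1 be th m (fun t => y (t + D)) 0 = Z1 be th m y D) by (unfold Z1; rewrite Ic_shift by auto; now rewrite Rplus_0_l).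
    assert (L8 : Z2 be th m (fun t => y (t + D)) 0 = Z2 be th m y D) by (unfold Z2; rewrite Is_shift by auto; now rewrite Rplus_0_l).
    assert (M5 : A1 * cos vt - A2 * sin vt = Z1 be th m y D). { transitivity ((sin vt * sin vt + cos vt * cos vt) * Z1 be th m y D). unfold A1, A2; ring. rewrite Hone; ring. }
    assert (M6 : A1 * sin vt + A2 * cos vt = Z2 be th m y D). { transitivity ((sin vt * sin vt + cos vt * cos vt) * Z2 be th m y D). unfold A1, A2; ring. rewrite Hone; ring. }
    destruct (Z_bound be w th m be1 w0 th0 mw Rs 0 (CRQ * (eps * U)) CRs) as [B1 B2]. intros; apply HRs; lra.
    assert (HeU : 0 <= eps * U) by pnra.
    assert (HCS : (1 + m * be) * (CRQ * (eps * U)) <= CS * (eps * U)).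
    { rewrite <- Rmult_assoc. apply Rmult_le_compat_r; auto. unfold CS. lra. }
    fold y1. rewrite Ey, L1, L2, L3, L4, L5, L6, L7, L8, M5, M6. split.
    replace (Z1 be th m Rs 0 + 1 * (Z1 be th m y D + -1 * Z1 be th m y D)) with (Z1 be th m Rs 0) by ring. lra.
    replace (Z2 be th m Rs 0 + 1 * (Z2 be th m y D + -1 * Z2 be th m y D)) with (Z2 be th m Rs 0) by ring. lra.
Qed.
End Dev.

(** Enough critical periods for the decaying component to shrink by a factor 4, using
    [exp z >= 1 + z]. The length does not depend on the amplitude. *)
Lemma good_period : exists D, 1 <= D /\ cos (th * D) = 1 /\ sin (th * D) = 0 /\
  forall (y F : R -> R) (H om Ph : R), cont y -> 0 <= H -> 0 <= om -> 0 <= Ph ->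
  (forall t, 0 < t -> is_derive y t (- m * (y t + be * y (t - 1)) + F t)) -> (forall t, 0 < t < D -> Rabs (F t) <= Ph) ->
  (forall t, -1 <= t <= 0 -> Rabs (y t) <= H) -> Rabs (Z1 be th m y 0) <= om -> Rabs (Z2 be th m y 0) <= om ->
  forall t, D - 1 <= t <= D -> Rabs (y t) <= / 4 * (H + 2 * Cq th m * om) + 2 * Cq th m * om + Ph * D * exp (aL be m * D).
Proof.
  destruct (inhom_bound be w th m be1 w0 w2 th0 costh sinth mw) as [M [eta [HM [He Hi]]]].
  assert (HMe : 0 < 4 * M / eta) by (apply Rdiv_lt_0_compat; lra).
  destruct (nfloor_ex (4 * M / eta + 1) ltac:(lra)) as [N [_ HN]]. set (D := 2 * INR (S N) * PI / th). exists D.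
  assert (HD : 4 * M / eta + 1 <= D).
  { apply Rle_trans with (INR (S N)). rewrite S_INR; lra. unfold D. apply Rmult_le_reg_r with th. lra. unfold Rdiv. rewrite (Rmult_assoc _ (/ th)), Rinv_l, Rmult_1_r by lra.
    replace (2 * INR (S N) * PI) with (INR (S N) * (2 * PI)) by ring. apply Rmult_le_compat_l. apply pos_INR. lra. }
  assert (ED : th * D = 0 + 2 * INR (S N) * PI) by (unfold D; field; lra).
  split. lra. rewrite ED, cos_period, sin_period, cos_0, sin_0. repeat split; auto.
  intros y F H om Ph Cy HH Hom HPh Dy HF Hh H1 H2 t Ht. eapply Rle_trans. apply (Hi D y F H om Ph ltac:(lra) Cy HH Hom HPh Dy HF Hh H1 H2 t Ht).
  apply Rplus_le_compat_r, Rplus_le_compat_r. pose proof (Cq_ge1 w th m w0 th0 mw). apply Rmult_le_compat_r. assert (0 <= Cq th m * om) by (apply Rmult_le_pos; lra). lra.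
  assert (Hx := exp_ineq1_le (eta * (D - 1))). assert (HD2 : 4 * M <= eta * (D - 1)). { apply Rle_trans with (eta * (4 * M / eta)). right; field; lra. apply Rmult_le_compat_l; lra. }
  replace (- eta * (D - 1)) with (- (eta * (D - 1))) by ring. rewrite exp_Ropp. set (E := exp (eta * (D - 1))) in *.
  apply Rmult_le_reg_r with E. lra. rewrite Rmult_assoc, Rinv_l by lra. lra.
Qed.

Definition sol (eps : R) (x : R -> R) : Prop := cont x /\ forall t, 0 < t -> is_derive x t (mE eps * (fN be n0 n3 (x (t - 1)) - x t)).
Lemma sol_shift eps x k : 0 <= k -> sol eps x -> sol eps (fun t => x (t + k)).
Proof.
  intros Hk [C Dx]. split. apply (cont_comp x (fun t => t + k)); [auto|ct].
  intros t Ht. eapply is_derive_eq. apply (D_comp x (fun t => t + k)). apply Dx; lra. apply D_plus. apply D_id. apply D_const. replace (t - 1 + k) with (t + k - 1) by ring. ring.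
Qed.
Definition near (eps : R) (x : R -> R) (t rho : R) : Prop := exists s, forall a, -1 <= a <= 0 -> Rabs (x (t + a) - X eps (s + a)) <= rho.

(** A weighted sum of amplitude defect, size of the residual and size of its projection decreases
    geometrically, though for small [eps] with a ratio close to 1. Stability and attraction both
    follow from the resulting bound. *)
Theorem stab_core : exists et, 0 < et <= eb /\ forall eps, 0 < eps <= et -> exists D d0 K q, 0 < D /\ 0 < d0 /\ 0 < K /\ 0 < q < 1 /\
  forall x d, sol eps x -> 0 <= d <= d0 -> near eps x 0 d -> forall (n : nat) t, INR n * D <= t -> near eps x t (K * d * q ^ n).
Proof.
  destruct good_period as (D & HD & HDc & HDs & Hinh).
  pose proof m_pos2 as Hm. destruct Cmu_pos as [HCmu Hcmu]. assert (He0 : 0 < eb / 4 /\ 4 * (eb / 4) <= eb) by lra. destruct He0 as [He0 He1]. assert (HCF : 0 <= CF) by (eapply CF_pos; eauto). assert (HCd : 0 < CdX) by (unfold CdX; lra).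
  assert (HCG : 1 <= CG D) by (eapply CG_ge1; eauto). assert (HCZ : 0 <= CZ D) by (eapply CZ_pos; eauto). clear He0 He1. assert (HCq := Cq_ge1 w th m w0 th0 mw). assert (HN := qN_ge1 w th m w0 th0 mw).
  assert (HCQ : 1 <= CQ D). { unfold CQ. assert (0 <= D * CZ D) by pnra. assert (0 <= 40 * D * Cmu) by pnra. pnra. }
  assert (Hmb : 0 < m * be) by pnra.
  assert (HCS : 1 <= CS D /\ CQ D <= CS D).
  { assert (0 <= CP D). { unfold CP. apply Rmult_le_pos; [|left; apply exp_pos]. apply Rmult_le_pos; [|lra]. pnra. }
    assert (0 <= CRQ D). { unfold CRQ. assert (0 < CR (4 * CQ D)) by (apply CR_pos; lra). apply Rmult_le_pos; pnra. }
    assert (0 <= CRQ D * (2 + m * be)) by (apply Rmult_le_pos; lra). unfold CS. lra. }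
  set (C := CS D) in *. destruct HCS as [HC1 HC2].
  assert (Hc : 0 < cS). { unfold cS. apply Rdiv_lt_0_compat; [|lra]. apply Rmult_lt_0_compat; [lra|]. apply Rmult_lt_0_compat; lra. }
  (* Each summand is one smallness condition on [eps]; the inverse of the sum meets them all. *)
  set (Kt := 1 + 4 / eb + (2 * (1 + L) + 1) + Cmu * 32 * D + 8 * C + 2 * (C + 8 * C * C) / cS).
  assert (P1 : 0 < 4 / eb) by (apply Rdiv_lt_0_compat; lra). assert (P2 : 0 <= Cmu * 32 * D) by (apply Rmult_le_pos; lra).
  assert (P3 : 0 < 2 * (C + 8 * C * C) / cS) by (apply Rdiv_lt_0_compat; pnra).
  assert (HKt : 1 < Kt) by (unfold Kt; lra).
  assert (Hthr : forall eps k, 0 < eps <= / Kt -> 0 <= k -> k <= Kt -> k * eps <= 1).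
  { intros eps k He Hk HkK. apply Rle_trans with (Kt * / Kt). apply Rmult_le_compat; lra. right; field; lra. }
  assert (He4 : forall eps, 0 < eps <= / Kt -> 4 * eps <= eb).
  { intros eps He. assert (E := Hthr eps (4 / eb) He ltac:(lra) ltac:(unfold Kt; lra)). replace (4 * eps) with (4 / eb * eps * eb) by (field; lra). pnra. }
  exists (/ Kt). split. { split. apply Rinv_0_lt_compat; lra. assert (0 < / Kt) by (apply Rinv_0_lt_compat; lra). assert (E := He4 (/ Kt) ltac:(lra)). lra. }
  intros eps He.
  assert (T1 := He4 eps He). assert (T2 := Hthr eps (2 * (1 + L) + 1) He ltac:(lra) ltac:(unfold Kt; lra)).
  assert (T3 := Hthr eps (Cmu * 32 * D) He ltac:(lra) ltac:(unfold Kt; lra)). assert (T4 := Hthr eps (8 * C) He ltac:(lra) ltac:(unfold Kt; lra)).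
  assert (T5 := Hthr eps _ He ltac:(left; apply P3) ltac:(unfold Kt; lra)). clear Hthr He4.
  assert (T5' : (C + 8 * C * C) * eps <= cS / 2). { replace ((C + 8 * C * C) * eps) with (2 * (C + 8 * C * C) / cS * eps * (cS / 2)) by (field; lra). pnra. }
  assert (T3' : Cmu * 32 * D * (eps * eps) <= 1) by pnra.
  (* The weight by which the decrease of [H] and [om] pays for what they add to the amplitude. The
     size [H] gets an extra [eps] because it enters the amplitude only through [eps H]. *)
  set (a := 4 * C). set (Kv := / (a * eps) + / a + 1).
  assert (Ha : 0 < a * eps) by (unfold a; pnra). assert (Ha' : 0 < a) by (unfold a; lra).
  assert (I1 : 0 < / (a * eps)) by (now apply Rinv_0_lt_compat). assert (I2 : 0 < / a) by (now apply Rinv_0_lt_compat).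
  set (v0 := eps * eps / (12 * (CG D + CQ D) * Kv)).
  assert (HKG : 0 < 12 * (CG D + CQ D) * Kv) by (apply Rmult_lt_0_compat; [lra | unfold Kv; lra]).
  assert (Hv0 : 0 < v0) by (apply Rdiv_lt_0_compat; [apply Rmult_lt_0_compat; lra | auto]).
  set (q := Rmax (1 - cS / 2 * (eps * eps)) (3 / 4)).
  assert (Hq : 0 < q < 1). { unfold q. split. eapply Rlt_le_trans; [|apply Rmax_r]. lra. apply Rmax_lub_lt; [|lra]. assert (0 < cS / 2 * (eps * eps)) by (apply Rmult_lt_0_compat; [lra | apply Rmult_lt_0_compat; lra]). lra. }
  (* The state of the iteration: some branch member and phase approximate the segment, with total
     weighted error at most [Vb]. *)
  set (St := fun (x : R -> R) (Vb : R) => exists e sg H om, 0 <= H /\ 0 <= om /\ (forall t, -1 <= t <= 0 -> Rabs (x t - X e (sg + t)) <= H) /\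
     Rabs (Z1 be th m (fun t => x t - X e (sg + t)) 0) <= om /\ Rabs (Z2 be th m (fun t => x t - X e (sg + t)) 0) <= om /\ Rabs (e - eps) + a * eps * H + a * om <= Vb).
  set (Kn := CG D * 2 * Kv + (1 + 3 * L) * (1 + 3 * L)).
  assert (Hstep : forall x Vb, sol eps x -> 0 <= Vb <= v0 -> St x Vb -> St (fun t => x (t + D)) (q * Vb) /\ forall t, 0 <= t <= D -> near eps x t (Kn * Vb)).
  { intros x Vb [Cx Dx] HVb (e & sg & H & om & HH & Hom & Hh & Hz1 & Hz2 & HV).
    set (r := e - eps) in *. pose proof (Rabs_pos r) as Hr. assert (0 <= a * eps * H) by (apply Rmult_le_pos; lra). assert (0 <= a * om) by (apply Rmult_le_pos; lra).
    assert (HHv : H <= / (a * eps) * Vb). { apply Rmult_le_reg_l with (a * eps); auto. rewrite <- Rmult_assoc, Rinv_r by lra. lra. }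
    assert (Homv : om <= / a * Vb). { apply Rmult_le_reg_l with a; auto. rewrite <- Rmult_assoc, Rinv_r by lra. lra. }
    assert (HKV : H + om + Rabs r <= Kv * Vb) by (unfold Kv; lra).
    assert (Hee : eps * eps <= eps) by (rewrite <- (Rmult_1_l eps) at 3; apply Rmult_le_compat_r; lra). assert (Hee0 : 0 < eps * eps) by pnra.
    assert (HKs : 12 * ((CG D + CQ D) * (Kv * Vb)) <= eps * eps).
    { apply Rle_trans with (12 * (CG D + CQ D) * Kv * v0). replace (12 * ((CG D + CQ D) * (Kv * Vb))) with (12 * (CG D + CQ D) * Kv * Vb) by ring. apply Rmult_le_compat_l; lra. right; unfold v0; field; unfold Kv; lra. }
    assert (HKV0 : 0 <= Kv * Vb) by lra. assert (K1 : 1 * (Kv * Vb) <= CG D * (Kv * Vb)) by (apply Rmult_le_compat_r; lra). assert (K2 : 1 * (Kv * Vb) <= CQ D * (Kv * Vb)) by (apply Rmult_le_compat_r; lra).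
    assert (Her : Rabs (e - eps) <= eps / 2) by (fold r; lra).
    assert (HU0 : eps * H <= H) by (rewrite <- (Rmult_1_l H) at 2; apply Rmult_le_compat_r; lra). assert (Hrr : eps * eps * Rabs r <= Rabs r) by (rewrite <- (Rmult_1_l (Rabs r)) at 2; apply Rmult_le_compat_r; lra).
    assert (HG1 : CG D * (H + eps * eps * Rabs r) <= CG D * (Kv * Vb)) by (apply Rmult_le_compat_l; lra).
    assert (HGs : CG D * (H + eps * eps * Rabs (e - eps)) < eps) by (fold r; lra).
    assert (HU1 : om + eps * H + eps * eps * Rabs (e - eps) <= eps * eps) by (fold r; lra).
    assert (HU2 : CQ D * (om + eps * H + eps * eps * Rabs (e - eps)) <= eps / 4). { fold r. assert (CQ D * (om + eps * H + eps * eps * Rabs r) <= CQ D * (Kv * Vb)) by (apply Rmult_le_compat_l; lra). lra. }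
    destruct He as [He0 _]. split.
    - destruct (step eps e sg D x He0 T1 T2 Her HD Cx Dx H om HH Hom Hh HGs HDc HDs Hz1 Hz2 Hinh HU1 HU2 T3') as (e1 & sg1 & S1 & S2 & S3 & S4). fold r C in S1, S2, S3, S4.
      set (U := om + eps * H + eps * eps * Rabs r) in *. assert (P4 : 0 <= eps * H) by (apply Rmult_le_pos; lra). assert (P5 : 0 <= eps * eps * Rabs r) by (apply Rmult_le_pos; lra). assert (P6 : 0 <= eps * (eps * eps * Rabs r)) by (apply Rmult_le_pos; lra).
      assert (HU : 0 <= U) by (unfold U; lra). assert (P7 : 0 <= eps * U) by (apply Rmult_le_pos; lra). assert (P8 : 0 <= C * U) by (apply Rmult_le_pos; lra). assert (P9 : 0 <= C * eps * H) by (rewrite Rmult_assoc; apply Rmult_le_pos; lra).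
      exists e1, sg1, (H / 4 + C * U), (C * (eps * U)). split. lra. split. apply Rmult_le_pos; lra. split. exact S2. split. exact S3. split. exact S4.
      assert (HV1 : Rabs (e1 - eps) <= (1 - cS * (eps * eps)) * Rabs r + C * (om + eps * H + eps * eps * eps * Rabs r)).
      { eapply Rle_trans. apply S1. apply Rplus_le_compat_l. apply Rmult_le_compat_r; auto. lra. }
      apply Rle_trans with (Rabs r * (1 - cS / 2 * (eps * eps)) + a * eps * H * (3 / 4) + a * om * (3 / 4)).
      (* Condition [T5'] lets half of the gain [cS eps^2] survive the third order errors in [r];
         condition [T4] keeps the coefficients of [H] and [om] at three quarters. *)
      + assert (G1 : (C + 8 * C * C) * eps * (eps * eps * Rabs r) <= cS / 2 * (eps * eps * Rabs r)) by (apply Rmult_le_compat_r; lra).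
        assert (G2 : 8 * C * eps * (C * eps * H) <= 1 * (C * eps * H)) by (apply Rmult_le_compat_r; lra).
        assert (G4 : 0 <= C * om) by (apply Rmult_le_pos; lra).
        assert (G3 : 8 * C * eps * (C * om) <= 1 * (C * om)) by (apply Rmult_le_compat_r; lra).
        unfold a, U in *. lra.
      + assert (q1 : 1 - cS / 2 * (eps * eps) <= q) by apply Rmax_l. assert (q2 : 3 / 4 <= q) by apply Rmax_r.
        apply Rle_trans with (q * (Rabs r + a * eps * H + a * om)). 2: apply Rmult_le_compat_l; lra.
        assert (Rabs r * (1 - cS / 2 * (eps * eps)) <= Rabs r * q) by (apply Rmult_le_compat_l; lra).
        assert (a * eps * H * (3 / 4) <= a * eps * H * q) by (apply Rmult_le_compat_l; lra).
        assert (a * om * (3 / 4) <= a * om * q) by (apply Rmult_le_compat_l; lra). lra.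
    - intros t Ht. apply Rabs_le_between in Her as Her'. destruct (Hfam eps ltac:(lra)) as (_ & _ & _ & _ & _ & _ & Hk & _).
      (* The time at which the orbit of [eps] has the phase that the approximating member has at
         time [sg + t]. *)
      exists (kap e * (sg + t) / kap eps). intros b Hb.
      assert (Y1 := y_growth eps e sg D x He0 T1 T2 Her HD Cx Dx H HH Hh HGs (t + b) ltac:(lra)). cbv beta in Y1. fold r in Y1.
      replace (x (t + b) - X eps (kap e * (sg + t) / kap eps + b)) with ((x (t + b) - X e (sg + (t + b))) + (X e (sg + (t + b)) - X eps (kap e * (sg + t) / kap eps + b))) by ring.
      triang.
      assert (Y2 : Rabs (X e (sg + (t + b)) - X eps (kap e * (sg + t) / kap eps + b)) <= (1 + 3 * L) * (1 + 3 * L) * Vb).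
      { unfold X. eapply Rle_trans. apply Yp_diff; lra. fold r. replace (kap e * (sg + (t + b)) - kap eps * (kap e * (sg + t) / kap eps + b)) with ((kap e - kap eps) * b) by (field; lra).
        rewrite Rmult_assoc. apply Rmult_le_compat_l. lra.
        destruct (Hlip e eps ltac:(lra) ltac:(lra)) as (_ & _ & _ & Kl). fold r in Kl. rewrite Rabs_mult.
        assert (Rabs b <= 1) by (apply Rabs_le; lra). pose proof (Rabs_pos b). pose proof (Rabs_pos (kap e - kap eps)).
        assert (Rabs (kap e - kap eps) * Rabs b <= L * ((e + eps) * Rabs r) * 1) by (apply Rmult_le_compat; lra).
        assert (L * ((e + eps) * Rabs r) <= L * (3 * Rabs r)) by (apply Rmult_le_compat_l; [lra | apply Rmult_le_compat_r; lra]).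
        assert (eps * (Rabs (kap e - kap eps) * Rabs b) <= 1 * (L * (3 * Rabs r))) by (apply Rmult_le_compat; [lra | apply Rmult_le_pos; auto | lra | lra]).
        apply Rle_trans with ((1 + 3 * L) * Rabs r). lra. apply Rmult_le_compat_l; lra. }
      unfold Kn. lra. }
  assert (HKn : 0 < Kn). { unfold Kn. assert (0 < CG D * 2 * Kv) by (apply Rmult_lt_0_compat; [lra | unfold Kv; lra]). pnra. }
  assert (Hit : forall n x Vb, sol eps x -> 0 <= Vb <= v0 -> St x Vb -> forall t, INR n * D <= t <= INR (S n) * D -> near eps x t (Kn * (Vb * q ^ n))).
  { induction n; intros x Vb Hx HVb HS t Ht; destruct (Hstep x Vb Hx HVb HS) as [S1 S2].
    - simpl in Ht. rewrite pow_O, Rmult_1_r. apply S2. lra.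
    - assert (HqV : 0 <= q * Vb <= v0). { split. apply Rmult_le_pos; lra. apply Rle_trans with (1 * Vb). apply Rmult_le_compat_r; lra. lra. }
      destruct (IHn _ _ (sol_shift eps x D ltac:(lra) Hx) HqV S1 (t - D)) as [s Hs]. rewrite !S_INR in *. lra.
      exists s. intros b Hb. specialize (Hs b Hb). replace (t - D + b + D) with (t + b) in Hs by ring. eapply Rle_trans. apply Hs. right. simpl. ring. }
  set (Ki := a * eps + a * (1 + m * be)). assert (HKi : 0 < Ki) by (unfold Ki; pnra).
  exists D, (v0 / Ki), (Kn * Ki), q. split. lra. split. now apply Rdiv_lt_0_compat. split. pnra. split. auto.
  intros x d Hx Hd [sg Hn] n t Ht.
  assert (HVd : 0 <= Ki * d <= v0). { split. pnra. apply Rle_trans with (Ki * (v0 / Ki)). apply Rmult_le_compat_l; lra. right; field; lra. }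
  assert (Cxx : cont (fun t => x t - X eps (sg + t))). { destruct Hx as [Cx _]. apply cont_minus; auto. apply (cont_comp (X eps) (fun t => sg + t)); [|ct]. apply cont_X; lra. }
  assert (HS : St x (Ki * d)).
  (* Initially the orbit under study itself is used, so the amplitude defect is zero. *)
  { exists eps, sg, d, ((1 + m * be) * d). split. lra. split. pnra. split. intros b Hb. specialize (Hn b Hb). now rewrite Rplus_0_l in Hn.
    destruct (Z_bound be w th m be1 w0 th0 mw (fun t => x t - X eps (sg + t)) 0 d Cxx) as [B1 B2].
    intros s Hs. specialize (Hn s ltac:(lra)). now rewrite Rplus_0_l in Hn.
    split. auto. split. auto. rewrite Rminus_diag, Rabs_R0. unfold Ki. right; ring. }
  assert (Ht0 : 0 <= t / D). { assert (0 <= INR n * D) by (apply Rmult_le_pos; [apply pos_INR | lra]). apply Rmult_le_pos; [lra | left; apply Rinv_0_lt_compat; lra]. }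
  destruct (nfloor_ex (t / D) Ht0) as [j [Hj1 Hj2]]. assert (Et : t = t / D * D) by (field; lra).
  assert (Htj : INR j * D <= t <= INR (S j) * D). { rewrite S_INR, Et. split; apply Rmult_le_compat_r; lra. }
  destruct (Hit j x (Ki * d) Hx HVd HS t Htj) as [s Hs]. exists s. intros b Hb. eapply Rle_trans. apply Hs; auto.
  assert (Hnj : (n <= j)%nat). { assert (Hlt : INR n < INR (S j)). { rewrite S_INR. apply Rmult_lt_reg_r with D. lra. rewrite Et in Ht. apply Rle_lt_trans with (t / D * D); auto. apply Rmult_lt_compat_r; lra. } apply INR_lt in Hlt. lia. }
  assert (Hpow : q ^ j <= q ^ n). { replace j with (n + (j - n))%nat by lia. rewrite pow_add. rewrite <- (Rmult_1_r (q ^ n)) at 2. apply Rmult_le_compat_l. apply pow_le; lra.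
    rewrite <- (pow1 (j - n)). apply pow_incr; lra. }
  replace (Kn * (Ki * d * q ^ j)) with (Kn * Ki * d * q ^ j) by ring. apply Rmult_le_compat_l; auto. apply Rmult_le_pos; pnra.
Qed.
End Fam.

(** * Nicholson's equation *)

Lemma exp_lip K a b : a <= K -> b <= K -> Rabs (exp a - exp b) <= exp K * Rabs (a - b).
Proof.
  assert (G : forall a b, a <= b -> b <= K -> exp b - exp a <= exp K * (b - a) /\ 0 <= exp b - exp a).
  { intros x y Hxy Hy. assert (E := exp_le x y Hxy). split; [|lra]. assert (E2 := exp_ineq1_le (x - y)).
    replace (exp x) with (exp y * exp (x - y)) by (rewrite <- exp_plus; f_equal; ring).
    apply Rle_trans with (exp y * (y - x)). pose proof (exp_pos y). pnra. apply Rmult_le_compat_r. lra. now apply exp_le. }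
  intros Ha Hb. destruct (Rle_lt_dec a b) as [H|H].
  - destruct (G a b H Hb). rewrite (Rabs_minus_sym (exp a)), (Rabs_minus_sym a), !Rabs_pos_eq by lra. auto.
  - destruct (G b a ltac:(lra) Ha). rewrite !Rabs_pos_eq by lra. auto.
Qed.
(* The integral form of the Taylor remainder of exp (- y) at order 3. *)
Definition E3 (y : R) : R := RI (fun s => (1 - s) ^ 2 / 2 * exp (- s * y)) 0 1.
Lemma E3_eq y : exp (- y) = 1 - y + y * y / 2 - y * (y * (y * E3 y)).
Proof.
  assert (D : forall s, is_derive (fun s => - exp (- s * y) * (y * y * (1 - s) ^ 2 / 2 - y * (1 - s) + 1)) s (y * y * y * ((1 - s) ^ 2 / 2 * exp (- s * y)))).
  { intros s. auto_derive; auto. field. }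
  assert (E := RI_derive _ _ 0 1 D ltac:(ct)). rewrite RI_scal in E by ct. fold (E3 y) in E.
  replace (- (0) * y) with 0 in E by ring. replace (- (1) * y) with (- y) in E by ring. rewrite exp_0 in E. lra.
Qed.
Lemma E3_0 : E3 0 = 1 / 6.
Proof.
  unfold E3. rewrite (RI_ext _ (fun s => (1 - s) ^ 2 / 2)). 2: intros; rewrite Rmult_0_r, exp_0; ring.
  rewrite (RI_derive (fun s => - (1 - s) ^ 3 / 6)). field. intros; auto_derive; auto. field. ct.
Qed.
Lemma E3_lip K y z : Rabs y <= K -> Rabs z <= K -> Rabs (E3 y - E3 z) <= exp K * Rabs (y - z).
Proof.
  intros Hy Hz. assert (0 <= K) by (from_abs Hy). unfold E3. rewrite <- RI_minus by ct.
  replace (exp K * Rabs (y - z)) with ((1 - 0) * (exp K * Rabs (y - z))) by ring. apply RI_abs. lra. ct. intros s Hs.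
  replace ((1 - s) ^ 2 / 2 * exp (- s * y) - (1 - s) ^ 2 / 2 * exp (- s * z)) with ((1 - s) ^ 2 / 2 * (exp (- s * y) - exp (- s * z))) by ring.
  rewrite Rabs_mult. assert (0 <= (1 - s) ^ 2 / 2 <= 1) by pnra. rewrite Rabs_pos_eq by lra.
  unabs Hy. unabs Hz.
  assert (E := exp_lip K (- s * y) (- s * z) ltac:(pnra) ltac:(pnra)). replace (- s * y - - s * z) with (- s * (y - z)) in E by ring.
  rewrite Rabs_mult, Rabs_Ropp, (Rabs_pos_eq s) in E by lra. pose proof (Rabs_pos (exp (- s * y) - exp (- s * z))). pose proof (Rabs_pos (y - z)). pose proof (exp_pos K).
  assert (exp K * (s * Rabs (y - z)) <= exp K * Rabs (y - z)) by (apply Rmult_le_compat_l; pnra). pnra.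
Qed.
Lemma cont_E3 : cont E3.
Proof.
  apply cont_eps. intros x e He. set (K := Rabs x + 1). pose proof (exp_pos K) as HK.
  exists (Rmin 1 (e / exp K)). split. apply Rmin_pos; [lra | now apply Rdiv_lt_0_compat].
  intros y Hy. assert (H1 := Rlt_le_trans _ _ _ Hy (Rmin_l _ _)). assert (H2 := Rlt_le_trans _ _ _ Hy (Rmin_r _ _)).
  eapply Rle_lt_trans. apply (E3_lip K); unfold K. replace y with ((y - x) + x) by ring. triang. lra. lra.
  replace e with (exp K * (e / exp K)) by (field; lra). now apply Rmult_lt_compat_l.
Qed.
Definition n3N (c y : R) : R := 1 / 2 - (c + y) * E3 y.
Lemma fN_nicholson c y : fN (c - 1) ((c - 2) / 2) (n3N c) y = (c + y) * exp (- y) - c.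
Proof. rewrite E3_eq. unfold fN, n3N. field. Qed.
Lemma n3N_props c : 2 < c -> exists Ln, cont (n3N c) /\ n3N c 0 = (3 - c) / 6 /\ (forall z, Rabs z <= 1 -> Rabs (n3N c z) <= Ln) /\
  (forall y z, Rabs y <= 1 -> Rabs z <= 1 -> Rabs (n3N c y - n3N c z) <= Ln * Rabs (y - z)).
Proof.
  intros Hc. pose proof (exp_pos 1) as He. set (L1 := (c + 1) * exp 1 + (1 / 6 + exp 1)). assert (HL1 : 0 < L1) by (unfold L1; pnra).
  assert (EB : forall z, Rabs z <= 1 -> Rabs (E3 z) <= 1 / 6 + exp 1).
  { intros z Hz. assert (E := E3_lip 1 z 0 Hz ltac:(rewrite Rabs_R0; lra)). rewrite E3_0, Rminus_0_r in E.
    replace (E3 z) with ((E3 z - 1 / 6) + 1 / 6) by ring. triang. rewrite (Rabs_pos_eq (1 / 6)) by lra. pnra. }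
  assert (LL : forall y z, Rabs y <= 1 -> Rabs z <= 1 -> Rabs (n3N c y - n3N c z) <= L1 * Rabs (y - z)).
  { intros y z Hy Hz. unfold n3N. replace (1 / 2 - (c + y) * E3 y - (1 / 2 - (c + z) * E3 z)) with (- ((c + y) * (E3 y - E3 z)) + - ((y - z) * E3 z)) by ring.
    triang. rewrite !Rabs_Ropp, !Rabs_mult. assert (E := E3_lip 1 y z Hy Hz). specialize (EB z Hz).
    assert (Rabs (c + y) <= c + 1) by (unabs Hy; apply Rabs_le; lra).
    assert (Rabs (c + y) * Rabs (E3 y - E3 z) <= (c + 1) * (exp 1 * Rabs (y - z))) by (apply Rmult_le_compat; auto using Rabs_pos).
    assert (Rabs (y - z) * Rabs (E3 z) <= Rabs (y - z) * (1 / 6 + exp 1)) by (apply Rmult_le_compat_l; auto using Rabs_pos). unfold L1. lra. }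
  exists (L1 + c). split. { unfold n3N. pose proof cont_E3. ct. } split. { unfold n3N. rewrite E3_0. field. } split.
  - intros z Hz. assert (E := LL z 0 Hz ltac:(rewrite Rabs_R0; lra)). rewrite Rminus_0_r in E. replace (n3N c 0) with ((3 - c) / 6) in E by (unfold n3N; rewrite E3_0; field).
    replace (n3N c z) with ((n3N c z - (3 - c) / 6) + (3 - c) / 6) by ring. triang.
    assert (Rabs ((3 - c) / 6) <= c) by (apply Rabs_le; lra). pnra.
  - intros y z Hy Hz. eapply Rle_trans. apply LL; auto. apply Rmult_le_compat_r. apply Rabs_pos. lra.
Qed.

Lemma polar A B : exists rho phi, 0 <= rho /\ A = rho * cos phi /\ B = rho * sin phi.
Proof.
  set (rho := sqrt (A * A + B * B)). assert (Hr : rho * rho = A * A + B * B) by (apply sqrt_sqrt; pnra). assert (H0 : 0 <= rho) by apply sqrt_pos.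
  destruct (Req_dec rho 0) as [E|E]. { exists 0, 0. rewrite E in Hr. assert (A = 0) by pnra. assert (B = 0) by pnra. subst A B. lra. }
  assert (Hx : -1 <= A / rho <= 1). { split; apply Rmult_le_reg_r with rho; try lra; unfold Rdiv; rewrite Rmult_assoc, Rinv_l by lra; pnra. }
  assert (Hs : rho * sqrt (1 - (A / rho)²) = Rabs B).
  { rewrite <- (Rabs_pos_eq rho H0) at 1. rewrite <- (Rabs_pos_eq (sqrt _)) by apply sqrt_pos. rewrite <- Rabs_mult. apply Rsqr_eq_abs_0. unfold Rsqr.
    replace (rho * sqrt (1 - A / rho * (A / rho)) * (rho * sqrt (1 - A / rho * (A / rho)))) with (rho * rho * (sqrt (1 - A / rho * (A / rho)) * sqrt (1 - A / rho * (A / rho)))) by ring.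
    rewrite sqrt_sqrt by pnra. transitivity (rho * rho - A * A). field; lra. lra. }
  destruct (Rle_lt_dec 0 B).
  - exists rho, (acos (A / rho)). rewrite cos_acos, sin_acos by auto. repeat split; auto. field; lra. rewrite Hs, Rabs_pos_eq; auto.
  - exists rho, (- acos (A / rho)). rewrite cos_neg, sin_neg, cos_acos, sin_acos by auto. repeat split; auto. field; lra.
    replace (rho * - sqrt (1 - (A / rho)²)) with (- (rho * sqrt (1 - (A / rho)²))) by ring. rewrite Hs, Rabs_left; lra.
Qed.

Definition nich (a p d x y : R) : R := p * y * exp (- a * y) - d * x.
(** The notions of the theorem in raw epsilon-delta form, so that the transport only has to deal
    with field operations, order and absolute value. *)
Definition perR (F : R -> R -> R) (tau T : R) (v : R -> R) : Prop :=
  0 < T /\ (forall t, v (t + T) = v t) /\ (exists s t, v s <> v t) /\ forall t, derivable_pt_lim v t (F (v t) (v (t - tau))).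
Definition fwdR (F : R -> R -> R) (tau : R) (u : R -> R) : Prop :=
  (forall x, - tau <= x -> forall e, 0 < e -> exists b, 0 < b /\ forall y, - tau <= y -> Rabs (y - x) < b -> Rabs (u y - u x) < e) /\
  forall t, 0 < t -> derivable_pt_lim u t (F (u t) (u (t - tau))).
Definition nearR (tau : R) (v : R -> R) (r : R) (u : R -> R) (t : R) : Prop :=
  exists s, forall b, - tau <= b <= 0 -> Rabs (u (t + b) - v (s + b)) < r.
Definition stableR (F : R -> R -> R) (tau : R) (v : R -> R) : Prop :=
  (forall e, 0 < e -> exists b, 0 < b /\ forall u, fwdR F tau u -> nearR tau v b u 0 -> forall t, 0 <= t -> nearR tau v e u t) /\
  exists b, 0 < b /\ forall u, fwdR F tau u -> nearR tau v b u 0 -> forall e, 0 < e -> exists t0, forall t, t0 <= t -> nearR tau v e u t.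

Section Core.
Variables a p d c : R.
Hypothesis ha : 0 < a.
Hypothesis hd : 0 < d.
Hypothesis hc : 2 < c.
Hypothesis hpc : p = d * exp c.
Let fc (y : R) : R := (c + y) * exp (- y) - c.
Lemma nich_eq x y : nich a p d ((c + x) / a) ((c + y) / a) = d / a * (fc y - x).
Proof.
  unfold nich, fc. rewrite hpc. replace (- a * ((c + y) / a)) with (- c + - y) by (field; lra). rewrite exp_plus, (exp_Ropp c). pose proof (exp_pos c). field. lra.
Qed.
(* An affine change of variable and of time turns the delay equation into [nu v' (s) + v (s) = fc (v (s - kap))]. *)
Lemma to_normal tau (v : R -> R) om t : 0 < om -> is_derive v (t / om) (nich a p d (v (t / om)) (v (t / om - tau))) ->
  is_derive (fun s => a * v (s / om) - c) t (d / om * (fc (a * v ((t - om * tau) / om) - c) - (a * v (t / om) - c))).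
Proof.
  intros Ho H. replace ((t - om * tau) / om) with (t / om - tau) by (field; lra).
  replace (v (t / om)) with ((c + (a * v (t / om) - c)) / a) in H at 1 by (field; lra). replace (v (t / om - tau)) with ((c + (a * v (t / om - tau) - c)) / a) in H by (field; lra).
  rewrite nich_eq in H. eapply is_derive_eq. apply D_minus. apply D_scal. apply (D_comp v (fun s => s / om)). exact H.
  unfold Rdiv. apply D_mult. apply D_id. apply D_const. apply D_const. cbv beta. field. lra.
Qed.
Lemma of_normal tau (v : R -> R) l om t : 0 < om -> is_derive v (om * t) l -> om * l = d * (fc (v (om * t - om * tau)) - v (om * t)) ->
  is_derive (fun s => (c + v (om * s)) / a) t (nich a p d ((c + v (om * t)) / a) ((c + v (om * (t - tau))) / a)).
Proof.
  intros Ho H E. rewrite nich_eq. replace (om * (t - tau)) with (om * t - om * tau) by ring. eapply is_derive_eq. unfold Rdiv. apply D_mult. apply D_plus. apply D_const. apply (D_comp v (fun s => om * s)). exact H.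
  apply D_scal, D_id. apply D_const. cbv beta. rewrite Rmult_1_r, E. field. lra.
Qed.

Variables be w th : R.
Hypothesis Ebe : be = c - 1.
Hypothesis w0 : 0 < w.
Hypothesis w2 : w * w = be * be - 1.
Hypothesis th0 : 0 < th < PI.
Hypothesis costh : be * cos th = -1.
Hypothesis sinth : be * sin th = w.
Let n0 : R := (c - 2) / 2.
Let n3 : R -> R := n3N c.
Let k (n : nat) : R := INR n * (2 * PI).
Let F : R -> R -> R := nich a p d.
Lemma fN_fc y : fN be n0 n3 y = fc y.
Proof. rewrite Ebe. apply fN_nicholson. Qed.

Theorem nicholson_branch (n : nat) : let taun := (th + k n) / (d * w) in
  exists (e0 C : R) (tau T : R -> R) (u : R -> R -> R), 0 < e0 /\ 0 < C /\ (tau 0 = taun /\ T 0 = 2 * PI / (d * w) /\ forall t, u 0 t = c / a) /\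
  (forall e e', 0 <= e < e0 -> 0 <= e' < e0 -> Rabs (tau e - tau e') <= C * Rabs (e - e') /\ Rabs (T e - T e') <= C * Rabs (e - e') /\
     forall s, Rabs (u e (T e * s) - u e' (T e' * s)) <= C * Rabs (e - e')) /\
  (forall e, 0 < e < e0 -> perR F (tau e) (T e) (u e)) /\
  (exists r, 0 < r /\ forall tau' T' v, Rabs (tau' - taun) < r -> Rabs (T' - 2 * PI / (d * w)) < r -> (forall t, Rabs (v t - c / a) < r) -> perR F tau' T' v ->
     exists e s, 0 < e < e0 /\ tau e = tau' /\ T e = T' /\ forall t, v t = u e (t + s)) /\
  (forall e, 0 < e < e0 -> taun < tau e) /\
  (exists r, 0 < r /\ forall tau', taun < tau' < taun + r -> exists e, 0 < e < e0 /\ tau e = tau') /\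
  (n = 0%nat -> forall e, 0 < e < e0 -> stableR F (tau e) (u e)).
Proof.
  intros taun. pose proof PI_RGT_0 as HPI. assert (be1 : 1 < be) by lra.
  destruct (n3N_props c hc) as (Ln & Cn3 & En3 & n3b & n3l). fold n3 in Cn3, En3, n3b, n3l.
  destruct (K0_operator be w th be1 w0 w2) as (K & K' & HK).
  assert (Hk0 : 0 <= k n) by (unfold k; pose proof (pos_INR n); pnra).
  destruct (family_of_operator be w th be1 w0 w2 th0 costh sinth n0 n3 Ln Cn3 n3b n3l K K' HK (k n) Hk0 ltac:(unfold n0; rewrite Ebe; field) ltac:(rewrite En3, Ebe; field))
    as (eb & L & s0 & psi & dpsi & nu & kap & Heb & HL & Hs0 & Hfam & Hlip & Hnu0 & Hkap0 & Hmono & eta & Heta & Huniq).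
  set (m := th / w). assert (mw : m * w = th) by (unfold m; field; lra).
  assert (Hst : exists et, 0 < et <= eb /\ (n = 0%nat -> forall eps, 0 < eps <= et -> exists D d0 K q, 0 < D /\ 0 < d0 /\ 0 < K /\ 0 < q < 1 /\
    forall x b, sol be n0 n3 nu kap eps x -> 0 <= b <= d0 -> near psi kap eps x 0 b -> forall (j : nat) t, INR j * D <= t -> near psi kap eps x t (K * b * q ^ j))).
  { destruct (Nat.eq_dec n 0) as [E|E]. 2:{ exists eb. split. lra. intros; contradiction. }
    assert (Hm0 : forall ea ec, 0 <= ea <= ec -> ec <= eb -> s0 * ((ec - ea) * (ec + ea)) <= mE nu kap ec - mE nu kap ea).
    { intros ea ec H1 H2. specialize (Hmono ea ec H1 H2). rewrite E in Hmono. unfold k in Hmono. simpl INR in Hmono. rewrite Rmult_0_l, !Rplus_0_r in Hmono. exact Hmono. }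
    destruct (stab_core be w th m be1 w0 w2 th0 costh sinth mw n0 n3 Ln n3b n3l eb L s0 psi dpsi nu kap Heb HL Hs0 Hfam Hlip Hnu0 Hkap0 Hm0) as (et & Het & H).
    exists et. auto. }
  destruct Hst as (et & Het & Hstab).
  (* The second bound makes the cosine dominate [psi], so that the values at phases 0 and [PI]
     differ and the solution is not constant. *)
  set (e0 := Rmin et (/ (2 * L))). assert (HiL : 0 < / (2 * L)) by (apply Rinv_0_lt_compat; lra).
  assert (He0 : 0 < e0) by (apply Rmin_pos; lra). assert (He0t : e0 <= et) by apply Rmin_l. assert (He0L : e0 <= / (2 * L)) by apply Rmin_r.
  set (Y := Yp psi).
  assert (Hom : forall e, 0 <= e <= eb -> w / 2 <= nu e /\ 0 < nu e * d /\ 0 < kap e). { intros e He. destruct (Hfam e He) as (_ & _ & _ & _ & _ & H1 & H2 & _). split; [auto|split; [pnra|lra]]. }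
  assert (HYper : forall e s, 0 <= e <= eb -> Y e (s + 2 * PI) = Y e s). { intros e s He. destruct (Hfam e He) as (_ & _ & Hp & _). unfold Y, Yp. now rewrite (Hp s), cos_plus, cos_2PI, sin_2PI, Rmult_1_r, Rmult_0_r, Rminus_0_r. }
  assert (HYper' : forall e s, 0 <= e <= eb -> Y e (s + k n) = Y e s). { intros e s He. unfold k. generalize n. intros j. induction j. simpl. f_equal; ring. rewrite S_INR. replace (s + (INR j + 1) * (2 * PI)) with (s + INR j * (2 * PI) + 2 * PI) by ring. now rewrite HYper. }
  set (tau := fun e => (kap e + k n) / (nu e * d)). set (T := fun e => 2 * PI / (nu e * d)). set (u := fun e t => (c + Y e (nu e * d * t)) / a).
  assert (Htau0 : tau 0 = taun) by (unfold tau, taun; rewrite Hnu0, Hkap0, (Rmult_comm w); reflexivity).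
  assert (HT0 : T 0 = 2 * PI / (d * w)) by (unfold T; rewrite Hnu0, (Rmult_comm w); reflexivity).
  set (C := 2 / (w * d) * L * 2 + (4 + k n) * (4 / (w * w * d)) * L * 2 + 2 * PI * (4 / (w * w * d)) * L * 2 + (1 + 3 * L) / a).
  assert (Q1 : 0 < 2 / (w * d)) by (apply Rdiv_lt_0_compat; pnra). assert (Q2 : 0 < 4 / (w * w * d)) by (apply Rdiv_lt_0_compat; [lra | apply Rmult_lt_0_compat; pnra]).
  assert (Q3 : 0 < (1 + 3 * L) / a) by (apply Rdiv_lt_0_compat; lra).
  assert (HC0 : 0 < 2 / (w * d) * L * 2 /\ 0 <= (4 + k n) * (4 / (w * w * d)) * L * 2 /\ 0 < 2 * PI * (4 / (w * w * d)) * L * 2).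
  { split. apply Rmult_lt_0_compat; [apply Rmult_lt_0_compat; lra | lra]. split. apply Rmult_le_pos; [apply Rmult_le_pos; [apply Rmult_le_pos; lra | lra] | lra]. apply Rmult_lt_0_compat; [apply Rmult_lt_0_compat; [apply Rmult_lt_0_compat; lra | lra] | lra]. }
  assert (HC : 0 < C) by (unfold C; lra).
  assert (Hinv : forall e e', 0 <= e <= eb -> 0 <= e' <= eb -> Rabs (/ (nu e * d) - / (nu e' * d)) <= 4 / (w * w * d) * L * 2 * Rabs (e - e') /\ Rabs (/ (nu e * d)) <= 2 / (w * d)).
  { intros e e' He He'. destruct (Hom e He) as (N1 & N2 & _). destruct (Hom e' He') as (N1' & N2' & _). destruct (Hlip e e' He He') as (_ & _ & Hn & _).
    assert (I1 : 0 < / nu e <= 2 / w). { split. apply Rinv_0_lt_compat; lra. replace (2 / w) with (/ (w / 2)) by (field; lra). apply Rinv_le_contravar; lra. }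
    assert (I2 : 0 < / nu e' <= 2 / w). { split. apply Rinv_0_lt_compat; lra. replace (2 / w) with (/ (w / 2)) by (field; lra). apply Rinv_le_contravar; lra. }
    assert (I3 : 0 < / d) by (now apply Rinv_0_lt_compat). pose proof (Rabs_pos (e - e')) as Hp. split.
    - replace (/ (nu e * d) - / (nu e' * d)) with (- (nu e - nu e') * (/ nu e * / nu e' * / d)) by (field; lra). rewrite Rabs_mult, Rabs_Ropp, (Rabs_pos_eq (_ * / d)) by (repeat apply Rmult_le_pos; lra).
      replace (4 / (w * w * d) * L * 2 * Rabs (e - e')) with ((L * (2 * Rabs (e - e'))) * (2 / w * (2 / w) * / d)) by (field; lra).
      apply Rmult_le_compat. apply Rabs_pos. repeat apply Rmult_le_pos; lra. eapply Rle_trans. apply Hn. apply Rmult_le_compat_l. lra. apply Rmult_le_compat_r; lra.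
      apply Rmult_le_compat_r. lra. apply Rmult_le_compat; lra.
    - rewrite Rinv_mult, Rabs_pos_eq by pnra. replace (2 / (w * d)) with (2 / w * / d) by (field; lra). apply Rmult_le_compat_r; lra. }
  assert (HLip : forall e e', 0 <= e < e0 -> 0 <= e' < e0 -> Rabs (tau e - tau e') <= C * Rabs (e - e') /\ Rabs (T e - T e') <= C * Rabs (e - e') /\
     forall s, Rabs (u e (T e * s) - u e' (T e' * s)) <= C * Rabs (e - e')).
  { intros e e' He He'. destruct (Hinv e e' ltac:(lra) ltac:(lra)) as [I1 I2]. destruct (Hlip e e' ltac:(lra) ltac:(lra)) as (_ & _ & _ & Hk).
    destruct (Hom e ltac:(lra)) as (N1 & N2 & N3). destruct (Hom e' ltac:(lra)) as (N1' & N2' & N3'). pose proof (Rabs_pos (e - e')) as Hp. destruct HC0 as (C1 & C2 & C3).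
    destruct (Hfam e' ltac:(lra)) as (_ & _ & _ & _ & _ & _ & Hk' & _). pose proof PI_4.
    assert (P1 := Rmult_le_pos _ _ (Rlt_le _ _ C1) Hp). assert (P2 := Rmult_le_pos _ _ C2 Hp). assert (P3 := Rmult_le_pos _ _ (Rlt_le _ _ C3) Hp). assert (P4 := Rmult_le_pos _ _ (Rlt_le _ _ Q3) Hp).
    split; [|split].
    - replace (tau e - tau e') with ((kap e - kap e') * / (nu e * d) + (kap e' + k n) * (/ (nu e * d) - / (nu e' * d))) by (unfold tau; field; lra).
      triang. rewrite !Rabs_mult, (Rabs_pos_eq (kap e' + k n)) by lra.
      assert (Rabs (kap e - kap e') * Rabs (/ (nu e * d)) <= (L * (2 * Rabs (e - e'))) * (2 / (w * d))).
      { apply Rmult_le_compat; auto using Rabs_pos. eapply Rle_trans. apply Hk. apply Rmult_le_compat_l. lra. apply Rmult_le_compat_r; lra. }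
      assert ((kap e' + k n) * Rabs (/ (nu e * d) - / (nu e' * d)) <= (4 + k n) * (4 / (w * w * d) * L * 2 * Rabs (e - e'))) by (apply Rmult_le_compat; try lra; apply Rabs_pos).
      unfold C. lra.
    - replace (T e - T e') with (2 * PI * (/ (nu e * d) - / (nu e' * d))) by (unfold T; field; lra). rewrite Rabs_mult, (Rabs_pos_eq (2 * PI)) by lra.
      assert (2 * PI * Rabs (/ (nu e * d) - / (nu e' * d)) <= 2 * PI * (4 / (w * w * d) * L * 2 * Rabs (e - e'))) by (apply Rmult_le_compat_l; lra). unfold C. lra.
    - intros s. unfold u, T. replace (nu e * d * (2 * PI / (nu e * d) * s)) with (2 * PI * s) by (field; lra). replace (nu e' * d * (2 * PI / (nu e' * d) * s)) with (2 * PI * s) by (field; lra).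
      replace ((c + Y e (2 * PI * s)) / a - (c + Y e' (2 * PI * s)) / a) with ((Y e (2 * PI * s) - Y e' (2 * PI * s)) * / a) by (field; lra).
      assert (HY := Yp_diff be w n0 n3 eb L psi dpsi nu kap Heb HL Hfam Hlip e e' (2 * PI * s) (2 * PI * s) ltac:(lra) ltac:(lra)). fold Y in HY. rewrite Rminus_diag, Rabs_R0, Rmult_0_r, Rplus_0_r in HY.
      assert (Ia : 0 < / a) by (now apply Rinv_0_lt_compat). rewrite Rabs_mult, (Rabs_pos_eq (/ a)) by lra.
      assert (Rabs (Y e (2 * PI * s) - Y e' (2 * PI * s)) * / a <= (1 + 3 * L) * Rabs (e - e') * / a) by (apply Rmult_le_compat_r; lra).
      unfold C. unfold Rdiv in *. lra. }
  assert (Hper : forall e, 0 < e < e0 -> perR F (tau e) (T e) (u e)).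
  { intros e He. destruct (Hom e ltac:(lra)) as (N1 & N2 & N3). destruct (Hfam e ltac:(lra)) as (_ & _ & _ & Bp & _ & _ & _ & Eq).
    split; [|split; [|split]].
    - unfold T. apply Rdiv_lt_0_compat; lra.
    - intros t. unfold u, T. replace (nu e * d * (t + 2 * PI / (nu e * d))) with (nu e * d * t + 2 * PI) by (field; lra). now rewrite HYper by lra.
    - exists 0, (PI / (nu e * d)). unfold u. replace (nu e * d * (PI / (nu e * d))) with PI by (field; lra). rewrite Rmult_0_r. intros E.
      assert (E2 : Y e 0 = Y e PI). { apply Rmult_eq_reg_r with (/ a). 2: apply Rinv_neq_0_compat; lra. unfold Rdiv in E. lra. }
      unfold Y, Yp in E2. rewrite cos_0, cos_PI in E2. assert (B1 := Bp 0). assert (B2 := Bp PI). unabs B1. unabs B2.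
      assert (e * L < 1). { apply Rlt_le_trans with (/ (2 * L) * (2 * L)). pnra. right; field; lra. } pnra.
    - intros t. apply is_derive_Reals. unfold u. apply (of_normal (tau e) (Y e) (- e * sin (nu e * d * t) + e * e * dpsi e (nu e * d * t)) (nu e * d) t N2).
      apply (Yp_D be w n0 n3 eb L psi dpsi nu kap Hfam). lra.
      specialize (Eq (nu e * d * t)). rewrite fN_fc in Eq. replace (nu e * d * t - nu e * d * tau e) with (nu e * d * t - kap e - k n) by (unfold tau; field; lra).
      assert (E := HYper' e (nu e * d * t - kap e - k n) ltac:(lra)). replace (nu e * d * t - kap e - k n + k n) with (nu e * d * t - kap e) in E by ring. rewrite <- E.
      unfold Y, Yp in *. rewrite <- Eq. ring. }
  assert (Hfwd : forall e, 0 <= e <= eb -> s0 * (e * e) / d <= tau e - taun).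
  { intros e He. assert (M := Hmono 0 e ltac:(lra) ltac:(lra)). destruct (Hom e He) as (N1 & N2 & N3). rewrite <- Htau0. unfold tau.
    destruct (Hom 0 ltac:(lra)) as (N1' & N2' & N3').
    replace ((kap e + k n) / (nu e * d) - (kap 0 + k n) / (nu 0 * d)) with (((kap e + k n) * / nu e - (kap 0 + k n) * / nu 0) * / d) by (field; lra).
    unfold Rdiv. apply Rmult_le_compat_r. left; now apply Rinv_0_lt_compat. lra. }
  assert (Hfwd' : forall e, 0 < e <= eb -> taun < tau e). { intros e He. assert (E := Hfwd e ltac:(lra)). assert (0 < s0 * (e * e) / d) by (apply Rdiv_lt_0_compat; [apply Rmult_lt_0_compat; [lra | pnra] | lra]). lra. }
  exists e0, C, tau, T, u. split. auto. split. auto. split.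
  { split. auto. split. auto. intros t. unfold u, Y, Yp. field. lra. }
  split. exact HLip. split. exact Hper. split; [|split; [|split]].
  4:{ intros En e He. destruct (Hstab En e ltac:(lra)) as (D & d0 & K1 & q & HD & Hd0 & HK1 & Hq & HS). destruct (Hom e ltac:(lra)) as (N1 & N2 & N3).
      assert (Ek : k n = 0) by (unfold k; rewrite En; simpl; ring).
      assert (Ht : tau e = kap e / (nu e * d)) by (unfold tau; rewrite Ek, Rplus_0_r; reflexivity). assert (Htp : 0 < tau e) by (rewrite Ht; apply Rdiv_lt_0_compat; lra).
      assert (Hut : forall s, u e (tau e * s) = (c + X psi kap e s) / a). { intros s. unfold u, X. replace (nu e * d * (tau e * s)) with (kap e * s) by (rewrite Ht; field; lra). reflexivity. }
      assert (Ht0 : forall t, t = tau e * (t / tau e)) by (intros; field; lra).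
      assert (Hx : forall v, fwdR F (tau e) v -> exists x, sol be n0 n3 nu kap e x /\ forall t, -1 <= t -> x t = a * v (tau e * t) - c).
      (* Freezing the solution before time -1 yields an everywhere continuous function without
         changing its history. *)
      { intros v [Cv Dv]. exists (fun t => a * v (tau e * Rmax t (-1)) - c). split. 2:{ intros t Hm. now rewrite Rmax_left. } split.
        - apply cont_eps. intros x b Hb. destruct (Cv (tau e * Rmax x (-1)) ltac:(pose proof (Rmax_r x (-1)); pnra) (b / a) ltac:(now apply Rdiv_lt_0_compat)) as (h & Hh & HH).
          exists (h / tau e). split. now apply Rdiv_lt_0_compat. intros y Hy.
          replace (a * v (tau e * Rmax y (-1)) - c - (a * v (tau e * Rmax x (-1)) - c)) with (a * (v (tau e * Rmax y (-1)) - v (tau e * Rmax x (-1)))) by ring.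
          rewrite Rabs_mult, Rabs_pos_eq by lra. replace b with (a * (b / a)) by (field; lra). apply Rmult_lt_compat_l; auto. apply HH. pose proof (Rmax_r y (-1)); pnra.
          rewrite <- Rmult_minus_distr_l, Rabs_mult, Rabs_pos_eq by lra. replace h with (tau e * (h / tau e)) by (field; lra). apply Rmult_lt_compat_l; auto.
          eapply Rle_lt_trans; [|apply Hy]. unfold Rmax. destruct (Rle_dec y (-1)), (Rle_dec x (-1)); unfold Rabs; repeat destruct (Rcase_abs _); lra.
        - intros t Hp. apply (is_derive_ext_loc (fun t => a * v (tau e * t) - c)). exists (mkposreal t Hp). intros y Hy. change (Rabs (y - t) < t) in Hy. apply Rabs_def2 in Hy. rewrite Rmax_left by lra. reflexivity.
          rewrite !Rmax_left by lra. assert (Dt := proj2 (is_derive_Reals _ _ _) (Dv (tau e * t) ltac:(pnra))). clear Dv. rename Dt into Dv. unfold F in Dv.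
          replace (v (tau e * t)) with ((c + (a * v (tau e * t) - c)) / a) in Dv at 1 by (field; lra). replace (tau e * t - tau e) with (tau e * (t - 1)) in Dv by ring.
          replace (v (tau e * (t - 1))) with ((c + (a * v (tau e * (t - 1)) - c)) / a) in Dv by (field; lra). rewrite nich_eq in Dv.
          rewrite fN_fc. eapply is_derive_eq. apply D_minus. apply D_scal. apply (D_comp v (fun s => tau e * s)). exact Dv. apply D_scal, D_id. apply D_const.
          unfold mE. rewrite Ht. field. lra. }
      assert (Hn1 : forall v x t b, (forall t, -1 <= t -> x t = a * v (tau e * t) - c) -> 0 <= t -> nearR (tau e) (u e) (b / a) v t -> near psi kap e x (t / tau e) b).
      { intros v x t b E Hp [s Hs]. exists (s / tau e). intros y Hy. specialize (Hs (tau e * y) ltac:(pnra)).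
        assert (0 <= t / tau e) by (apply Rmult_le_pos; [auto | left; now apply Rinv_0_lt_compat]). rewrite E by lra. rewrite Rmult_plus_distr_l, <- Ht0.
        replace (s + tau e * y) with (tau e * (s / tau e + y)) in Hs by (field; lra). rewrite Hut in Hs.
        replace (a * v (t + tau e * y) - c - X psi kap e (s / tau e + y)) with (a * (v (t + tau e * y) - (c + X psi kap e (s / tau e + y)) / a)) by (field; lra).
        rewrite Rabs_mult, (Rabs_pos_eq a) by lra. replace b with (a * (b / a)) by (field; lra). apply Rmult_le_compat_l; lra. }
      assert (Hn2 : forall v x t b b', (forall t, -1 <= t -> x t = a * v (tau e * t) - c) -> 0 <= t -> b < a * b' -> near psi kap e x (t / tau e) b -> nearR (tau e) (u e) b' v t).
      { intros v x t b b' E Hp Hb [s Hs]. exists (tau e * s). intros y Hy.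
        assert (Hy' : -1 <= y / tau e <= 0). { split; apply Rmult_le_reg_r with (tau e); auto; unfold Rdiv; rewrite Rmult_assoc, Rinv_l; lra. }
        specialize (Hs (y / tau e) Hy').
        assert (0 <= t / tau e) by (apply Rmult_le_pos; [auto | left; now apply Rinv_0_lt_compat]). rewrite E in Hs by lra. rewrite Rmult_plus_distr_l, <- !Ht0 in Hs.
        replace (tau e * s + y) with (tau e * (s + y / tau e)) by (field; lra). rewrite Hut.
        apply Rmult_lt_reg_l with a; auto. rewrite <- (Rabs_pos_eq a) at 1 by lra. rewrite <- Rabs_mult.
        replace (a * (v (t + y) - (c + X psi kap e (s + y / tau e)) / a)) with (a * v (t + y) - c - X psi kap e (s + y / tau e)) by (field; lra). lra. }
      (* Rescaling by [a] in space and by the delay in time; the strict inequality in [nearR] costs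
         a little room between [b'] and the bound. *)
      assert (Hall : forall b v, 0 < b <= d0 / a -> fwdR F (tau e) v -> nearR (tau e) (u e) b v 0 -> forall (j : nat) t, INR j * D * tau e <= t -> forall b', K1 * (a * b) * q ^ j < a * b' -> nearR (tau e) (u e) b' v t).
      { intros b v Hb Hv Hn j t Hj b' Hb'. destruct (Hx v Hv) as (x & Sx & Ex). assert (0 <= INR j * D * tau e) by (apply Rmult_le_pos; [apply Rmult_le_pos; [apply pos_INR | lra] | lra]).
        apply (Hn2 v x t (K1 * (a * b) * q ^ j) b' Ex ltac:(lra) Hb'). apply HS; auto.
        assert (a * b <= a * (d0 / a)) by (apply Rmult_le_compat_l; lra). replace (a * (d0 / a)) with d0 in * by (field; lra). split; pnra.
        replace 0 with (0 / tau e) by (field; lra). apply (Hn1 v x 0 (a * b) Ex ltac:(lra)). now replace (a * b / a) with b by (field; lra).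
        apply Rmult_le_reg_r with (tau e); auto. unfold Rdiv. rewrite (Rmult_assoc t), Rinv_l, Rmult_1_r; lra. }
      assert (Hda : 0 < d0 / a) by (now apply Rdiv_lt_0_compat).
      split.
      - intros b Hb. assert (Hbk : 0 < b / (2 * K1)) by (apply Rdiv_lt_0_compat; lra). exists (Rmin (d0 / a) (b / (2 * K1))). split. now apply Rmin_pos.
        intros v Hv Hn t Htt. apply (Hall _ v (conj (Rmin_pos _ _ Hda Hbk) (Rmin_l _ _)) Hv Hn 0%nat). simpl; lra. rewrite pow_O, Rmult_1_r.
        apply Rle_lt_trans with (K1 * (a * (b / (2 * K1)))). apply Rmult_le_compat_l. lra. apply Rmult_le_compat_l. lra. apply Rmin_r.
        replace (K1 * (a * (b / (2 * K1)))) with (a * b / 2) by (field; lra). assert (0 < a * b) by pnra. lra.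
      - exists (d0 / a). split; auto. intros v Hv Hn b Hb.
        destruct (pow_lt_1_zero q ltac:(rewrite Rabs_pos_eq; lra) (a * b / (K1 * (a * (d0 / a))))) as [j Hj]. { apply Rdiv_lt_0_compat. apply Rmult_lt_0_compat; lra. apply Rmult_lt_0_compat; [auto | apply Rmult_lt_0_compat; auto]. }
        specialize (Hj j (le_n _)). rewrite Rabs_pos_eq in Hj by (apply pow_le; lra).
        exists (INR j * D * tau e). intros t Htt. apply (Hall (d0 / a) v ltac:(lra) Hv Hn j t Htt).
        assert (P : 0 < K1 * (a * (d0 / a))) by (apply Rmult_lt_0_compat; [auto | apply Rmult_lt_0_compat; auto]).
        apply Rmult_lt_compat_l with (r := K1 * (a * (d0 / a))) in Hj; auto. eapply Rlt_le_trans. apply Hj. right. field. lra. }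
  - assert (HTp : 0 < 2 * PI / (d * w)) by (apply Rdiv_lt_0_compat; pnra). set (T0 := 2 * PI / (d * w)) in *.
    assert (Htn : 0 < taun) by (unfold taun; apply Rdiv_lt_0_compat; pnra).
    (* The first summand converts an error of the period into one of [nu], the second errors of
       delay and period into one of [kap]. The bounds in [r] with [a] make the solution small and
       its amplitude less than [e0]. *)
    set (Kb := (2 * PI / d * (2 / (T0 * T0))) + 2 * PI * (2 / T0 + taun * (2 / (T0 * T0)))).
    assert (R1 : 0 < 2 / (T0 * T0)) by (apply Rdiv_lt_0_compat; pnra). assert (R2 : 0 < 2 * PI / d) by (apply Rdiv_lt_0_compat; lra). assert (R3 : 0 < 2 / T0) by (apply Rdiv_lt_0_compat; lra).
    assert (R4 : 0 < 2 * PI / d * (2 / (T0 * T0))) by pnra. assert (R5 : 0 < taun * (2 / (T0 * T0))) by pnra. assert (R6 : 0 < 2 * PI * (2 / T0 + taun * (2 / (T0 * T0)))) by (apply Rmult_lt_0_compat; lra).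
    set (r := Rmin (T0 / 2) (Rmin (eta / Kb) (Rmin (eta / a) (e0 / (3 * a))))).
    assert (Hr : 0 < r). { unfold r. repeat apply Rmin_pos; try lra; apply Rdiv_lt_0_compat; unfold Kb; lra. }
    assert (Hr1 : r <= T0 / 2) by apply Rmin_l. assert (Hr2 : r <= eta / Kb) by (min_le).
    assert (Hr3 : r <= eta / a) by (min_le).
    assert (Hr4 : r <= e0 / (3 * a)) by (eapply Rle_trans; [apply Rmin_r |]; eapply Rle_trans; [apply Rmin_r |]; apply Rmin_r).
    exists r. split; auto. intros tau' T' v Ht HT Hv (HT'0 & Hpv & Hnc & Dv).
    assert (HT' : T0 / 2 <= T') by (apply Rabs_def2 in HT; lra).
    assert (HKr : Kb * r <= eta). { replace eta with (Kb * (eta / Kb)) by (field; unfold Kb; lra). apply Rmult_le_compat_l; auto. unfold Kb; lra. }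
    assert (HiT : Rabs (/ T' - / T0) <= 2 / (T0 * T0) * r).
    { replace (/ T' - / T0) with (- (T' - T0) * (/ T' * / T0)) by (field; lra). rewrite Rabs_mult, Rabs_Ropp.
      assert (I1 : 0 < / T' <= 2 / T0). { split. apply Rinv_0_lt_compat; lra. replace (2 / T0) with (/ (T0 / 2)) by (field; lra). apply Rinv_le_contravar; lra. }
      assert (I2 : 0 < / T0) by (now apply Rinv_0_lt_compat). rewrite (Rabs_pos_eq (_ * _)) by pnra.
      replace (2 / (T0 * T0) * r) with (r * (2 / T0 * / T0)) by (field; lra). apply Rmult_le_compat. apply Rabs_pos. pnra. lra. apply Rmult_le_compat_r; lra. }
    set (om := 2 * PI / T'). assert (Hom0 : 0 < om) by (apply Rdiv_lt_0_compat; lra).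
    set (nu' := om / d). set (kap' := om * tau' - k n).
    assert (Hnu' : Rabs (nu' - w) <= eta).
    { replace (nu' - w) with (2 * PI / d * (/ T' - / T0)) by (unfold nu', om, T0; field; lra). rewrite Rabs_mult, (Rabs_pos_eq (2 * PI / d)) by lra.
      assert (2 * PI / d * Rabs (/ T' - / T0) <= 2 * PI / d * (2 / (T0 * T0) * r)) by (apply Rmult_le_compat_l; lra).
      assert (0 <= 2 * PI * (2 / T0 + taun * (2 / (T0 * T0))) * r) by (apply Rmult_le_pos; lra). unfold Kb in HKr. lra. }
    assert (Hkap' : Rabs (kap' - th) <= eta).
    { replace (kap' - th) with (2 * PI * ((tau' - taun) * / T' + taun * (/ T' - / T0))) by (unfold kap', om, T0, taun; field; lra). rewrite Rabs_mult, (Rabs_pos_eq (2 * PI)) by lra.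
      assert (I1 : 0 < / T' <= 2 / T0). { split. apply Rinv_0_lt_compat; lra. replace (2 / T0) with (/ (T0 / 2)) by (field; lra). apply Rinv_le_contravar; lra. }
      assert (B : Rabs ((tau' - taun) * / T' + taun * (/ T' - / T0)) <= (2 / T0 + taun * (2 / (T0 * T0))) * r).
      { triang. rewrite !Rabs_mult, (Rabs_pos_eq (/ T')), (Rabs_pos_eq taun) by lra.
        assert (Rabs (tau' - taun) * / T' <= r * (2 / T0)) by (apply Rmult_le_compat; try lra; apply Rabs_pos).
        assert (taun * Rabs (/ T' - / T0) <= taun * (2 / (T0 * T0) * r)) by (apply Rmult_le_compat_l; lra). lra. }
      assert (2 * PI * Rabs ((tau' - taun) * / T' + taun * (/ T' - / T0)) <= 2 * PI * ((2 / T0 + taun * (2 / (T0 * T0))) * r)) by (apply Rmult_le_compat_l; lra).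
      assert (0 <= 2 * PI / d * (2 / (T0 * T0)) * r) by (apply Rmult_le_pos; lra). unfold Kb in HKr. lra. }
    set (V := fun s => a * v (s / om) - c).
    set (V' := fun s => d / om * (fc (V (s - om * tau')) - V s)).
    assert (DV : forall s, is_derive V s (V' s)). { intros s. apply (to_normal tau' v om s Hom0). apply is_derive_Reals, Dv. }
    assert (CV : cont V) by (apply (is_derive_cont _ V' DV)).
    assert (CV' : cont V'). { unfold V', fc. assert (cont (fun s => V (s - om * tau'))) by (apply (cont_comp V (fun s => s - om * tau')); [auto | ct]). ct. }
    assert (PV : per V). { intros s. unfold V. replace ((s + 2 * PI) / om) with (s / om + T') by (unfold om; field; lra). now rewrite Hpv. }
    assert (BV : forall s, Rabs (V s) <= a * r). { intros s. unfold V. replace (a * v (s / om) - c) with (a * (v (s / om) - c / a)) by (field; lra). rewrite Rabs_mult, Rabs_pos_eq by lra. apply Rmult_le_compat_l. lra. left; apply Hv. }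
    assert (BV2 : a * r <= eta /\ 3 * (a * r) <= e0).
    { split. replace eta with (a * (eta / a)) by (field; lra). apply Rmult_le_compat_l; lra. replace e0 with (3 * (a * (e0 / (3 * a)))) by (field; lra). apply Rmult_le_compat_l. lra. apply Rmult_le_compat_l; lra. }
    (* shift the phase so that the first harmonic is a nonnegative multiple of the cosine *)
    destruct (polar (pA V 1) (- pB V 1)) as (rho & phi & Hrho & EA & EB).
    destruct (coef_shift V phi 1 CV PV) as [SA SB]. simpl INR in SA, SB. rewrite Rmult_1_l in SA, SB.
    assert (Hone : sin phi * sin phi + cos phi * cos phi = 1) by (exact (sin2_cos2 phi)).
    set (e := rho / PI). assert (He : 0 <= e) by (apply Rmult_le_pos; [auto | left; now apply Rinv_0_lt_compat]).
    set (W := fun s => V (s - phi)). fold W in SA, SB.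
    assert (WA : pA W 1 = PI * e). { rewrite SA. replace (pB V 1) with (- (rho * sin phi)) by lra. rewrite EA. transitivity (rho * (sin phi * sin phi + cos phi * cos phi)). ring. rewrite Hone. unfold e. field. lra. }
    assert (WB : pB W 1 = 0). { rewrite SB. replace (pB V 1) with (- (rho * sin phi)) by lra. rewrite EA. ring. }
    assert (DW : forall s, is_derive W s (V' (s - phi))) by (intros s; apply D_shift, DV).
    (* The [n] full turns contained in the delay are invisible to a periodic function. *)
    assert (EW : forall s, nu' * V' (s - phi) + W s = fN be n0 n3 (W (s - kap'))).
    { intros s. rewrite fN_fc. unfold W, V', nu'. replace (s - kap' - phi) with (s - phi - om * tau' + INR n * (2 * PI)) by (unfold kap', k; ring). rewrite (per_nat V n _ PV). field. lra. }
    assert (Hee : e < e0). { destruct (coef_bound W (a * r) 1) as [B1 _]. apply (cont_comp V (fun s => s - phi)); [auto|ct]. intros; apply BV. rewrite WA, Rabs_pos_eq in B1 by pnra.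
      assert (e <= 2 * (a * r)). { apply Rmult_le_reg_l with PI; lra. } assert (0 < a * r) by pnra. lra. }
    destruct (Huniq W (fun s => V' (s - phi)) nu' kap' e DW) as [U | (U1 & U2 & U3 & U4)]; auto.
    { apply (cont_comp V' (fun s => s - phi)); [auto|ct]. } { apply per_shift, PV. } { intros s. eapply Rle_trans. apply BV. lra. }
    { exfalso. destruct Hnc as (s & t & Hst). apply Hst.
      assert (G : forall t, v t = c / a). { intros y. assert (E := U (y * om + phi)). unfold W, V in E. replace ((y * om + phi - phi) / om) with y in E by (field; lra). apply Rmult_eq_reg_l with a; [|lra]. replace (a * (c / a)) with c by (field; lra). lra. }
      now rewrite !G. }
    destruct (Hom e ltac:(lra)) as (N1 & N2 & N3).
    assert (Eom : nu e * d = om) by (rewrite <- U2; unfold nu'; field; lra).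
    exists e, (phi / om). split. lra. split. { unfold tau. rewrite Eom, <- U3. unfold kap'. field. lra. } split. { unfold T. rewrite Eom. unfold om. field. lra. }
    intros t. unfold u. rewrite Eom. replace (om * (t + phi / om)) with (om * t + phi) by (field; lra).
    assert (E := U4 (om * t + phi)). unfold W, V in E. replace ((om * t + phi - phi) / om) with t in E by (field; lra).
    unfold Y, Yp. rewrite <- E. field. lra.
  - intros e He. apply Hfwd'. lra.
  (* The delay is controlled only on [[0, e0[], so its argument is clamped before the intermediate
     value theorem for continuous functions on the line is applied. *)
  - set (e1 := e0 / 2). set (g := fun x => tau (Rmax 0 (Rmin x e1))).
    assert (Hcl : forall x, 0 <= Rmax 0 (Rmin x e1) <= e1). { intros x. split. apply Rmax_l. apply Rmax_lub. unfold e1; lra. apply Rmin_r. }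
    assert (Cg : continuity g).
    { intros x. apply cont_pt, cont_eps. clear x. intros x b Hb. exists (b / C). split. now apply Rdiv_lt_0_compat. intros y Hy. assert (Hx1 := Hcl x). assert (Hy1 := Hcl y).
      destruct (HLip (Rmax 0 (Rmin y e1)) (Rmax 0 (Rmin x e1))) as [H _]. unfold e1 in *; lra. unfold e1 in *; lra.
      eapply Rle_lt_trans. apply H. apply Rle_lt_trans with (C * Rabs (y - x)). apply Rmult_le_compat_l. lra.
      unfold Rmax, Rmin. destruct (Rle_dec y e1), (Rle_dec x e1); repeat destruct (Rle_dec 0 _); unfold Rabs; repeat destruct (Rcase_abs _); lra.
      replace b with (C * (b / C)) by (field; lra). apply Rmult_lt_compat_l; auto. }
    assert (Hg0 : g 0 = taun). { unfold g. rewrite Rmin_left, Rmax_left by (unfold e1; lra). apply Htau0. }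
    assert (Hg1 : g e1 = tau e1). { unfold g. rewrite Rmin_left, Rmax_right by (unfold e1; lra). reflexivity. }
    exists (tau e1 - taun). assert (F1 := Hfwd' e1 ltac:(unfold e1; lra)). split. lra. intros tau' Ht'.
    destruct (IVT_gen g 0 e1 tau' Cg) as (x & Hx & Ex). { rewrite Hg0, Hg1, Rmin_left, Rmax_right; lra. }
    rewrite Rmin_left, Rmax_right in Hx by (unfold e1; lra).
    assert (Ex2 : g x = tau x). { unfold g. rewrite Rmin_left, Rmax_right by lra. reflexivity. }
    exists x. split; [|congruence]. destruct (Req_dec x 0) as [E|E]. subst x. lra. unfold e1 in Hx. lra.
Qed.
End Core.

(** Differential equations characterise the elementary functions, which identifies the two versions
    of them across the isomorphism; so too for sine and cosine below. *)
Lemma exp_unique (h : R -> R) : (forall y, derivable_pt_lim h y (h y)) -> h 0 = 1 -> forall y, h y = exp y.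
Proof.
  intros D H0 y. assert (E := zero_deriv (fun t => h t * exp (- t))).
  assert (E2 : h y * exp (- y) = h 0 * exp (- 0)).
  { apply E. intros t. assert (Dx : is_derive (fun t => exp (- t)) t (- exp (- t))) by (auto_derive; auto; ring).
    eapply is_derive_eq. apply D_mult. apply is_derive_Reals, D. apply Dx. cbv beta. ring. }
  rewrite H0, Ropp_0, exp_0, Rmult_1_r in E2. rewrite exp_Ropp in E2. pose proof (exp_pos y).
  apply Rmult_eq_reg_r with (/ exp y). rewrite E2. field. lra. apply Rinv_neq_0_compat. lra.
Qed.
Lemma cos_sin_unique (C S : R -> R) : (forall y, derivable_pt_lim C y (- S y)) -> (forall y, derivable_pt_lim S y (C y)) -> C 0 = 1 -> S 0 = 0 ->
  forall y, C y = cos y /\ S y = sin y.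
Proof.
  intros DC DS C0 S0 y. assert (E := zero_deriv (fun t => (C t - cos t) * (C t - cos t) + (S t - sin t) * (S t - sin t))).
  assert (E2 : (C y - cos y) * (C y - cos y) + (S y - sin y) * (S y - sin y) = (C 0 - cos 0) * (C 0 - cos 0) + (S 0 - sin 0) * (S 0 - sin 0)).
  { apply E. intros t. assert (D1 : is_derive (fun t => C t - cos t) t (- S t - - sin t)) by (apply D_minus; [apply is_derive_Reals, DC | apply is_derive_cos]).
    assert (D2 : is_derive (fun t => S t - sin t) t (C t - cos t)) by (apply D_minus; [apply is_derive_Reals, DS | apply is_derive_sin]).
    eapply is_derive_eq. apply D_plus; apply D_mult; eauto. cbv beta. ring. }
  rewrite C0, S0, cos_0, sin_0 in E2. pose proof (Rle_0_sqr (C y - cos y)) as Q1. pose proof (Rle_0_sqr (S y - sin y)) as Q2. unfold Rsqr in *.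
  split; apply Rminus_diag_uniq, Rsqr_0_uniq; unfold Rsqr; lra.
Qed.
(** The bound 4 places [z / 2] in the interval where the cosine is injective. *)
Lemma PI_unique z : 0 < z < 4 -> cos (z / 2) = 0 -> z = PI.
Proof.
  intros Hz Hc. pose proof PI2_3_2. pose proof PI_RGT_0. assert (z / 2 = PI / 2). { apply cos_inj; try lra. rewrite cos_PI2. auto. } lra.
Qed.

Theorem nicholson_main (a p d c th h s : R) (n : nat) : 0 < a -> 0 < p -> 0 < d -> exp c = p / d -> 2 < c -> 0 <= th <= 2 * PI -> 0 <= s -> s * s = c * c - 2 * c ->
  cos th = 1 / (1 - c) -> sin th = - (s / (1 - c)) -> h = d * s -> let taun := (th + 2 * INR n * PI) / h in let F := nich a p d in
  exists (e0 C : R) (tau T : R -> R) (u : R -> R -> R), 0 < e0 /\ 0 < C /\ (tau 0 = taun /\ T 0 = 2 * PI / h /\ forall t, u 0 t = c / a) /\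
  (forall e e', 0 <= e < e0 -> 0 <= e' < e0 -> Rabs (tau e - tau e') <= C * Rabs (e - e') /\ Rabs (T e - T e') <= C * Rabs (e - e') /\
     forall s, Rabs (u e (T e * s) - u e' (T e' * s)) <= C * Rabs (e - e')) /\
  (forall e, 0 < e < e0 -> perR F (tau e) (T e) (u e)) /\
  (exists r, 0 < r /\ forall tau' T' v, Rabs (tau' - taun) < r -> Rabs (T' - 2 * PI / h) < r -> (forall t, Rabs (v t - c / a) < r) -> perR F tau' T' v ->
     exists e s, 0 < e < e0 /\ tau e = tau' /\ T e = T' /\ forall t, v t = u e (t + s)) /\
  (forall e, 0 < e < e0 -> taun < tau e) /\
  (exists r, 0 < r /\ forall tau', taun < tau' < taun + r -> exists e, 0 < e < e0 /\ tau e = tau') /\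
  (n = 0%nat -> forall e, 0 < e < e0 -> stableR F (tau e) (u e)).
Proof.
  intros Ha Hp Hd Hc Hc2 Hth Hs Hss Hcos Hsin Hh. assert (Hs0 : 0 < s) by pnra.
  assert (Hsin' : (c - 1) * sin th = s) by (rewrite Hsin; field; lra). assert (Hsp : 0 < sin th) by pnra.
  (* The sine is positive because [1 - c] is negative, which excludes 0 and the upper half of the
     interval. *)
  assert (Hth' : 0 < th < PI).
  { split. destruct (Req_dec th 0) as [E|E]; [|lra]. rewrite E, sin_0 in Hsp; lra. destruct (Rlt_le_dec th PI); auto. assert (sin th <= 0) by (apply sin_le_0; lra). lra. }
  assert (Hpc : p = d * exp c) by (rewrite Hc; field; lra).
  intros taun F. assert (E : taun = (th + INR n * (2 * PI)) / (d * s)) by (unfold taun; rewrite Hh; f_equal; ring). rewrite E, Hh.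
  apply (nicholson_branch a p d c Ha Hd Hc2 Hpc (c - 1) s th eq_refl Hs0 ltac:(pnra) Hth' ltac:(rewrite Hcos; field; lra) Hsin' n).
Qed.

End NicholsonReal.

Require Import Defs.
From HB Require Import structures.
From mathcomp Require Import all_boot all_order all_algebra.
From mathcomp Require Import all_classical all_reals all_analysis.
Import Order.TTheory GRing.Theory Num.Theory.
Import numFieldNormedType.Exports.
Local Open Scope classical_set_scope.
Local Open Scope ring_scope.

(** * Transport to an arbitrary field of real numbers *)

Module Transport.
From mathcomp Require Import Rstruct.
From Stdlib Require Import Rdefinitions Raxioms RIneq Rbasic_fun.
From Stdlib Require Rtrigo_def Rtrigo1 Ranalysis1.
Set Implicit Arguments.
Unset Strict Implicit.
Unset Printing Implicit Defensive.

Lemma rat_between (R : realType) (x y : R) : x < y -> exists q : rat, x < ratr q /\ ratr q < y.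
Proof. by move=> /rat_in_itvoo[q]; rewrite in_itv /= => /andP[? ?]; exists q. Qed.

Section Iso.
Variables R S : realType.
(** A real number is carried over by its rational lower cut. *)
Definition riso (x : R) : S := sup ((@ratr S) @` [set q | ratr q <= x]).

Lemma riso_has_sup (x : R) : has_sup ((@ratr S) @` [set q | ratr q <= x]).
Proof.
have xm : x - 1 < x by rewrite ltrBlDr ltrDl.
have xp : x < x + 1 by rewrite ltrDl.
split.
  have [q [_ qx]] := rat_between xm.
  by exists (ratr q), q => //=; exact: ltW.
have [q [xq _]] := rat_between xp.
by exists (ratr q) => _ [r /= rx <-]; rewrite ler_rat -(ler_rat R); exact: le_trans rx (ltW xq).
Qed.
Lemma riso_ge (x : R) q : ratr q <= x -> ratr q <= riso x.
Proof. by move=> qx; apply: sup_upper_bound; [exact: riso_has_sup | exists q]. Qed.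
Lemma riso_le (x : R) q : x <= ratr q -> riso x <= ratr q.
Proof.
move=> xq; apply: sup_le_ub; first by case: (riso_has_sup x).
by move=> _ [r /= rx <-]; rewrite ler_rat -(ler_rat R); exact: le_trans rx xq.
Qed.
(** Only rationals strictly on either side of [x] are tested. Strictness leaves room for splitting
    such a rational, which proves additivity and multiplicativity. *)
Lemma riso_unique (x : R) (z : S) : (forall q, ratr q < x -> ratr q <= z) -> (forall q, x < ratr q -> z <= ratr q) -> z = riso x.
Proof.
move=> lo up; apply/eqP; rewrite eq_le; apply/andP; split; rewrite leNgt; apply/negP => /rat_between[q [q1 q2]].
- have : x <= ratr q by rewrite leNgt; apply/negP => /ltW/riso_ge; rewrite leNgt q1.
  rewrite le_eqVlt => /orP[/eqP E|/up]; last by rewrite leNgt q2.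
  have [r [r1 r2]] := rat_between q2.
  have : x < ratr r by rewrite E ltr_rat -(ltr_rat S).
  by move/up; rewrite leNgt r2.
- have : ratr q <= x by rewrite leNgt; apply/negP => /ltW/riso_le; rewrite leNgt q2.
  rewrite le_eqVlt => /orP[/eqP E|/lo]; last by rewrite leNgt q1.
  have [r [r1 r2]] := rat_between q1.
  have : ratr r < x by rewrite -E ltr_rat -(ltr_rat S).
  by move/lo; rewrite leNgt r1.
Qed.
Lemma riso_rat q : riso (ratr q) = ratr q.
Proof. by symmetry; apply: riso_unique => r; rewrite ltr_rat ler_rat => /ltW. Qed.
Lemma risoD (x y : R) : riso (x + y) = riso x + riso y.
Proof.
symmetry; apply: riso_unique => q.
- rewrite -ltrBlDr => /rat_between[r [r1 r2]].
  have -> : ratr q = ratr r + ratr (q - r) :> S by rewrite -rmorphD addrC subrK.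
  apply: lerD; apply: riso_ge; first exact: ltW.
  by rewrite rmorphB /= lerBlDr -lerBlDl ltW // ltrBlDr -ltrBlDl // ltrBlDr addrC -ltrBlDr.
- rewrite -ltrBrDr => /rat_between[r [r1 r2]].
  have -> : ratr q = ratr r + ratr (q - r) :> S by rewrite -rmorphD addrC subrK.
  apply: lerD; apply: riso_le; first exact: ltW.
  by rewrite rmorphB /= lerBrDr ltW // addrC -ltrBrDr.
Qed.
Lemma riso0 : riso 0 = 0. Proof. by rewrite -(rmorph0 (@ratr R)) riso_rat rmorph0. Qed.
Lemma riso1 : riso 1 = 1. Proof. by rewrite -(rmorph1 (@ratr R)) riso_rat rmorph1. Qed.
Lemma risoN (x : R) : riso (- x) = - riso x.
Proof. by apply/eqP; rewrite -addr_eq0 -risoD addNr riso0. Qed.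
Lemma riso_lt (x y : R) : x < y -> riso x < riso y.
Proof.
move=> /rat_between[q [xq /rat_between[r [qr ry]]]].
apply: (le_lt_trans (riso_le (ltW xq))); apply: (lt_le_trans _ (riso_ge (ltW ry))).
by rewrite ltr_rat -(ltr_rat R).
Qed.
Lemma risoM_pos (x y : R) : 0 < x -> 0 < y -> riso (x * y) = riso x * riso y.
Proof.
move=> x0 y0; have fx0 : 0 < riso x by rewrite -riso0 riso_lt.
have fy0 : 0 < riso y by rewrite -riso0 riso_lt.
symmetry; apply: riso_unique => q.
- move=> qxy; case: (leP (ratr q : R) 0) => [q0|q0].
    apply: (le_trans _ (mulr_ge0 (ltW fx0) (ltW fy0))).
    by rewrite -(rmorph0 (@ratr S)) ler_rat -(ler_rat R) rmorph0.
  have : ratr q / y < x by rewrite ltr_pdivrMr.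
  move=> /rat_between[r [r1 r2]].
  have r0 : 0 < ratr r :> R by apply: (le_lt_trans _ r1); rewrite divr_ge0 // ltW.
  have rq0 : 0 < r by rewrite -(ltr0q R).
  have r0' : r != 0 by rewrite gt_eqF.
  (* With [r] strictly between [q / y] and [x], the factors [r] and [q / r] lie below [x] and
     [y]. *)
  have -> : ratr q = ratr r * ratr (q / r) :> S by rewrite -rmorphM mulrC divfK.
  have q0q : 0 < q by rewrite -(ltr0q R).
  apply: ler_pM; rewrite ?ler0q ?divr_ge0 ?(ltW rq0) ?(ltW q0q) //.
    by apply: riso_ge; exact: ltW.
  apply: riso_ge; rewrite fmorph_div /= ltW // ltr_pdivrMr // mulrC.
  by rewrite -ltr_pdivrMr.
- move=> xyq; have : x < ratr q / y by rewrite ltr_pdivlMr.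
  move=> /rat_between[r [r1 r2]].
  have r0 : 0 < ratr r :> R by apply: lt_trans r1.
  have rq0 : 0 < r by rewrite -(ltr0q R).
  have r0' : r != 0 by rewrite gt_eqF.
  have -> : ratr q = ratr r * ratr (q / r) :> S by rewrite -rmorphM mulrC divfK.
  apply: ler_pM; rewrite ?(ltW fx0) ?(ltW fy0) //.
    by apply: riso_le; exact: ltW.
  apply: riso_le; rewrite fmorph_div /= ltW // ltr_pdivlMr // mulrC.
  by rewrite -ltr_pdivlMr.
Qed.
Lemma risoM (x y : R) : riso (x * y) = riso x * riso y.
Proof.
wlog x0 : x / 0 < x => [H|].
  case: (ltrgtP x 0) => [x0|x0|->].
  - by rewrite -[x]opprK mulNr risoN H ?oppr_gt0 // (risoN (- x)) mulNr.
  - exact: H.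
  - by rewrite mul0r riso0 mul0r.
case: (ltrgtP y 0) => [y0|y0|->].
- by rewrite -[y]opprK mulrN risoN risoM_pos ?oppr_gt0 // (risoN (- y)) mulrN.
- exact: risoM_pos.
- by rewrite mulr0 riso0 mulr0.
Qed.
End Iso.
Lemma risoK (R S : realType) (x : R) : riso R (riso S x) = x.
Proof.
symmetry; apply: riso_unique => q H; rewrite leNgt; apply/negP => /ltW.
- by move/(riso_le S); rewrite leNgt H.
- by move/(riso_ge S); rewrite leNgt H.
Qed.

(** * Derivatives and continuity in epsilon-delta form *)

Section EpsDelta.
Variable R : realType.
Lemma derive_epsP (u : R -> R) (t l : R) : is_derive t 1 u l <->
  forall e : R, 0 < e -> exists2 b : R, 0 < b & forall h, h != 0 -> `|h| < b -> `|(u (t + h) - u t) / h - l| < e.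
Proof.
pose q := fun h : R => h^-1 *: ((u \o shift t) (h *: 1) - u t).
have qE h : q h = (u (t + h) - u t) / h by rewrite /q /= -[h *: 1]/(h * 1) mulr1 -[_ *: _]/(_ * _) mulrC (addrC h).
have limE : (q @ 0^' --> l) <-> (forall e : R, 0 < e -> exists2 b : R, 0 < b & forall h, h != 0 -> `|h| < b -> `|(u (t + h) - u t) / h - l| < e).
  split.
  - move=> /cvgrPdist_lt H e e0; have := H e e0; rewrite near_withinE => /nbhs_ballP[b /= b0 Hb].
    exists b => // h h0 hb; rewrite -qE distrC; apply: Hb => //.
    by rewrite /ball /= sub0r normrN.
  - move=> H; apply/cvgrPdist_lt => e e0; have [b b0 Hb] := H e e0.
    rewrite near_withinE; apply/nbhs_ballP; exists b => //= h; rewrite /ball /= sub0r normrN => hb h0.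
    by rewrite -/(q h) distrC qE; exact: Hb.
split.
- by case=> df dl; apply/limE; rewrite -dl.
- move=> /limE H; split; first by apply/cvg_ex; exists l.
  by apply/cvg_lim.
Qed.

Lemma within_epsP (A : set R) (u : R -> R) : {within A, continuous u} <->
  forall x, A x -> forall e : R, 0 < e -> exists2 b : R, 0 < b & forall y, A y -> `|y - x| < b -> `|u y - u x| < e.
Proof.
split.
- move=> /subspace_continuousP H x Ax e e0; have /cvgrPdist_lt/(_ _ e0) := H x Ax.
  rewrite near_withinE => /nbhs_ballP[b /= b0 Hb]; exists b => // y Ay yb.
  by rewrite distrC; apply: Hb => //; rewrite /ball /= distrC.
- move=> H; apply/subspace_continuousP => x Ax; apply/cvgrPdist_lt => e e0; have [b b0 Hb] := H x Ax e e0.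
  rewrite near_withinE; apply/nbhs_ballP; exists b => //= y; rewrite /ball /= distrC => yb Ay.
  by rewrite distrC; exact: Hb.
Qed.

(** The uniform topology is reached through its entourages; a Lipschitz bound uniform in [s] is all
    the branch offers and all that is required. *)
Lemma within_uniform_lipschitz (A : set R) (u : R -> R -> R) (C : R) : 0 < C ->
  (forall x y, A x -> A y -> forall s, `|u x s - u y s| <= C * `|x - y|) ->
  {within A, continuous (fun x => u x : {uniform R -> R})}.
Proof.
move=> C0 H; apply/subspace_continuousP => x Ax P /uniform_nbhs[E [entE EP]].
have [e e0 He] : exists2 e : R, 0 < e & [set xy | `|xy.1 - xy.2| < e] `<=` E.
  by move: entE; rewrite -entourage_ballE => -[e e0 He]; exists e.
suff: \forall y \near x, A y -> P (u y) by [].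
apply/nbhs_ballP; exists (e / C); first by rewrite /= divr_gt0.
move=> y; rewrite /ball /= => yb Ay; apply: EP => s _; apply: He => /=.
by apply: (le_lt_trans (H _ _ Ax Ay s)); rewrite mulrC -ltr_pdivlMr.
Qed.
End EpsDelta.

Local Notation RR := Rdefinitions.R.

(** * Carrying the equation and its solutions across the isomorphism *)

Section Transfer.
Variable R : realType.
Let f (x : R) : RR := riso RR x.
Let g (y : RR) : R := riso R y.
Lemma fK : cancel f g. Proof. exact: risoK. Qed.
Lemma gK : cancel g f. Proof. exact: risoK. Qed.
Lemma fD x y : f (x + y) = Rplus (f x) (f y). Proof. exact: risoD. Qed.
Lemma fM x y : f (x * y) = Rmult (f x) (f y). Proof. exact: risoM. Qed.
Lemma fN x : f (- x) = Ropp (f x). Proof. exact: risoN. Qed.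
Lemma fB x y : f (x - y) = Rminus (f x) (f y). Proof. by rewrite fD fN. Qed.
Lemma f0 : f 0 = IZR 0. Proof. exact: riso0. Qed.
Lemma f1 : f 1 = IZR 1. Proof. exact: riso1. Qed.
Lemma f2 : f 2 = IZR 2.
Proof. by rewrite -[2]/(1 + 1) fD f1; exact: esym (plus_IZR 1 1). Qed.
Lemma fV x : f x^-1 = Rinv (f x).
Proof.
have [->|x0] := eqVneq x 0; first by rewrite invr0 f0 RinvE R0E invr0.
have fx0 : f x != 0 by apply: contra x0 => /eqP E; rewrite -[x]fK E /g riso0.
by rewrite RinvE; apply: (mulIf fx0); rewrite mulVf // -RmultE -fM mulVf // f1.
Qed.
Lemma fdiv x y : f (x / y) = Rdiv (f x) (f y). Proof. by rewrite fM fV. Qed.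
Lemma f_nat n : f n%:R = INR n.
Proof. by elim: n => [|n IH]; [rewrite f0 | rewrite S_INR -natr1 fD f1 IH]. Qed.
Lemma f_lt x y : (x < y) <-> Rlt (f x) (f y).
Proof.
split=> [xy|/RltP xy]; first by apply/RltP; exact: riso_lt.
by rewrite -(fK x) -(fK y); exact: riso_lt.
Qed.
Lemma f_le x y : (x <= y) <-> Rle (f x) (f y).
Proof.
split; first by rewrite le_eqVlt => /predU1P[->|/f_lt xy]; [exact: Rle_refl | exact: Rlt_le].
by move=> H; rewrite leNgt; apply/negP => /f_lt; exact: Rle_not_lt.
Qed.
Lemma f_norm x : f `|x| = Rabs (f x).
Proof.
case: (leP 0 x) => [x0|x0].
  by rewrite ger0_norm // Rabs_pos_eq // -f0; apply/f_le.
by rewrite ltr0_norm // Rabs_left ?fN // -f0; apply/f_lt.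
Qed.
Lemma f_inj x y : f x = f y -> x = y. Proof. by move=> E; rewrite -[x]fK E fK. Qed.
(** Conjugation by the isomorphism: [lift] for hypotheses on given functions, [lower] for the
    functions to be exhibited. *)
Definition lift (u : R -> R) (y : RR) : RR := f (u (g y)).
Definition lower (v : RR -> RR) (x : R) : R := g (v (f x)).
Lemma lift_lower v : lift (lower v) = v.
Proof. by apply: funext => y; rewrite /lift /lower !gK. Qed.
Lemma lift_f u x : lift u (f x) = f (u x). Proof. by rewrite /lift fK. Qed.

Lemma f_derive (u : R -> R) (t l : R) : is_derive t 1 u l <-> Ranalysis1.derivable_pt_lim (lift u) (f t) (f l).
Proof.
rewrite derive_epsP; split.
- move=> H e /RltP e0.
  have e0' : 0 < g e by apply/f_lt; rewrite gK f0; apply/RltP.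
  have [b b0 Hb] := H _ e0'.
  have b0' : Rlt (IZR 0) (f b) by rewrite -f0; apply/f_lt.
  exists (mkposreal _ b0') => h h0 /= hb.
  have hh0 : g h != 0 by apply/eqP => E; apply: h0; rewrite -(gK h) E f0.
  have hhb : `|g h| < b by apply/f_lt; rewrite f_norm gK.
  have /f_lt := Hb _ hh0 hhb.
  by rewrite gK f_norm fB fdiv fB -!(lift_f u) fD gK.
- move=> H e e0.
  have e0' : Rlt (IZR 0) (f e) by rewrite -f0; apply/f_lt.
  have [b Hb] := H _ e0'.
  exists (g b); first by apply/f_lt; rewrite f0 gK; exact: cond_pos b.
  move=> h h0 hb; apply/f_lt; rewrite f_norm fB fdiv fB -!(lift_f u) fD.
  apply: Hb; first by move=> E; move/eqP: h0; apply; apply: f_inj; rewrite E f0.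
  by rewrite -f_norm -[X in Rlt _ X]gK; apply/f_lt.
Qed.
Lemma f_derive_lift u (y : RR) l : Ranalysis1.derivable_pt_lim (lift u) y l <-> is_derive (g y) 1 u (g l).
Proof. by rewrite f_derive !gK. Qed.

Lemma f_exp x : f (expR x) = Rtrigo_def.exp (f x).
Proof.
rewrite -lift_f; apply: NicholsonReal.exp_unique.
- by move=> y; apply/f_derive_lift; rewrite /lift fK; exact: is_derive_expR.
- by rewrite /lift -f0 fK exp.expR0 f1.
Qed.
Lemma f_cos_sin x : f (cos x) = Rtrigo_def.cos (f x) /\ f (sin x) = Rtrigo_def.sin (f x).
Proof.
have := @NicholsonReal.cos_sin_unique (lift (@cos R)) (lift (@sin R)) _ _ _ _ (f x); rewrite !lift_f; apply.
- by move=> y; apply/f_derive_lift; rewrite /lift -fN fK; exact: is_derive_cos.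
- by move=> y; apply/f_derive_lift; rewrite /lift fK; exact: is_derive_sin.
- by rewrite /lift -f0 fK cos0 f1.
- by rewrite /lift -f0 fK sin0 f0.
Qed.
Lemma f_pi : f pi = Rtrigo1.PI.
Proof.
apply: NicholsonReal.PI_unique; last first.
  have [E _] := f_cos_sin (pi / 2); rewrite cos_pihalf fdiv f2 f0 in E; exact: esym E.
have /andP[p0 p2] := pihalf_02 R; split.
  by rewrite -f0; apply/f_lt; exact: pi_gt0.
have -> : IZR 4 = f (2 * 2) by rewrite fM f2 -mult_IZR.
by apply/f_lt; rewrite -ltr_pdivrMr.
Qed.

Variables a p d : R.
Let FF := NicholsonReal.nich (f a) (f p) (f d).
Lemma f_nich x y : f (nicholson a p d x y) = FF (f x) (f y).
Proof. by rewrite /nicholson fB !fM f_exp fM fN. Qed.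
Lemma f_dde (tau t : R) (u : R -> R) : is_derive t 1 u (nicholson a p d (u t) (u (t - tau))) <->
  Ranalysis1.derivable_pt_lim (lift u) (f t) (FF (lift u (f t)) (lift u (Rminus (f t) (f tau)))).
Proof. by rewrite f_derive f_nich -!(lift_f u) fB. Qed.
Lemma f_fwd (tau : R) u : dde_forward_solution (nicholson a p d) tau u -> NicholsonReal.fwdR FF (f tau) (lift u).
Proof.
case=> /within_epsP Cu Du; split.
- move=> x xt e e0.
  have Ax : - tau <= g x by apply/f_le; rewrite fN gK.
  have e0' : 0 < g e by apply/f_lt; rewrite f0 gK.
  have [|b b0 Hb] := Cu (g x) _ _ e0'; first by rewrite /= in_itv /= andbT.
  exists (f b); split; first by rewrite -f0; apply/f_lt.
  move=> y yt yb; have Ay : - tau <= g y by apply/f_le; rewrite fN gK.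
  have hb : `|g y - g x| < b by apply/f_lt; rewrite f_norm fB !gK.
  have By : [set` `[- tau, +oo[] (g y) by rewrite /= in_itv /= andbT.
  by have /f_lt := Hb _ By hb; rewrite f_norm fB gK.
- move=> t t0; rewrite -(gK t); apply/f_dde; apply: Du.
  by apply/f_lt; rewrite f0 gK.
Qed.
Lemma f_near (tau : R) v r u t : near_orbit tau v r u t <-> NicholsonReal.nearR (f tau) (lift v) (f r) (lift u) (f t).
Proof.
split=> [[s Hs]|[s Hs]].
- exists (f s) => b [b1 b2]; rewrite -(gK b) -!fD !lift_f -fB -f_norm; apply/f_lt; apply: Hs.
  by apply/andP; split; apply/f_le; rewrite ?fN ?f0 gK.
- exists (g s) => b /andP[/f_le b1 /f_le b2]; apply/f_lt; rewrite f_norm fB -(lift_f u) -(lift_f v) !fD gK.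
  by apply: Hs; rewrite -f0 -fN.
Qed.
Lemma f_per (tau T : R) v : dde_periodic_solution (nicholson a p d) tau T v <-> NicholsonReal.perR FF (f tau) (f T) (lift v).
Proof.
split.
- case=> T0 Tp [s [t st]] D; split; first by rewrite -f0; apply/f_lt.
  split; first by move=> y; rewrite -(gK y) -fD !lift_f Tp.
  split; first by exists (f s), (f t); rewrite !lift_f => /f_inj/eqP; apply/negP.
  by move=> y; rewrite -(gK y); apply/f_dde.
- move=> [T0 [Tp [[s [t st]] D]]]; split.
  + by apply/f_lt; rewrite f0.
  + by move=> t'; apply: f_inj; rewrite -!(lift_f v) fD.
  + by exists (g s), (g t); apply/eqP => E; apply: st; rewrite /lift -/(g s) E.
  + by move=> t'; apply/f_dde.
Qed.
Lemma f_stable (tau : R) v : NicholsonReal.stableR FF (f tau) (lift v) -> orbitally_asymptotically_stable (nicholson a p d) tau v.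
Proof.
move=> [St [b [b0 At]]]; split.
- move=> e /f_lt e0; rewrite f0 in e0; have [c [c0 Hc]] := St _ e0.
  exists (g c); first by apply/f_lt; rewrite f0 gK.
  move=> u /f_fwd Su /f_near; rewrite f0 gK => Nu t /f_le t0; apply/f_near; apply: Hc => //.
  by rewrite -f0.
- exists (g b); first by apply/f_lt; rewrite f0 gK.
  move=> u /f_fwd Su /f_near; rewrite f0 gK => Nu e /f_lt e0; rewrite f0 in e0.
  have [t0 Ht] := At _ Su Nu _ e0; exists (g t0) => t /f_le tt; apply/f_near; apply: Ht.
  by rewrite -(gK t0).
Qed.

Lemma nicholson_hopf (c0 theta0 h0 : R) (n : nat) : 0 < a -> 0 < p -> 0 < d -> c0 = ln (p / d) -> 2 < c0 -> 0 <= theta0 <= 2 * pi ->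
  cos theta0 = 1 / (1 - c0) -> sin theta0 = - (Num.sqrt (c0 ^+ 2 - 2 * c0) / (1 - c0)) -> h0 = d * Num.sqrt (c0 ^+ 2 - 2 * c0) ->
  let taun := (theta0 + 2 * n%:R * pi) / h0 in
  exists (e0 : R) (tau T : R -> R) (u : R -> R -> R),
    [/\ hopf_branch (nicholson a p d) (c0 / a) taun h0 e0 tau T u, forward_branch taun e0 tau
      & n = 0%N -> forall e : R, 0 < e < e0 -> orbitally_asymptotically_stable (nicholson a p d) (tau e) (u e)].
Proof.
move=> a0 p0 d0 Ec c2 /andP[th0 th2] Ecos Esin Eh taun.
set s := Num.sqrt _ in Esin Eh.
have ss : s * s = c0 * c0 - 2 * c0.
  by rewrite -expr2 sqr_sqrtr ?expr2 // -mulrBl mulr_ge0 ?subr_ge0 // ltW //; apply: lt_trans c2.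
have Ep : expR c0 = p / d by rewrite Ec lnK // posrE divr_gt0.
have [cE sE] := f_cos_sin theta0.
have Rlt0 x : 0 < x -> Rlt (IZR 0) (f x) by move=> x0; rewrite -f0; apply/f_lt.
have E1 : Rtrigo_def.exp (f c0) = Rdiv (f p) (f d) by rewrite -f_exp Ep fdiv.
have E2 : Rlt (IZR 2) (f c0) by rewrite -f2; apply/f_lt.
have E3 : Rle (IZR 0) (f theta0) /\ Rle (f theta0) (Rmult (IZR 2) Rtrigo1.PI).
  by rewrite -f0 -f2 -f_pi -fM; split; apply/f_le.
have E4 : Rle (IZR 0) (f s) by rewrite -f0; apply/f_le; exact: sqrtr_ge0.
have E5 : Rmult (f s) (f s) = Rminus (Rmult (f c0) (f c0)) (Rmult (IZR 2) (f c0)).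
  by rewrite -fM ss fB !fM f2.
have E6 : Rtrigo_def.cos (f theta0) = Rdiv (IZR 1) (Rminus (IZR 1) (f c0)) by rewrite -cE Ecos fdiv fB f1.
have E7 : Rtrigo_def.sin (f theta0) = Ropp (Rdiv (f s) (Rminus (IZR 1) (f c0))) by rewrite -sE Esin fN fdiv fB f1.
have E8 : f h0 = Rmult (f d) (f s) by rewrite Eh fM.
have := @NicholsonReal.nicholson_main (f a) (f p) (f d) (f c0) (f theta0) (f h0) (f s) n
  (Rlt0 _ a0) (Rlt0 _ p0) (Rlt0 _ d0) E1 E2 E3 E4 E5 E6 E7 E8.
have -> : Rdiv (Rplus (f theta0) (Rmult (Rmult (IZR 2) (INR n)) Rtrigo1.PI)) (f h0) = f taun.
  by rewrite /taun fdiv fD !fM f2 f_nat f_pi.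
have -> : Rdiv (Rmult (IZR 2) Rtrigo1.PI) (f h0) = f (2 * pi / h0) by rewrite fdiv fM f2 f_pi.
rewrite -/FF => -[e1 [C [tau [T [u [e10 [C0 [[tau0 [T0 u0]] [Lip [Per [[r [r0 Uni]] [Fwd [[r' [r0' Onto]] Sta]]]]]]]]]]]]].
pose e0 := g e1; pose tau' := lower tau; pose T' := lower T; pose u' := fun e => lower (u (f e)).
have e00 : 0 < e0 by apply/f_lt; rewrite f0 gK.
have C00 : 0 < g C by apply/f_lt; rewrite f0 gK.
have in_e0 e : 0 < e < e0 -> Rlt (IZR 0) (f e) /\ Rlt (f e) e1.
  by move=> /andP[/f_lt h1 /f_lt h2]; rewrite f0 in h1; rewrite gK in h2.
have in_e0' e : `[0, e0[%classic e -> Rle (IZR 0) (f e) /\ Rlt (f e) e1.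
  by rewrite /= in_itv /= => /andP[/f_le h1 /f_lt h2]; rewrite f0 in h1; rewrite gK in h2.
have out_e0 (e : RR) : Rlt (IZR 0) e /\ Rlt e e1 -> 0 < g e < e0.
  by move=> [h1 h2]; apply/andP; split; apply/f_lt; rewrite ?f0 !gK.
have ftau e : f (tau' e) = tau (f e) by rewrite /tau' /lower gK.
have fT e : f (T' e) = T (f e) by rewrite /T' /lower gK.
have fu e : lift (u' e) = u (f e) by rewrite lift_lower.
have fu' e x : f (u' e x) = u (f e) (f x) by rewrite -(lift_f (u' e)) fu.
(* Lipschitz bounds survive the isomorphism as inequalities, so continuity is derived only after the
   transport. *)
have lipschitz (q : RR -> RR) : (forall e e', (Rle (IZR 0) e /\ Rlt e e1) -> (Rle (IZR 0) e' /\ Rlt e' e1) ->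
     Rle (Rabs (Rminus (q e) (q e'))) (Rmult C (Rabs (Rminus e e')))) -> {within `[0, e0[, continuous (lower q)}.
  move=> Hq; apply/within_epsP => x Ax e ep; exists (e / g C); first by rewrite divr_gt0.
  move=> y Ay yx; apply: (@le_lt_trans _ _ (g C * `|y - x|)); last by rewrite mulrC -ltr_pdivlMr.
  by apply/f_le; rewrite fM !f_norm !fB /lower !gK; apply: Hq; exact: in_e0'.
exists e0, tau', T', u'; split.
- split => //.
  + split; rewrite /tau' /T' /lower ?f0 ?tau0 ?T0 ?fK //.
    by move=> t; rewrite /u' /lower f0 u0 -fdiv fK.
  + split.
    * by apply: lipschitz => x y xe ye; case: (Lip x y xe ye).
    * by apply: lipschitz => x y xe ye; case: (Lip x y xe ye) => _ [].
    * have lip x y : `[0, e0[%classic x -> `[0, e0[%classic y -> forall s', `|u' x (T' x * s') - u' y (T' y * s')| <= g C * `|x - y|.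
        move=> Ax Ay s'; apply/f_le.
        rewrite (fM (g C)) (f_norm (x - y)) (fB x y) (f_norm (_ - _)) (fB (u' x _)).
        have uT e : f (u' e (T' e * s')) = u (f e) (Rmult (T (f e)) (f s')) by rewrite fu' fM fT.
        by case: (Lip _ _ (in_e0' _ Ax) (in_e0' _ Ay)) => _ [_ /(_ (f s'))]; rewrite -!uT gK.
      exact: (@within_uniform_lipschitz R _ (fun e s' => u' e (T' e * s')) _ C00 lip).
  + by move=> e /in_e0 He; apply/f_per; rewrite ftau fT fu; exact: Per.
  + exists (g r); first by apply/f_lt; rewrite f0 gK.
    move=> t1 T1 v /f_lt ht /f_lt hT hv /f_per Pv.
    rewrite f_norm fB gK in ht; rewrite f_norm fB gK in hT.
    have hv' (y : RR) : Rlt (Rabs (Rminus (lift v y) (Rdiv (f c0) (f a)))) r.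
      by rewrite -(gK y) lift_f -fdiv -fB -f_norm -(gK r); apply/f_lt.
    have [e [s' [He [Et [ET Ev]]]]] := Uni _ _ _ ht hT hv' Pv.
    exists (g e), (g s'); split; first exact: out_e0.
    * by apply: f_inj; rewrite ftau gK.
    * by apply: f_inj; rewrite fT gK.
    * by move=> t; apply: f_inj; rewrite fu' fD !gK -Ev lift_f.
- split.
  + by move=> e /in_e0 He; apply/f_lt; rewrite ftau; exact: Fwd.
  + exists (g r'); first by apply/f_lt; rewrite f0 gK.
    move=> t1 /andP[/f_lt h1 /f_lt h2]; rewrite fD gK in h2.
    have [e [He Et]] := Onto _ (conj h1 h2).
    exists (g e); first exact: out_e0.
    by apply: f_inj; rewrite ftau gK.
- by move=> n0 e /in_e0 He; apply: f_stable; rewrite ftau fu; exact: Sta.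
Qed.
End Transfer.
End Transport.

Theorem mainTheorem5 (R : realType) (a p d c0 theta0 h0 : R)
  (ha : 0 < a) (hp : 0 < p) (hd : 0 < d)
  (hc0 : c0 = ln (p / d)) (hc0_gt2 : 2 < c0)
  (htheta0 : 0 <= theta0 <= 2 * pi)
  (hcos : cos theta0 = 1 / (1 - c0))
  (hsin : sin theta0 = - (Num.sqrt (c0 ^+ 2 - 2 * c0) / (1 - c0)))
  (hh0 : h0 = d * Num.sqrt (c0 ^+ 2 - 2 * c0)) :
  forall n : nat,
    let taun := (theta0 + 2 * n%:R * pi) / h0 in
    exists (e0 : R) (tau T : R -> R) (u : R -> R -> R),
      [/\ hopf_branch (nicholson a p d) (c0 / a) taun h0 e0 tau T u,
          forward_branch taun e0 tau
        & n = 0%N -> forall e : R, 0 < e < e0 ->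
            orbitally_asymptotically_stable (nicholson a p d) (tau e) (u e)].
Proof.
  move=> n; exact: Transport.nicholson_hopf.
Qed.
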